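(* Let $V$ be a vector space of dimension $n\ge1$ over $\Bbbk$ and let $U\subset\mathrm{Sym}^2V^\vee$ be a $k$-dimensional linear space of quadrics such that $\bigcap_{u\in U}Q_u=\varnothing$ in $\mathbb P(V)$. Then the coordinate algebra $\mathbf B_U$ of the Clifford space $(\mathbb P(U),\mathcal C\ell_0(V))$ is Artin–Schelter regular of dimension $k$ and Gorenstein degree $2k-n$. Moreover, the Hilbert series of $\mathbf B_U$ is $$\mathbf h_{\mathbf B_U}(z)=\sum_{i\ge0}\dim\bigl((\mathbf B_U)_i\bigr)z^i=\frac1{(1-z)^n(1-z^2)^{k-n}} .$$
   Context: $\Bbbk$ is a field of characteristic zero. $\mathbb P(E)$ denotes the projective space of one-dimensional subspaces of $E$, so $H^0(\mathbb P(E),\mathcal O(1))=E^\vee$. For $u\in U$, $Q_u\subset\mathbb P(V)$ is the zero scheme of the quadratic form $u$; emptiness of the intersection is scheme-theoretic (no nonzero common zero over an algebraic closure). In particular $k\ge n$. Let $\mathbf q_U\colon\mathrm{Sym}^2V\otimes\mathcal O\to U^\vee\otimes\mathcal O\to\mathcal O(1)$ on $\mathbb P(U)$ be the composition of the dual of $U\hookrightarrow\mathrm{Sym}^2V^\vee$ and the tautological epimorphism. For $i\in\mathbb Z$ set $\mathcal C\ell_i(V)=\bigoplus_{s\in\mathbb Z}\bigwedge^{i-2s}V\otimes\mathcal O(s)$ on $\mathbb P(U)$ (with $\bigwedge^jV=0$ unless $0\le j\le n$). Clifford multiplication is the associative $\mathcal O$-bilinear product $\mathcal C\ell_i(V)\otimes\mathcal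 C\ell_j(V)\to\mathcal C\ell_{i+j}(V)$ with unit $1\in\bigwedge^0V\otimes\mathcal O$ determined by $$v\cdot(w_1\wedge\dots\wedge w_m)=v\wedge w_1\wedge\dots\wedge w_m+\sum_{t=1}^m(-1)^{t-1}\mathbf q_U(v,w_t)\,w_1\wedge\dots\wedge\widehat{w_t}\wedge\dots\wedge w_m .$$ The coordinate algebra is $\mathbf B_U=\bigoplus_{i\ge0}\mathrm{Hom}_{\mathcal C\ell_0(V)}(\mathcal C\ell_0(V),\mathcal C\ell_i(V))=\bigoplus_{i\ge0}H^0(\mathbb P(U),\mathcal C\ell_i(V))$ with product induced by Clifford multiplication. A graded algebra $\mathbf A=\bigoplus_{i\ge0}\mathbf A_i$ with $\mathbf A_0=\Bbbk$ is Artin–Schelter regular of dimension $d$ if every graded (right) $\mathbf A$-module has projective dimension at most $d$, the Gelfand–Kirillov dimension of $\mathbf A$ is finite, and $\mathbf A$ has the Gorenstein property $\mathrm{Ext}^\bullet_{\mathbf A}(\Bbbk,\mathbf A)\cong\Bbbk(\ell)[-d]$ for some $\ell\in\mathbb Z$, called the Gorenstein degree of $\mathbf A$. Here $M(m)_j=M_{m+j}$ (so $\mathbf A(-m)_i=\mathbf A_{i-m}$), Ext is the graded Ext, and $[-d]$ means concentration in cohomological degree $d$. *)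

(* Defs.v *)
From HB Require Import structures.
From mathcomp Require Import all_boot all_order all_algebra.
From mathcomp Require Import mpoly ring.
From Stdlib Require Reals.
From Coquelicot Require Lim_seq Rbar.
Set Implicit Arguments.
Unset Strict Implicit.
Unset Printing Implicit Defensive.
Import Order.TTheory GRing.Theory Num.Theory.
Local Open Scope ring_scope.

Section Exterior.
Variables (R : comNzRingType) (n : nat).

(* The exterior algebra of the free module R^n: [x J] is the coefficient of x on
   e_{j_1} /\ ... /\ e_{j_m}, where j_1 < ... < j_m are the elements of J. *)
Local Notation exterior := {ffun {set 'I_n} -> R^o}.

Implicit Types (i j : 'I_n) (J : {set 'I_n}) (x y : exterior) (a b : 'I_n -> R).

Definition ext_basis J : exterior := [ffun K : {set _} => (K == J)%:R].
Definition ext_sgn i J : R := (-1) ^+ #|[set j in J | (j < i)%N]|.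

(* Left exterior multiplication by e_i, and contraction by the i-th coordinate. *)
Definition wedge1 i x : exterior :=
  [ffun J : {set _} => if i \in J then ext_sgn i J * x (J :\ i) else 0].
Definition contr1 i x : exterior :=
  [ffun J : {set _} => if i \in J then 0 else ext_sgn i J * x (i |: J)].
Definition wedge a x : exterior := \sum_i a i *: wedge1 i x.
Definition contr a x : exterior := \sum_i a i *: contr1 i x.


Lemma ext_sgnE i J : ext_sgn i J = \prod_(j in J) (-1) ^+ (j < i)%N.
Proof.
rewrite (bigID (fun j : 'I_n => (j < i)%N)) /= [X in _ * X]big1 ?mulr1.
  rewrite (eq_bigr (fun _ => -1)) => [|j /andP[_ ->]]; last by rewrite expr1.
  by rewrite prodr_const /ext_sgn; congr (_ ^+ _); apply: eq_card => j; rewrite inE.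
by move=> j /andP[_ /negPf->].
Qed.

Lemma ext_sgnU i j J : j \notin J ->
  ext_sgn i (j |: J) = (-1) ^+ (j < i)%N * ext_sgn i J.
Proof. by move=> jJ; rewrite !ext_sgnE big_setU1. Qed.

Lemma ext_sgnD i j J : j \in J ->
  ext_sgn i J = (-1) ^+ (j < i)%N * ext_sgn i (J :\ j).
Proof. by move=> jJ; rewrite !ext_sgnE (big_setD1 j). Qed.

Lemma ext_sgn2 i J : ext_sgn i J * ext_sgn i J = 1.
Proof. by rewrite /ext_sgn -expr2 sqrr_sign. Qed.

Fact wedge1_is_linear i : linear (wedge1 i).
Proof.
move=> r x y; apply/ffunP => J; rewrite !ffunE; case: ifP => _.
  by rewrite mulrDr; congr (_ + _); rewrite /GRing.scale /= mulrCA.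
by rewrite /GRing.scale /= mulr0 addr0.
Qed.
HB.instance Definition _ i :=
  GRing.isLinear.Build R exterior exterior *:%R (wedge1 i) (wedge1_is_linear i).

Fact contr1_is_linear i : linear (contr1 i).
Proof.
move=> r x y; apply/ffunP => J; rewrite !ffunE; case: ifP => _.
  by rewrite /GRing.scale /= mulr0 addr0.
by rewrite mulrDr; congr (_ + _); rewrite /GRing.scale /= mulrCA.
Qed.
HB.instance Definition _ i :=
  GRing.isLinear.Build R exterior exterior *:%R (contr1 i) (contr1_is_linear i).

Fact wedge_is_linear a : linear (wedge a).
Proof.
move=> r x y; rewrite /wedge scaler_sumr -big_split; apply: eq_bigr => i _ /=.
by rewrite linearP scalerDr !scalerA mulrC.
Qed.
HB.instance Definition _ a :=
  GRing.isLinear.Build R exterior exterior *:%R (wedge a) (wedge_is_linear a).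

Fact contr_is_linear a : linear (contr a).
Proof.
move=> r x y; rewrite /contr scaler_sumr -big_split; apply: eq_bigr => i _ /=.
by rewrite linearP scalerDr !scalerA mulrC.
Qed.
HB.instance Definition _ a :=
  GRing.isLinear.Build R exterior exterior *:%R (contr a) (contr_is_linear a).

Lemma wedge1K i x : wedge1 i (wedge1 i x) = 0.
Proof.
by apply/ffunP => J; rewrite !ffunE !inE eqxx /=; case: ifP; rewrite ?mulr0.
Qed.

Lemma contr1K i x : contr1 i (contr1 i x) = 0.
Proof.
by apply/ffunP => J; rewrite !ffunE !inE eqxx /=; case: ifP; rewrite ?mulr0.
Qed.

Lemma sgn_swap i j : i != j ->
  (-1) ^+ (i < j)%N = - (-1) ^+ (j < i)%N :> R.
Proof.
move=> ij; case: (ltngtP i j) => [||/val_inj/eqP]; rewrite ?opprK //.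
by rewrite (negPf ij).
Qed.

Lemma wedge1C i j x : i != j -> wedge1 i (wedge1 j x) = - wedge1 j (wedge1 i x).
Proof.
move=> ij; apply/ffunP => J; rewrite !ffunE !inE [j == i]eq_sym (negPf ij) /=.
have [iJ|iJ] := boolP (i \in J); last by case: ifP; rewrite ?mulr0 ?oppr0.
have [jJ|jJ] := boolP (j \in J); last by rewrite mulr0 oppr0.
rewrite setDDl setUC -setDDl !mulrA -mulNr; congr (_ * _).
rewrite (ext_sgnD i jJ) (ext_sgnD j iJ) (sgn_swap ij).
by rewrite !mulNr opprK -!mulrA [ext_sgn i _ * _]mulrC.
Qed.

Lemma contr1C i j x : i != j -> contr1 i (contr1 j x) = - contr1 j (contr1 i x).
Proof.
move=> ij; apply/ffunP => J; rewrite !ffunE !inE [j == i]eq_sym (negPf ij) /=.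
have [iJ|iJ] := boolP (i \in J); first by case: ifP; rewrite ?mulr0 ?oppr0.
have [jJ|jJ] := boolP (j \in J); first by rewrite mulr0 oppr0.
rewrite setUCA !mulrA -mulNr; congr (_ * _).
rewrite (ext_sgnU j iJ) (ext_sgnU i jJ) (sgn_swap ij).
by rewrite mulNr mulrN; congr (- _); rewrite mulrCA [RHS]mulrCA [ext_sgn i J * _]mulrC.
Qed.

Lemma contr1_wedge1 i j x :
  contr1 i (wedge1 j x) = (i == j)%:R *: x - wedge1 j (contr1 i x).
Proof.
have [<-|ij] := eqVneq i j.
  rewrite scale1r; apply/ffunP => J; rewrite !ffunE !inE eqxx /=.
  have [iJ|iJ] := boolP (i \in J).
    by rewrite setD1K // (ext_sgnD i iJ) ltnn mul1r mulrA ext_sgn2 mul1r subrr.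
  by rewrite subr0 setU1K // (ext_sgnU i iJ) ltnn mul1r mulrA ext_sgn2 mul1r.
rewrite scale0r sub0r; apply/ffunP => J; rewrite !ffunE !inE (negPf ij) [j == i]eq_sym (negPf ij) /=.
have [iJ|iJ] := boolP (i \in J); first by case: ifP; rewrite ?mulr0 ?oppr0.
have [jJ|jJ] := boolP (j \in J); last by rewrite mulr0 oppr0.
have -> : (i |: J) :\ j = i |: J :\ j.
  by apply/setP => k; rewrite !inE; case: (eqVneq k i) => [->|]; rewrite ?ij.
rewrite !mulrA -mulNr; congr (_ * _).
rewrite (ext_sgnU j iJ) (ext_sgnD i jJ) (sgn_swap ij).
by rewrite !mulNr mulrN mulrACA -expr2 sqrr_sign mul1r mulrC.
Qed.

Lemma wedge1_anti i j x : wedge1 i (wedge1 j x) = - wedge1 j (wedge1 i x).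
Proof.
have [->|/wedge1C//] := eqVneq i j; by rewrite wedge1K oppr0.
Qed.

Lemma contr1_anti i j x : contr1 i (contr1 j x) = - contr1 j (contr1 i x).
Proof.
have [->|/contr1C//] := eqVneq i j; by rewrite contr1K oppr0.
Qed.

Lemma contr_contr1 a i x : contr a (contr1 i x) = - contr1 i (contr a x).
Proof.
rewrite /contr linear_sum -sumrN; apply: eq_bigr => j _.
by rewrite linearZ /= contr1_anti scalerN.
Qed.

Lemma contr_anti a b x : contr a (contr b x) = - contr b (contr a x).
Proof.
rewrite [contr b x]/contr linear_sum -sumrN; apply: eq_bigr => j _.
by rewrite linearZ /= contr_contr1 scalerN.
Qed.

Lemma contrK a x : contr a (contr a x) = 0.
Proof.
pose D r u : exterior := \sum_(j <- r) a j *: contr1 j u.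
rewrite -[contr a x]/(D _ x) -[contr a _]/(D _ _).
elim: (index_enum _) => [|i r IH]; first by rewrite /D big_nil.
have Dl : linear (D r).
  move=> c u v; rewrite /D scaler_sumr -big_split; apply: eq_bigr => j _ /=.
  by rewrite linearP scalerDr !scalerA mulrC.
have Dc u : D r (contr1 i u) = - contr1 i (D r u).
  rewrite /D linear_sum -sumrN; apply: eq_bigr => j _.
  by rewrite linearZ /= contr1_anti scalerN.
have Dcons u : D (i :: r) u = a i *: contr1 i u + D r u by rewrite /D big_cons.
rewrite !Dcons Dl IH addr0 Dc.
by rewrite linearD linearZ /= contr1K scaler0 add0r scalerN subrr.
Qed.

Lemma contr_wedge1 a i x : contr a (wedge1 i x) = a i *: x - wedge1 i (contr a x).
Proof.
rewrite /contr linear_sum -sumrN (bigD1 i) //= [in RHS](bigD1 i) //=.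
rewrite contr1_wedge1 eqxx scale1r scalerBr -addrA.
congr (_ + (_ + _)); first by congr (- _); rewrite linearZ.
apply: eq_bigr => j /negPf ji.
by rewrite contr1_wedge1 ji scale0r sub0r linearZ /= scalerN.
Qed.

Lemma contr_wedge a b x :
  contr a (wedge b x) = (\sum_i a i * b i) *: x - wedge b (contr a x).
Proof.
rewrite [wedge b x]/wedge linear_sum scaler_suml -sumrN -big_split.
apply: eq_bigr => i _ /=; rewrite linearZ /= contr_wedge1 scalerBr scalerA.
by rewrite mulrC.
Qed.

Definition ext_supp (s : seq 'I_n) x := forall J, ~~ (J \subset s) -> x J = 0.

Lemma ext_supp_enum x : ext_supp (enum 'I_n) x.
Proof. by move=> J /negP[]; apply/subsetP => i _; rewrite mem_enum. Qed.

Lemma ext_suppD s x y : ext_supp s x -> ext_supp s y -> ext_supp s (x + y).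
Proof. by move=> xs ys J Js; rewrite ffunE xs // ys // addr0. Qed.

Lemma ext_suppN s x : ext_supp s x -> ext_supp s (- x).
Proof. by move=> xs J Js; rewrite ffunE xs // oppr0. Qed.

Lemma ext_suppB s x y : ext_supp s x -> ext_supp s y -> ext_supp s (x - y).
Proof. by move=> xs /ext_suppN; apply: ext_suppD. Qed.

Lemma ext_suppZ s c x : ext_supp s x -> ext_supp s (c *: x).
Proof. by move=> xs J Js; rewrite ffunE xs // scaler0. Qed.

Lemma ext_supp_wedge1 s i x : i \in s -> ext_supp s x -> ext_supp s (wedge1 i x).
Proof.
move=> si xs J Js; rewrite ffunE; case: ifP => // iJ; rewrite xs ?mulr0 //.
apply: contra Js => /subsetP H; apply/subsetP => k kJ.
by have [->//|ki] := eqVneq k i; apply: H; rewrite !inE ki.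
Qed.

Lemma ext_supp_contr1 s i x : ext_supp s x -> ext_supp s (contr1 i x).
Proof.
move=> xs J Js; rewrite ffunE; case: ifP => // iJ; rewrite xs ?mulr0 //.
by apply: contra Js => /subsetP H; apply/subsetP => k kJ; apply: H; rewrite !inE kJ orbT.
Qed.

Lemma ext_supp_contr s a x : ext_supp s x -> ext_supp s (contr a x).
Proof.
move=> xs; rewrite /contr; elim/big_ind: _ => [||i _].
- by move=> J _; rewrite ffunE.
- by move=> u v; apply: ext_suppD.
- by apply: ext_suppZ; apply: ext_supp_contr1.
Qed.

Lemma contr1_supp s i x : i \notin s -> ext_supp s x -> contr1 i x = 0.
Proof.
move=> si xs; apply/ffunP => J; rewrite !ffunE; case: ifP => // iJ.
rewrite xs ?mulr0 //; apply/negP => /subsetP /(_ i); rewrite !inE eqxx => /(_ isT).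
by rewrite (negPf si).
Qed.

Lemma ext_supp_tail s i x : ext_supp (i :: s) x -> contr1 i x = 0 -> ext_supp s x.
Proof.
move=> xs x0 J Js; have [iJ|iJ] := boolP (i \in J).
  have := congr1 (fun z : exterior => ext_sgn i (J :\ i) * z (J :\ i)) x0.
  by rewrite !ffunE !inE eqxx /= mulrA ext_sgn2 mul1r setD1K // mulr0.
apply: xs; apply: contra Js => /subsetP H; apply/subsetP => k kJ.
by have := H k kJ; rewrite !inE => /orP[/eqP ki|//]; rewrite -ki kJ in iJ.
Qed.

Lemma ext_split s i x : ext_supp (i :: s) x ->
  ext_supp s (contr1 i x) /\ ext_supp s (x - wedge1 i (contr1 i x)).
Proof.
move=> xs; split; apply: (@ext_supp_tail _ i); rewrite ?contr1K //.
- exact: ext_supp_contr1.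
- by apply: ext_suppB => //; apply: ext_supp_wedge1; rewrite ?inE ?eqxx //; apply: ext_supp_contr1.
- by rewrite linearB /= contr1_wedge1 eqxx scale1r contr1K linear0 subr0 subrr.
Qed.

Variable q : 'I_n -> 'I_n -> R.

(* Left Clifford multiplication by e_i. *)
Definition clifford_gen i x : exterior := wedge1 i x + contr (q i) x.

Fact clifford_gen_is_linear i : linear (clifford_gen i).
Proof. by move=> r x y; rewrite /clifford_gen !linearP /= scalerDr addrACA. Qed.
HB.instance Definition _ i :=
  GRing.isLinear.Build R exterior exterior *:%R (clifford_gen i) (clifford_gen_is_linear i).

Lemma clifford_genC i j x :
  clifford_gen i (clifford_gen j x) + clifford_gen j (clifford_gen i x)
    = (q i j + q j i) *: x.
Proof.
rewrite /clifford_gen !linearD /= !contr_wedge1 wedge1_anti contr_anti scalerDl.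
set A := wedge1 j (wedge1 i x); set B := wedge1 i (contr _ x).
set C := wedge1 j (contr _ x); set D := contr _ (contr _ x).
set X := q i j *: x; set Y := q j i *: x.
apply/ffunP => J; rewrite !ffunE; ring.
Qed.

(* Writing x = x0 + e_i /\ x1, the rule e_i x1 = e_i /\ x1 + contr (q i) x1 gives
   x y = x0 y + e_i (x1 y) - (contr (q i) x1) y, which is solved recursively on
   the indices. The product is characterized by [clifford_mulE] below. *)
Fixpoint clifford_act (s : seq 'I_n) x y : exterior :=
  if s is i :: s' then
    clifford_act s' (x - wedge1 i (contr1 i x)) y
    + clifford_gen i (clifford_act s' (contr1 i x) y)
    - clifford_act s' (contr (q i) (contr1 i x)) y
  else x set0 *: y.

Definition clifford_mul := clifford_act (enum 'I_n).

Fact clifford_act_is_linear s x : linear (clifford_act s x).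
Proof.
elim: s x => [|i s IH] x r y z /=; first by rewrite scalerDr !scalerA mulrC.
rewrite !IH linearP /=; apply/ffunP => J; rewrite !ffunE; ring.
Qed.

Lemma clifford_actP s y r x z :
  clifford_act s (r *: x + z) y = r *: clifford_act s x y + clifford_act s z y.
Proof.
elim: s x z => [|i s IH] x z /=; first by rewrite !ffunE scalerDl scalerA.
have -> : r *: x + z - wedge1 i (contr1 i (r *: x + z)) =
  r *: (x - wedge1 i (contr1 i x)) + (z - wedge1 i (contr1 i z)).
  rewrite [contr1 i (_ *: _ + _)]linearP [wedge1 i (_ *: _ + _)]linearP /=.
  by move: (wedge1 i _) (wedge1 i _) => A B; apply/ffunP => J; rewrite !ffunE; ring.
rewrite [contr1 i (_ *: _ + _)]linearP [contr _ (_ *: _ + _)]linearP /= !IH.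
rewrite [clifford_gen _ (_ *: _ + _)]linearP /=.
by apply/ffunP => J; rewrite !ffunE; ring.
Qed.

Lemma clifford_act0 s y : clifford_act s 0 y = 0.
Proof. by have := clifford_actP s y (-1) 0 0; rewrite scaler0 addr0 scaleN1r addNr. Qed.

Lemma clifford_actZ s y r x : clifford_act s (r *: x) y = r *: clifford_act s x y.
Proof. by rewrite -[r *: x]addr0 clifford_actP clifford_act0 addr0. Qed.

Lemma clifford_actD s y x z :
  clifford_act s (x + z) y = clifford_act s x y + clifford_act s z y.
Proof. by rewrite -[x]scale1r clifford_actP !scale1r. Qed.

Lemma clifford_actN s y x : clifford_act s (- x) y = - clifford_act s x y.
Proof. by rewrite -scaleN1r clifford_actZ scaleN1r. Qed.

Lemma clifford_actB s y x z :
  clifford_act s (x - z) y = clifford_act s x y - clifford_act s z y.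
Proof. by rewrite clifford_actD clifford_actN. Qed.

Lemma clifford_act_cons s i x0 x1 y : i \notin s -> ext_supp s x0 -> ext_supp s x1 ->
  clifford_act (i :: s) (x0 + wedge1 i x1) y =
  clifford_act s x0 y + clifford_gen i (clifford_act s x1 y)
  - clifford_act s (contr (q i) x1) y.
Proof.
move=> si xs0 xs1 /=.
have -> : contr1 i (x0 + wedge1 i x1) = x1.
  rewrite linearD /= (contr1_supp si xs0) add0r contr1_wedge1 eqxx scale1r.
  by rewrite (contr1_supp si xs1) linear0 subr0.
by rewrite addrK.
Qed.

Lemma clifford_act_gen s i x y : uniq s -> i \in s -> ext_supp s x ->
  clifford_act s (clifford_gen i x) y = clifford_gen i (clifford_act s x y).
Proof.
elim: s i x => [//|k s IH] i x /= /andP[ks us] iks xs.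
have [xs1 xs0] := ext_split xs.
have -> : x = (x - wedge1 k (contr1 k x)) + wedge1 k (contr1 k x) by rewrite subrK.
move: (contr1 k x) (x - _) xs1 xs0 => x1 x0 xs1 xs0 {x xs}.
rewrite -[RHS]/(clifford_gen i (clifford_act (k :: s) _ _)).
rewrite -[LHS]/(clifford_act (k :: s) _ _) [in RHS]clifford_act_cons //.
have [eik|ik] := eqVneq i k.
  subst i.
  have -> : clifford_gen k (x0 + wedge1 k x1) =
      (contr (q k) x0 + q k k *: x1) + wedge1 k (x0 - contr (q k) x1).
    rewrite /clifford_gen !linearD /= wedge1K contr_wedge1 linearN /=.
    by apply/ffunP => J; rewrite !ffunE; ring.
  rewrite clifford_act_cons //; last 2 first.
  - by apply: ext_suppD; [apply: ext_supp_contr|apply: ext_suppZ].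
  - by apply: ext_suppB => //; apply: ext_supp_contr.
  rewrite !linearB linearD /= contrK clifford_actB clifford_actD clifford_actZ.
  rewrite subr0.
  have LL u : clifford_gen k (clifford_gen k u) = q k k *: u.
    by rewrite /clifford_gen !linearD /= wedge1K contrK contr_wedge1 add0r addr0
         addrC subrK.
  rewrite LL linearB /=; move: (clifford_gen k _) (clifford_act s _ y) => A B.
  by apply/ffunP => J; rewrite !ffunE; ring.
have si : i \in s by move: iks; rewrite inE (negPf ik).
have -> : clifford_gen i (x0 + wedge1 k x1) =
    (clifford_gen i x0 + q i k *: x1) + wedge1 k (- clifford_gen i x1).
  rewrite /clifford_gen !linearD /= contr_wedge1 wedge1_anti.
  rewrite [wedge1 k (- wedge1 _ _)]linearN [wedge1 k (- contr _ _)]linearN /=.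
  move: (wedge1 k _) (wedge1 k _) (wedge1 i _) (contr _ _) => A B C D.
  by apply/ffunP => J; rewrite !ffunE; ring.
have supp_gen u : ext_supp s u -> ext_supp s (clifford_gen i u).
  by move=> us'; apply: ext_suppD; [apply: ext_supp_wedge1|apply: ext_supp_contr].
rewrite clifford_act_cons //; last 2 first.
- by apply: ext_suppD; [apply: supp_gen|apply: ext_suppZ].
- by apply: ext_suppN; apply: supp_gen.
rewrite clifford_actD clifford_actZ clifford_actN !IH //.
have -> : contr (q k) (- clifford_gen i x1) = clifford_gen i (contr (q k) x1) - q k i *: x1.
  rewrite [contr _ (- _)]linearN /= /clifford_gen [contr _ (_ + _)]linearD /= contr_wedge1 [contr (q k) (contr _ _)]contr_anti.
  by apply/ffunP => J; rewrite !ffunE; ring.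
rewrite clifford_actB clifford_actZ IH //; last exact: ext_supp_contr.
rewrite [clifford_gen k (- _)]linearN [clifford_gen i (_ - _)]linearB /=.
rewrite [clifford_gen i (_ + _)]linearD /=.
have := clifford_genC i k (clifford_act s x1 y); rewrite scalerDl => /(canRL (addrK _)) ->.
move: (clifford_gen i _) (clifford_gen k _) (clifford_gen i _) => A B C.
by apply/ffunP => J; rewrite !ffunE; ring.
Qed.

Lemma clifford_mul_gen i x y :
  clifford_mul (clifford_gen i x) y = clifford_gen i (clifford_mul x y).
Proof.
by apply: clifford_act_gen; rewrite ?enum_uniq ?mem_enum //; apply: ext_supp_enum.
Qed.

Lemma clifford_mulA x y z :
  clifford_mul x (clifford_mul y z) = clifford_mul (clifford_mul x y) z.
Proof.
rewrite {1 4}/clifford_mul; elim: (enum 'I_n) x => [|i s IH] x /=.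
  by rewrite /clifford_mul clifford_actZ.
have mB u v : clifford_mul (u - v) z = clifford_mul u z - clifford_mul v z.
  exact: clifford_actB.
have mD u v : clifford_mul (u + v) z = clifford_mul u z + clifford_mul v z.
  exact: clifford_actD.
by rewrite mB mD clifford_mul_gen !IH.
Qed.

Definition ext_one := ext_basis set0.

Lemma contr1_one i : contr1 i ext_one = 0.
Proof.
apply/ffunP => J; rewrite !ffunE; case: ifP => // iJ.
by rewrite setU_eq0 -cards_eq0 cards1 mulr0.
Qed.

Lemma clifford_mul1l x : clifford_mul ext_one x = x.
Proof.
rewrite /clifford_mul; elim: (enum 'I_n) => [|i s IH] /=.
  by rewrite ffunE eqxx scale1r.
rewrite contr1_one [wedge1 i 0]linear0 [contr _ 0]linear0 !clifford_act0.
by rewrite [clifford_gen i 0]linear0 !subr0 addr0 IH.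
Qed.

Lemma clifford_mul1r x : clifford_mul x ext_one = x.
Proof.
rewrite /clifford_mul; move: (ext_supp_enum x); elim: (enum 'I_n) x => [|i s IH] x xs /=.
  apply/ffunP => J; rewrite !ffunE /GRing.scale /=.
  have [->|J0] := eqVneq J set0; first by rewrite mulr1.
  rewrite mulr0 xs //; apply: contra J0 => /subsetP H.
  by apply/eqP/setP => k; rewrite inE; apply/negP => /H.
have [xs1 xs0] := ext_split xs; rewrite !IH //; last exact: ext_supp_contr.
by rewrite /clifford_gen addrA addrK subrK.
Qed.

Lemma clifford_mulDl x y z :
  clifford_mul (x + y) z = clifford_mul x z + clifford_mul y z.
Proof. exact: clifford_actD. Qed.

Lemma clifford_mulDr x y z :
  clifford_mul x (y + z) = clifford_mul x y + clifford_mul x z.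
Proof.
by have := clifford_act_is_linear (enum 'I_n) x 1 y z; rewrite !scale1r.
Qed.

Lemma clifford_mulZr r x y : clifford_mul x (r *: y) = r *: clifford_mul x y.
Proof.
have E : clifford_mul x 0 = 0.
  by have := clifford_mulDr x 0 0; rewrite addr0 => /(congr1 (+%R^~ (- clifford_mul x 0)));
    rewrite addrK subrr.
have := clifford_act_is_linear (enum 'I_n) x r y 0.
by rewrite -/clifford_mul E !addr0.
Qed.

Lemma ext_one_neq0 : ext_one != 0.
Proof. by apply/eqP => /ffunP /(_ set0) /eqP; rewrite !ffunE eqxx oner_eq0. Qed.


Definition ext_vec a := wedge a ext_one.
Definition wedges (ws : seq ('I_n -> R)) := foldr wedge ext_one ws.

Lemma contr_wedges a ws :
  contr a (wedges ws) =
  \sum_(t < size ws) ((-1) ^+ t * \sum_j a j * nth (fun=> 0) ws t j)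
     *: wedges (take t ws ++ drop t.+1 ws).
Proof.
elim: ws => [|w ws IH] /=.
  by rewrite big_ord0 /contr big1 // => i _; rewrite contr1_one scaler0.
rewrite big_ord_recl /= drop0 mul1r contr_wedge; congr (_ + _).
rewrite IH [wedge w _]linear_sum -sumrN; apply: eq_bigr => t _.
by rewrite /= [wedge w (_ *: _)]linearZ /= -scaleNr exprS mulN1r mulNr.
Qed.

Lemma clifford_mul_vec a y :
  clifford_mul (ext_vec a) y = wedge a y + contr (fun j => \sum_i a i * q i j) y.
Proof.
have S (f : 'I_n -> exterior) :
    clifford_mul (\sum_i f i) y = \sum_i clifford_mul (f i) y.
  by apply: (big_morph (clifford_mul^~ y)) => [u v|]; [apply: clifford_mulDl|apply: clifford_act0].
rewrite /ext_vec /wedge S.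
transitivity (\sum_i a i *: clifford_gen i y).
  apply: eq_bigr => i _; rewrite [LHS]clifford_actZ; congr (_ *: _).
  have -> : wedge1 i ext_one = clifford_gen i ext_one.
    rewrite /clifford_gen [contr _ _]big1 ?addr0 // => j _.
    by rewrite contr1_one scaler0.
  by rewrite -/clifford_mul clifford_mul_gen clifford_mul1l.
rewrite /clifford_gen; under eq_bigr do rewrite scalerDr.
rewrite big_split; congr (_ + _) => /=.
rewrite /contr; under eq_bigr do rewrite scaler_sumr.
rewrite exchange_big; apply: eq_bigr => j _; rewrite scaler_suml.
by apply: eq_bigr => i _; rewrite scalerA.
Qed.

Lemma clifford_mulE a ws :
  clifford_mul (ext_vec a) (wedges ws) =
  wedges (a :: ws) +
  \sum_(t < size ws)
     ((-1) ^+ t * \sum_j \sum_i a i * q i j * nth (fun=> 0) ws t j)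
     *: wedges (take t ws ++ drop t.+1 ws).
Proof.
rewrite clifford_mul_vec contr_wedges; congr (_ + _); apply: eq_bigr => t _.
by congr (_ * _ *: _); apply: eq_bigr => j _; rewrite mulr_suml.
Qed.

End Exterior.

Section CliffordAlgebra.
Variables (F : fieldType) (R : comAlgType F) (n : nat).

Definition clifford (q : 'I_n -> 'I_n -> R) : Type := {ffun {set 'I_n} -> R}.
HB.instance Definition _ q :=
  GRing.Lmodule.copy (clifford q) {ffun {set 'I_n} -> R}.

Variable q : 'I_n -> 'I_n -> R.

HB.instance Definition _ :=
  GRing.Zmodule_isNzRing.Build (clifford q)
    (@clifford_mulA R n q) (@clifford_mul1l R n q) (@clifford_mul1r R n q)
    (@clifford_mulDl R n q) (@clifford_mulDr R n q) (@ext_one_neq0 R n).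

Lemma clifford_scaleE (c : F) (x : clifford q) :
  c *: x = c%:A *: (x : {ffun {set 'I_n} -> R^o}) :> {ffun {set 'I_n} -> R}.
Proof. by apply/ffunP => J; rewrite !ffunE -[RHS]/(c%:A * x J) mulr_algl. Qed.

Fact clifford_scaleAl (c : F) (x y : clifford q) : c *: (x * y) = (c *: x) * y.
Proof.
by rewrite !clifford_scaleE; apply/esym; apply: (@clifford_actZ R n q).
Qed.
HB.instance Definition _ :=
  GRing.Lmodule_isLalgebra.Build F (clifford q) clifford_scaleAl.

Fact clifford_scaleAr (c : F) (x y : clifford q) : c *: (x * y) = x * (c *: y).
Proof. by rewrite !clifford_scaleE; apply/esym; apply: (@clifford_mulZr R n q). Qed.
HB.instance Definition _ :=
  GRing.Lalgebra_isAlgebra.Build F (clifford q) clifford_scaleAr.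

End CliffordAlgebra.

Section LinearAlgebra.
Variables (F : fieldType) (V : lmodType F).

Definition lin_span (P : V -> Prop) (v : V) : Prop :=
  exists (m : nat) (c : 'I_m -> F) (b : 'I_m -> V),
    (forall i, P (b i)) /\ v = \sum_i c i *: b i.

Definition has_dim (P : V -> Prop) (d : nat) : Prop :=
  exists b : 'I_d -> V,
    (forall c : 'I_d -> F, \sum_i c i *: b i = 0 -> forall i, c i = 0) /\
    (forall v, P v <-> exists c : 'I_d -> F, v = \sum_i c i *: b i).

End LinearAlgebra.

Definition direct_sum (I : eqType) (M : zmodType) (gr : I -> M -> Prop) : Prop :=
  [/\ forall i, gr i 0,
      forall i x y, gr i x -> gr i y -> gr i (x - y),
      forall x, exists (s : seq I) (f : I -> M),
        (forall i, gr i (f i)) /\ x = \sum_(i <- s) f i &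
      forall (s : seq I) (f : I -> M), uniq s -> (forall i, gr i (f i)) ->
        \sum_(i <- s) f i = 0 -> forall i, i \in s -> f i = 0].

(* Since [ga_gr _ 0] consists of the scalars, the augmentation [ga_aug] is
   determined by the grading. *)
Record gradedAlgebra (F : fieldType) := GradedAlgebra {
  ga_sort :> algType F;
  ga_gr : nat -> ga_sort -> Prop;
  ga_aug : ga_sort -> F;
  ga_direct : direct_sum ga_gr;
  ga_grM : forall i j a b, ga_gr i a -> ga_gr j b -> ga_gr (i + j) (a * b);
  ga_gr0 : forall a, ga_gr 0 a <-> exists c : F, a = c%:A;
  ga_augD : forall a b, ga_aug (a + b) = ga_aug a + ga_aug b;
  ga_aug_scalar : forall c : F, ga_aug c%:A = c;
  ga_aug_pos : forall i a, ga_gr i.+1 a -> ga_aug a = 0 }.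

(* Right modules are left modules over the converse algebra [A^c]: for [a : A]
   and [x : M], the product x.a is written [(a : A^c) *: x]. *)
Record gradedModule (F : fieldType) (A : gradedAlgebra F) := GradedModule {
  gm_sort :> lmodType A^c;
  gm_gr : int -> gm_sort -> Prop;
  gm_direct : direct_sum gm_gr;
  gm_grM : forall (j : int) (i : nat) (x : gm_sort) (a : A),
    gm_gr j x -> ga_gr i a -> gm_gr (j + i%:Z) ((a : A^c) *: x) }.

Definition residue (F : fieldType) (A : gradedAlgebra F) : Type := F.
HB.instance Definition _ (F : fieldType) (A : gradedAlgebra F) :=
  GRing.Zmodule.copy (residue A) F.

Section GradedModules.
Variables (F : fieldType) (A : gradedAlgebra F).

Lemma ga_aug_is_additive : ga_aug (0 : A) = 0 /\ {morph @ga_aug F A : a / - a >-> - a}.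
Proof.
have a0 : ga_aug (0 : A) = 0.
  by have := @ga_aug_scalar F A 0; rewrite scale0r.
split=> // a; apply/eqP; rewrite -addr_eq0 -ga_augD addNr; exact/eqP.
Qed.

Lemma ga_augM (a b : A) : ga_aug (a * b) = ga_aug a * ga_aug b.
Proof.
have [_ _ dec _] := ga_direct A; have [a0 _] := ga_aug_is_additive.
have augS (s : seq nat) (f : nat -> A) :
    ga_aug (\sum_(i <- s) f i) = \sum_(i <- s) ga_aug (f i).
  by apply: big_morph => //; apply: ga_augD.
have [s [f [fP ->]]] := dec a; have [t [g [gP ->]]] := dec b.
rewrite big_distrlr /= augS [in RHS]augS [in RHS]augS big_distrlr /=.
apply: eq_bigr => i _; rewrite augS; apply: eq_bigr => j _.
have := ga_grM (fP i) (gP j); case: i (fP i) => [|i] fi; last first.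
  by move/ga_aug_pos => ->; rewrite (ga_aug_pos fi) mul0r.
case: j (gP j) => [|j] gj; last first.
  by move/ga_aug_pos => ->; rewrite (ga_aug_pos gj) mulr0.
have [/(_ fi) [c ->] _] := ga_gr0 (f 0%N); have [/(_ gj) [d ->] _] := ga_gr0 (g 0%N).
by move=> _; rewrite mulr_algl scalerA !ga_aug_scalar.
Qed.

Definition residue_scale (a : A^c) (c : residue A) : residue A := c * ga_aug (a : A).

Fact residue_scaleA a b c :
  residue_scale a (residue_scale b c) = residue_scale (a * b) c.
Proof. by rewrite /residue_scale -mulrA; congr (_ * _); rewrite -ga_augM. Qed.
Fact residue_scale1 : left_id 1 residue_scale.
Proof.
move=> c; rewrite /residue_scale -[1]/(1 : A) -(scale1r (1 : A)) ga_aug_scalar.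
exact: mulr1.
Qed.
Fact residue_scaleDr : right_distributive residue_scale +%R.
Proof. by move=> a c d; apply: mulrDl. Qed.
Fact residue_scaleDl c : {morph residue_scale^~ c : a b / a + b}.
Proof. by move=> a b; rewrite /residue_scale -mulrDr -ga_augD. Qed.
HB.instance Definition _ := GRing.Zmodule_isLmodule.Build A^c (residue A)
  residue_scaleA residue_scale1 residue_scaleDr residue_scaleDl.

Definition residue_gr (j : int) (c : residue A) : Prop := j = 0 \/ c = 0.

Fact residue_direct : direct_sum residue_gr.
Proof.
split=> [i|i x y [->|->]|x|s f us fP].
- by right.
- by left.
- by case=> [->|->]; [left|right; rewrite subr0].
- exists [:: 0], (fun i => if i == 0 then x else 0).
  split; last by rewrite big_seq1 eqxx.
  by move=> i; case: eqP => [->|_]; [left|right].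
- move=> fs i si; have [i0|i0] := eqVneq i 0; last first.
    by case: (fP i) => // /eqP; rewrite (negPf i0).
  subst i; rewrite (bigD1_seq 0) //= big1_seq ?addr0 // in fs.
  by move=> i /andP[/negPf i0 _]; case: (fP i) => // /eqP; rewrite i0.
Qed.

Fact residue_grM (j : int) (i : nat) (x : residue A) (a : A) :
  residue_gr j x -> ga_gr i a -> residue_gr (j + i%:Z) ((a : A^c) *: x).
Proof.
case=> [->|->] ai; last by right; rewrite scaler0.
case: i ai => [|i] ai; first by left.
by right; rewrite /GRing.scale /= /residue_scale (ga_aug_pos ai) mulr0.
Qed.

Definition residue_module : gradedModule A :=
  GradedModule residue_direct residue_grM.

Definition regular_gr (j : int) (a : (A^c)^o) : Prop :=
  if j is Posz i then ga_gr i (a : A) else a = 0.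

Fact regular_direct : direct_sum regular_gr.
Proof.
have [gr0 grB dec ind] := ga_direct A; split.
- by case=> // i; apply: gr0.
- by case=> [i|i] x y /=; [apply: grB|move=> -> ->; rewrite subr0].
- move=> x; have [s [f [fP ->]]] := dec x.
  exists (map Posz s), (fun j => if j is Posz i then f i else 0).
  by split; [case|rewrite big_map].
- move=> s f us fP fs [i|i] si; last exact: fP (Negz i).
  pose t := pmap (fun j => if j is Posz k then Some k else None) s.
  have tP : pcancel Posz (fun j => if j is Posz k then Some k else None) by [].
  have E : map Posz t = [seq j <- s | if j is Posz _ then true else false].
    by rewrite /t; elim: (s) => //= -[k|k] s' /= ->.
  have ut : uniq t by rewrite -(map_inj_uniq (f := Posz)) ?E ?filter_uniq // => ? ? [].
  apply: (ind t (fun k => f (Posz k)) ut (fun k => fP (Posz k))); last first.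
    by rewrite -(mem_map (f := Posz)) ?E ?mem_filter // => ? ? [].
  rewrite -(big_map Posz predT f) E big_filter -[RHS]fs.
  rewrite [in RHS](bigID (fun j => if j is Posz _ then true else false)) /=.
  by rewrite [X in _ + X]big1 ?addr0 // => -[//|k] _; apply: fP (Negz k).
Qed.

Fact regular_grM (j : int) (i : nat) (x : (A^c)^o) (a : A) :
  regular_gr j x -> ga_gr i a -> regular_gr (j + i%:Z) ((a : A^c) *: x).
Proof.
case: j => [j|j] /= xj ai; first exact: (ga_grM xj ai).
have [gr0 _ _ _] := ga_direct A.
rewrite xj scaler0; case: (_ + _) => [k|k] //=; exact: gr0.
Qed.

Definition regular_module : gradedModule A := GradedModule regular_direct regular_grM.

Section Shift.
Variables (M : gradedModule A) (m : int).

Definition shift_gr (j : int) (x : M) : Prop := gm_gr (m + j) x.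

Fact shift_direct : direct_sum shift_gr.
Proof.
have [gr0 grB dec ind] := gm_direct M; split.
- by move=> i; apply: gr0.
- by move=> i x y; apply: grB.
- move=> x; have [s [f [fP ->]]] := dec x.
  exists [seq i - m | i <- s], (fun i => f (m + i)); split=> [i|]; first exact: fP.
  by rewrite big_map; apply: eq_bigr => i _; rewrite addrC subrK.
- move=> s f us fP fs i si.
  have := ind [seq m + i | i <- s] (fun i => f (i - m)).
  rewrite (map_inj_uniq (addrI m)) big_map => /(_ us) H.
  rewrite -[i](addKr m) addrC; apply: H => [j||].
  - by have := fP (j - m); rewrite /shift_gr addrC subrK.
  - by rewrite -[RHS]fs; apply: eq_bigr => j _; rewrite addrC addKr.
  - by rewrite mem_map //; apply: addrI.
Qed.

Fact shift_grM (j : int) (i : nat) (x : M) (a : A) :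
  shift_gr j x -> ga_gr i a -> shift_gr (j + i%:Z) ((a : A^c) *: x).
Proof. by move=> xj ai; rewrite /shift_gr addrA; apply: gm_grM. Qed.

Definition gm_shift : gradedModule A := GradedModule shift_direct shift_grM.

End Shift.

Definition graded_map (M N : gradedModule A) (f : {linear M -> N}) : Prop :=
  forall j x, gm_gr j x -> gm_gr j (f x).

Definition graded_projective (P : gradedModule A) : Prop :=
  forall (M N : gradedModule A) (p : {linear M -> N}) (g : {linear P -> N}),
    graded_map p -> (forall y, exists x, p x = y) -> graded_map g ->
    exists h : {linear P -> M}, graded_map h /\ forall x, p (h x) = g x.

Record projective_resolution (M : gradedModule A) := ProjectiveResolution {
  pr_module :> nat -> gradedModule A;
  pr_diff : forall p, {linear pr_module p.+1 -> pr_module p};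
  pr_aug : {linear pr_module 0 -> M};
  pr_projective : forall p, graded_projective (pr_module p);
  pr_diff_graded : forall p, graded_map (pr_diff p);
  pr_aug_graded : graded_map pr_aug;
  pr_aug_surj : forall y, exists x, pr_aug x = y;
  pr_exact0 : forall x, pr_aug x = 0 <-> exists y, x = pr_diff 0 y;
  pr_exact : forall p x, pr_diff p x = 0 <-> exists y, x = pr_diff p.+1 y }.

Definition projective_dim_le (M : gradedModule A) (d : nat) : Prop :=
  exists P : projective_resolution M, forall p, (d < p)%N -> forall x : P p, x = 0.

(* The degree-j part of the graded Ext is computed by the complex of
   degree-preserving homomorphisms into the gm_shift N(j). *)
Section Ext.
Variables (M N : gradedModule A) (P : projective_resolution M) (p : nat) (j : int).

Definition cocycle (f : {linear P p -> gm_shift N j}) : Prop :=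
  graded_map f /\ forall y, f (pr_diff P p y) = 0.

Definition coboundary_of (q : nat) : {linear P q -> gm_shift N j} -> Prop :=
  match q with
  | 0 => fun f => forall x, f x = 0
  | q'.+1 => fun f => exists g : {linear P q' -> gm_shift N j},
      graded_map g /\ forall x, f x = g (pr_diff P q' x)
  end.

Definition coboundary f := coboundary_of (q := p) f.

(* Ext^p(M,N)_j is isomorphic to the subspace W of T. *)
Definition Ext_iso (T : lmodType F) (W : T -> Prop) : Prop :=
  exists phi : {linear P p -> gm_shift N j} -> T,
  [/\ forall (c : F) (f g h : {linear P p -> gm_shift N j}),
        cocycle f -> cocycle g -> cocycle h ->
        (forall x, h x = (c%:A : A^c) *: f x + g x) ->
        phi h = c *: phi f + phi g,
      forall f, cocycle f -> (phi f = 0 <-> coboundary f) &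
      forall t, W t <-> exists f, cocycle f /\ phi f = t].

End Ext.

(* Ext^*(k, A) = k(l)[-d] as graded vector spaces. *)
Definition Gorenstein (d : nat) (l : int) : Prop :=
  exists P : projective_resolution residue_module,
  forall (p : nat) (j : int),
    Ext_iso regular_module P p j
      (fun c : F^o => if p == d then gm_gr (g := gm_shift residue_module l) j c else c = 0).

(* The dimension of (k + W + ... + W^m), where W is spanned by ws, is d m. *)
Definition growth (ws : seq A) (d : nat -> nat) : Prop :=
  forall m, has_dim
    (lin_span (fun x : A => exists t : seq A,
      [/\ (size t <= m)%N, {subset t <= ws} & x = \prod_(y <- t) y])) (d m).

Definition log_growth (d : nat -> nat) (m : nat) : Rdefinitions.R :=
  Rdefinitions.Rdiv (Rpower.ln (Raxioms.INR (d m))) (Rpower.ln (Raxioms.INR m)).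

(* GKdim A is the supremum over W of limsup_m log_m dim (k + W + ... + W^m). *)
Definition GKdim_le (r : Rdefinitions.R) : Prop :=
  forall ws : seq A, exists d : nat -> nat,
    growth ws d /\
    Rbar.Rbar_le (Lim_seq.LimSup_seq (log_growth d)) (Rbar.Finite r).

Definition finite_GKdim : Prop := exists r, GKdim_le r.

Definition AS_regular (d : nat) (l : int) : Prop :=
  [/\ forall M : gradedModule A, projective_dim_le M d,
      finite_GKdim & Gorenstein d l].

Definition Hilbert_series (h : nat -> nat) : Prop :=
  forall i, has_dim (ga_gr (g := A) i) (h i).

End GradedModules.

(* The formal power series with coefficients h is the inverse of p. *)
Definition series_eq_inv (h : nat -> nat) (p : {poly int}) : Prop :=
  forall N : nat, \sum_(i < N.+1) (h i)%:Z * p`_(N - i) = (N == 0)%:Z.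

Section CliffordGrading.
Variables (F : fieldType) (n k : nat) (q : 'I_n -> 'I_n -> {mpoly F[k]}).

Local Notation S := {mpoly F[k]}.
Local Notation C := (clifford q).

(* The component of x in /\^{|J|} V (x) Sym^s has degree |J| + 2s. *)
Definition clifford_gr (i : nat) (x : C) : Prop :=
  forall (J : {set 'I_n}) (m : 'X_{1..k}),
    m \in msupp (x J : S) -> (#|J| + 2 * mdeg m)%N = i.

Hypothesis q_homog : forall i j, q i j \is 1.-homog.

Lemma clifford_gr0 i : clifford_gr i 0.
Proof. by move=> J m; rewrite ffunE msupp0. Qed.

Lemma clifford_grD i x y : clifford_gr i x -> clifford_gr i y -> clifford_gr i (x + y).
Proof.
by move=> xi yi J m; rewrite ffunE => /msuppD_le; rewrite mem_cat => /orP[/xi|/yi].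
Qed.

Lemma clifford_grN i x : clifford_gr i x -> clifford_gr i (- x).
Proof. by move=> xi J m; rewrite ffunE (perm_mem (msuppN _)) => /xi. Qed.

Lemma clifford_grB i x y : clifford_gr i x -> clifford_gr i y -> clifford_gr i (x - y).
Proof. by move=> xi /clifford_grN; apply: clifford_grD. Qed.

Lemma clifford_gr_sum i (I : Type) (s : seq I) (P : pred I) (f : I -> C) :
  (forall t, P t -> clifford_gr i (f t)) -> clifford_gr i (\sum_(t <- s | P t) f t).
Proof. by move=> H; elim/big_ind: _ => //; [apply: clifford_gr0|apply: clifford_grD]. Qed.

Lemma ext_sgn_msupp (i : 'I_n) J (p : S) m :
  m \in msupp (ext_sgn S i J * p) -> m \in msupp p.
Proof.
rewrite /ext_sgn; case: (odd _) (signr_odd S #|[set j in J | (j < i)%N]|) => <-.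
  by rewrite expr1 mulN1r (perm_mem (msuppN _)).
by rewrite mul1r.
Qed.

Lemma clifford_gr_wedge1 i t (x : C) : clifford_gr i x -> clifford_gr i.+1 (wedge1 t x).
Proof.
move=> xi J m; rewrite ffunE; case: ifP => tJ; last by rewrite msupp0.
by move/ext_sgn_msupp/xi => <-; rewrite (cardsD1 t J) tJ.
Qed.

Lemma clifford_gr_contr1 i t (x : C) : clifford_gr i x -> clifford_gr i.-1 (contr1 t x).
Proof.
move=> xi J m; rewrite ffunE; case: ifP => tJ; first by rewrite msupp0.
by move/ext_sgn_msupp/xi => <-; rewrite cardsU1 tJ.
Qed.

Lemma clifford_gr_contr1_0 t (x : C) : clifford_gr 0 x -> contr1 t x = 0.
Proof.
move=> xi; apply/ffunP => J; rewrite !ffunE; case: ifP => // tJ.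
suff -> : x (t |: J) = 0 by rewrite mulr0.
apply/eqP; rewrite -[_ == _]msupp_eq0; apply/eqP; apply: size0nil.
by case E: msupp => [//|m s]; have := xi (t |: J) m; rewrite E inE eqxx cardsU1 tJ => /(_ isT).
Qed.

Lemma clifford_gr_scale i s (r : S) (x : C) : r \is s.-homog -> clifford_gr i x ->
  clifford_gr (i + 2 * s) (r *: (x : {ffun {set 'I_n} -> S^o})).
Proof.
move=> /dhomogP rs xi J m; rewrite ffunE => /msuppM_le /allpairsP[[a b] /= [ar bx ->]].
by rewrite mdegD -(xi _ _ bx) (rs _ ar) mulnDr [(_ + 2 * _)%N in RHS]addnC addnCA.
Qed.

Lemma clifford_gr_contr i t (x : C) : clifford_gr i x -> clifford_gr i.+1 (contr (q t) x).
Proof.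
move=> xi; apply: clifford_gr_sum => u _; case: i xi => [|i] xi.
  by rewrite (clifford_gr_contr1_0 _ xi) scaler0; apply: clifford_gr0.
have := clifford_gr_scale (q_homog t u) (@clifford_gr_contr1 _ u _ xi).
by rewrite /= addn2.
Qed.

Lemma clifford_gr_gen i t (x : C) : clifford_gr i x -> clifford_gr i.+1 (clifford_gen q t x).
Proof.
by move=> xi; apply: clifford_grD; [apply: clifford_gr_wedge1|apply: clifford_gr_contr].
Qed.

Lemma clifford_gr_act s i j (x y : C) : clifford_gr i x -> clifford_gr j y ->
  clifford_gr (i + j) (clifford_act q s x y).
Proof.
elim: s i x => [|t s IH] i x xi yj /=.
  move=> J m; rewrite ffunE => /msuppM_le /allpairsP[[a b] /= [ar bx ->]].
  by rewrite mdegD -(xi _ _ ar) -(yj _ _ bx) cards0 mulnDr add0n addnCA.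
have x1 := @clifford_gr_contr1 _ t _ xi.
have [x0|i0] : contr1 t x = 0 \/ i = i.-1.+1.
- by case: i xi {x1} => [/clifford_gr_contr1_0|i _]; [left|right].
- rewrite x0 [wedge1 t 0]linear0 [contr _ 0]linear0 !clifford_act0.
  by rewrite [clifford_gen _ _ 0]linear0 !subr0 addr0; apply: IH.
apply: clifford_grB; last by apply: IH => //; rewrite i0; apply: clifford_gr_contr.
apply: clifford_grD; last by rewrite i0 addSn; apply: clifford_gr_gen; apply: IH.
by apply: IH => //; apply: clifford_grB => //; rewrite i0; apply: clifford_gr_wedge1.
Qed.

Lemma clifford_grM i j (x y : C) :
  clifford_gr i x -> clifford_gr j y -> clifford_gr (i + j) (x * y).
Proof. exact: clifford_gr_act. Qed.

Definition clifford_comp (i : nat) (x : C) : C :=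
  [ffun J : {set _} => \sum_(m <- msupp (x J : S) | (#|J| + 2 * mdeg m)%N == i)
                          (x J : S)@_m *: 'X_[m]].

Lemma mcoeff_clifford_comp i (x : C) J m :
  (clifford_comp i x J : S)@_m = if (#|J| + 2 * mdeg m)%N == i then (x J : S)@_m else 0.
Proof.
rewrite ffunE raddf_sum /=; under eq_bigr do rewrite mcoeffZ mcoeffX.
have [mx|mx] := boolP (m \in msupp (x J : S)); last first.
  rewrite big1_seq => [|a /andP[_ ax]]; first by rewrite (memN_msupp_eq0 mx) if_same.
  by case: eqP ax mx => [-> ->|]; rewrite ?mulr0.
rewrite big_mkcond (bigD1_seq m) ?msupp_uniq //= eqxx mulr1 big1 ?addr0 // => a /negPf am.
by rewrite am mulr0 if_same.
Qed.

Lemma clifford_comp_gr i x : clifford_gr i (clifford_comp i x).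
Proof. by move=> J m; rewrite mcoeff_msupp mcoeff_clifford_comp; case: ifP => [/eqP//|_]; rewrite eqxx. Qed.

Fact clifford_direct : direct_sum clifford_gr.
Proof.
split=> [i|i x y|x|s f us fP fs i si]; [exact: clifford_gr0|exact: clifford_grB| |].
  pose N := (\max_(J : {set 'I_n}) (#|J| + 2 * msize (x J : S))).+1%N.
  exists (iota 0 N), (clifford_comp^~ x); split=> [i|]; first exact: clifford_comp_gr.
  apply/ffunP => J; apply/mpolyP => m; rewrite sum_ffunE raddf_sum /=.
  under eq_bigr do rewrite mcoeff_clifford_comp.
  have [mx|mx] := boolP (m \in msupp (x J : S)); last first.
    by rewrite (memN_msupp_eq0 mx) big1 // => i _; rewrite if_same.
  have mN : (#|J| + 2 * mdeg m)%N \in iota 0 N.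
    rewrite mem_iota add0n leq0n /N ltnS; apply: leq_trans (leq_bigmax J).
    by rewrite leq_add2l leq_mul2l /= ltnW ?msize_mdeg_lt.
  rewrite (bigD1_seq _ mN (iota_uniq _ _)) /= eqxx.
  by rewrite big1 ?addr0 // => i /negPf; rewrite eq_sym => ->.
apply/ffunP => J; apply/mpolyP => m; rewrite ffunE mcoeff0.
have [mf|/memN_msupp_eq0//] := boolP (m \in msupp (f i J : S)).
have /(congr1 (fun z : C => (z J : S)@_m)) := fs.
rewrite sum_ffunE raddf_sum /= ffunE mcoeff0 (bigD1_seq i) //= big1 ?addr0 // => j ji.
apply: memN_msupp_eq0; apply: contra ji => mj.
by rewrite -(fP _ _ _ mf) -(fP _ _ _ mj).
Qed.

Definition clifford_aug (x : C) : F := (x set0 : S)@_0%MM.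

Lemma clifford_scalarE (c : F) J : (c%:A : C) J = if J == set0 then c%:MP else 0.
Proof.
have -> : (c%:A : C) J = c *: (@ext_one S n J : S) by rewrite ffunE.
rewrite ffunE; case: eqP => _; last exact: scaler0.
by rewrite -alg_mpolyC.
Qed.

Fact clifford_gr0P (x : C) : clifford_gr 0 x <-> exists c : F, x = c%:A.
Proof.
split=> [x0|[c ->]].
  exists (clifford_aug x); apply/ffunP => J; rewrite clifford_scalarE; apply/mpolyP => m.
  have [mx|mx] := boolP (m \in msupp (x J : S)).
    have /eqP := x0 _ _ mx; rewrite addn_eq0 muln_eq0 /= cards_eq0 mdeg_eq0.
    by case/andP => /eqP -> /eqP ->; rewrite eqxx mcoeffC eqxx mulr1.
  rewrite (memN_msupp_eq0 mx); case: eqP mx => [->|_ _]; last by rewrite mcoeff0.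
  rewrite mcoeffC; case: eqP => [->|]; last by rewrite mulr0.
  by move/memN_msupp_eq0; rewrite /clifford_aug => ->; rewrite mul0r.
move=> J m; rewrite clifford_scalarE; case: eqP => [->|_]; last by rewrite msupp0.
by rewrite msuppC; case: ifP => // _; rewrite inE => /eqP ->; rewrite cards0 mdeg0.
Qed.

Fact clifford_augD (x y : C) : clifford_aug (x + y) = clifford_aug x + clifford_aug y.
Proof. by rewrite /clifford_aug ffunE mcoeffD. Qed.

Fact clifford_aug_scalar c : clifford_aug c%:A = c.
Proof. by rewrite /clifford_aug clifford_scalarE eqxx mcoeffC eqxx mulr1. Qed.

Fact clifford_aug_pos i x : clifford_gr i.+1 x -> clifford_aug x = 0.
Proof.
move=> xi; apply: memN_msupp_eq0; apply/negP => /xi.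
by rewrite cards0 mdeg0.
Qed.

Definition graded_clifford : gradedAlgebra F :=
  GradedAlgebra clifford_direct clifford_grM clifford_gr0P
    clifford_augD clifford_aug_scalar clifford_aug_pos.

End CliffordGrading.

Section TwistedSections.
Variables (F : fieldType) (k : nat).
Local Notation S := {mpoly F[k]}.

(* A global section of O(s) on P^{k-1}, given on each chart y_a <> 0 by the
   fraction p a / y_a^N, homogeneous of degree s. *)
Definition twisted_section (s : int) (N : nat) (p : 'I_k -> S) : Prop :=
  (forall a m, m \in msupp (p a) -> (mdeg m)%:Z = s + N%:Z) /\
  (forall a b, p a * 'X_b ^+ N = p b * 'X_a ^+ N).

Lemma twisted_section_val s N p : (0 < k)%N -> (1 < k)%N || (0 <= s) ->
  twisted_section s N p ->
  exists g : S, (forall m, m \in msupp g -> (mdeg m)%:Z = s) /\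
                forall a, p a = g * 'X_a ^+ N.
Proof.
move=> k0 ks [ph pc].
have XN (a : 'I_k) : 'X_a ^+ N = 'X_[U_(a) *+ N] :> S by rewrite mpolyXn.
have le a m : m \in msupp (p a) -> (U_(a) *+ N <= m)%MM.
  move=> ma; apply/mnm_lepP => c; rewrite mulmnE mnm1E; case: eqP => // <-.
  rewrite mul1n; have [/existsP[b ba]|] := boolP [exists b : 'I_k, b != a].
    have ma' : (m + U_(b) *+ N)%MM \in msupp (p a * 'X_[U_(b) *+ N]).
      by rewrite (perm_mem (msuppMX _ _)); apply/mapP; exists m => //; rewrite addmC.
    rewrite -XN pc XN (perm_mem (msuppMX _ _)) in ma'.
    have [m' _ /mnmP /(_ a)] := mapP ma'.
    rewrite !mnmDE !mulmnE !mnm1E eqxx (negPf ba) mul1n mul0n addn0 => ->; exact: leq_addr.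
  rewrite negb_exists => /forallP H.
  have k1 : k = 1%N.
    apply/eqP; rewrite eqn_leq k0 andbT leqNgt; apply/negP => k2.
    have := H (if val a == 0%N then Ordinal k2 else Ordinal k0).
    rewrite negbK => /eqP /(congr1 val); case: eqP => [-> //|a0] /= a0'.
    by case: a0.
  have s0 : 0 <= s by move: ks; rewrite k1.
  have := ph _ _ ma; rewrite mdegE (bigD1 a) //= big1 => [|b ba]; last first.
    by have := H b; rewrite ba.
  by rewrite addn0 => E; rewrite -lez_nat E lerDr.
pose g a : S := \sum_(m <- msupp (p a)) (p a)@_m *: 'X_[m - U_(a) *+ N].
have gE a : p a = g a * 'X_a ^+ N.
  rewrite {1}[p a]mpolyE mulr_suml; apply: eq_big_seq => m /le ma.
  by rewrite -scalerAl XN -mpolyXD submK.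
have gg a b : g a = g b.
  have XNZ c : 'X_c ^+ N != 0 :> S by rewrite XN; apply/eqP => /(congr1 (mcoeff (U_(c) *+ N))) /eqP;
      rewrite mcoeffX eqxx mcoeff0 oner_eq0.
  apply: (mulIf (XNZ b)); apply: (mulIf (XNZ a)).
  by rewrite mulrAC -(gE a) -(gE b) pc.
exists (g (Ordinal k0)); split=> [m mg|a]; last by rewrite -(gg a) -gE.
have : (U_(Ordinal k0) *+ N + m)%MM \in msupp (p (Ordinal k0)).
  by rewrite gE XN (perm_mem (msuppMX _ _)); apply: map_f.
move/ph; rewrite mdegD mdegMn mdeg1 mul1n PoszD addrC => /addIr. exact.
Qed.

End TwistedSections.

Section CoordinateAlgebra.
Variables (F : fieldType) (V : vectType F) (U : {vspace 'Hom(V, 'Hom(V, F^o))}).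

Local Notation n := (\dim {: V}).
Local Notation k := (\dim U).

Definition vec_basis (i : 'I_n) : V := tnth (vbasis {: V}) i.
Definition form_basis (a : 'I_k) : 'Hom(V, 'Hom(V, F^o)) := tnth (vbasis U) a.

(* ['X_a] is the linear form on U dual to [form_basis a]. *)
Definition q_U (v w : V) : {mpoly F[k]} :=
  \sum_a (form_basis a v w : F) *: 'X_a.

Fact q_U_homog v w : q_U v w \is 1.-homog.
Proof.
rewrite /q_U; apply: rpred_sum => a _; apply: rpredZ.
by rewrite dhomogX /= mdeg1.
Qed.

Definition gram (i j : 'I_n) : {mpoly F[k]} := q_U (vec_basis i) (vec_basis j).

Fact gram_homog i j : gram i j \is 1.-homog.
Proof. exact: q_U_homog. Qed.

(* H^0(P(U), O(s)) = Sym^s U^\vee, with Sym U^\vee = k['X_1, ..., 'X_k]; see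
   [twisted_section_val].  Terms /\^{i-2s} V (x) O(s) with s < 0 contribute
   nothing to degree i >= 0 when dim V <= dim U. *)
Definition coordinate_algebra : gradedAlgebra F := graded_clifford gram_homog.

Definition vec_coord (v : V) (i : 'I_n) : {mpoly F[k]} :=
  (coord (vbasis {: V}) i v)%:A.
Definition vec (v : V) : coordinate_algebra := ext_vec (vec_coord v).
Definition vec_wedge (ws : seq V) : coordinate_algebra := wedges (map vec_coord ws).

Lemma q_U_suml (I : finType) (f : I -> V) (w : V) :
  q_U (\sum_i f i) w = \sum_i q_U (f i) w.
Proof.
rewrite /q_U exchange_big; apply: eq_bigr => a _.
by rewrite linear_sum sum_lfunE scaler_suml.
Qed.

Lemma q_U_sumr (I : finType) (f : I -> V) (v : V) :
  q_U v (\sum_i f i) = \sum_i q_U v (f i).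
Proof.
rewrite /q_U exchange_big; apply: eq_bigr => a _.
by rewrite linear_sum scaler_suml.
Qed.

Lemma q_UZ (c d : F) v w : q_U (c *: v) (d *: w) = c%:A * q_U v w * d%:A.
Proof.
rewrite /q_U mulr_sumr mulr_suml; apply: eq_bigr => a _.
by rewrite !linearZ /= lfunE /= mulr_algl mulr_algr !scalerA.
Qed.

Lemma gramE v w :
  \sum_j \sum_i vec_coord v i * gram i j * vec_coord w j = q_U v w.
Proof.
rewrite {2}(coord_vbasis (memvf v)) {2}(coord_vbasis (memvf w)) q_U_sumr.
apply: eq_bigr => j _; rewrite q_U_suml; apply: eq_bigr => i _.
by rewrite q_UZ /gram /vec_basis !(tnth_nth 0).
Qed.

Lemma coordinate_algebra_mulE (v : V) (ws : seq V) :
  vec v * vec_wedge ws =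
  vec_wedge (v :: ws) +
  \sum_(t < size ws)
     ((-1) ^+ t * q_U v ws`_t)
       *: (vec_wedge (take t ws ++ drop t.+1 ws)
             : {ffun {set 'I_n} -> {mpoly F[k]}^o}).
Proof.
rewrite -[LHS]/(clifford_mul gram (ext_vec (vec_coord v)) (wedges (map vec_coord ws))).
rewrite clifford_mulE size_map; congr (_ + _); apply: eq_bigr => t _.
have E : \sum_j \sum_i vec_coord v i * gram i j
    * nth (fun=> 0) (map vec_coord ws) t j = q_U v ws`_t.
  rewrite -gramE; apply: eq_bigr => j _; apply: eq_bigr => i _.
  by rewrite (nth_map 0).
by rewrite E -map_take -map_drop -map_cat.
Qed.

(* A point x of P(V) over an extension iota : F -> L is given by its coordinates
   in [vec_basis]. *)
Definition form_value (L : fieldType) (iota : {rmorphism F -> L})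
    (u : 'Hom(V, 'Hom(V, F^o))) (x : 'I_n -> L) : L :=
  \sum_i \sum_j iota (u (vec_basis i) (vec_basis j) : F) * x i * x j.

Definition empty_base_locus : Prop :=
  exists (L : closedFieldType) (iota : {rmorphism F -> L}),
    (forall z, algebraicOver iota z) /\
    forall x : 'I_n -> L,
      (forall u, u \in U -> form_value iota u x = 0) -> forall i, x i = 0.

(* In characteristic zero Sym^2 V^\vee is the space of symmetric bilinear forms,
   a form u representing the quadratic form v |-> u v v. *)
Definition symmetric_forms : Prop := forall u v w, u \in U -> u v w = u w v.

End CoordinateAlgebra.

(* Main.v *)
(* [B_U] is the enveloping algebra of the super Lie algebra with odd part V, spanned by
   the [e_i], and central even part U^\vee, spanned by the [y_a]. Its PBW basis [e_J y^m]
   gives the Hilbert series. The Chevalley-Eilenberg complex, whose chains are the elements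
   of [M (x) B_U (x) Gamma(x_1, ..., x_n) (x) /\(xi_1, ..., xi_k)], with divided powers
   in the [x_i], resolves M by an Euler homotopy. The contraction [iota_a] is a homotopy
   between 0 and the operator [q_a(d/dx)]. Since the quadrics have no common zero, a power
   of each [x_i] lies in the ideal that they generate, so [d/dx_i] acts nilpotently on
   the cohomology of [Hom(-, N)]. On the common kernel of the [d/dx_i] only the [xi_a]
   remain, so this complex vanishes above degree k; the long exact sequences of the
   [d/dx_i] carry the vanishing to the whole complex, whence the projective dimension.
   For M = F and N = B_U, the common kernel gives the Koszul complex of the regular
   sequence [y_a], with cohomology [B_U/(y) = /\V] in degree k, whose socle is the top
   exterior form; hence Ext is one-dimensional, of degree 2k - n. *)
Require Import Defs.
From HB Require Import structures.
From mathcomp Require Import all_boot all_order all_algebra.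
From mathcomp Require Import finmap monalg mpoly ring lra zify.
From mathcomp Require Import boolp functions.
Set Implicit Arguments.
Unset Strict Implicit.
Unset Printing Implicit Defensive.
Import Order.TTheory GRing.Theory Num.Theory.
Local Open Scope ring_scope.
Local Notation "{ 'mpoly' T [ n ] }" := (mpoly.mpoly n T) : type_scope.

(** The divided powers make the complex infinitely long, so it does not bound the projective
    dimension by its mere length. The bound comes from taking for N the module of k-cycles: the
    boundary map into it is a cocycle of degree k + 1, a primitive of that cocycle is a retraction
    onto the boundaries, and the complex can be cut off at a projective summand in degree k.
    Exactness is a descent on weight. The differential equals a Koszul differential plus terms of
    smaller weight, and the homotopy reproduces a cycle of weight w multiplied by w, up to smaller
    weight; characteristic zero allows the division. The long exact sequences are never formed:
    primitives and cocycles are carried by hand through the kernels of d/dx_1, ..., d/dx_l for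
    varying l. The empty base locus enters only through identities x_i^(p+2) = sum of r_a q_a over F
    itself. They are the solution of a linear system, which may be tested over an algebraic closure.
    The same identities make F[x] a finite module over the algebra generated by the q_a, and
    counting monomials then gives n <= k. *)

Definition linear_of (R : nzRingType) (M N : lmodType R) (f : M -> N)
    (fl : linear f) : {linear M -> N} :=
  HB.pack f (GRing.isLinear.Build R M N *:%R f fl).
Arguments linear_of : simpl never.

(** * Graded modules *)

Section GradedSubmodules.
Variables (F : fieldType) (A : gradedAlgebra F) (V : lmodType A^c).
Variable gr : int -> V -> Prop.

Definition graded_sum (P : V -> Prop) (x : V) : Prop :=
  exists (s : seq int) (f : int -> V),
    [/\ uniq s, forall i, gr i (f i) /\ P (f i) & x = \sum_(i <- s) f i].

Definition graded_submodule (P : V -> Prop) : Prop :=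
  [/\ P 0, forall a x y, P x -> P y -> P (a *: x + y) & forall x, P x -> graded_sum P x].

(** Unlike in [direct_sum], no decomposition is required: chains form a full function space, which
    is a product and not the sum of its homogeneous parts. The submodules that do decompose are
    singled out by [graded_submodule]. *)
Record grading : Prop := Grading {
  grading0 : forall i, gr i 0;
  gradingB : forall i x y, gr i x -> gr i y -> gr i (x - y);
  grading_indep : forall (s : seq int) (f : int -> V), uniq s ->
    (forall i, gr i (f i)) -> \sum_(i <- s) f i = 0 -> forall i, i \in s -> f i = 0;
  gradingM : forall (j : int) (i : nat) (x : V) (a : A),
    gr j x -> ga_gr i a -> gr (j + i%:Z) ((a : A^c) *: x) }.

Hypothesis grP : grading.

Lemma gradingN i x : gr i x -> gr i (- x).
Proof. by rewrite -[- x]add0r; apply: gradingB => //; apply: grading0. Qed.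

Lemma gradingD i x y : gr i x -> gr i y -> gr i (x + y).
Proof. by move=> xi yi; rewrite -[y]opprK; apply: gradingB => //; apply: gradingN. Qed.

Lemma grading_sum i (I : Type) (s : seq I) (Q : pred I) (f : I -> V) :
  (forall t, Q t -> gr i (f t)) -> gr i (\sum_(t <- s | Q t) f t).
Proof. by move=> H; elim/big_ind: _ => //; [apply: grading0|apply: gradingD]. Qed.

Section Sums.
Variable P : V -> Prop.
Hypotheses (P0 : P 0) (PD : forall x y, P x -> P y -> P (x + y)).

Lemma graded_sum_seq (s : seq int) (f : int -> V) :
  (forall i, gr i (f i) /\ P (f i)) -> graded_sum P (\sum_(i <- s) f i).
Proof.
move=> fP; exists (undup s), (fun i => f i *+ count_mem i s); split.
- exact: undup_uniq.
- move=> i; have [gi Pi] := fP i.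
  elim: (count_mem i s) => [|m [gm Pm]]; first by rewrite mulr0n; split=> //; apply: grading0.
  by rewrite mulrS; split; [apply: gradingD|apply: PD].
- by rewrite -big_undup_iterop_count.
Qed.

Lemma graded_sum_hom i x : gr i x -> P x -> graded_sum P x.
Proof.
move=> gx Px; have := @graded_sum_seq [:: i] (fun j => if j == i then x else 0).
rewrite big_seq1 eqxx; apply=> j; case: eqP => [->//|_]; split=> //; exact: grading0.
Qed.

Lemma graded_sumD x y : graded_sum P x -> graded_sum P y -> graded_sum P (x + y).
Proof.
case=> s [f [us fP ->]] [t [g [ut gP ->]]].
pose h i := (if i \in s then f i else 0) + (if i \in t then g i else 0).
have -> : \sum_(i <- s) f i + \sum_(i <- t) g i = \sum_(i <- undup (s ++ t)) h i.
  rewrite big_split /=; congr (_ + _); rewrite -big_mkcond /= -[RHS]big_filter; apply: perm_big.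
    apply: uniq_perm => //; first by rewrite filter_uniq ?undup_uniq.
    by move=> i; rewrite mem_filter mem_undup mem_cat; case: (i \in s).
  apply: uniq_perm => //; first by rewrite filter_uniq ?undup_uniq.
  by move=> i; rewrite mem_filter mem_undup mem_cat orbC; case: (i \in t).
apply: graded_sum_seq => i; have [fi Pfi] := fP i; have [gi Pgi] := gP i.
rewrite /h; do 2 case: ifP => _; rewrite ?addr0 ?add0r.
- by split; [apply: gradingD|apply: PD].
- by [].
- by [].
- by split; first apply: grading0.
Qed.

Lemma graded_sum_big (I : Type) (s : seq I) (Q : pred I) (f : I -> V) :
  (forall t, Q t -> graded_sum P (f t)) -> graded_sum P (\sum_(t <- s | Q t) f t).
Proof.
move=> H; elim/big_ind: _ => //; last exact: graded_sumD.
by exists [::], (fun=> 0); split=> //; [split=> //; apply: grading0|rewrite big_nil].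
Qed.
End Sums.

(** The two proofs are phantom arguments: they tie the predicate to the data from which its closure
    properties are inferred. *)
Definition gsub_pred (P : V -> Prop) (_ : grading) (_ : graded_submodule P) : {pred V} :=
  fun x => `[< P x >].

Section Gsub.
Variables (P : V -> Prop) (PP : graded_submodule P).

Fact gsub_submod_closed : GRing.submod_closed (gsub_pred grP PP).
Proof.
have [P0 PD _] := PP; split=> [|a x y]; first exact/asboolP.
by move=> /asboolP xP /asboolP yP; apply/asboolP/PD.
Qed.
HB.instance Definition _ := GRing.isSubmodClosed.Build A^c V (gsub_pred grP PP) gsub_submod_closed.

Record gsub_sort := GSub { gval : V; gvalP : gval \in gsub_pred grP PP }.
HB.instance Definition _ := [isSub for gval].
HB.instance Definition _ := [Choice of gsub_sort by <:].
HB.instance Definition _ := [SubChoice_isSubLmodule of gsub_sort by <:].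

Definition gsub_gr (j : int) (x : gsub_sort) : Prop := gr j (gval x).

Lemma gval_P x : P (gval x). Proof. exact: asboolW (gvalP x). Qed.

Definition gsub_in (x : V) (Px : P x) : gsub_sort := GSub (asboolT Px : x \in gsub_pred grP PP).

Fact gsub_direct : direct_sum gsub_gr.
Proof.
split=> [i|i x y|x|s f us fP fs i si].
- exact: grading0.
- exact: gradingB.
- have [_ _ /(_ _ (gval_P x)) [s [f [us fP xE]]]] := PP.
  exists s, (fun i => gsub_in (fP i).2); split=> [i|]; first exact: (fP i).1.
  by apply: val_inj; rewrite linear_sum.
- apply: val_inj; apply: (grading_indep grP us (f := fun i => gval (f i))) => //.
  by rewrite -[RHS](congr1 val fs) linear_sum.
Qed.

Fact gsub_grM (j : int) (i : nat) (x : gsub_sort) (a : A) :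
  gsub_gr j x -> ga_gr i a -> gsub_gr (j + i%:Z) ((a : A^c) *: x).
Proof. exact: gradingM. Qed.

Definition gsub : gradedModule A := GradedModule gsub_direct gsub_grM.

End Gsub.

Lemma linear_gval (P : V -> Prop) (PP : graded_submodule P) : linear (fun x : gsub PP => gval x : V).
Proof. by []. Qed.

Section Restriction.
Variables (P Q : V -> Prop) (PP : graded_submodule P) (QP : graded_submodule Q).
Variables (f : {linear V -> V}) (fPQ : forall x, P x -> Q (f x)).

Definition gsub_map_fun (x : gsub PP) : gsub QP := gsub_in QP (fPQ (gval_P x)).
Fact gsub_map_linear : linear gsub_map_fun.
Proof. by move=> a x y; apply: val_inj; rewrite /= linearP. Qed.
Definition gsub_map : {linear gsub PP -> gsub QP} := linear_of gsub_map_linear.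

Lemma gsub_map_graded : (forall j x, P x -> gr j x -> gr j (f x)) -> graded_map gsub_map.
Proof. by move=> H j x; apply: H; apply: gval_P. Qed.
End Restriction.

End GradedSubmodules.

Lemma gm_grading (F : fieldType) (A : gradedAlgebra F) (M : gradedModule A) :
  grading (@gm_gr F A M).
Proof. by have [g0 gB _ gi] := gm_direct M; split=> //; apply: gm_grM. Qed.

Lemma gm_graded_sum (F : fieldType) (A : gradedAlgebra F) (M : gradedModule A) (x : M) :
  exists (s : seq int) (f : int -> M), [/\ uniq s, forall i, gm_gr i (f i) & x = \sum_(i <- s) f i].
Proof.
have [_ _ /(_ x) [s [f [fP ->]]] _] := gm_direct M.
have [//|//|i|t [g [ut gP ->]]] := @graded_sum_seq _ _ _ _ (gm_grading M) (fun=> True) _ _ s f.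
- by split.
- by exists t, g; split=> // i; have [] := gP i.
Qed.

(** The family f minus the family concentrated in degree j with value y is homogeneous with sum
    zero, so independence annihilates it term by term. *)
Lemma grading_component (F : fieldType) (A : gradedAlgebra F) (V : lmodType A^c)
    (gr : int -> V -> Prop) (s : seq int) (f : int -> V) (j : int) (y : V) :
  @grading F A V gr -> uniq s -> (forall i, gr i (f i)) -> gr j y ->
  \sum_(i <- s) f i = y -> y = if j \in s then f j else 0.
Proof.
move=> grP us fP yj fs.
pose h i := (if i \in s then f i else 0) - (if i == j then y else 0).
have hP i : gr i (h i).
  apply: gradingB => //; first by case: ifP => _; [exact: fP|exact: grading0].
  by case: eqP => [->|_]; [exact: yj|exact: grading0].
have sE (t : seq int) (g : int -> V) : uniq t -> {subset s <= t} ->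
    \sum_(i <- t) (if i \in s then g i else 0) = \sum_(i <- s) g i.
  move=> ut st; rewrite -big_mkcond /= -[LHS]big_filter; apply: perm_big.
  apply: uniq_perm => // [|i]; first exact: filter_uniq.
  by rewrite mem_filter; case: (boolP (i \in s)) => // /st ->.
pose t := undup (j :: s).
have tj : j \in t by rewrite mem_undup inE eqxx.
have h0 : \sum_(i <- t) h i = 0.
  rewrite sumrB sE ?undup_uniq //; last by move=> i si; rewrite mem_undup inE si orbT.
  by rewrite fs -big_mkcond /= -big_filter filter_pred1_uniq ?undup_uniq // big_seq1 subrr.
have := grading_indep grP (undup_uniq _) hP h0 tj.
by rewrite /h eqxx => /eqP; rewrite subr_eq0 => /eqP.
Qed.

(** The component of degree j of an arbitrary preimage still maps to y. *)
Lemma graded_lift (F : fieldType) (A : gradedAlgebra F) (M N : gradedModule A)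
    (p : {linear M -> N}) (j : int) (y : N) :
  graded_map p -> (forall y, exists x, p x = y) -> gm_gr j y ->
  exists2 x, gm_gr j x & p x = y.
Proof.
move=> pg ps yj; have [x xy] := ps y; have [s [f [us fP xE]]] := gm_graded_sum x.
have := @grading_component F A N _ s (fun i => p (f i)) j y (gm_grading N) us.
rewrite -linear_sum -xE xy => /(_ (fun i => pg _ _ (fP i)) yj erefl); case: ifP => _ ->.
  by exists (f j).
by exists 0; rewrite ?linear0 //; apply: grading0 (gm_grading M) _.
Qed.

(** * Free graded modules *)

Section FreeLift.
Variables (R S : nzRingType) (h : {additive R -> S}) (X : choiceType) (N : lmodType S).
Variable u : X -> N.

(** The coefficient map h is only additive. This covers the identity (free modules), the inclusion
    of the scalars (F-bases) and arbitrary additive operators on the coefficients. *)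
Definition malg_lift (t : {malg R[X]}) : N :=
  \sum_(x <- monalg.msupp t) h (monalg.mcoeff x t) *: u x.

Lemma malg_liftEw (d : {fset X}) t : (monalg.msupp t `<=` d)%fset ->
  malg_lift t = \sum_(x <- d) h (monalg.mcoeff x t) *: u x.
Proof.
move=> td; rewrite /malg_lift (big_fset_incl _ td) // => x _ xt.
by rewrite mcoeff_outdom // raddf0 scale0r.
Qed.

Fact malg_lift_additive : zmod_morphism malg_lift.
Proof.
move=> s t.
have S1 := fsubsetUl (monalg.msupp s) (monalg.msupp t).
have S2 := fsubsetUr (monalg.msupp s) (monalg.msupp t).
rewrite (malg_liftEw (monalg.msuppB_le s t)) (malg_liftEw S1) (malg_liftEw S2) -sumrB.
by apply: eq_bigr => x _; rewrite monalg.mcoeffB raddfB scalerBl.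
Qed.
HB.instance Definition _ := GRing.isZmodMorphism.Build _ _ malg_lift malg_lift_additive.

Lemma malg_liftU c x : malg_lift (monalg.mkmalgU x c) = h c *: u x.
Proof.
rewrite (malg_liftEw (monalg.msuppU_le)) big_seq_fset1 monalg.mcoeffUU //.
Qed.

Lemma malg_liftZ (f : S) (c : R) t : (forall x, h (c * x) = f * h x) ->
  malg_lift (c *: t) = f *: malg_lift t.
Proof.
move=> hE; rewrite (malg_liftEw (monalg.msuppZ_le c t)) scaler_sumr.
by apply: eq_bigr => x _; rewrite monalg.mcoeffZ hE scalerA.
Qed.

End FreeLift.

Lemma malg_ind (R : nzRingType) (X : choiceType) (P : {malg R[X]} -> Prop) :
  (forall s t, P s -> P t -> P (s + t)) -> P 0 -> (forall c x, P (monalg.mkmalgU x c)) ->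
  forall t, P t.
Proof. by move=> PD P0 PU t; rewrite [t]monalgE; elim/big_ind: _. Qed.

Section FreeModule.
Variables (F : fieldType) (A : gradedAlgebra F) (X : choiceType) (deg : X -> int).
Local Notation T := {malg A^c[X]}.
Local Notation rg := (@gm_gr F A (regular_module A)).

Definition free_gr (j : int) (t : T) : Prop :=
  forall x, rg (j - deg x) (monalg.mcoeff x t).

Fact free_grading : @grading F A T free_gr.
Proof.
have G := gm_grading (regular_module A).
split=> [i x|i s t si ti x|s f us fP fs i si|j i t a tj ai x].
- by rewrite monalg.mcoeff0; apply: (grading0 G).
- by rewrite monalg.mcoeffB; apply: (gradingB G).
- apply/malgP => x; rewrite monalg.mcoeff0.
  have := grading_indep G (s := [seq l - deg x | l <- s])
    (f := fun l => monalg.mcoeff x (f (l + deg x)) ).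
  rewrite map_inj_uniq; last exact: addIr.
  move=> /(_ us) H; rewrite -[i](subrK (deg x)); apply: H.
  + by move=> l; have := fP (l + deg x) x; rewrite addrK.
  + rewrite big_map -[RHS](monalg.mcoeff0 (K := X) (G := A^c) x) -fs [RHS]raddf_sum.
    by apply: eq_bigr => l _; rewrite subrK.
  + by apply/mapP; exists i.
- by rewrite monalg.mcoeffZ addrAC; apply: (gradingM G (x := monalg.mcoeff x t)).
Qed.

Fact free_graded_sum (t : T) : graded_sum free_gr (fun=> True) t.
Proof.
elim/malg_ind: t => [s t|//|c x]; first exact: (graded_sumD free_grading).
  by apply: (@graded_sum_hom _ _ _ _ free_grading _ _ _ 0) => //; apply: (grading0 free_grading).
have [s [f [us fP cE]]] := gm_graded_sum (c : regular_module A).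
have -> : monalg.mkmalgU x c = \sum_(i <- s) monalg.mkmalgU x (f i : A^c) :> T.
  by rewrite -raddf_sum; congr (monalg.mkmalgU _ _).
apply: (graded_sum_big free_grading) => // i _.
apply: (@graded_sum_hom _ _ _ _ free_grading _ _ _ (i + deg x)) => // y; rewrite monalg.mcoeffU.
have [<-|_] := eqVneq x y; last by rewrite mulr0n; apply: (grading0 (gm_grading (regular_module A))).
by rewrite addrK mulr1n; apply: fP.
Qed.

Fact free_direct : direct_sum free_gr.
Proof.
have G := free_grading; split=> [i|i x y|t|s f us fP fs i].
- exact: grading0.
- exact: gradingB.
- by have [s [f [us fP ->]]] := free_graded_sum t; exists s, f; split=> // i; have [] := fP i.
- exact: (grading_indep G us fP fs).
Qed.

Definition free_module : gradedModule A := GradedModule free_direct (gradingM free_grading).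

Definition free_gen (x : X) : T := monalg.mkmalgU x 1.

Lemma free_genZ (c : A^c) x : c *: free_gen x = monalg.mkmalgU x c.
Proof.
by apply/malgP => y; rewrite monalg.mcoeffZ !monalg.mcoeffU; case: eqP => _; rewrite ?mulr1 // !mulr0n mulr0.
Qed.

Lemma free_ind (P : T -> Prop) :
  (forall s t, P s -> P t -> P (s + t)) -> P 0 -> (forall (c : A^c) x, P (c *: free_gen x)) ->
  forall t, P t.
Proof. by move=> PD P0 PU; apply: malg_ind => // c x; rewrite -free_genZ. Qed.

Lemma free_gen_gr x : free_gr (deg x) (free_gen x).
Proof.
move=> y; rewrite monalg.mcoeffU; have [<-|_] := eqVneq x y; last first.
  by rewrite mulr0n; apply: (grading0 (gm_grading (regular_module A))).
by rewrite subrr /= (ga_gr0 (1 : A)); exists 1; rewrite scale1r.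
Qed.

Section Lift.
Variables (N : lmodType A^c) (u : X -> N).
Definition free_lift : T -> N := malg_lift (@idfun A^c) u.

Fact free_lift_linear : linear free_lift.
Proof.
by move=> c s t; rewrite /free_lift raddfD /=; congr (_ + _); apply: malg_liftZ.
Qed.
HB.instance Definition _ := GRing.isLinear.Build A^c T N *:%R free_lift free_lift_linear.

Lemma free_lift_gen x : free_lift (free_gen x) = u x.
Proof. by rewrite /free_lift malg_liftU scale1r. Qed.

Lemma free_lift_gr (gr : int -> N -> Prop) (e : int) : @grading F A N gr ->
  (forall x, gr (deg x + e) (u x)) -> forall j t, free_gr j t -> gr (j + e) (free_lift t).
Proof.
move=> G uP j t tj; apply: grading_sum => // x _.
have := tj x; move: (monalg.mcoeff x t) => c; case E : (j - deg x) => [i|i] /= ci; last first.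
  by rewrite ci scale0r; apply: grading0.
have -> : j = deg x + i%:Z by rewrite -E addrC subrK.
by rewrite addrAC; apply: gradingM.
Qed.
End Lift.

Lemma free_eq (N : lmodType A^c) (f g : {linear T -> N}) :
  (forall x, f (free_gen x) = g (free_gen x)) -> f =1 g.
Proof.
move=> fg; apply: free_ind => [s t fs ft||c x]; first by rewrite !linearD fs ft.
  by rewrite !linear0.
by rewrite !linearZ fg.
Qed.

Lemma free_projective : graded_projective free_module.
Proof.
move=> M N p g pg ps gg.
have /choice [u uP] (x : X) : exists m : M, gm_gr (deg x) m /\ p m = g (free_gen x).
  have [m mx pm] := graded_lift pg ps (gg _ _ (free_gen_gr x)); by exists m.
exists (free_lift u); split=> [j t tj|t].
  rewrite -[j]addr0; apply: (free_lift_gr (gr := @gm_gr F A M)) => //; first exact: gm_grading.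
  by move=> x; rewrite addr0; have [] := uP x.
elim/free_ind: t => [s t|| c x]; first by rewrite !linearD => -> ->.
  by rewrite !linear0.
by rewrite !linearZ /= free_lift_gen (uP x).2.
Qed.

End FreeModule.

Definition alg_scalar (F : fieldType) (A : gradedAlgebra F) (c : F) : A^c := (c%:A : A).

Section AlgScalar.
Variables (F : fieldType) (A : gradedAlgebra F).
Fact alg_scalar_additive : zmod_morphism (@alg_scalar F A).
Proof. by move=> c d; rewrite /alg_scalar scalerBl. Qed.
HB.instance Definition _ := GRing.isZmodMorphism.Build F A^c (@alg_scalar F A) alg_scalar_additive.

Lemma alg_scalarM c d : alg_scalar A (c * d) = alg_scalar A c * alg_scalar A d.
Proof. by rewrite /alg_scalar mulrC -scalerA -mulr_algl. Qed.

Lemma alg_scalar1 : alg_scalar A 1 = 1. Proof. exact: scale1r. Qed.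

Lemma alg_scalar_comm c (a : A^c) : a * alg_scalar A c = alg_scalar A c * a.
Proof. by rewrite /alg_scalar -[LHS]/((c%:A : A) * (a : A)) mulr_algl -mulr_algr. Qed.

Lemma alg_scalar_gr0 c : ga_gr 0 (alg_scalar A c : A).
Proof. by apply/ga_gr0; exists c. Qed.

Lemma alg_scaleA (M : lmodType A^c) c d (x : M) :
  alg_scalar A c *: (alg_scalar A d *: x) = alg_scalar A (c * d) *: x.
Proof. by rewrite scalerA alg_scalarM. Qed.

Lemma alg_scaleC (M : lmodType A^c) c (a : A^c) (x : M) :
  alg_scalar A c *: (a *: x) = a *: (alg_scalar A c *: x).
Proof. by rewrite !scalerA alg_scalar_comm. Qed.

Lemma alg_scale_gr (V : lmodType A^c) (gr : int -> V -> Prop) j c x :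
  @grading F A V gr -> gr j x -> gr j (alg_scalar A c *: x).
Proof. by move=> G xj; rewrite -[j]addr0; apply: gradingM => //; apply: alg_scalar_gr0. Qed.
End AlgScalar.

(** * Homogeneous bases over the ground field *)

Record homogeneous_basis (F : fieldType) (A : gradedAlgebra F) (M : gradedModule A) := HBasis {
  hb_index : choiceType;
  hb_vec : hb_index -> M;
  hb_deg : hb_index -> int;
  hb_coord : M -> {malg F[hb_index]};
  hb_vec_gr : forall x, gm_gr (hb_deg x) (hb_vec x);
  hb_coordK : cancel hb_coord (malg_lift (alg_scalar A) hb_vec);
  hb_vecK : cancel (malg_lift (alg_scalar A) hb_vec) hb_coord }.

Section BasisExistence.
Variables (F : fieldType) (A : gradedAlgebra F) (M : gradedModule A).
Local Notation "c '*f:' x" := (alg_scalar A c *: x) (at level 40).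

Definition independent_set (S : M -> Prop) : Prop :=
  (forall x, S x -> exists j, gm_gr j x) /\
  forall (s : seq M) (c : M -> F), uniq s -> (forall x, x \in s -> S x) ->
    \sum_(x <- s) c x *f: x = 0 -> forall x, x \in s -> c x = 0.

(** Zorn's lemma applies because a relation is finite: its terms already lie in one member of a
    chain of independent sets. *)
Lemma maximal_independent_set : exists S, independent_set S /\
  forall S', independent_set S' -> (forall x, S x -> S' x) -> forall x, S' x -> S x.
Proof.
have [|S [Si Smax]] := @classical_sets.Zorn_bigcup M independent_set.
  move=> C CP Ctot; split=> [x [Y CY Yx]|s c us sC c0 x xs].
    by have [+ _] := CP Y CY; apply.
  have [Y [CY sY]] : exists Y, C Y /\ forall z, z \in s -> Y z.
    have [Y0 CY0 _] := sC x xs.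
    elim: s {us c0 xs} sC => [|z s IH] sC; first by exists Y0.
    have [|Y [CY sY]] := IH; first by move=> t ts; apply: sC; rewrite inE ts orbT.
    have [Z CZ Zz] := sC z (mem_head _ _).
    case: (Ctot Y Z CY CZ) => H.
      exists Z; split=> // t; rewrite inE => /orP[/eqP -> //|/sY]; exact: H.
    by exists Y; split=> // t; rewrite inE => /orP[/eqP ->|/sY//]; apply: H.
  by have [_ Yi] := CP Y CY; apply: (Yi s c us sY c0 x xs).
exists S; split=> // S' S'i SS' x S'x; apply: contrapT => Sx.
by apply: (Smax S') => //; split=> // /(_ x S'x).
Qed.

(** A maximal independent set of homogeneous elements spans, since a homogeneous element outside its
    span could be added to it. The result is only [inhabited] because a basis is data, while Zorn's
    lemma gives mere existence. *)
Lemma exists_homogeneous_basis : inhabited (homogeneous_basis M).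
Proof.
have [S [[Shom Sind] Smax]] := maximal_independent_set.
pose X : choiceType := {x : M | `[< S x >]}.
pose b (x : X) : M := val x.
have bS x : S (b x) by apply: asboolW (valP x).
have [deg degP] := choice (fun x => Shom _ (bS x)).
pose L := malg_lift (alg_scalar A) b.
have L0 : L 0 = 0 := raddf0 _.
have LD u v : L (u + v) = L u + L v := raddfD _ _ _.
have LB u v : L (u - v) = L u - L v := raddfB _ _ _.
have LE (s : seq M) (c : M -> F) : (forall x, x \in s -> S x) ->
    exists u, L u = \sum_(x <- s) c x *f: x.
  elim: s => [|x s IH] sS; first by exists 0; rewrite big_nil L0.
  have [|u uE] := IH; first by move=> z zs; apply: sS; rewrite inE zs orbT.
  have Sx : S x by apply: sS; rewrite mem_head.
  exists (monalg.mkmalgU (exist _ x (asboolT Sx) : X) (c x) + u).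
  by rewrite LD uE big_cons; congr (_ + _); apply: malg_liftU.
have Lscale c u : exists v, L v = c *f: L u.
  by exists (c *: u); apply: malg_liftZ => y; apply: alg_scalarM.
have Lhom j x : gm_gr j x -> exists u, L u = x.
  move=> xj; apply: contrapT => nx.
  have Sx : ~ S x.
    move=> Sx; apply: nx; have [|u uE] := LE [:: x] (fun=> 1).
      by move=> z; rewrite inE => /eqP ->.
    by exists u; rewrite uE big_seq1 alg_scalar1 scale1r.
  apply: Sx; apply: (Smax (fun z => S z \/ z = x)); last by right.
  - split=> [z [/Shom//|->]|s c us sS c0]; first by exists j.
    have [xs|xs] := boolP (x \in s); last first.
      apply: (Sind s c us) => // z zs; case: (sS z zs) => // zx.
      by rewrite zx (negPf xs) in zs.
    have remS z : z \in rem x s -> S z.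
      rewrite mem_rem_uniq // inE => /andP[/eqP zx zs].
      by case: (sS z zs).
    have cE := c0; rewrite (perm_big _ (perm_to_rem xs)) big_cons in cE.
    have cx : c x = 0.
      apply/eqP/negP => /negP cx; apply: nx.
      have [u uE] := LE (rem x s) c remS.
      have [v vE] := Lscale (- (c x)^-1) u; exists v; rewrite vE uE.
      have /eqP := cE; rewrite addr_eq0 => /eqP /(congr1 -%R); rewrite opprK => <-.
      by rewrite (raddfN (alg_scalar A)) scaleNr scalerN opprK alg_scaleA mulVf // alg_scalar1 scale1r.
    move=> z zs; have [->//|zx] := eqVneq z x.
    apply: (Sind (rem x s) c (rem_uniq _ us) remS).
      by rewrite -[RHS]cE cx (raddf0 (alg_scalar A)) scale0r [RHS]add0r.
    by rewrite mem_rem_uniq // inE zx.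
  - by left.
have Lsurj x : exists u, L u = x.
  have [s [f [us fP ->]]] := gm_graded_sum x.
  elim: s {us} => [|i s [u uE]]; first by exists 0; rewrite big_nil L0.
  have [v vE] := Lhom i (f i) (fP i).
  by exists (v + u); rewrite big_cons LD uE vE.
have Linj u : L u = 0 -> u = 0.
  move=> Lu; apply/malgP => x; rewrite monalg.mcoeff0.
  have [|/mcoeff_outdom//] := boolP (x \in monalg.msupp u) => xu.
  (* Independence is stated for coefficient functions on M, so the coefficients of u are transported
     from the index type and extended by zero. *)
  pose c (m : M) := if insub m is Some z then monalg.mcoeff z u else 0.
  have cb z : c (b z) = monalg.mcoeff z u by rewrite /c valK.
  rewrite -cb; apply: (Sind [seq b z | z <- monalg.msupp u] c).
  - by rewrite map_inj_uniq //; apply: val_inj.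
  - by move=> m /mapP[z _ ->].
  - by rewrite big_map -[RHS]Lu; apply: eq_bigr => z _; rewrite cb.
  - by apply/mapP; exists x.
have [crd crdK] := choice Lsurj.
constructor; apply: (@HBasis F A M X b deg crd degP crdK) => u.
by apply/eqP; rewrite -subr_eq0; apply/eqP/Linj; rewrite LB crdK subrr.
Qed.
End BasisExistence.

Lemma signZC (R : nzRingType) (T : lmodType R) (b : bool) (c : R) (x : T) :
  (-1) ^+ b *: (c *: x) = c *: ((-1) ^+ b *: x).
Proof. by rewrite !scaler_sign; case: b; rewrite ?scalerN. Qed.

Lemma signZ (R : nzRingType) (T : lmodType R) (b c : bool) (x : T) :
  (-1) ^+ b *: ((-1) ^+ c *: x) = (-1) ^+ (b (+) c) *: x.
Proof. by rewrite scalerA -signr_addb. Qed.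

(** * The free module M (x) A with its left and right multiplications *)

Section ExtensionOfScalars.
Variables (F : fieldType) (A : gradedAlgebra F) (M : gradedModule A).
Variable B : homogeneous_basis M.
Local Notation X := (hb_index B).
Local Notation b := (@hb_vec _ _ _ B).
Local Notation "c '*f:' x" := (alg_scalar A c *: x) (at level 40).

Fact tens_key : unit. Proof. exact: tt. Qed.

(* The graded right module M (x)_F A; [tens1 m] is m (x) 1. *)
Definition tens : gradedModule A := free_module A (@hb_deg _ _ _ B).
Definition tens1 : M -> tens :=
  locked_with tens_key (fun m => malg_lift (alg_scalar A) (free_gen A (X := X)) (hb_coord B m)).

Lemma tens1_lift m : tens1 m = malg_lift (alg_scalar A) (free_gen A (X := X)) (hb_coord B m).
Proof. by rewrite /tens1 locked_withE. Qed.

Definition F_linear (N : lmodType A^c) (N' : lmodType A^c) (f : N -> N') : Prop :=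
  forall c x y, f (c *f: x + y) = c *f: f x + f y.

Lemma hb_coord_linear c m m' :
  hb_coord B (c *f: m + m') = c *: hb_coord B m + hb_coord B m'.
Proof.
apply: (can_inj (@hb_vecK _ _ _ B)); rewrite raddfD /= !hb_coordK.
by rewrite [in RHS](@malg_liftZ _ _ _ _ _ _ (alg_scalar A c)) ?hb_coordK // => d; apply: alg_scalarM.
Qed.

Lemma tens1_linear : F_linear tens1.
Proof.
move=> c m m'; rewrite !tens1_lift hb_coord_linear raddfD /=; congr (_ + _).
by apply: malg_liftZ => d; apply: alg_scalarM.
Qed.

Lemma tens1_vec x : tens1 (b x) = free_gen A x.
Proof.
have <- : malg_lift (alg_scalar A) b (monalg.mkmalgU x 1) = b x.
  by rewrite malg_liftU /= alg_scalar1 scale1r.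
by rewrite tens1_lift hb_vecK malg_liftU /= alg_scalar1 scale1r.
Qed.

Lemma hb_ind (P : M -> Prop) : (forall c x m, P m -> P (c *f: b x + m)) -> P 0 -> forall m, P m.
Proof.
move=> PD P0 m; rewrite -(hb_coordK B m) /malg_lift.
by elim: (enum_fset _) => [|x s IH]; rewrite ?big_nil // big_cons; apply: PD.
Qed.

Lemma F_linear0 (N N' : lmodType A^c) (f : N -> N') : F_linear f -> f 0 = 0.
Proof.
move=> fl; have := fl 1 0 0; rewrite alg_scalar1 !scale1r addr0.
by move=> /esym/eqP; rewrite -subr_eq0 addrK => /eqP.
Qed.

Lemma F_linear_eq (N : lmodType A^c) (f g : M -> N) : F_linear f -> F_linear g ->
  (forall x, f (b x) = g (b x)) -> f =1 g.
Proof.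
move=> fl gl fg; apply: hb_ind => [c x m|]; last by rewrite !F_linear0.
by rewrite fl gl fg => ->.
Qed.

Lemma linear_F_linear (N N' : lmodType A^c) (f : {linear N -> N'}) : F_linear f.
Proof. by move=> c x y; rewrite linearP. Qed.

Lemma F_linear_comp (N N' N'' : lmodType A^c) (f : N' -> N'') (g : N -> N') :
  F_linear f -> F_linear g -> F_linear (f \o g).
Proof. by move=> fl gl c x y /=; rewrite gl fl. Qed.

Lemma F_linear_scale (N : lmodType A^c) (a : A^c) : F_linear (fun x : N => a *: x).
Proof. by move=> c x y; rewrite scalerDr alg_scaleC. Qed.

Section Lift.
Variables (N : lmodType A^c) (f : M -> N).
Definition tens_lift : {linear tens -> N} := free_lift (f \o b).

Lemma tens_lift1 m : F_linear f -> tens_lift (tens1 m) = f m.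
Proof.
move=> fl; apply: (F_linear_eq (f := tens_lift \o tens1)) => //.
  exact: F_linear_comp (linear_F_linear _) tens1_linear.
by move=> x /=; rewrite tens1_vec free_lift_gen.
Qed.

Lemma tens_lift_gr (gr : int -> N -> Prop) (e : int) : @grading F A N gr ->
  (forall j m, gm_gr j m -> gr (j + e) (f m)) ->
  forall j t, gm_gr (g := tens) j t -> gr (j + e) (tens_lift t).
Proof.
by move=> G fP j t tj; apply: (free_lift_gr G) tj => x; apply/fP/hb_vec_gr.
Qed.
End Lift.

(** Grouping the terms of m by the degrees of the basis vectors gives a homogeneous decomposition of
    m, of which only the group of degree j can survive. *)
Lemma hb_coord_gr j m x : gm_gr j m -> x \in monalg.msupp (hb_coord B m) -> hb_deg x = j.
Proof.
move=> mj; pose u := hb_coord B m; pose sm := monalg.msupp u.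
pose f i : {malg F[X]} := \sum_(x <- sm | hb_deg x == i) monalg.mkmalgU x (monalg.mcoeff x u).
have Lf i : malg_lift (alg_scalar A) b (f i) =
    \sum_(x <- sm | hb_deg x == i) monalg.mcoeff x u *f: b x.
  by rewrite raddf_sum; apply: eq_bigr => z _; apply: malg_liftU.
have uE : u = if j \in undup (map (@hb_deg _ _ _ B) sm) then f j else 0.
  apply: (can_inj (@hb_vecK _ _ _ B)); rewrite hb_coordK.
  rewrite (fun_if (malg_lift (alg_scalar A) b)) raddf0.
  apply: (grading_component (gm_grading M) (f := fun i => malg_lift (alg_scalar A) b (f i))) => //.
  - exact: undup_uniq.
  - move=> i; rewrite Lf; apply: grading_sum => [|z /eqP <-]; first exact: gm_grading.
    by apply: alg_scale_gr (gm_grading M) _; apply: hb_vec_gr.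
  - under eq_bigr do rewrite Lf.
    rewrite -[RHS](hb_coordK B m) /malg_lift -/u -/sm.
    rewrite (exchange_big_dep predT) //=; apply: eq_big_seq => z zs.
    rewrite -big_filter (eq_filter (a2 := pred1 (hb_deg z))) => [|i]; last exact: eq_sym.
    by rewrite filter_pred1_uniq ?undup_uniq ?big_seq1 // mem_undup map_f.
rewrite -mcoeff_neq0 -/u uE => xj; apply/eqP/negP => /negP xNj; case/eqP: xj.
case: ifP => _; last exact: monalg.mcoeff0.
rewrite raddf_sum big1 // => z zj; rewrite /= monalg.mcoeffU.
by have [zx|_] := eqVneq z x; [rewrite -zx zj in xNj|rewrite mulr0n].
Qed.

Lemma tens1E m : tens1 m = \sum_(x <- monalg.msupp (hb_coord B m))
  monalg.mcoeff x (hb_coord B m) *f: free_gen A x.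
Proof. exact: tens1_lift. Qed.

Lemma tens1_gr j m : gm_gr j m -> gm_gr j (tens1 m).
Proof.
move=> mj; rewrite tens1E big_seq; apply: grading_sum => [|x xm]; first exact: (gm_grading tens).
rewrite -(hb_coord_gr mj xm).
by apply: alg_scale_gr (gm_grading tens) _; apply: free_gen_gr.
Qed.

(* The sign of the degree in M. *)
Definition tens_sign : {linear tens -> tens} := locked_with tens_key
  (free_lift (fun x => (-1) ^+ odd `|hb_deg x|%N *: free_gen A x : tens) : {linear tens -> tens}).
Lemma tens_signE : tens_sign = free_lift (fun x => (-1) ^+ odd `|hb_deg x|%N *: free_gen A x : tens).
Proof. exact: locked_withE. Qed.

Lemma tens_sign1 j m : gm_gr j m -> tens_sign (tens1 m) = (-1) ^+ odd `|j|%N *: tens1 m.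
Proof.
move=> mj; rewrite tens_signE tens1E linear_sum scaler_sumr big_seq [RHS]big_seq.
apply: eq_bigr => x xm; rewrite linearZ /= free_lift_gen (hb_coord_gr mj xm).
by rewrite signZC.
Qed.

(* Sealed, since the unifier would otherwise unfold them. *)
Fact tens_left_key : {f : A -> {linear tens -> tens} |
  forall z, f z = tens_lift (fun m => (z : A^c) *: tens1 m)}.
Proof. by exists (fun z => tens_lift (fun m => (z : A^c) *: tens1 m)). Qed.
Definition tens_left : A -> {linear tens -> tens} := sval tens_left_key.
Fact tens_right_key : {f : A -> {linear tens -> tens} |
  forall z, f z = tens_lift (fun m => tens1 ((z : A^c) *: m))}.
Proof. by exists (fun z => tens_lift (fun m => tens1 ((z : A^c) *: m))). Qed.
Definition tens_right : A -> {linear tens -> tens} := sval tens_right_key.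
Definition tens_eval : {linear tens -> M} := locked_with tens_key (tens_lift id).

Lemma tens_left1 z m : tens_left z (tens1 m) = (z : A^c) *: tens1 m.
Proof.
rewrite /tens_left (svalP tens_left_key z).
by apply: tens_lift1 => c x y; rewrite tens1_linear; apply: F_linear_scale.
Qed.

Lemma tens_right1 z m : tens_right z (tens1 m) = tens1 ((z : A^c) *: m).
Proof.
rewrite /tens_right (svalP tens_right_key z).
by apply: tens_lift1 => c x y; rewrite F_linear_scale tens1_linear.
Qed.

Lemma tens_eval1 m : tens_eval (tens1 m) = m.
Proof. by rewrite /tens_eval locked_withE; apply: tens_lift1. Qed.

Lemma tens_eq_vec (N : lmodType A^c) (f g : {linear tens -> N}) :
  (forall j m, gm_gr j m -> f (tens1 m) = g (tens1 m)) -> f =1 g.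
Proof. by move=> fg; apply: free_eq => x; rewrite -tens1_vec; apply/fg/hb_vec_gr. Qed.

Lemma tens_left_gr i z j t : ga_gr i z -> gm_gr (g := tens) j t -> gm_gr (j + i%:Z) (tens_left z t).
Proof.
move=> zi; rewrite /tens_left (svalP tens_left_key z); apply: (tens_lift_gr (gm_grading tens)) => l m ml.
by apply: gm_grM => //; apply: tens1_gr.
Qed.

Lemma tens_right_gr i z j t : ga_gr i z -> gm_gr (g := tens) j t -> gm_gr (j + i%:Z) (tens_right z t).
Proof.
move=> zi; rewrite /tens_right (svalP tens_right_key z); apply: (tens_lift_gr (gm_grading tens)) => l m ml.
by apply: tens1_gr; apply: gm_grM.
Qed.

Lemma tens_eval_gr j t : gm_gr (g := tens) j t -> gm_gr j (tens_eval t).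
Proof.
move=> tj; rewrite /tens_eval locked_withE -[j]addr0; apply: (tens_lift_gr (gm_grading M)) tj => l m ml.
by rewrite addr0.
Qed.

Lemma sign_gr (V : gradedModule A) (c : bool) j (t : V) : gm_gr j t -> gm_gr j ((-1) ^+ c *: t).
Proof. by rewrite scaler_sign; case: c => // tj; apply: (gradingN (gm_grading V)). Qed.

Lemma tens_sign_gr j t : gm_gr (g := tens) j t -> gm_gr j (tens_sign t).
Proof.
move=> tj; rewrite tens_signE -[j]addr0; apply: (free_lift_gr (gm_grading tens)) tj => x.
by rewrite addr0; apply: sign_gr; exact: free_gen_gr.
Qed.

Lemma conv_scaleA (N : lmodType A^c) (z z' : A) (m : N) :
  (z' : A^c) *: ((z : A^c) *: m) = ((z * z' : A) : A^c) *: m.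
Proof. exact: scalerA. Qed.

Fact lin_comp_linear (N N' N'' : lmodType A^c) (f : {linear N' -> N''}) (g : {linear N -> N'}) :
  linear (fun t => f (g t)).
Proof. by move=> c s t; rewrite (linearP g) (linearP f). Qed.

Lemma tens_eqf (N : lmodType A^c) (f g : tens -> N) : linear f -> linear g ->
  (forall j m, gm_gr j m -> f (tens1 m) = g (tens1 m)) -> forall t, f t = g t.
Proof. by move=> fl gl fg; apply: (tens_eq_vec (f := linear_of fl) (g := linear_of gl)). Qed.

Lemma tens_signK t : tens_sign (tens_sign t) = t.
Proof.
move: t; apply: tens_eqf => [||j m mj]; [exact: lin_comp_linear|by []|].
by rewrite (tens_sign1 mj) (linearZ_LR tens_sign) (tens_sign1 mj) signZ addbb scale1r.
Qed.

Lemma tens_left_left z z' t : tens_left z (tens_left z' t) = tens_left (z * z') t.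
Proof.
move: t; apply: tens_eqf => [||j m mj]; [exact: lin_comp_linear|exact: linearP|].
rewrite (tens_left1 z' m).
rewrite (linearZ_LR (tens_left z)). 
rewrite (tens_left1 z m).
rewrite (tens_left1 (z * z') m).
exact: conv_scaleA.
Qed.

Lemma tens_right_right z z' t : tens_right z (tens_right z' t) = tens_right (z' * z) t.
Proof.
move: t; apply: tens_eqf => [||j m mj]; [exact: lin_comp_linear|exact: linearP|].
by rewrite (tens_right1 z' m) (tens_right1 z _) (tens_right1 (z' * z) m) conv_scaleA.
Qed.

Lemma tens_left_right z z' t : tens_left z (tens_right z' t) = tens_right z' (tens_left z t).
Proof.
move: t; apply: tens_eqf => [||j m mj]; [exact: lin_comp_linear|exact: lin_comp_linear|].
rewrite (tens_right1 z' m) (tens_left1 z m) (tens_left1 z _).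
by rewrite (linearZ_LR (tens_right z')) (tens_right1 z' m).
Qed.

Lemma tens_sign_left z t : tens_sign (tens_left z t) = tens_left z (tens_sign t).
Proof.
move: t; apply: tens_eqf => [||j m mj]; [exact: lin_comp_linear|exact: lin_comp_linear|].
rewrite (tens_left1 z m) (linearZ_LR tens_sign) (tens_sign1 mj) (linearZ_LR (tens_left z)).
by rewrite (tens_left1 z m) signZC.
Qed.

Lemma tens_sign_right i z t : ga_gr i z ->
  tens_sign (tens_right z t) = (-1) ^+ odd i *: tens_right z (tens_sign t).
Proof.
move=> zi; move: t; apply: tens_eqf => [||j m mj]; first exact: lin_comp_linear.
  move=> c s s'; rewrite (linearP tens_sign) (linearP (tens_right z)).
  by rewrite scalerDr signZC.
rewrite (tens_right1 z m) (tens_sign1 mj) (linearZ_LR (tens_right z)) (tens_right1 z m) signZ.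
have zm : gm_gr (j + i%:Z) ((z : A^c) *: m) by apply: gm_grM.
rewrite (tens_sign1 zm); congr ((-1) ^+ _ *: _); congr nat_of_bool; lia.
Qed.

Fact lin_combination (N N' : lmodType A^c) (f g : {linear N -> N'}) c :
  linear (fun t => alg_scalar A c *: f t + g t).
Proof. by move=> d s s'; rewrite (linearP f) (linearP g) !scalerDr alg_scaleC addrACA. Qed.

Lemma conv_scaleDl (N : lmodType A^c) c (z z' : A) (m : N) :
  ((c *: z + z' : A) : A^c) *: m = alg_scalar A c *: ((z : A^c) *: m) + (z' : A^c) *: m.
Proof.
by rewrite -[(c *: z + z')%R]/((c *: z : A^c) + (z' : A^c)) scalerDl scalerA -alg_scalar_comm
  -[_ * alg_scalar _ _]/((c%:A : A) * z) mulr_algl.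
Qed.

Lemma tens_left_lin z z' c t :
  tens_left (c *: z + z') t = alg_scalar A c *: tens_left z t + tens_left z' t.
Proof.
move: t; apply: tens_eqf => [||j m mj]; [exact: linearP|exact: lin_combination|].
by rewrite (tens_left1 z m) (tens_left1 z' m) (tens_left1 _ m) conv_scaleDl.
Qed.

Lemma tens_right_lin z z' c t :
  tens_right (c *: z + z') t = alg_scalar A c *: tens_right z t + tens_right z' t.
Proof.
move: t; apply: tens_eqf => [||j m mj]; [exact: linearP|exact: lin_combination|].
by rewrite (tens_right1 z m) (tens_right1 z' m) (tens_right1 _ m) conv_scaleDl tens1_linear.
Qed.

(** The evaluation m (x) a -> m a is balanced over A. Therefore it kills the supercommutators [ad_e]
    and [ad_y], and the augmentation of the complex kills the differential. *)
Lemma tens_eval_left z t : tens_eval (tens_left z t) = tens_eval (tens_right z t).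
Proof.
move: t; apply: tens_eqf => [||j m mj]; [exact: lin_comp_linear|exact: lin_comp_linear|].
rewrite (tens_left1 z m) (tens_right1 z m) (linearZ_LR tens_eval).
by rewrite (tens_eval1 m) (tens_eval1 _).
Qed.

End ExtensionOfScalars.

Lemma mnm_subUK n (al : 'X_{1..n}) i : al i != 0%N -> (al - U_(i) + U_(i))%MM = al.
Proof.
move=> ali; rewrite submK //; apply/mnm_lepP => l; rewrite mnm1E.
by case: eqP => // <-; rewrite lt0n.
Qed.

Lemma mdeg_subU n (al : 'X_{1..n}) i : al i != 0%N -> mdeg al = (mdeg (al - U_(i))%MM).+1.
Proof. by move=> ali; rewrite -{1}(mnm_subUK ali) mdegD mdeg1 addn1. Qed.

(** * Operators on divided powers and exterior monomials *)

Section ChainOperators.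
Variables (R : nzRingType) (T : lmodType R) (n k : nat).

(* A chain assigns to (al, be) its coefficient on x^(al) xi_be, where x^(al) is a
   divided power and xi_be an exterior monomial. *)
Definition chain : Type := 'X_{1..n} -> {set 'I_k} -> T.
HB.instance Definition _ := GRing.Lmodule.on chain.
Implicit Types (f g : chain) (al : 'X_{1..n}) (be : {set 'I_k}) (a b : 'I_k) (i j : 'I_n).

Lemma chainP f g : (forall al be, f al be = g al be) -> f = g.
Proof. by move=> fg; apply: funext => al; apply: funext => be. Qed.

Lemma chain0E al be : (0 : chain) al be = 0. Proof. by []. Qed.
Lemma chainDE f g al be : (f + g) al be = f al be + g al be. Proof. by []. Qed.
Lemma chainNE f al be : (- f) al be = - f al be. Proof. by []. Qed.
Lemma chainZE (c : R) f al be : (c *: f) al be = c *: f al be. Proof. by []. Qed.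
Lemma chain_sumE (I : Type) (s : seq I) (P : pred I) (f : I -> chain) al be :
  (\sum_(t <- s | P t) f t) al be = \sum_(t <- s | P t) f t al be.
Proof. by rewrite !fct_sumE. Qed.
Definition chainE := (chain0E, chainDE, chainNE, chainZE, chain_sumE).

Definition sgb a be : bool := odd #|[set b in be | (b < a)%N]|.
(** As x^(al) is a divided power, d/dx_i sends it to x^(al - U_i) without a factor, while x_i x^(al
    - U_i) = al_i x^(al). The truncated subtraction in [mx] is harmless, because the multiplicity
    vanishes when al_i = 0. The integral [ix] is the section of [dx] without constant term in
    x_i. *)
Definition dx i f : chain := fun al be => f (al + U_(i))%MM be.
Definition ix i f : chain := fun al be => if al i == 0%N then 0 else f (al - U_(i))%MM be.
Definition mx i f : chain := fun al be => f (al - U_(i))%MM be *+ al i.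
Definition iota a f : chain := fun al be =>
  if a \in be then 0 else (-1) ^+ sgb a be *: f al (a |: be).
Definition xi a f : chain := fun al be =>
  if a \in be then (-1) ^+ sgb a be *: f al (be :\ a) else 0.
Definition tau f : chain := fun al be => (-1) ^+ odd #|be| *: f al be.
Definition coef (u : T -> T) f : chain := fun al be => u (f al be).

Lemma sgbU a b be : b \notin be -> sgb a (b |: be) = (b < a)%N (+) sgb a be.
Proof.
move=> bbe; rewrite /sgb; case: (ltnP b a) => ba.
  rewrite (_ : [set c in b |: be | (c < a)%N] = b |: [set c in be | (c < a)%N]).
    by rewrite cardsU1 !inE (negPf bbe).
  by apply/setP => c; rewrite !inE; case: eqP => // ->; rewrite ba.
rewrite (_ : [set c in b |: be | (c < a)%N] = [set c in be | (c < a)%N]) //.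
by apply/setP => c; rewrite !inE; case: eqP => // ->; rewrite ltnNge ba !andbF.
Qed.

Lemma sgbD a b be : b \in be -> sgb a (be :\ b) = (b < a)%N (+) sgb a be.
Proof.
move=> bbe; rewrite -[in RHS](setD1K bbe) sgbU ?inE ?eqxx //.
by rewrite addbA addbb.
Qed.

Lemma ltn_neqC a b : a != b -> (b < a)%N = ~~ (a < b)%N.
Proof. by move=> ab; case: ltngtP => // /val_inj E; rewrite E eqxx in ab. Qed.

Lemma signN (b : bool) (x : T) : (-1) ^+ (~~ b) *: x = - ((-1) ^+ b *: x).
Proof. by rewrite !scaler_sign; case: b; rewrite //= opprK. Qed.

Lemma iotaK a f : iota a (iota a f) = 0.
Proof. by apply/chainP => al be; rewrite /iota !inE eqxx /=; case: ifP => //; rewrite scaler0. Qed.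

Lemma iotaC a b f : iota a (iota b f) = - iota b (iota a f).
Proof.
have [->|ab] := eqVneq a b; first by rewrite iotaK oppr0.
apply/chainP => al be; rewrite /iota chainNE !inE [b == a]eq_sym (negPf ab) /=.
have [abe|abe] := boolP (a \in be); first by case: ifP; rewrite ?scaler0 ?oppr0.
have [bbe|bbe] := boolP (b \in be); first by rewrite scaler0 oppr0.
rewrite !signZ setUCA -signN sgbU // sgbU // (ltn_neqC ab).
by case: (a < b)%N (sgb a be) (sgb b be) => [] [] [].
Qed.

Lemma xiK a f : xi a (xi a f) = 0.
Proof. by apply/chainP => al be; rewrite /xi !inE eqxx /=; case: ifP => //; rewrite scaler0. Qed.

Lemma xiC a b f : xi a (xi b f) = - xi b (xi a f).
Proof.
have [->|ab] := eqVneq a b; first by rewrite xiK oppr0.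
apply/chainP => al be; rewrite /xi chainNE !inE [b == a]eq_sym (negPf ab) /=.
have [abe|abe] := boolP (a \in be); last by case: ifP; rewrite ?scaler0 ?oppr0.
have [bbe|bbe] := boolP (b \in be); last by rewrite scaler0 oppr0.
rewrite !signZ setDDl setUC -setDDl -signN sgbD // sgbD // (ltn_neqC ab).
by case: (a < b)%N (sgb a be) (sgb b be) => [] [] [].
Qed.

Lemma iota_xi a b f : iota a (xi b f) + xi b (iota a f) = if a == b then f else 0.
Proof.
apply/chainP => al be; rewrite chainDE /iota /xi !inE.
have [<-|ab] := eqVneq a b; rewrite /=.
  rewrite ?eqxx /=; have [abe|abe] := boolP (a \in be).
    by rewrite add0r setD1K // signZ sgbD // ltnn addFb addbb scale1r.
  by rewrite addr0 setU1K // signZ sgbU // ltnn addFb addbb scale1r.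
rewrite /=.
have [abe|abe] := boolP (a \in be); first by case: ifP; rewrite ?scaler0 ?addr0.
have [bbe|bbe] := boolP (b \in be); last by rewrite scaler0 addr0.
have -> : (a |: be) :\ b = a |: be :\ b.
  by apply/setP => c; rewrite !inE; case: (eqVneq c a) => [->|]; rewrite ?ab.
rewrite !signZ sgbU // sgbD // (ltn_neqC ab).
rewrite !scaler_sign.
by case: (a < b)%N (sgb a be) (sgb b be) => [] [] [] /=; rewrite ?addNr ?subrr.
Qed.

Lemma tauK f : tau (tau f) = f.
Proof. by apply/chainP => al be; rewrite /tau signZ addbb scale1r. Qed.

Lemma tau_iota a f : tau (iota a f) = - iota a (tau f).
Proof.
apply/chainP => al be; rewrite chainNE /tau /iota; case: ifP => abe; first by rewrite scaler0 oppr0.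
by rewrite cardsU1 abe !signZ -signN oddD addbC; case: (odd _) (sgb _ _) => [] [].
Qed.

Lemma tau_xi a f : tau (xi a f) = - xi a (tau f).
Proof.
apply/chainP => al be; rewrite chainNE /tau /xi; case: ifP => abe; last by rewrite scaler0 oppr0.
by rewrite (cardsD1 a be) abe !signZ -signN oddD; case: (odd #|be :\ a|) (sgb _ _) => [] [].
Qed.

Lemma dxC i j f : dx i (dx j f) = dx j (dx i f).
Proof. by apply/chainP => al be; rewrite /dx -!addmA [(U_(i) + _)%MM]addmC. Qed.
Lemma dx_iota i a f : dx i (iota a f) = iota a (dx i f). Proof. by []. Qed.
Lemma dx_xi i a f : dx i (xi a f) = xi a (dx i f). Proof. by []. Qed.
Lemma dx_tau i f : dx i (tau f) = tau (dx i f). Proof. by []. Qed.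
Lemma dx_coef u i f : dx i (coef u f) = coef u (dx i f). Proof. by []. Qed.
End ChainOperators.

Section ChainLinear.
Variables (R : nzRingType) (T : lmodType R) (n k : nat).
Local Notation chain := (chain T n k).
Implicit Types (f g : chain) (al : 'X_{1..n}) (be : {set 'I_k}) (a b : 'I_k) (i j : 'I_n).

Fact dx_linear i : linear (@dx R T n k i). Proof. by []. Qed.
HB.instance Definition _ i := GRing.isLinear.Build R chain chain *:%R (@dx R T n k i) (dx_linear i).

Fact ix_linear i : linear (@ix R T n k i).
Proof. by move=> c f g; apply/chainP => al be; rewrite /ix !chainE; case: ifP; rewrite ?scaler0 ?addr0. Qed.
HB.instance Definition _ i := GRing.isLinear.Build R chain chain *:%R (@ix R T n k i) (ix_linear i).

Fact mx_linear i : linear (@mx R T n k i).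
Proof. by move=> c f g; apply/chainP => al be; rewrite /mx !chainE mulrnDl scalerMnr. Qed.
HB.instance Definition _ i := GRing.isLinear.Build R chain chain *:%R (@mx R T n k i) (mx_linear i).

Fact iota_linear a : linear (@iota R T n k a).
Proof.
move=> c f g; apply/chainP => al be; rewrite /iota !chainE; case: ifP => _.
  by rewrite scaler0 addr0.
by rewrite scalerDr signZC.
Qed.
HB.instance Definition _ a := GRing.isLinear.Build R chain chain *:%R (@iota R T n k a) (iota_linear a).

Fact xi_linear a : linear (@xi R T n k a).
Proof.
move=> c f g; apply/chainP => al be; rewrite /xi !chainE; case: ifP => _.
  by rewrite scalerDr signZC.
by rewrite scaler0 addr0.
Qed.
HB.instance Definition _ a := GRing.isLinear.Build R chain chain *:%R (@xi R T n k a) (xi_linear a).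

Fact tau_linear : linear (@tau R T n k).
Proof. by move=> c f g; apply/chainP => al be; rewrite /tau !chainE scalerDr signZC. Qed.
HB.instance Definition _ := GRing.isLinear.Build R chain chain *:%R (@tau R T n k) tau_linear.

Section Coef.
Variable u : {linear T -> T}.
Fact coef_linear : linear (@coef R T n k u).
Proof. by move=> c f g; apply/chainP => al be; rewrite /coef !chainE linearP. Qed.
HB.instance Definition _ := GRing.isLinear.Build R chain chain *:%R (@coef R T n k u) coef_linear.
End Coef.

Section AdditiveCoef.
Variable u : {additive T -> T}.
Lemma raddf_signZ (b : bool) x : u ((-1) ^+ b *: x) = (-1) ^+ b *: u x.
Proof. by rewrite !scaler_sign; case: b; rewrite ?raddfN. Qed.
Lemma coef_additive : zmod_morphism (@coef R T n k u).
Proof. by move=> f g; apply/chainP => al be; rewrite /coef !chainE raddfB. Qed.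
Lemma coef_sub f g : coef u (f - g) = coef u f - coef u g. Proof. exact: coef_additive. Qed.
Lemma coef_sum (I : Type) (s : seq I) (P : pred I) (f : I -> chain) :
  coef u (\sum_(i <- s | P i) f i) = \sum_(i <- s | P i) coef u (f i).
Proof. by apply/chainP => al be; rewrite chain_sumE /coef chain_sumE raddf_sum. Qed.
Lemma coef_tau f : coef u (tau f) = tau (coef u f).
Proof. by apply/chainP => al be; rewrite /coef /tau raddf_signZ. Qed.
Lemma coef_iota a f : coef u (iota a f) = iota a (coef u f).
Proof. by apply/chainP => al be; rewrite /coef /iota; case: ifP; rewrite ?raddf0 ?raddf_signZ. Qed.
Lemma coef_xi a f : coef u (xi a f) = xi a (coef u f).
Proof. by apply/chainP => al be; rewrite /coef /xi; case: ifP; rewrite ?raddf0 ?raddf_signZ. Qed.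
Lemma coef_mx i f : coef u (mx i f) = mx i (coef u f).
Proof. by apply/chainP => al be; rewrite /coef /mx raddfMn. Qed.
End AdditiveCoef.

Lemma mx_iota i a f : mx i (iota a f) = iota a (mx i f).
Proof. by apply/chainP => al be; rewrite /mx /iota; case: ifP; rewrite ?mul0rn // scalerMnr. Qed.
Lemma mx_tau i f : mx i (tau f) = tau (mx i f).
Proof. by apply/chainP => al be; rewrite /mx /tau scalerMnr. Qed.

Lemma dx_mx i j f : dx i (mx j f) = mx j (dx i f) + (if i == j then f else 0).
Proof.
apply/chainP => al be; rewrite chainDE /dx /mx; have [<-|ij] := eqVneq i j.
  rewrite mnmDE mnm1E eqxx addn1 mulrSr.
  rewrite (_ : (al + U_(i) - U_(i))%MM = al) ?addmK //; congr (_ + _).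
  case E : (al i) => [|p]; first by rewrite !mulr0n.
  by rewrite mnm_subUK // E.
rewrite chain0E addr0 mnmDE mnm1E (negPf ij) addn0.
case E : (al j) => [|p]; first by rewrite !mulr0n.
congr (f _ _ *+ _); apply/mnmP => l; rewrite !(mnmDE, mnmBE, mnm1E).
by have [<-|_] := eqVneq j l; [rewrite (negPf ij) E; lia|lia].
Qed.

Lemma mxdx i f al be : mx i (dx i f) al be = f al be *+ al i.
Proof.
rewrite /mx /dx; case E : (al i) => [|p]; first by rewrite !mulr0n.
by rewrite mnm_subUK // E.
Qed.

Lemma dx_ix i f : dx i (ix i f) = f.
Proof.
by apply/chainP => al be; rewrite /dx /ix mnmDE mnm1E eqxx addn1 addmK.
Qed.

Lemma dx_ixC i j f : i != j -> dx i (ix j f) = ix j (dx i f).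
Proof.
move=> ij; apply/chainP => al be; rewrite /dx /ix mnmDE mnm1E (negPf ij) addn0.
case E : (al j) => [|p] //=; congr (f _ _); apply/mnmP => l; rewrite !(mnmDE, mnmBE, mnm1E).
by have [<-|_] := eqVneq j l; [rewrite (negPf ij) E; lia|lia].
Qed.

End ChainLinear.

Section DoubleInjectivity.
Variables (F : fieldType) (A : gradedAlgebra F) (F2 : (2 : F) != 0).
Lemma alg_double_inj (V : lmodType A^c) (x y : V) : x *+ 2 = y *+ 2 -> x = y.
Proof.
move=> /(congr1 (fun z => alg_scalar A 2^-1 *: z)).
have E (z : V) : alg_scalar A 2^-1 *: (z *+ 2) = z.
  have E2 : (2^-1 : F) *+ 2 = 1 by rewrite -[LHS]mulr_natl divff.
  rewrite -scalerMnr scalerMnl -(raddfMn (alg_scalar A)).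
  by rewrite E2 /= alg_scalar1 scale1r.
by rewrite !E.
Qed.
End DoubleInjectivity.

(** * The differential, from abstract commutation relations *)

Section Differential.
Variables (F : fieldType) (A : gradedAlgebra F) (V : lmodType A^c) (n k : nat).
Variable G : 'I_k -> 'I_n -> 'I_n -> F.

(* The operators d/dx_i, iota_a, xi_a, the sign tau, and operators Z_i, Y_a
   commuting with all of these and satisfying the relations of the Clifford algebra. *)
Record clifford_operators := CliffordOperators {
  opD : 'I_n -> {linear V -> V};
  opI : 'I_k -> {linear V -> V};
  opX : 'I_k -> {linear V -> V};
  opT : {linear V -> V};
  opZ : 'I_n -> {linear V -> V};
  opY : 'I_k -> {linear V -> V};
  opDC : forall i j f, opD i (opD j f) = opD j (opD i f);
  opD_I : forall i a f, opD i (opI a f) = opI a (opD i f);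
  opD_X : forall i a f, opD i (opX a f) = opX a (opD i f);
  opD_T : forall i f, opD i (opT f) = opT (opD i f);
  opD_Z : forall i j f, opD i (opZ j f) = opZ j (opD i f);
  opD_Y : forall i a f, opD i (opY a f) = opY a (opD i f);
  opIC : forall a b f, opI a (opI b f) = - opI b (opI a f);
  opXC : forall a b f, opX a (opX b f) = - opX b (opX a f);
  opI_X : forall a b f, opI a (opX b f) + opX b (opI a f) = if a == b then f else 0;
  opTK : forall f, opT (opT f) = f;
  opT_I : forall a f, opT (opI a f) = - opI a (opT f);
  opT_X : forall a f, opT (opX a f) = - opX a (opT f);
  opZ_T : forall i f, opZ i (opT f) = opT (opZ i f);
  opZ_I : forall i a f, opZ i (opI a f) = opI a (opZ i f);
  opZ_X : forall i a f, opZ i (opX a f) = opX a (opZ i f);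
  opY_T : forall b f, opY b (opT f) = opT (opY b f);
  opY_I : forall b a f, opY b (opI a f) = opI a (opY b f);
  opY_X : forall b a f, opY b (opX a f) = opX a (opY b f);
  opZZ : forall i j f,
    opZ i (opZ j f) + opZ j (opZ i f) = (\sum_a alg_scalar A (G a i j) *: opY a f) *+ 2;
  opZY : forall i a f, opZ i (opY a f) = opY a (opZ i f);
  opYY : forall a b f, opY a (opY b f) = opY b (opY a f) }.

Variable O : clifford_operators.
Local Notation D := (opD O).
Local Notation I := (opI O).
Local Notation X := (opX O).
Local Notation tau := (opT O).
Local Notation Z := (opZ O).
Local Notation Y := (opY O).
Implicit Types (f g : V) (a b : 'I_k) (i j : 'I_n).

Fact qx_linear a : linear (fun f => \sum_i \sum_j alg_scalar A (G a i j) *: D i (D j f)).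
Proof.
move=> c f g; rewrite scaler_sumr -big_split; apply: eq_bigr => i _ /=.
rewrite scaler_sumr -big_split; apply: eq_bigr => j _ /=.
by rewrite !linearP scalerDr alg_scaleC.
Qed.
(* q_a(d/dx) *)
Definition qx a : {linear V -> V} := linear_of (qx_linear a).
Lemma qxE a f : qx a f = \sum_i \sum_j alg_scalar A (G a i j) *: D i (D j f).
Proof. by []. Qed.

Fact diff1_linear : linear (fun f => tau (\sum_i D i (Z i f))).
Proof.
move=> c f g; rewrite -linearP; congr (tau _).
rewrite scaler_sumr -big_split; apply: eq_bigr => i _ /=; by rewrite !linearP.
Qed.
Definition diff1 : {linear V -> V} := linear_of diff1_linear.
Lemma diff1E f : diff1 f = tau (\sum_i D i (Z i f)). Proof. by []. Qed.

Fact diff2_linear : linear (fun f => \sum_a I a (Y a f)).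
Proof.
move=> c f g; rewrite scaler_sumr -big_split; apply: eq_bigr => i _; rewrite !linearP; reflexivity.
Qed.
Definition diff2 : {linear V -> V} := linear_of diff2_linear.
Lemma diff2E f : diff2 f = \sum_a I a (Y a f). Proof. by []. Qed.

Fact diff3_linear : linear (fun f => \sum_a qx a (X a f)).
Proof.
move=> c f g; rewrite scaler_sumr -big_split; apply: eq_bigr => i _; rewrite !linearP; reflexivity.
Qed.
Definition diff3 : {linear V -> V} := linear_of diff3_linear.
Lemma diff3E f : diff3 f = \sum_a qx a (X a f). Proof. by []. Qed.

Fact diff_linear : linear (fun f => diff1 f + diff2 f - diff3 f).
Proof.
move=> c f g; rewrite !(linearP diff1, linearP diff2, linearP diff3) scalerBr scalerDr.
by rewrite opprD (AC ((2*2)*2) ((1*3*5)*(2*4*6))).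
Qed.
(** As in the Chevalley-Eilenberg complex, [diff1] and [diff2] are the actions of the e_i and y_a,
    and [diff3] comes from the brackets of the odd generators. The sign [tau] makes [diff1]
    anticommute with the I_a and X_a, and the minus sign lets the anticommutator of [diff2] and
    [diff3] cancel the square of [diff1]. *)
Definition diff : {linear V -> V} := linear_of diff_linear.
Lemma diffE f : diff f = diff1 f + diff2 f - diff3 f. Proof. by []. Qed.

Lemma qx_comm (u : {linear V -> V}) a f :
  (forall i g, u (D i g) = D i (u g)) -> u (qx a f) = qx a (u f).
Proof.
move=> uD; rewrite !qxE linear_sum; apply: eq_bigr => i _; rewrite linear_sum.
by apply: eq_bigr => j _; rewrite linearZ /= !uD.
Qed.

Lemma T_qx a f : tau (qx a f) = qx a (tau f).
Proof. by apply: qx_comm => i g; rewrite opD_T. Qed.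
Lemma I_qx b a f : I b (qx a f) = qx a (I b f).
Proof. by apply: qx_comm => i g; rewrite opD_I. Qed.
Lemma X_qx b a f : X b (qx a f) = qx a (X b f).
Proof. by apply: qx_comm => i g; rewrite opD_X. Qed.
Lemma D_qx i a f : D i (qx a f) = qx a (D i f).
Proof. by apply: qx_comm => j g; rewrite opDC. Qed.
Lemma Z_qx i a f : Z i (qx a f) = qx a (Z i f).
Proof. by apply: qx_comm => j g; rewrite opD_Z. Qed.
Lemma Y_qx b a f : Y b (qx a f) = qx a (Y b f).
Proof. by apply: qx_comm => j g; rewrite opD_Y. Qed.
Lemma qxC a b f : qx a (qx b f) = qx b (qx a f).
Proof. by apply: qx_comm => i g; rewrite D_qx. Qed.

Lemma D_diff i f : D i (diff f) = diff (D i f).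
Proof.
rewrite !diffE linearB linearD; congr (_ + _ - _).
- rewrite !diff1E opD_T; congr (tau _); rewrite linear_sum; apply: eq_bigr => j _.
  by rewrite opDC opD_Z.
- by rewrite !diff2E linear_sum; apply: eq_bigr => a _; rewrite opD_I opD_Y.
- by rewrite !diff3E linear_sum; apply: eq_bigr => a _; rewrite D_qx opD_X.
Qed.

Lemma diff1_I a f : diff1 (I a f) = - I a (diff1 f).
Proof.
rewrite !diff1E -opT_I; congr (tau _); rewrite linear_sum; apply: eq_bigr => i _.
by rewrite opZ_I opD_I.
Qed.
Lemma diff1_X a f : diff1 (X a f) = - X a (diff1 f).
Proof.
rewrite !diff1E -opT_X; congr (tau _); rewrite linear_sum; apply: eq_bigr => i _.
by rewrite opZ_X opD_X.
Qed.
Lemma diff2_I a f : diff2 (I a f) = - I a (diff2 f).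
Proof.
rewrite !diff2E linear_sum -sumrN; apply: eq_bigr => b _.
by rewrite opY_I opIC.
Qed.
Lemma diff3_I a f : diff3 (I a f) = qx a f - I a (diff3 f).
Proof.
rewrite !diff3E linear_sum (bigD1 a) //= [X in _ = _ - X](bigD1 a) //= opprD addrA -sumrN.
congr (_ + _).
  rewrite I_qx -(linearB (qx a)); congr (qx a _).
  by have := opI_X O a a f; rewrite eqxx => {2}<-; rewrite addrAC subrr add0r.
apply: eq_bigr => b ba; rewrite I_qx -(linearN (qx b)); congr (qx b _).
have := opI_X O a b f; rewrite eq_sym (negPf ba) addrC => /eqP.
by rewrite addr_eq0 => /eqP.
Qed.

Lemma diff_I a f : diff (I a f) + I a (diff f) = - qx a f.
Proof.
rewrite !diffE diff1_I diff2_I diff3_I (linearB (I a)) (linearD (I a)).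
move: (I a (diff1 f)) (I a (diff2 f)) (I a (diff3 f)) (qx a f) => x y z t.
by rewrite opprB (AC ((2*2)*(2*1)) ((1*5)*(2*6)*(3*7)*4)) /= !addNr subrr !add0r.
Qed.

Hypothesis F2 : (2 : F) != 0.

(** The D_i commute, so in twice the double sum each product Z_i Z_j may be replaced by the
    anticommutator, which the Clifford relation evaluates. *)
Lemma diff1K f : diff1 (diff1 f) = \sum_a qx a (Y a f).
Proof.
have -> : diff1 (diff1 f) = \sum_i \sum_j D i (D j (Z i (Z j f))).
  rewrite !diff1E linear_sum; apply: eq_bigr => i _.
  rewrite opZ_T opD_T opTK !linear_sum; apply: eq_bigr => j _.
  by rewrite -opD_Z.
have -> : \sum_a qx a (Y a f) =
    \sum_i \sum_j D i (D j (\sum_a alg_scalar A (G a i j) *: Y a f)).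
  under eq_bigr do rewrite qxE.
  rewrite exchange_big; apply: eq_bigr => i _; rewrite exchange_big.
  by apply: eq_bigr => j _; rewrite !linear_sum; apply: eq_bigr => a _; rewrite !linearZ.
apply: (alg_double_inj F2); rewrite mulr2n [X in X + _]exchange_big -big_split /= -sumrMnl.
apply: eq_bigr => i _; rewrite -big_split /= -sumrMnl; apply: eq_bigr => j _.
by rewrite opDC -!linearD -!linearMn addrC opZZ.
Qed.

Lemma anti_sum (W : lmodType A^c) (m : nat) (u : 'I_m -> 'I_m -> W) :
  (forall s t, u s t = - u t s) -> \sum_s \sum_t u s t = 0.
Proof.
move=> uN; apply: (alg_double_inj F2); rewrite mul0rn mulr2n {1}exchange_big -big_split big1 //= => a _.
by rewrite -big_split big1 // => b _ /=; rewrite uN addNr.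
Qed.

Lemma diff_diff f : diff (diff f) = 0.
Proof.
have d12 g : diff1 (diff2 g) + diff2 (diff1 g) = 0.
  rewrite [diff1 _]linear_sum diff2E -big_split big1 //= => a _.
  rewrite [X in X + _]diff1_I addrC -(linearB (I a)) -[RHS](linear0 (I a)); congr (I a _).
  rewrite !diff1E opY_T -(linearB tau) -[RHS](linear0 tau); congr (tau _).
  by rewrite (linear_sum (Y a)) -sumrB big1 // => i _; rewrite opZY opD_Y subrr.
have d13 g : diff1 (diff3 g) + diff3 (diff1 g) = 0.
  rewrite [diff1 _]linear_sum diff3E -big_split big1 //= => a _.
  rewrite -[X in _ + qx a X]opprK -diff1_X linearN !diff1E -T_qx -(linearB tau) -[RHS](linear0 tau).
  congr (tau _); rewrite (linear_sum (qx a)) -sumrB big1 // => i _.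
  by rewrite Z_qx D_qx subrr.
have d22 g : diff2 (diff2 g) = 0.
  rewrite -[RHS](anti_sum (u := fun a b => I a (I b (Y a (Y b g))))).
    rewrite !diff2E; apply: eq_bigr => a _; rewrite !linear_sum; apply: eq_bigr => b _.
    by rewrite opY_I.
  by move=> a b; rewrite opIC opYY.
have d33 g : diff3 (diff3 g) = 0.
  rewrite -[RHS](anti_sum (u := fun a b => X a (X b (qx a (qx b g))))).
    rewrite !diff3E; apply: eq_bigr => a _; rewrite !linear_sum; apply: eq_bigr => b _.
    by rewrite -!X_qx.
  by move=> a b; rewrite opXC qxC.
have d23 g : diff2 (diff3 g) + diff3 (diff2 g) = \sum_a qx a (Y a g).
  rewrite diff2E [diff3 (diff2 g)]linear_sum -big_split; apply: eq_bigr => b _ /=.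
  rewrite [X in _ + X]diff3_I addrCA -[RHS]addr0; congr (_ + _); apply/eqP; rewrite subr_eq0.
  apply/eqP; congr (I b _); rewrite !diff3E linear_sum; apply: eq_bigr => a _.
  by rewrite Y_qx opY_X.
have E : diff (diff f) = diff1 (diff1 f) + diff2 (diff2 f) + diff3 (diff3 f)
    + (diff1 (diff2 f) + diff2 (diff1 f)) - (diff1 (diff3 f) + diff3 (diff1 f))
    - (diff2 (diff3 f) + diff3 (diff2 f)).
  rewrite [diff f]diffE (linearB diff) (linearD diff) !diffE.
  move: (diff1 (diff1 f)) (diff1 (diff2 f)) (diff1 (diff3 f)) (diff2 (diff1 f)) (diff2 (diff2 f)) (diff2 (diff3 f)) (diff3 (diff1 f)) (diff3 (diff2 f)) (diff3 (diff3 f)).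
  move=> x11 x12 x13 x21 x22 x23 x31 x32 x33.
  rewrite !opprD !opprK !addrA.
  by rewrite (AC (9) (1*5*9*4*2*7*3*8*6)).
by rewrite E d12 d13 d22 d33 d23 diff1K subr0 !addr0 subrr.
Qed.

End Differential.

(** * Cohomology of Hom(-, N) along the flag of kernels of the d/dx_i *)

Section Cohomology.
Variables (F : fieldType) (A : gradedAlgebra F) (V : lmodType A^c) (n k : nat).
Variable G : 'I_k -> 'I_n -> 'I_n -> F.
Variable O : clifford_operators V G.
Local Notation D := (opD O).
Local Notation I := (opI O).
Local Notation d := (diff O).
Implicit Types (f z : V) (a b : 'I_k) (i j : 'I_n) (m p : nat) (s t : int).

(* [J i] integrates in x_i, [W m] is the space of chains of homological degree m and
   [gr t] that of chains of internal degree t. *)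
Variables (J : 'I_n -> {linear V -> V}) (W : nat -> V -> Prop) (gr : int -> V -> Prop).
Record chain_gradings := ChainGradings {
  DJ : forall i f, D i (J i f) = f;
  DJC : forall i j f, i != j -> D i (J j f) = J j (D i f);
  W_B : forall m f z, W m f -> W m z -> W m (f - z);
  W_D : forall m i f, W m.+1 f -> W m (D i f);
  W_D0 : forall i f, W 0 f -> D i f = 0;
  W_I : forall m a f, W m.+1 f -> W m (I a f);
  W_J : forall m i f, W m f -> W m.+1 (J i f);
  W_JD : forall m i f, W m f -> W m (J i (D i f));
  W_d : forall m f, W m.+1 f -> W m (d f);
  gr_D : forall t i f, gr t f -> gr (t - 1) (D i f);
  gr_I : forall t a f, gr t f -> gr (t - 2) (I a f);
  gr_J : forall t i f, gr t f -> gr (t + 1) (J i f);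
  gr_d : forall t f, gr t f -> gr t (d f);
  W_top : forall m f, (k < m)%N -> W m f -> (forall i, D i f = 0) -> f = 0 }.
Hypothesis CG : chain_gradings.
Hypothesis F2 : (2 : F) != 0.

Variable N : gradedModule A.
Implicit Types (phi psi u w : {linear V -> N}).

Definition of_degree s phi : Prop := forall t f, gr t f -> gm_gr (t + s) (phi f).
(** The flags descend from all chains (m = 0) to the common kernel of the d/dx_i (m = n). A cochain
    is always a linear map on all of V and is merely tested on a flag, so that no map has to be
    extended from one flag to a larger one. *)
Definition flag m f : Prop := forall i, (i < m)%N -> D i f = 0.
Definition closed_on l m phi : Prop := forall z, W m.+1 z -> flag l z -> phi (d z) = 0.
Definition exact_on s l m phi : Prop := exists psi, of_degree s psi /\
  forall z, W m z -> flag l z -> phi z = psi (d z).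

Lemma flag_D l i f : flag l f -> flag l (D i f).
Proof. by move=> fl j jl; rewrite opDC fl // linear0. Qed.
Lemma flag_I l a f : flag l f -> flag l (I a f).
Proof. by move=> fl j jl; rewrite opD_I fl // linear0. Qed.
Lemma flag_d l f : flag l f -> flag l (d f).
Proof. by move=> fl j jl; rewrite D_diff fl // linear0. Qed.
Lemma flag_J i f : flag i f -> flag i (J i f).
Proof. by move=> fl j jl; rewrite DJC ?fl ?linear0 // -val_eqE /= neq_ltn jl. Qed.
Lemma flag_lt l m f : (m <= l)%N -> flag l f -> flag m f.
Proof. by move=> ml fl j jl; apply: fl; apply: leq_trans ml. Qed.
Lemma flagS (i : 'I_n) f : flag i f -> D i f = 0 -> flag i.+1 f.
Proof. by move=> fl fi j; rewrite ltnS leq_eqVlt => /orP[/eqP/val_inj->|/fl]. Qed.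

Lemma closed_on_lt l l' m phi : (l <= l')%N -> closed_on l m phi -> closed_on l' m phi.
Proof. by move=> ll H z Wz fz; apply: H => //; apply: flag_lt fz. Qed.

Fact comp_linear (u : {linear V -> N}) (v : {linear V -> V}) : linear (fun f => u (v f)).
Proof. by move=> c f z; rewrite !linearP. Qed.
Definition compL u (v : {linear V -> V}) : {linear V -> N} := linear_of (comp_linear u v).
Fact sub_linear u w : linear (fun f => u f - w f).
Proof. by move=> c f z; rewrite (linearP u) (linearP w) scalerBr opprD addrACA. Qed.
Definition subL u w : {linear V -> N} := linear_of (sub_linear u w).
Fact add_linear u w : linear (fun f => u f + w f).
Proof. by move=> c f z; rewrite !linearP scalerDr addrACA. Qed.
Definition addL u w : {linear V -> N} := linear_of (add_linear u w).

Lemma of_degree_sub s u w : of_degree s u -> of_degree s w -> of_degree s (subL u w).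
Proof. by move=> us ws t f ft; apply: (gradingB (gm_grading N)); [apply: us|apply: ws]. Qed.
Lemma of_degree_add s u w : of_degree s u -> of_degree s w -> of_degree s (addL u w).
Proof. by move=> us ws t f ft; apply: (gradingD (gm_grading N)); [apply: us|apply: ws]. Qed.
Lemma of_degree_comp s s' e u (v : {linear V -> V}) : of_degree s u ->
  (forall t f, gr t f -> gr (t + e) (v f)) -> s' = s + e -> of_degree s' (compL u v).
Proof. by move=> us ve -> t f ft; rewrite [s + e]addrC addrA; apply/us/ve. Qed.
Lemma of_degree_d s u : of_degree s u -> of_degree s (compL u d).
Proof. by move=> us; apply: (of_degree_comp (e := 0) us) => [t f|]; rewrite addr0 //; apply: gr_d. Qed.

(** [J i] is a section of [D i] that respects the flag, so z - J i (D i z) lies in the next flag,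
    where phi vanishes. *)
Lemma peel (i : 'I_n) m phi z : (forall z, W m z -> flag i.+1 z -> phi z = 0) ->
  W m z -> flag i z -> phi z = phi (J i (D i z)).
Proof.
move=> phi0 Wz fz; apply/eqP; rewrite -subr_eq0 -linearB; apply/eqP/phi0.
  by apply: W_B => //; apply: W_JD.
apply: flagS; last by rewrite linearB (DJ CG) subrr.
move=> j ji; rewrite linearB; have := flag_J (flag_D i fz) ji; rewrite (fz j ji) => ->.
by rewrite subrr.
Qed.

(* Hom(-, N) of 0 -> ker d/dx_i -> ker (d/dx_1, ..., d/dx_(i-1)) -> itself -> 0 is exact;
   this is the part of its long exact cohomology sequence that lifts primitives. *)
Lemma exact_lift s (i : 'I_n) m phi : of_degree s phi ->
  closed_on i m.+1 phi -> exact_on s i.+1 m.+1 phi ->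
  (forall phi', of_degree (s + 1) phi' -> closed_on i m phi' -> exact_on (s + 1) i m phi') ->
  exact_on s i m.+1 phi.
Proof.
move=> phis phic [u [us uE]] H; pose chi := subL phi (compL u d).
have chi0 z : W m.+1 z -> flag i.+1 z -> chi z = 0.
  by move=> Wz fz; rewrite /chi /= /linear_of /= uE // subrr.
have chis : of_degree s chi by apply: of_degree_sub => //; apply: of_degree_d.
(* chi vanishes on the next flag, hence factors through D_i by way of chi o J_i, which has one
   homological degree less. It is closed: d z = D_i y for the boundary y = d (J_i z), and chi y =
   phi y - u (d y) = 0. *)
have [||w [ws wE]] := H (compL chi (J i)).
- by apply: (of_degree_comp (e := 1) chis) => // t f; apply: gr_J.
- move=> z Wz fz; pose y := d (J i z).
  have yE : d z = D i y by rewrite /y D_diff DJ.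
  have fy : flag i y by apply/flag_d/flag_J.
  have Wy : W m.+1 y by apply/W_d/W_J.
  rewrite yE -[LHS]/(chi (J i (D i y))) -(peel chi0) //.
  rewrite -[LHS]/(phi y - u (d y)) /y diff_diff // linear0 subr0.
  by apply: phic; [apply: W_J|apply: flag_J].
exists (addL u (compL w (D i))); split=> [|z Wz fz].
  apply: of_degree_add => //; apply: (of_degree_comp (e := -1) ws); last by rewrite addrK.
  by move=> t f; apply: gr_D.
rewrite -[RHS]/(u (d z) + w (D i (d z))) D_diff -wE; [|exact: W_D|exact: flag_D].
rewrite -[X in _ + X]/(chi (J i (D i z))) -(peel chi0) //.
by rewrite -[chi z]/(phi z - u (d z)) addrC subrK.
Qed.

(** Downward induction on l, starting from the common kernel l = n. Lifting a primitive from flag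
    l.+1 to flag l costs a primitive on flag l in one degree less, hence the inner induction on m.
    In degree 0 the D_i vanish and all flags coincide. *)
Lemma low_exact (k' : nat) :
  (forall s m phi, (m < k')%N -> of_degree s phi -> closed_on n m phi -> exact_on s n m phi) ->
  forall l s m phi, (l <= n)%N -> (m < k')%N -> of_degree s phi -> closed_on l m phi ->
    exact_on s l m phi.
Proof.
move=> base l; move: {2}(n - l)%N (leqnn (n - l)) => e; elim: e l => [|e IHe] l le s m phi ln.
  have -> : l = n by lia.
  exact: base.
have [->|lnn] := eqVneq l n; first exact: base.
have ln' : (l < n)%N by lia.
pose i := Ordinal ln'.
have IH s' m' phi' : (m' < k')%N -> of_degree s' phi' -> closed_on l m' phi' ->
    exact_on s' l.+1 m' phi'.
  by move=> mk ps pc; apply: IHe => //; [lia|apply: closed_on_lt pc].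
elim: m s phi => [|m IHm] s phi mk ps pc.
  have [u [us uE]] := IH _ _ _ mk ps pc; exists u; split=> // z Wz fz; apply: uE => //.
  by apply: (flagS (i := i)) => //; apply: W_D0.
apply: (exact_lift (i := i)) => //; first exact: IH.
by move=> phi' ps' pc'; apply: IHm => //; apply: ltnW.
Qed.

Section Vanishing.
Variable p : nat.
Hypothesis nilp : forall i, exists r : 'I_k -> {linear V -> V},
  [/\ forall a j f, D j (r a f) = r a (D j f), forall a f, d (r a f) = r a (d f),
      forall a m f, W (m + p)%N f -> W m (r a f),
      forall a t f, gr t f -> gr (t - p%:Z) (r a f) &
      forall f, iter p.+2 (D i) f = \sum_a r a (qx O a f)].

(** In degrees above k the common kernel of the D_i is zero. For the step from flag l.+1 to flag l,
    the vanishing on flag l.+1 makes D_i act injectively on the cohomology of flag l, while the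
    quadrics make it nilpotent; so this cohomology is zero. [Q q] says that the q-th power of D_i
    kills the class of phi. *)
Lemma high_exact l s m phi : (l <= n)%N -> (k < m)%N -> of_degree s phi -> closed_on l m phi ->
  exact_on s l m phi.
Proof.
move: {2}(n - l)%N (leqnn (n - l)) => e; elim: e l s m phi => [|e IHe] l s m phi le ln km ps pc.
  (* Any cochain serves as a primitive here: there are no nonzero chains to test it on. *)
  exists phi; split=> // z Wz fz; rewrite (W_top CG (m := m) (f := z)) // ?linear0 //.
  by move=> i; apply: fz; have := ltn_ord i; lia.
have [lnn|lnn] := eqVneq l n; first by subst l; apply: IHe => //; rewrite subnn.
have ln' : (l < n)%N by lia.
pose i := Ordinal ln'.
pose Q q := exists w, of_degree (s - q%:Z) w /\
  forall z, W (m + q)%N z -> flag l z -> phi (iter q (D i) z) = w (d z).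
(* By [diff_I] and the closedness of phi, phi (r_a (q_a z)) = - phi (r_a (I_a (d z))). Summing over
   a gives w. *)
have Q0 : Q p.+2.
  have [r [rD rd rW rgr rE]] := nilp i.
  have wl : linear (fun f => - \sum_a phi (r a (I a f))).
    move=> c f z; rewrite scalerN -opprD; congr (- _); rewrite scaler_sumr -big_split.
    by apply: eq_bigr => a _; rewrite !linearP.
  exists (linear_of wl); split=> [t f ft|z Wz fz].
    apply: (gradingN (gm_grading N)); apply: (grading_sum (gm_grading N)) => a _.
    have := ps _ _ (rgr a _ _ (gr_I CG a ft)); rewrite (_ : _ - _ - _ + _ = t + (s - p.+2%:Z)) //.
    lia.
  rewrite rE linear_sum -[RHS]/(- \sum_a phi (r a (I a (d z)))) -sumrN; apply: eq_bigr => a _.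
  have := diff_I O a z => /(congr1 -%R); rewrite opprK => <-.
  rewrite linearN linearD -rd linearN linearD pc ?add0r //.
    by apply: rW; apply: (W_I CG); move: Wz; rewrite !addnS addSn.
  by move=> j jl; rewrite rD (flag_I a fz jl) linear0.
(* On flag l.+1 the left side of [Q q.+1] vanishes, so w is closed there and, being of degree m + q
   > k, exact by the outer induction. After subtraction of u o d it factors through D_i, and
   evaluating at J_i z removes one D_i from the left side. *)
have QS q : Q q.+1 -> Q q.
  move=> [w [ws wE]].
  have [|||||u [us uE]] := IHe l.+1 (s - q.+1%:Z) (m + q)%N w; try lia.
  - exact: ws.
  - move=> z Wz fz; rewrite -wE ?addnS //; last exact: flag_lt fz.
    by rewrite iterSr (fz i) // iter_fix ?linear0.
  pose chi := subL w (compL u d).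
  have chis : of_degree (s - q.+1%:Z) chi by apply: of_degree_sub => //; apply: of_degree_d.
  exists (compL chi (J i)); split.
    by apply: (of_degree_comp (e := 1) chis) => [t f|]; [apply: gr_J|lia].
  move=> z Wz fz.
  have fJ : flag l (J i z) by apply: (flag_J (i := i)).
  have WJ : W (m + q.+1)%N (J i z) by rewrite addnS; apply: W_J.
  have := wE _ WJ fJ; rewrite iterSr DJ // => ->.
  rewrite -[RHS]/(chi (J i (d z))) -{2}(DJ CG i z) -D_diff.
  have Wd : W (m + q)%N (d (J i z)) by apply: (W_d CG); rewrite -addnS.
  rewrite -(peel (i := i) (m := (m + q)%N)) //; last exact: flag_d.
    by rewrite -[RHS]/(w (d (J i z)) - u (d (d (J i z)))) diff_diff // linear0 subr0.
  by move=> y Wy fy; rewrite -[LHS]/(w y - u (d y)) -uE // subrr.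
have : Q 0%N by elim: p.+2 Q0 => // q IH /QS.
by case=> w [ws wE]; exists w; split=> [|z Wz fz]; [rewrite -[s]subr0|apply: wE; rewrite ?addn0].
Qed.
End Vanishing.

Section TopClass.
Variables (g0 : V) (crit : N -> Prop) (e0 : N) (k_gt0 : (0 < k)%N).
Hypothesis low_base :
  forall s m phi, (m < k)%N -> of_degree s phi -> closed_on n m phi -> exact_on s n m phi.
Hypothesis top_base : forall s phi, of_degree s phi -> crit (phi g0) -> exact_on s n k phi.
Hypothesis g0_flag : forall i, D i g0 = 0.

Lemma top_exact l s phi : (l <= n)%N -> of_degree s phi -> closed_on l k phi ->
  crit (phi g0) -> exact_on s l k phi.
Proof.
move: {2}(n - l)%N (leqnn (n - l)) => e; elim: e l s phi => [|e IHe] l s phi le ln ps pc pt.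
  have -> : l = n by lia.
  exact: top_base.
have [->|lnn] := eqVneq l n; first exact: top_base.
have ln' : (l < n)%N by lia.
pose i := Ordinal ln'.
have k1 : k = k.-1.+1 by rewrite prednK.
rewrite k1; apply: (exact_lift (i := i)) => //; rewrite -?k1 //.
  by apply: IHe => //; [rewrite /=; lia|apply: closed_on_lt pc].
move=> phi' ps' pc'; apply: (low_exact low_base) => //; by rewrite prednK.
Qed.

Variable s0 : int.
Hypothesis crit_J : forall phi i, phi g0 = e0 -> crit (phi (d (J i g0))).
Hypothesis top_gen : exists phi, of_degree s0 phi /\ phi g0 = e0.

(** A cochain with value e0 at g0 is closed on the last flag for lack of chains, and is corrected
    flag by flag. The obstruction to passing from flag i.+1 to flag i is the class of phi o d o J_i
    in degree k, which dies by [crit_J]. The correction v o D_i leaves the value at g0 unchanged, as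
    D_i g0 = 0. *)
Lemma top_class : exists phi, [/\ of_degree s0 phi, closed_on 0 k phi & phi g0 = e0].
Proof.
have : forall l, (l <= n)%N -> exists phi, [/\ of_degree s0 phi, closed_on (n - l)%N k phi & phi g0 = e0].
  elim=> [_|l IH ln].
    have [phi [ps pe]] := top_gen; exists phi; split=> // z Wz fz.
    rewrite (W_top CG (m := k.+1) (f := z)) ?linear0 // => i; apply: fz.
    by rewrite subn0 ltn_ord.
  have [phi [ps pc pe]] := IH (ltnW ln).
  have jn : (n - l.+1 < n)%N by lia.
  pose i := Ordinal jn; have iS : (n - l = i.+1)%N by rewrite /=; lia.
  rewrite iS in pc; rewrite -[(n - l.+1)%N]/(i : nat).
  pose chi := compL phi d; have chis : of_degree s0 chi by apply: of_degree_d.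
  have chi0 z : W k.+1 z -> flag i.+1 z -> chi z = 0 by apply: pc.
  have ws : of_degree (s0 + 1) (compL chi (J i)).
    by apply: (of_degree_comp (e := 1) chis) => // t f; apply: gr_J.
  have [|||v [vs vE]] := top_exact (l := i) _ ws; first exact: ltnW jn.
  - move=> z Wz fz; pose y := d (J i z).
    have yE : d z = D i y by rewrite /y D_diff DJ.
    rewrite yE -[LHS]/(chi (J i (D i y))) -(peel chi0).
    + by rewrite -[LHS]/(phi (d y)) /y diff_diff // linear0.
    + by apply/W_d/W_J.
    + by apply/flag_d/flag_J.
  - exact: crit_J.
  exists (subL phi (compL v (D i))); split.
  - apply: of_degree_sub => //; apply: (of_degree_comp (e := -1) vs); last by rewrite addrK.
    by move=> t f; apply: gr_D.
  - move=> z Wz fz; rewrite -[LHS]/(phi (d z) - v (D i (d z))) D_diff -vE.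
    + rewrite -[X in _ - X]/(chi (J i (D i z))) -(peel chi0) //.
      by rewrite subrr.
    + exact: W_D.
    + exact: flag_D.
  - by rewrite -[LHS]/(phi g0 - v (D i g0)) g0_flag linear0 subr0.
by move=> /(_ n (leqnn n)); rewrite subnn.
Qed.
End TopClass.

End Cohomology.

(** * Homological and internal degrees of chains *)

Section ConcreteChains.
Variables (F : fieldType) (A : gradedAlgebra F) (T : gradedModule A) (n k : nat).
Variable G : 'I_k -> 'I_n -> 'I_n -> F.
Variables (Z : 'I_n -> {linear T -> T}) (Y : 'I_k -> {linear T -> T}).
Hypothesis ZZ : forall i j x,
  Z i (Z j x) + Z j (Z i x) = (\sum_a alg_scalar A (G a i j) *: Y a x) *+ 2.
Hypothesis ZY : forall i a x, Z i (Y a x) = Y a (Z i x).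
Hypothesis YY : forall a b x, Y a (Y b x) = Y b (Y a x).
Hypothesis Z_gr : forall i t x, gm_gr t x -> gm_gr (t + 1) (Z i x).
Hypothesis Y_gr : forall a t x, gm_gr t x -> gm_gr (t + 2) (Y a x).
Local Notation V := (chain T n k).
Implicit Types (f g : V) (al : 'X_{1..n}) (be : {set 'I_k}).

Lemma coef_ZZ i j f : coef (Z i) (coef (Z j) f) + coef (Z j) (coef (Z i) f) =
  (\sum_a alg_scalar A (G a i j) *: coef (Y a) f) *+ 2.
Proof. by apply/chainP => al be; rewrite chainDE /coef ZZ !mulr2n chainDE chain_sumE. Qed.
Lemma coef_ZY i a f : coef (Z i) (coef (Y a) f) = coef (Y a) (coef (Z i) f).
Proof. by apply/chainP => al be; rewrite /coef ZY. Qed.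
Lemma coef_YY a b f : coef (Y a) (coef (Y b) f) = coef (Y b) (coef (Y a) f).
Proof. by apply/chainP => al be; rewrite /coef YY. Qed.

Definition chain_operators : clifford_operators V G :=
  @CliffordOperators F A V n k G
    (fun i => @dx _ T n k i) (fun a => @iota _ T n k a) (fun a => @xi _ T n k a)
    (@tau _ T n k) (fun i => @coef _ T n k (Z i)) (fun a => @coef _ T n k (Y a))
    (@dxC _ T n k) (@dx_iota _ T n k) (@dx_xi _ T n k) (@dx_tau _ T n k)
    (fun i j => @dx_coef _ T n k (Z j) i) (fun i a => @dx_coef _ T n k (Y a) i)
    (@iotaC _ T n k) (@xiC _ T n k) (@iota_xi _ T n k) (@tauK _ T n k)
    (@tau_iota _ T n k) (@tau_xi _ T n k)
    (fun i => @coef_tau _ T n k (Z i)) (fun i => @coef_iota _ T n k (Z i)) (fun i => @coef_xi _ T n k (Z i))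
    (fun i => @coef_tau _ T n k (Y i)) (fun i => @coef_iota _ T n k (Y i)) (fun i => @coef_xi _ T n k (Y i))
    coef_ZZ coef_ZY coef_YY.

Definition hom_degree (m : nat) f : Prop :=
  forall al be, (mdeg al + #|be|)%N != m -> f al be = 0.
(** x_i has the internal degree 1 of e_i and xi_a the degree 2 of y_a, which makes the differential
    homogeneous of degree 0. *)
Definition chain_gr (t : int) f : Prop :=
  forall al be, gm_gr (t - (mdeg al)%:Z - 2 * #|be|%:Z) (f al be).

Lemma hom_degree0 m : hom_degree m 0. Proof. by []. Qed.
Lemma hom_degreeD m f g : hom_degree m f -> hom_degree m g -> hom_degree m (f + g).
Proof. by move=> fm gm al be E; rewrite chainDE fm // gm // addr0. Qed.
Lemma hom_degreeN m f : hom_degree m f -> hom_degree m (- f).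
Proof. by move=> fm al be E; rewrite chainNE fm // oppr0. Qed.
Lemma hom_degreeB m f g : hom_degree m f -> hom_degree m g -> hom_degree m (f - g).
Proof. by move=> fm /hom_degreeN; apply: hom_degreeD. Qed.
Lemma hom_degreeZ m (c : A^c) f : hom_degree m f -> hom_degree m (c *: f).
Proof. by move=> fm al be E; rewrite chainZE fm // scaler0. Qed.
Lemma hom_degree_sum m (I : Type) (s : seq I) (P : pred I) (f : I -> V) :
  (forall i, P i -> hom_degree m (f i)) -> hom_degree m (\sum_(i <- s | P i) f i).
Proof. by move=> H; elim/big_ind: _ => //; apply: hom_degreeD. Qed.

Lemma hom_degree_dx m i f : hom_degree m.+1 f -> hom_degree m (dx i f).
Proof. by move=> fm al be E; rewrite /dx fm // mdegD mdeg1 addn1 addSn eqSS. Qed.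
Lemma hom_degree_dx0 i f : hom_degree 0 f -> dx i f = 0.
Proof. by move=> fm; apply/chainP => al be; rewrite /dx fm // mdegD mdeg1 addn1. Qed.
Lemma hom_degree_iota m a f : hom_degree m.+1 f -> hom_degree m (iota a f).
Proof.
move=> fm al be E; rewrite /iota; case: ifP => // abe.
by rewrite fm ?scaler0 // cardsU1 abe addnCA eqSS.
Qed.
Lemma hom_degree_iota0 a f : hom_degree 0 f -> iota a f = 0.
Proof.
move=> fm; apply/chainP => al be; rewrite /iota; case: ifP => // abe.
by rewrite fm ?scaler0 // cardsU1 abe addnCA.
Qed.
Lemma hom_degree_xi m a f : hom_degree m f -> hom_degree m.+1 (xi a f).
Proof.
move=> fm al be E; rewrite /xi; case: ifP => // abe.
by rewrite fm ?scaler0 //; apply: contraNN E => /eqP <-; rewrite (cardsD1 a be) abe addnCA.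
Qed.
Lemma hom_degree_ix m i f : hom_degree m f -> hom_degree m.+1 (ix i f).
Proof.
move=> fm al be E; rewrite /ix; case: ifP => // /negbT ali; rewrite fm //.
by apply: contraNN E => /eqP <-; rewrite (mdeg_subU ali) addSn.
Qed.
Lemma hom_degree_tau m f : hom_degree m f -> hom_degree m (tau f).
Proof. by move=> fm al be E; rewrite /tau fm // scaler0. Qed.
Lemma hom_degree_coef m (u : {additive T -> T}) f : hom_degree m f -> hom_degree m (coef u f).
Proof. by move=> fm al be E; rewrite /coef fm // raddf0. Qed.

Lemma chain_gr_dx t i f : chain_gr t f -> chain_gr (t - 1) (dx i f).
Proof.
move=> ft al be; have := ft (al + U_(i))%MM be; rewrite mdegD mdeg1 PoszD /dx.
by congr (gm_gr _ _); lia.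
Qed.
Lemma chain_gr_iota t a f : chain_gr t f -> chain_gr (t - 2) (iota a f).
Proof.
move=> ft al be; rewrite /iota; case: ifP => abe; first exact: (grading0 (gm_grading T)).
apply: sign_gr; have := ft al (a |: be); rewrite cardsU1 abe add1n.
by congr (gm_gr _ _); move: #|be| => c; lia.
Qed.
Lemma chain_gr_xi t a f : chain_gr t f -> chain_gr (t + 2) (xi a f).
Proof.
move=> ft al be; rewrite /xi; case: ifP => abe; last exact: (grading0 (gm_grading T)).
apply: sign_gr; have := ft al (be :\ a); rewrite [in X in _ -> X](cardsD1 a be) abe add1n.
by congr (gm_gr _ _); move: #|_| => c; lia.
Qed.
Lemma chain_gr_ix t i f : chain_gr t f -> chain_gr (t + 1) (ix i f).
Proof.
move=> ft al be; rewrite /ix; case: ifP => [_|/negbT ali]; first exact: (grading0 (gm_grading T)).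
have := ft (al - U_(i))%MM be; rewrite (mdeg_subU ali).
by congr (gm_gr _ _); lia.
Qed.
Lemma chain_gr_tau t f : chain_gr t f -> chain_gr t (tau f).
Proof. by move=> ft al be; apply: sign_gr. Qed.
Lemma chain_gr_coef t e (u : T -> T) f : (forall t x, gm_gr t x -> gm_gr (t + e) (u x)) ->
  chain_gr t f -> chain_gr (t + e) (coef u f).
Proof.
move=> uH ft al be; have := uH _ _ (ft al be); rewrite /coef.
by congr (gm_gr _ _); lia.
Qed.

Lemma chain_grading : grading chain_gr.
Proof.
have GT := gm_grading T; split=> [i al be|i f g fi gi al be|s f us fP fs i si|j i f a fj ai al be].
- exact: (grading0 GT).
- exact: (gradingB GT).
- apply/chainP => al be; rewrite chain0E; pose e := (mdeg al)%:Z + 2 * #|be|%:Z.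
  have := grading_indep GT (s := [seq l - e | l <- s]) (f := fun l => f (l + e) al be).
  rewrite map_inj_uniq; last exact: addIr.
  move=> /(_ us) H; rewrite -[i](subrK e); apply: H.
  + by move=> l; have := fP (l + e) al be; congr (gm_gr _ _); rewrite /e; lia.
  + rewrite big_map; transitivity ((\sum_(l <- s) f l) al be); last by rewrite fs.
    by rewrite chain_sumE; apply: eq_bigr => l _; rewrite subrK.
  + by apply/mapP; exists i.
- have := gradingM GT (fj al be) ai; rewrite chainZE.
  by congr (gm_gr _ _); lia.
Qed.

Lemma chain_gr_qx t a f : chain_gr t f -> chain_gr (t - 2) (qx chain_operators a f).
Proof.
move=> ft; rewrite qxE; do 2 (apply: (grading_sum chain_grading) => ? _).
apply: (alg_scale_gr _ chain_grading); rewrite (_ : t - 2 = t - 1 - 1); last by lia.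
by do 2 apply: chain_gr_dx.
Qed.

Lemma hom_degree_qx m a f : hom_degree m.+2 f -> hom_degree m (qx chain_operators a f).
Proof.
move=> fm; rewrite qxE; do 2 (apply: hom_degree_sum => ? _).
by apply: hom_degreeZ; do 2 apply: hom_degree_dx.
Qed.

Lemma hom_degree_qx1 m a f : (m <= 1)%N -> hom_degree m f -> qx chain_operators a f = 0.
Proof.
case: m => [|[|//]] _ fm; rewrite qxE big1 // => i _; rewrite big1 // => j _.
  by rewrite /= (hom_degree_dx0 j fm) linear0 scaler0.
by rewrite /= (hom_degree_dx0 i (hom_degree_dx j fm)) scaler0.
Qed.

Lemma hom_degree_diff m f : hom_degree m.+1 f -> hom_degree m (diff chain_operators f).
Proof.
move=> fm; rewrite diffE; apply: hom_degreeB; first apply: hom_degreeD.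
- rewrite diff1E; apply: hom_degree_tau; apply: hom_degree_sum => i _.
  by apply: hom_degree_dx; apply: hom_degree_coef.
- rewrite diff2E; apply: hom_degree_sum => a _.
  by apply: hom_degree_iota; apply: hom_degree_coef.
- rewrite diff3E; apply: hom_degree_sum => a _.
  by apply: hom_degree_qx; apply: hom_degree_xi.
Qed.

Lemma hom_degree_diff0 f : hom_degree 0 f -> diff chain_operators f = 0.
Proof.
move=> f0; rewrite diffE diff1E diff2E diff3E !big1 ?linear0 ?addr0 ?subr0 // => a _.
- by apply: (@hom_degree_qx1 1) => //; apply: hom_degree_xi.
- by apply: hom_degree_iota0; apply: hom_degree_coef.
- by apply: hom_degree_dx0; apply: hom_degree_coef.
Qed.

Lemma chain_gr_diff t f : chain_gr t f -> chain_gr t (diff chain_operators f).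
Proof.
move=> ft; rewrite diffE; apply: (gradingB chain_grading); first apply: (gradingD chain_grading).
- rewrite diff1E; apply: chain_gr_tau; apply: (grading_sum chain_grading) => i _.
  by rewrite -[t](addrK 1); apply: chain_gr_dx; apply: chain_gr_coef => // *; apply: Z_gr.
- rewrite diff2E; apply: (grading_sum chain_grading) => a _.
  by rewrite -[t](addrK 2); apply: chain_gr_iota; apply: chain_gr_coef => // *; apply: Y_gr.
- rewrite diff3E; apply: (grading_sum chain_grading) => a _.
  by rewrite -[t](addrK 2); apply: chain_gr_qx; apply: chain_gr_xi.
Qed.

Lemma concrete_gradings :
  chain_gradings chain_operators (fun i => @ix _ T n k i) hom_degree chain_gr.
Proof.
split.
- exact: dx_ix.
- exact: dx_ixC.
- exact: hom_degreeB.
- exact: hom_degree_dx.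
- exact: hom_degree_dx0.
- exact: hom_degree_iota.
- exact: hom_degree_ix.
- move=> [|m] i f fm; last by apply/hom_degree_ix/hom_degree_dx.
  by rewrite /= (hom_degree_dx0 i fm) linear0.
- exact: hom_degree_diff.
- exact: chain_gr_dx.
- exact: chain_gr_iota.
- exact: chain_gr_ix.
- exact: chain_gr_diff.
(* A coefficient with al = 0 vanishes because |be| <= k < m. Any other coefficient has some al_i > 0
   and is therefore a coefficient of D_i f. *)
- move=> m f km fm f0; apply/chainP => al be; have [al0|al0] := eqVneq (mdeg al) 0%N.
    apply: fm; rewrite al0 add0n neq_ltn (leq_ltn_trans _ km) //.
    by have := max_card (mem be); rewrite card_ord.
  have [i ali] : exists i, al i != 0%N.
    apply/existsP; apply: contraNT al0; rewrite negb_exists => /forallP al0.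
    rewrite mdegE big1 // => i _; by have := al0 i; rewrite negbK => /eqP.
  have /(congr1 (fun g : V => g (al - U_(i))%MM be)) := f0 i.
  by rewrite /= /dx mnm_subUK.
Qed.
End ConcreteChains.

Definition additive_of (U W : zmodType) (f : U -> W) (fa : zmod_morphism f) : {additive U -> W} :=
  HB.pack f (GRing.isZmodMorphism.Build U W f fa).
Arguments additive_of : simpl never.

Section CoefficientMaps.
Variables (F : fieldType) (A : gradedAlgebra F) (M : gradedModule A) (B : homogeneous_basis M).
Local Notation T := (tens B).
Local Notation X := (hb_index B).
Local Notation co x t := (monalg.mcoeff x (t : {malg A^c[X]})).

Fact tmap_key : {f : {additive A^c -> A^c} -> {additive T -> T} |
  forall g t, f g t = malg_lift g (free_gen A (X := X)) t}.
Proof. by exists (fun g => malg_lift g (free_gen A (X := X))). Qed.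
(* id (x) g *)
Definition tmap : {additive A^c -> A^c} -> {additive T -> T} := sval tmap_key.
Lemma tmap_lift g t : tmap g t = malg_lift g (free_gen A (X := X)) t.
Proof. exact: (svalP tmap_key). Qed.

Lemma mcoeff_free_gen (a : A^c) (x z : X) : co z (a *: free_gen A x) = if x == z then a else 0.
Proof. by rewrite free_genZ monalg.mcoeffU; case: eqP. Qed.

Lemma tmapE g t x : co x (tmap g t) = g (co x t).
Proof.
move: t; apply: malg_ind => [s t|| c z].
- by rewrite (raddfD (tmap g)) !monalg.mcoeffD (raddfD g) => -> ->.
- by rewrite (raddf0 (tmap g)) !monalg.mcoeff0 raddf0.
- rewrite tmap_lift malg_liftU mcoeff_free_gen monalg.mcoeffU; case: eqP => // _.
  by rewrite mulr0n raddf0.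
Qed.

Lemma mcoeff_left z t x : co x (tens_left B z t) = ((z : A) * (co x t : A))%R.
Proof.
move: t; apply: free_ind => [s t||c u].
- by rewrite (linearD (tens_left B z)) !monalg.mcoeffD => -> ->; rewrite mulrDr.
- by rewrite linear0 !monalg.mcoeff0 mulr0.
- rewrite linearZ_LR -tens1_vec tens_left1 tens1_vec scalerA !mcoeff_free_gen.
  by case: eqP; rewrite ?mulr0.
Qed.

Lemma mcoeff_tens1 (a : A^c) m x :
  co x (a *: tens1 B m) = (monalg.mcoeff x (hb_coord B m) *: (a : A))%R.
Proof.
rewrite monalg.mcoeffZ.
have -> : co x (tens1 B m) = alg_scalar A (monalg.mcoeff x (hb_coord B m)).
  rewrite tens1_lift; move: (hb_coord B m); apply: malg_ind => [u v||c z].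
  - by rewrite raddfD !monalg.mcoeffD raddfD => -> ->.
  - by rewrite raddf0 !monalg.mcoeff0 raddf0.
  - by rewrite malg_liftU mcoeff_free_gen monalg.mcoeffU; case: eqP => // _; rewrite mulr0n raddf0.
by rewrite -[LHS]/((_%:A : A) * (a : A)) mulr_algl.
Qed.

Definition F_homogeneous (g : A -> A) := forall c (a : A), g (c *: a) = c *: g a.

Lemma mcoeff_sign t x : co x (tens_sign B t) = (-1) ^+ odd `|hb_deg x|%N *: (co x t : A).
Proof.
move: t; apply: free_ind => [s t||a z].
- by rewrite (linearD (tens_sign B)) !monalg.mcoeffD => -> ->; rewrite scalerDr.
- by rewrite linear0 !monalg.mcoeff0 scaler0.
- rewrite (linearZ_LR (tens_sign B)) -tens1_vec (tens_sign1 B (hb_vec_gr z)) -signZC tens1_vec !scaler_sign.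
  case: ifP => ox; rewrite ?monalg.mcoeffN !mcoeff_free_gen.
    by have [<-|_] := eqVneq z x; rewrite ?ox // ?if_same ?oppr0 ?if_same //; case: ifP; rewrite ?oppr0.
  by have [<-|_] := eqVneq z x; rewrite ?ox //; case: ifP; rewrite ?oppr0.
Qed.

Lemma tmap_sign (g : {additive A^c -> A^c}) t : tmap g (tens_sign B t) = tens_sign B (tmap g t).
Proof.
apply/malgP => x; rewrite tmapE !mcoeff_sign tmapE !scaler_sign.
by case: ifP => _ //; rewrite raddfN.
Qed.

(* A subspace of A, extended to M (x) A. *)
Variable P : A -> Prop.
Hypotheses (P0 : P 0) (PD : forall a b, P a -> P b -> P (a + b)) (PZ : forall c a, P a -> P (c *: a)).

Definition tsub (t : T) : Prop := forall x, P (co x t).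

Lemma tsub_ind (Q : T -> Prop) : Q 0 -> (forall s t, Q s -> Q t -> Q (s + t)) ->
  (forall a x, P a -> Q ((a : A^c) *: free_gen A x)) -> forall t, tsub t -> Q t.
Proof.
move=> Q0 QD QU t tP; rewrite [t]monalgE; elim/big_ind: _ => // x _.
by rewrite -free_genZ; apply: QU.
Qed.

Lemma tsub0 : tsub 0. Proof. by move=> x; rewrite monalg.mcoeff0. Qed.
Lemma tsubD s t : tsub s -> tsub t -> tsub (s + t).
Proof. by move=> sP tP x; rewrite monalg.mcoeffD; apply: PD. Qed.

Lemma tsub_right z t : tsub t -> tsub (tens_right B z t).
Proof.
move: t; apply: tsub_ind => [|s t sP tP|a x aP].
- by rewrite linear0; apply: tsub0.
- by rewrite (linearD (tens_right B z)); apply: tsubD.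
- rewrite linearZ_LR -tens1_vec tens_right1 => w.
  by rewrite mcoeff_tens1; apply: PZ.
Qed.

Lemma tsub_sign t : tsub t -> tsub (tens_sign B t).
Proof. by move=> tP x; rewrite mcoeff_sign; apply: PZ. Qed.

Lemma tsub_scalar t : (forall a, P a -> exists c, a = c%:A) -> tsub t -> exists m, t = tens1 B m.
Proof.
move=> Ps; move: t; apply: tsub_ind => [|s t [m ->] [m' ->]|a x /Ps [c ->]].
- by exists 0; rewrite (F_linear0 (@tens1_linear _ _ _ B)).
- by exists (m + m'); have := @tens1_linear _ _ _ B 1 m m'; rewrite alg_scalar1 !scale1r.
- exists (alg_scalar A c *: hb_vec x).
  have := @tens1_linear _ _ _ B c (hb_vec x) 0; rewrite (F_linear0 (@tens1_linear _ _ _ B)) !addr0 => ->.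
  by rewrite tens1_vec.
Qed.
End CoefficientMaps.

Lemma wedge1Z (R : comNzRingType) n i (r : R) (x : {ffun {set 'I_n} -> R^o}) :
  wedge1 i (r *: x) = r *: wedge1 i x.
Proof. exact: linearZ. Qed.
Lemma contr1Z (R : comNzRingType) n i (r : R) (x : {ffun {set 'I_n} -> R^o}) :
  contr1 i (r *: x) = r *: contr1 i x.
Proof. exact: linearZ. Qed.

(** * Generators of the Clifford algebra and the weight of PBW monomials *)

Section CliffordElements.
Variables (F : fieldType) (n k : nat) (q : 'I_n -> 'I_n -> {mpoly F[k]}).
Local Notation S := {mpoly F[k]}.
Local Notation C := (clifford q).
Local Notation ext := {ffun {set 'I_n} -> S^o}.
Hypothesis q_homog : forall i j, q i j \is 1.-homog.
Local Notation A := (graded_clifford q_homog).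
Implicit Types (x : C) (J : {set 'I_n}) (m : 'X_{1..k}).

Definition cl_e i : C := wedge1 i (ext_one S n).
Definition cl_y (a : 'I_k) : C := ('X_a : S) *: (ext_one S n : ext).

Lemma cl_eM i x : cl_e i * x = clifford_gen q i x.
Proof.
have -> : cl_e i = clifford_gen q i (ext_one S n).
  rewrite /clifford_gen [contr _ _]big1 ?addr0 // => j _.
  by rewrite contr1_one scaler0.
by rewrite -[LHS]/(clifford_mul q _ _) clifford_mul_gen clifford_mul1l.
Qed.

Lemma cl_yM a x : cl_y a * x = ('X_a : S) *: (x : ext).
Proof. by rewrite -[LHS]/(clifford_mul q _ _) [LHS]clifford_actZ -/(clifford_mul _ _ _) clifford_mul1l. Qed.

Lemma cl_Mr r x : x * (r *: (ext_one S n : ext)) = r *: (x : ext).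
Proof. by rewrite -[LHS]/(clifford_mul q _ _) clifford_mulZr clifford_mul1r. Qed.

Lemma cl_y_central a x : x * cl_y a = cl_y a * x.
Proof. by rewrite cl_Mr cl_yM. Qed.

Lemma clifford_gr_one : clifford_gr 0 (ext_one S n : C).
Proof. by apply/(clifford_gr0P (q := q)); exists 1; rewrite scale1r. Qed.

Lemma cl_e_gr i : ga_gr (g := A) 1 (cl_e i : A).
Proof. exact: clifford_gr_wedge1 clifford_gr_one. Qed.

Lemma cl_y_gr a : ga_gr (g := A) 2 (cl_y a : A).
Proof.
have X1 : ('X_a : S) \is 1.-homog by rewrite dhomogX /= mdeg1.
exact: (clifford_gr_scale X1 clifford_gr_one).
Qed.

Lemma cl_scaleE (c : F) x J : (c *: x : C) J = c *: (x J : S).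
Proof. by rewrite ffunE. Qed.

Variable G : 'I_k -> 'I_n -> 'I_n -> F.
Hypothesis qE : forall i j, q i j = \sum_a G a i j *: 'X_a.
Hypothesis Gsym : forall a i j, G a i j = G a j i.

Lemma cl_ee i j : cl_e i * cl_e j + cl_e j * cl_e i = (\sum_a G a i j *: cl_y a) *+ 2 :> C.
Proof.
have e1 l : cl_e l = clifford_gen q l (ext_one S n) by rewrite -[LHS]mulr1 cl_eM.
rewrite (cl_eM i) (cl_eM j) (e1 i) (e1 j).
rewrite [LHS](clifford_genC q i j (ext_one S n)); have -> : q i j + q j i = (\sum_a G a i j *: 'X_a) *+ 2.
  by rewrite mulr2n !qE; congr (_ + _); apply: eq_bigr => a _; rewrite Gsym.
rewrite -scalerMnl; congr (_ *+ 2); rewrite scaler_suml; apply: eq_bigr => a _.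
by rewrite clifford_scaleE scalerA mulr_algl.
Qed.

(* The PBW weight of e_J y^m, counting all generators with weight 1. *)
Definition pbw (w s : nat) (x : C) : Prop :=
  forall J m, m \in msupp (x J : S) -> (#|J| + mdeg m + s < w)%N.

Lemma pbw0 w s : pbw w s 0. Proof. by move=> J m; rewrite ffunE msupp0. Qed.
Lemma pbwD w s x z : pbw w s x -> pbw w s z -> pbw w s (x + z).
Proof. by move=> xw zw J m; rewrite ffunE => /msuppD_le; rewrite mem_cat => /orP[/xw|/zw]. Qed.
Lemma pbwZ w s (c : F) x : pbw w s x -> pbw w s (c *: x).
Proof. by move=> xw J m; rewrite cl_scaleE => /msuppZ_le/xw. Qed.
Lemma pbw_sum w s (I : Type) (r : seq I) (P : pred I) (f : I -> C) :
  (forall t, P t -> pbw w s (f t)) -> pbw w s (\sum_(t <- r | P t) f t).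
Proof. by move=> H; elim/big_ind: _ => //; [apply: pbw0|apply: pbwD]. Qed.
Lemma pbw_le w w' s s' x : pbw w s x -> (w + s' <= w' + s)%N -> pbw w' s' x.
Proof. by move=> xw le J m /xw; move: #|J| (mdeg m) => c d; lia. Qed.

Lemma pbw_wedge1 w s i x : pbw w s.+1 x -> pbw w s (wedge1 i x).
Proof.
move=> xw J m; rewrite ffunE; case: ifP => iJ; last by rewrite msupp0.
by move=> /ext_sgn_msupp/xw; rewrite (cardsD1 i J) iJ; move: #|J :\ i| (mdeg m) => c d; lia.
Qed.
Lemma pbw_contr1 w s i x : pbw w s x -> pbw w s.+1 (contr1 i x).
Proof.
move=> xw J m; rewrite ffunE; case: ifP => iJ; first by rewrite msupp0.
by move=> /ext_sgn_msupp/xw; rewrite cardsU1 iJ; move: #|J| (mdeg m) => c d; lia.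
Qed.
Lemma pbw_scale w s d (r : S) x : r \is d.-homog -> pbw w (s + d)%N x -> pbw w s (r *: (x : ext)).
Proof.
move=> /dhomogP rd xw J m; rewrite ffunE => /msuppM_le /allpairsP[[a b] /= [ar bx ->]].
by rewrite mdegD (rd _ ar); have := xw _ _ bx; move: #|J| (mdeg b) => c e; lia.
Qed.
Lemma pbw_contr w s i x : pbw w s x -> pbw w s (contr (q i) x).
Proof.
move=> xw; rewrite /contr; apply: pbw_sum => j _.
by apply: (pbw_scale (d := 1)) => //; rewrite addn1; apply: pbw_contr1.
Qed.

Definition cl_deriv (a : 'I_k) (x : C) : C := [ffun J : {set _} => (x J : S)^`M(a)].

Lemma pbw_deriv w s a x : pbw w s x -> pbw w s.+1 (cl_deriv a x).
Proof.
move=> xw J m; rewrite ffunE mcoeff_msupp mcoeff_mderiv => xm.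
have /xw : (m + U_(a))%MM \in msupp (x J : S).
  by rewrite mcoeff_msupp; apply: contraNN xm => /eqP ->; rewrite mul0rn.
by rewrite mdegD mdeg1; move: #|J| (mdeg m) => c d; lia.
Qed.

Lemma pbw_bounded x : exists w, pbw w 0 x.
Proof.
exists (\max_(J : {set 'I_n}) (#|J| + msize (x J : S))).+1%N => J m xm.
rewrite addn0 ltnS; apply: leq_trans (leq_bigmax J).
by rewrite leq_add2l ltnW ?msize_mdeg_lt.
Qed.

Lemma pbw1_scalar x : pbw 1 0 x -> exists c : F, x = c%:A.
Proof.
move=> x1; apply/(clifford_gr0P (q := q)) => J m /x1; rewrite addn0 ltnS leqn0 addn_eq0.
by case/andP => /eqP -> /eqP ->.
Qed.

Lemma pbw_0 x s : pbw 0 s x -> x = 0.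
Proof.
move=> x0; apply/ffunP => J; apply/mpolyP => m; rewrite ffunE mcoeff0.
by apply: memN_msupp_eq0; apply/negP => /x0.
Qed.

Lemma F_homogeneous_wedge1 i : F_homogeneous (A := A) (wedge1 i : C -> C).
Proof.
move=> c x; rewrite [RHS]clifford_scaleE.
have -> : c *: (x : A) = c%:A *: (x : ext) := clifford_scaleE c x.
exact: linearZ.
Qed.
Lemma F_homogeneous_contr1 i : F_homogeneous (A := A) (contr1 i : C -> C).
Proof.
move=> c x; rewrite [RHS]clifford_scaleE.
have -> : c *: (x : A) = c%:A *: (x : ext) := clifford_scaleE c x.
exact: linearZ.
Qed.
Lemma F_homogeneous_contr i : F_homogeneous (A := A) (contr (q i) : C -> C).
Proof.
move=> c x; rewrite [RHS]clifford_scaleE.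
have -> : c *: (x : A) = c%:A *: (x : ext) := clifford_scaleE c x.
exact: linearZ.
Qed.
Lemma F_homogeneous_deriv a : F_homogeneous (A := A) (cl_deriv a).
Proof. by move=> c x; apply/ffunP => J; rewrite ffunE !cl_scaleE ffunE mderivZ. Qed.

Fact wedge1_zmod i : zmod_morphism (wedge1 i : C -> C). Proof. exact: raddfB. Qed.
Fact contr1_zmod i : zmod_morphism (contr1 i : C -> C). Proof. exact: raddfB. Qed.
Fact contr_zmod i : zmod_morphism (contr (q i) : C -> C). Proof. exact: raddfB. Qed.
Fact deriv_zmod a : zmod_morphism (cl_deriv a).
Proof. by move=> x z; apply/ffunP => J; rewrite !ffunE mderivB. Qed.
Fact ymul_zmod a : zmod_morphism (fun x : C => cl_y a * x).
Proof. by move=> x z; rewrite mulrBr. Qed.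

Lemma deriv_ymul a b x :
  cl_deriv a (cl_y b * x) = cl_y b * cl_deriv a x + (if a == b then x else 0).
Proof.
apply/ffunP => J; rewrite !cl_yM !ffunE [_ *: _]/GRing.scale /= mderivM mderivX mnm1E eq_sym.
rewrite addrC; congr (_ + _).
case: eqP => [->|_]; last by rewrite ffunE scale0r mul0r.
have -> : (U_(b) - U_(b))%MM = 0%MM :> 'X_{1..k} by apply/mnmP => l; rewrite mnmBE subnn mnm0E.
by rewrite mpolyX0 scale1r mul1r.
Qed.

Lemma deriv_wedge1 a i x : cl_deriv a (wedge1 i x) = wedge1 i (cl_deriv a x).
Proof.
apply/ffunP => J; rewrite !ffunE; case: ifP => _; last exact: mderiv0.
by rewrite /ext_sgn; case: (odd _) (signr_odd S #|[set j in J | (j < i)%N]|) => <- /=;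
  rewrite ?expr1 ?mulN1r ?mderivN // !mul1r.
Qed.
Lemma ymul_contr1 a i x : cl_y a * contr1 i x = contr1 i (cl_y a * x).
Proof. rewrite (cl_yM a (contr1 i x)) (cl_yM a x); exact: esym (contr1Z _ _ _). Qed.

Lemma mcoeff_ysum (x : C) J m :
  ((\sum_a cl_y a * cl_deriv a x : C) J : S)@_m = (x J : S)@_m *+ mdeg m.
Proof.
rewrite sum_ffunE raddf_sum /= mdegE -sumrMnr; apply: eq_bigr => a _.
rewrite cl_yM !ffunE [_ *: _]/GRing.scale /=.
have [ma|ma] := eqVneq (m a) 0%N.
  rewrite ma mulr0n; apply: memN_msupp_eq0; rewrite mulrC (perm_mem (msuppMX _ _)).
  by apply/negP => /mapP[m' _ mE]; move: ma; rewrite mE mnmDE mnm1E eqxx.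
have := mcoeffMX (x J : S)^`M(a) U_(a) (m - U_(a)); rewrite addmC mnm_subUK // mulrC => ->.
rewrite mcoeff_mderiv mnm_subUK //.
by rewrite mnmBE mnm1E eqxx subn1 prednK // lt0n.
Qed.

(* The Euler operator multiplies e_J y^m by |J| + |m|. *)
Definition cl_euler x : C := \sum_i wedge1 i (contr1 i x) + \sum_a cl_y a * cl_deriv a x.

Lemma cl_eulerE x J m : (cl_euler x J : S)@_m = (x J : S)@_m *+ (#|J| + mdeg m).
Proof.
rewrite ffunE mcoeffD mcoeff_ysum mulrnDr; congr (_ + _).
rewrite sum_ffunE raddf_sum /= -sum1_card -sumrMnr [RHS]big_mkcond; apply: eq_bigr => i _.
rewrite !ffunE /=; case: ifP => iJ; last exact: mcoeff0.
by rewrite !inE eqxx /= setD1K // (@ext_sgnD S n i i J iJ) ltnn mul1r mulrA ext_sgn2 mul1r.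
Qed.

(** The operator multiplies e_J y^m by |J| + |m| + s - w, which is zero exactly on the monomials of
    the largest weight that the bound w.+1 admits. *)
Lemma pbw_euler w s x : pbw w.+1 s x -> pbw w s (cl_euler x + x *+ s - x *+ w).
Proof.
move=> xw J m; rewrite mcoeff_msupp => xm.
have nE (z : C) r : ((z *+ r) J : S)@_m = (z J : S)@_m *+ r.
  by elim: r => [|r IH]; rewrite ?mulr0n ?ffunE ?mcoeff0 // !mulrS ffunE mcoeffD IH.
rewrite ffunE mcoeffD [(- _ : C) J]ffunE mcoeffN [(_ + _ : C) J]ffunE mcoeffD cl_eulerE !nE -mulrnDr in xm.
have mx : m \in msupp (x J : S).
  by rewrite mcoeff_msupp; apply: contraNN xm => /eqP ->; rewrite !mul0rn subrr.
have := xw _ _ mx; rewrite ltnS leq_eqVlt => /orP[/eqP wE|//].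
by rewrite wE subrr eqxx in xm.
Qed.

End CliffordElements.

(** * The Chevalley-Eilenberg complex *)

Section KoszulComplex.
Variables (F : fieldType) (A : gradedAlgebra F) (n k : nat).
Variables (e : 'I_n -> A) (y : 'I_k -> A) (G : 'I_k -> 'I_n -> 'I_n -> F).
Hypothesis e_gr : forall i, ga_gr 1 (e i).
Hypothesis y_gr : forall a, ga_gr 2 (y a).
Hypothesis ee : forall i j, e i * e j + e j * e i = (\sum_a G a i j *: y a) *+ 2.
Hypothesis y_central : forall a x, x * y a = y a * x.
Variables (M : gradedModule A) (B : homogeneous_basis M).
Local Notation T := (tens B).
Local Notation E z := (tens_left B z).
Local Notation R z := (tens_right B z).
Local Notation sgn := (tens_sign B).

Fact ad_e_linear i : linear (fun t => E (e i) (sgn t) - R (e i) (sgn t)).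
Proof.
move=> c s t; rewrite (linearP sgn) (linearP (E (e i))) (linearP (R (e i))).
by rewrite scalerBr opprD addrACA.
Qed.
(* The super-commutator of M (x) A with e_i, up to the sign of the M-component. *)
Definition ad_e i : {linear T -> T} := linear_of (ad_e_linear i).
Lemma ad_eE i t : ad_e i t = E (e i) (sgn t) - R (e i) (sgn t). Proof. by []. Qed.

Fact ad_y_linear a : linear (fun t => E (y a) t - R (y a) t).
Proof.
by move=> c s t; rewrite (linearP (E (y a))) (linearP (R (y a))) scalerBr opprD addrACA.
Qed.
Definition ad_y a : {linear T -> T} := linear_of (ad_y_linear a).
Lemma ad_yE a t : ad_y a t = E (y a) t - R (y a) t. Proof. by []. Qed.

Lemma lin_family_sum (W : lmodType A^c) (f : A -> W) (c : 'I_k -> F) (z : 'I_k -> A) :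
  (forall d u v, f (d *: u + v) = alg_scalar A d *: f u + f v) ->
  f ((\sum_a c a *: z a) *+ 2) = (\sum_a alg_scalar A (c a) *: f (z a)) *+ 2.
Proof.
move=> fl; have f0 : f 0 = 0.
  have := fl 1 0 0; rewrite alg_scalar1 !scale1r addr0 => /esym/eqP.
  by rewrite -subr_eq0 addrK => /eqP.
have fD u v : f (u + v) = f u + f v by have := fl 1 u v; rewrite alg_scalar1 !scale1r.
have fS : f (\sum_a c a *: z a) = \sum_a alg_scalar A (c a) *: f (z a).
  elim/big_rec2: _ => // a w x _ <-; exact: fl.
by rewrite !mulr2n fD fS.
Qed.

Lemma sgnR i t : sgn (R (e i) t) = - R (e i) (sgn t).
Proof. by rewrite (tens_sign_right t (e_gr i)) scaler_sign. Qed.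
Lemma sgnRy a t : sgn (R (y a) t) = R (y a) (sgn t).
Proof. by rewrite (tens_sign_right t (y_gr a)) scale1r. Qed.

(** The sign operator anticommutes with the right action of the e_i, so the mixed left-right terms
    cancel in the anticommutator. What remains is the Clifford relation for the left multiplications
    minus that for the right actions. *)
Lemma ad_ee i j t :
  ad_e i (ad_e j t) + ad_e j (ad_e i t) = (\sum_a alg_scalar A (G a i j) *: ad_y a t) *+ 2.
Proof.
have ZE l m : ad_e l (ad_e m t) = E (e l * e m) t - R (e m * e l) t
    + (R (e m) (E (e l) t) - R (e l) (E (e m) t)).
  rewrite !ad_eE (linearB sgn) tens_sign_left sgnR tens_signK opprK.
  rewrite (linearD (E (e l))) (linearD (R (e l))) tens_left_left tens_left_right tens_right_right.
  by rewrite opprD (AC (2*2) ((1*4)*(2*3))).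
rewrite !ZE [LHS](AC ((2*2)*(2*2)) ((1*5)*(2*6)*((3*8)*(7*4)))) /= !subrr !addr0 -opprD.
have lD z z' : E (z + z') t = E z t + E z' t.
  by have := tens_left_lin (B := B) z z' 1 t; rewrite alg_scalar1 !scale1r.
have rD z z' : R (z + z') t = R z t + R z' t.
  by have := tens_right_lin (B := B) z z' 1 t; rewrite alg_scalar1 !scale1r.
rewrite -lD -rD [X in R X t]addrC ee.
rewrite (lin_family_sum (f := fun z => E z t)) => [|d u v]; last exact: tens_left_lin.
rewrite (lin_family_sum (f := fun z => R z t)) => [|d u v]; last exact: tens_right_lin.
rewrite -mulrnBl -sumrB; congr (_ *+ 2); apply: eq_bigr => a _.
by rewrite -[RHS]/(alg_scalar A (G a i j) *: (E (y a) t - R (y a) t)) scalerBr.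
Qed.

Lemma ad_ey i a t : ad_e i (ad_y a t) = ad_y a (ad_e i t).
Proof.
rewrite !ad_eE !ad_yE (linearB sgn) tens_sign_left sgnRy.
rewrite (linearB (E (e i))) (linearB (R (e i))) (linearB (E (y a))) (linearB (R (y a))).
rewrite !tens_left_left !tens_right_right !tens_left_right (y_central a).
by rewrite !opprB [RHS](AC (2*2) ((1*4)*(3*2))).
Qed.

Lemma ad_yy a b t : ad_y a (ad_y b t) = ad_y b (ad_y a t).
Proof.
rewrite !ad_yE (linearB (E (y a))) (linearB (R (y a))) (linearB (E (y b))) (linearB (R (y b))).
rewrite !tens_left_left !tens_right_right !tens_left_right (y_central a (y b)).
by rewrite !opprB [RHS](AC (2*2) ((1*4)*(3*2))).
Qed.

Lemma ad_e_gr i j t : gm_gr j t -> gm_gr (j + 1) (ad_e i t).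
Proof.
move=> tj; rewrite ad_eE; apply: (gradingB (gm_grading T)).
  by apply: (tens_left_gr (e_gr i)); apply: tens_sign_gr.
by apply: (tens_right_gr (e_gr i)); apply: tens_sign_gr.
Qed.

Lemma ad_y_gr a j t : gm_gr j t -> gm_gr (j + 2) (ad_y a t).
Proof.
move=> tj; rewrite ad_yE; apply: (gradingB (gm_grading T)).
  exact: (tens_left_gr (y_gr a)).
exact: (tens_right_gr (y_gr a)).
Qed.

Definition koszul_ops : clifford_operators (chain T n k) G := chain_operators ad_ee ad_ey ad_yy.

End KoszulComplex.

(** * The Euler homotopy for the leading part of the differential *)

Section Homotopy.
Variables (R : nzRingType) (T : lmodType R) (n k : nat).
Variables (w c : 'I_n -> {additive T -> T}) (y p : 'I_k -> {additive T -> T}).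
Hypothesis wc : forall i j t, w i (c j t) + c j (w i t) = if i == j then t else 0.
Hypothesis wp : forall i a t, w i (p a t) = p a (w i t).
Hypothesis cy : forall i a t, c i (y a t) = y a (c i t).
Hypothesis py : forall a b t, p a (y b t) = y b (p a t) + (if a == b then t else 0).
Local Notation V := (chain T n k).
Implicit Types (f g : V).

(** The leading part of the differential for the weight filtration: Koszul differentials that trade
    x_i for e_i and xi_a for y_a. The maps [homo1] and [homo2] trade them back. *)
Definition lead1 f : V := tau (\sum_i dx i (coef (w i) f)).
Definition lead2 f : V := \sum_a iota a (coef (y a) f).
Definition homo1 f : V := tau (\sum_i mx i (coef (c i) f)).
Definition homo2 f : V := \sum_a xi a (coef (p a) f).

Fact lead1_additive : zmod_morphism lead1.
Proof.
move=> f g; rewrite /lead1 -linearB -sumrB; congr (tau _); apply: eq_bigr => i _.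
by rewrite coef_sub linearB.
Qed.
Fact lead2_additive : zmod_morphism lead2.
Proof.
move=> f g; rewrite /lead2 -sumrB; apply: eq_bigr => i _.
by rewrite coef_sub linearB.
Qed.
Fact homo1_additive : zmod_morphism homo1.
Proof.
move=> f g; rewrite /homo1 -linearB -sumrB; congr (tau _); apply: eq_bigr => i _.
by rewrite coef_sub linearB.
Qed.
Fact homo2_additive : zmod_morphism homo2.
Proof.
move=> f g; rewrite /homo2 -sumrB; apply: eq_bigr => i _.
by rewrite coef_sub linearB.
Qed.
HB.instance Definition _ := GRing.isZmodMorphism.Build V V lead1 lead1_additive.
HB.instance Definition _ := GRing.isZmodMorphism.Build V V lead2 lead2_additive.
HB.instance Definition _ := GRing.isZmodMorphism.Build V V homo1 homo1_additive.
HB.instance Definition _ := GRing.isZmodMorphism.Build V V homo2 homo2_additive.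

Lemma coefC (u v : T -> T) : (forall t, u (v t) = v (u t)) ->
  forall f, coef u (coef v f) = coef v (coef u f).
Proof. by move=> uv f; apply/chainP => al be; apply: uv. Qed.

Lemma lead1_xi a f : lead1 (xi a f) = - xi a (lead1 f).
Proof.
rewrite /lead1 -tau_xi; congr (tau _); rewrite linear_sum; apply: eq_bigr => i _.
by rewrite coef_xi.
Qed.
Lemma homo1_iota a f : homo1 (iota a f) = - iota a (homo1 f).
Proof.
rewrite /homo1 -tau_iota; congr (tau _); rewrite linear_sum; apply: eq_bigr => i _.
by rewrite coef_iota mx_iota.
Qed.
Lemma lead1_coef (u : {additive T -> T}) f : (forall i t, w i (u t) = u (w i t)) ->
  lead1 (coef u f) = coef u (lead1 f).
Proof.
move=> wu; rewrite /lead1 coef_tau coef_sum; congr (tau _); apply: eq_bigr => i _.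
by rewrite (coefC (wu i)).
Qed.
Lemma homo1_coef (u : {additive T -> T}) f : (forall i t, c i (u t) = u (c i t)) ->
  homo1 (coef u f) = coef u (homo1 f).
Proof.
move=> cu; rewrite /homo1 coef_tau coef_sum; congr (tau _); apply: eq_bigr => i _.
by rewrite (coefC (cu i)) coef_mx.
Qed.

Lemma lead1_homo2 f : lead1 (homo2 f) + homo2 (lead1 f) = 0.
Proof.
rewrite {1}/homo2 [lead1 _]raddf_sum /homo2 -big_split big1 // => a _ /=.
by rewrite lead1_xi lead1_coef ?addNr // => i t; rewrite wp.
Qed.

Lemma lead2_homo1 f : lead2 (homo1 f) + homo1 (lead2 f) = 0.
Proof.
rewrite [in X in _ + X]/lead2 [homo1 (\sum_(_ <- _) _)]raddf_sum /lead2 -big_split big1 // => a _ /=.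
by rewrite homo1_iota homo1_coef ?subrr // => i t; rewrite cy.
Qed.

(** x_i and d/dx_i satisfy the Weyl relation, w_i and c_i the Clifford relation. Hence the terms
    with distinct indices cancel, and each diagonal term is al_i + w_i c_i. In [lead2_homo2] the two
    kinds of relation exchange roles. *)
Lemma lead1_homo1 f al be : (lead1 (homo1 f) + homo1 (lead1 f)) al be =
  f al be *+ mdeg al + \sum_i w i (c i (f al be)).
Proof.
have -> : lead1 (homo1 f) = \sum_i \sum_j dx i (mx j (coef (w i) (coef (c j) f))).
  rewrite /lead1 [tau _]linear_sum; apply: eq_bigr => i _.
  rewrite /homo1 coef_tau /= dx_tau tauK coef_sum linear_sum.
  by apply: eq_bigr => j _; rewrite coef_mx.
have -> : homo1 (lead1 f) = \sum_i \sum_j mx j (dx i (coef (c j) (coef (w i) f))).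
  rewrite /homo1 [tau _]linear_sum exchange_big; apply: eq_bigr => j _.
  rewrite /lead1 coef_tau /= mx_tau tauK coef_sum linear_sum.
  by apply: eq_bigr => i _.
rewrite -big_split chain_sumE mdegE -sumrMnr -big_split; apply: eq_bigr => i _ /=.
rewrite -big_split chain_sumE (bigD1 i) //= big1 ?addr0 => [|j ji].
  by rewrite dx_mx eqxx addrAC !chainDE !mxdx -mulrnDl /coef wc eqxx.
rewrite dx_mx eq_sym (negPf ji) addr0; apply: etrans (erefl _).
rewrite -[mx j _ + mx j _](linearD (mx j)) -[dx i _ + dx i _](linearD (dx i)).
rewrite (_ : coef (w i) _ + _ = 0) ?linear0 //; apply/chainP => al' be'.
by rewrite chainDE /coef wc eq_sym (negPf ji).
Qed.

Lemma lead2_homo2 f al be : (lead2 (homo2 f) + homo2 (lead2 f)) al be =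
  f al be *+ #|be| + \sum_a y a (p a (f al be)).
Proof.
have -> : lead2 (homo2 f) = \sum_a \sum_b iota a (xi b (coef (y a) (coef (p b) f))).
  rewrite /lead2; apply: eq_bigr => a _.
  rewrite /homo2 coef_sum linear_sum; apply: eq_bigr => b _.
  by rewrite coef_xi.
have -> : homo2 (lead2 f) = \sum_a \sum_b xi b (iota a (coef (p b) (coef (y a) f))).
  rewrite /homo2 exchange_big; apply: eq_bigr => b _.
  rewrite /lead2 coef_sum linear_sum; apply: eq_bigr => a _.
  by rewrite coef_iota.
rewrite -big_split chain_sumE -sum1_card -sumrMnr [X in X + _]big_mkcond -big_split.
apply: eq_bigr => a _ /=.
have E b : coef (p b) (coef (y a) f) = coef (y a) (coef (p b) f) + (if b == a then f else 0).
  by apply/chainP => al' be'; rewrite chainDE /coef py; case: eqP.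
have E2 : \sum_b iota a (xi b (coef (y a) (coef (p b) f))) +
    \sum_b xi b (iota a (coef (p b) (coef (y a) f))) =
    xi a (iota a f) + coef (y a) (coef (p a) f).
  rewrite -big_split (bigD1 a) //= big1 ?addr0 => [|b ba].
    rewrite E eqxx linearD linearD /= addrA -[in RHS](addrC (coef _ _)); congr (_ + _).
    by have := iota_xi a a (coef (y a) (coef (p a) f)); rewrite eqxx.
  rewrite E (negPf ba) addr0; have := iota_xi a b (coef (y a) (coef (p b) f)).
  by rewrite eq_sym (negPf ba).
rewrite E2 chainDE; congr (_ + _); rewrite /xi /iota; case: ifP => abe //.
by rewrite !inE eqxx /= setD1K // signZ sgbD // ltnn addFb addbb scale1r mulr1n.
Qed.
End Homotopy.

(* Operators on A satisfying the formal properties of the exterior and polynomial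
   parts of the Clifford algebra, with a filtration by the number of generators. *)
Record pbw_structure (F : fieldType) (A : gradedAlgebra F) (n k : nat)
    (e : 'I_n -> A) (y : 'I_k -> A) := PbwStructure {
  pw_w : 'I_n -> {additive A^c -> A^c};
  pw_v : 'I_n -> {additive A^c -> A^c};
  pw_c : 'I_n -> {additive A^c -> A^c};
  pw_p : 'I_k -> {additive A^c -> A^c};
  pw_y : 'I_k -> {additive A^c -> A^c};
  pw_P : nat -> nat -> A -> Prop;
  pw_e : forall i (x : A), e i * x = pw_w i x + pw_v i x;
  pw_yE : forall a (x : A), pw_y a x = y a * x;
  pw_wF : forall i, F_homogeneous (A := A) (pw_w i);
  pw_vF : forall i, F_homogeneous (A := A) (pw_v i);
  pw_cF : forall i, F_homogeneous (A := A) (pw_c i);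
  pw_pF : forall a, F_homogeneous (A := A) (pw_p a);
  pw_wc : forall i j x, pw_w i (pw_c j x) + pw_c j (pw_w i x) = if i == j then x else 0;
  pw_wp : forall i a x, pw_w i (pw_p a x) = pw_p a (pw_w i x);
  pw_cy : forall i a x, pw_c i (pw_y a x) = pw_y a (pw_c i x);
  pw_py : forall a b x, pw_p a (pw_y b x) = pw_y b (pw_p a x) + if a == b then x else 0;
  pw_0 : forall w s, pw_P w s 0;
  pw_D : forall w s x z, pw_P w s x -> pw_P w s z -> pw_P w s (x + z);
  pw_Z : forall w s (c : F) x, pw_P w s x -> pw_P w s (c *: x);
  pw_le : forall w w' s s' x, pw_P w s x -> (w + s' <= w' + s)%N -> pw_P w' s' x;
  pw_Pw : forall w s i x, pw_P w s.+1 x -> pw_P w s (pw_w i x);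
  pw_Pv : forall w s i x, pw_P w s x -> pw_P w s (pw_v i x);
  pw_Pc : forall w s i x, pw_P w s x -> pw_P w s.+1 (pw_c i x);
  pw_Pp : forall w s a x, pw_P w s x -> pw_P w s.+1 (pw_p a x);
  pw_bounded : forall x, exists w, pw_P w 0 x;
  pw_scalar : forall x, pw_P 1 0 x -> exists c : F, x = c%:A;
  pw_P0 : forall s x, pw_P 0 s x -> x = 0;
  pw_euler : forall w s x, pw_P w.+1 s x ->
    pw_P w s (\sum_i pw_w i (pw_c i x) + \sum_a pw_y a (pw_p a x) + x *+ s - x *+ w) }.

Lemma homotopy_combine (U : zmodType) (d l1 l2 h1 h2 lo : U -> U) :
  (forall x z, l1 (x + z) = l1 x + l1 z) -> (forall x z, l2 (x + z) = l2 x + l2 z) ->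
  (forall x z, h1 (x + z) = h1 x + h1 z) -> (forall x z, h2 (x + z) = h2 x + h2 z) ->
  (forall x, d x = l1 x + l2 x + lo x) ->
  (forall x, l1 (h2 x) + h2 (l1 x) = 0) -> (forall x, l2 (h1 x) + h1 (l2 x) = 0) ->
  forall x, d (h1 x + h2 x) + (h1 (d x) + h2 (d x)) =
    (l1 (h1 x) + h1 (l1 x)) + (l2 (h2 x) + h2 (l2 x))
    + (lo (h1 x + h2 x) + (h1 (lo x) + h2 (lo x))).
Proof.
move=> l1D l2D h1D h2D dE Z1 Z2 x; rewrite !dE l1D l2D !h1D !h2D.
rewrite [LHS](AC (((2*2)*1)*(3*3))
  (((1*6)*(4*10))*((2*9)*(3*7))*(5*(8*11)))) /=.
by rewrite Z1 Z2 !addr0.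
Qed.

(** * Exactness of the complex by descent on weight *)

Section Exactness.
Variables (F : fieldType) (A : gradedAlgebra F) (n k : nat).
Variables (e : 'I_n -> A) (y : 'I_k -> A) (G : 'I_k -> 'I_n -> 'I_n -> F).
Hypothesis e_gr : forall i, ga_gr 1 (e i).
Hypothesis y_gr : forall a, ga_gr 2 (y a).
Hypothesis ee : forall i j, e i * e j + e j * e i = (\sum_a G a i j *: y a) *+ 2.
Hypothesis y_central : forall a x, x * y a = y a * x.
Hypothesis charF : forall m, (m.+1%:R : F) != 0.
Variable W : pbw_structure e y.
Variables (M : gradedModule A) (B : homogeneous_basis M).
Local Notation T := (tens B).
Local Notation R z := (tens_right B z).
Local Notation sgn := (tens_sign B).
Local Notation V := (chain T n k).
Local Notation co x t := (monalg.mcoeff x (t : {malg A^c[hb_index B]})).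
Local Notation ops := (koszul_ops e_gr y_gr ee y_central B).
Local Notation d := (diff ops).

Fact tsgn_additive (g : {additive A^c -> A^c}) : zmod_morphism (fun t : T => tmap B g (sgn t)).
Proof. by move=> s t; rewrite (linearB sgn) (raddfB (tmap B g)). Qed.
Definition tsgn g : {additive T -> T} := additive_of (tsgn_additive g).
Lemma tsgnE g t : tsgn g t = tmap B g (sgn t). Proof. by []. Qed.

Local Notation w i := (tsgn (pw_w W i)).
Local Notation c i := (tsgn (pw_c W i)).
Local Notation p a := (tmap B (pw_p W a)).
Local Notation yy a := (tmap B (pw_y W a)).

Fact rest_additive i : zmod_morphism (fun t : T => tsgn (pw_v W i) t - R (e i) (sgn t)).
Proof.
move=> s t; rewrite (raddfB (tsgn _)) (linearB sgn) (linearB (R (e i))).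
by rewrite opprB (AC (2*2) ((1*4)*(2*3))) /= opprD opprK.
Qed.
Definition rest i : {additive T -> T} := additive_of (rest_additive i).
Lemma restE i t : rest i t = tsgn (pw_v W i) t - R (e i) (sgn t). Proof. by []. Qed.

Lemma ad_e_split i t : ad_e e B i t = w i t + rest i t.
Proof.
rewrite ad_eE restE !tsgnE addrA; congr (_ - _); apply/malgP => x.
by rewrite mcoeff_left monalg.mcoeffD !tmapE (pw_e W).
Qed.

Lemma ad_y_split a t : ad_y y B a t = yy a t - R (y a) t.
Proof.
rewrite ad_yE; congr (_ - _); apply/malgP => x.
by rewrite mcoeff_left !tmapE (pw_yE W).
Qed.

Lemma tsgn_tsgn (g g' : {additive A^c -> A^c}) (t : T) : tsgn g (tsgn g' t) = tmap B g (tmap B g' t).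
Proof. by rewrite !tsgnE -tmap_sign tens_signK. Qed.

Lemma tsgn_tmap (g g' : {additive A^c -> A^c}) (t : T) : (forall x, g (g' x) = g' (g x)) ->
  tsgn g (tmap B g' t) = tmap B g' (tsgn g t).
Proof. move=> gg; rewrite !tsgnE -tmap_sign; apply/malgP => x.
by rewrite (tmapE g) (tmapE g') (tmapE g') (tmapE g) gg. Qed.

Fact t_wc i j t : w i (c j t) + c j (w i t) = if i == j then t else 0.
Proof.
rewrite !tsgn_tsgn; apply/malgP => x; rewrite monalg.mcoeffD !tmapE (pw_wc W).
by case: eqP => // _; rewrite monalg.mcoeff0.
Qed.
Fact t_py a b t : p a (yy b t) = yy b (p a t) + (if a == b then t else 0).
Proof.
apply/malgP => x; rewrite monalg.mcoeffD !tmapE (pw_py W).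
by case: eqP => // _; rewrite monalg.mcoeff0.
Qed.
Fact t_wp i a t : w i (p a t) = p a (w i t). Proof. exact: tsgn_tmap (pw_wp W i a). Qed.
Fact t_cy i a t : c i (yy a t) = yy a (c i t). Proof. exact: tsgn_tmap (pw_cy W i a). Qed.

Local Notation l1 := (lead1 (fun i => w i)).
Local Notation l2 := (lead2 (fun a => yy a)).
Local Notation h1 := (homo1 (fun i => c i)).
Local Notation h2 := (homo2 (fun a => p a)).
Definition homotopy (f : V) : V := h1 f + h2 f.
(** Each of the three terms lowers the total weight: the contraction part of e_i and the actions on
    M lose an x_i or a xi_a without raising the weight in A, and the bracket term replaces two x by
    one xi. *)
Definition lower (f : V) : V :=
  tau (\sum_i dx i (coef (rest i) f)) - \sum_a iota a (coef (R (y a)) f) - diff3 ops f.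

Lemma diff_split f : d f = l1 f + l2 f + lower f.
Proof.
have E1 : diff1 ops f = l1 f + tau (\sum_i dx i (coef (rest i) f)).
  rewrite diff1E /lead1 -[RHS](linearD (@tau _ T n k)); congr (tau _).
  rewrite -big_split; apply: eq_bigr => i _ /=.
  by apply/chainP => al be; rewrite chainDE; exact: ad_e_split.
have E2 : diff2 ops f = l2 f - \sum_a iota a (coef (R (y a)) f).
  rewrite diff2E /lead2 -sumrB; apply: eq_bigr => a _ /=.
  rewrite -[RHS](linearB (@iota _ T n k a)); congr (iota _ _).
  by apply/chainP => al be; rewrite chainDE chainNE; exact: ad_y_split.
rewrite diffE E1 E2 /lower.
move: (l1 f) (l2 f) (tau (\sum_i _)) (\sum_a iota a _) (diff3 ops f) => u1 u2 u3 u4 u5.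
by rewrite [LHS](AC ((2*2)*1) ((1*3)*(2*4*5))).
Qed.

(** The monomial x^(al) xi_be counts with weight |al| + |be|, so exchanging e_i with x_i or y_a with
    xi_a preserves the total weight. *)
Definition fil (m : nat) (f : V) : Prop :=
  forall (al : 'X_{1..n}) (be : {set 'I_k}), tsub (pw_P W m (mdeg al + #|be|)%N) (f al be).

Lemma tsubW0 m s : tsub (pw_P W m s) (0 : T).
Proof. by move=> x; rewrite monalg.mcoeff0; apply: pw_0. Qed.
Lemma tsubWD m s (t t' : T) : tsub (pw_P W m s) t -> tsub (pw_P W m s) t' ->
  tsub (pw_P W m s) (t + t').
Proof. by move=> tm tm' x; rewrite monalg.mcoeffD; apply: pw_D; [apply: tm|apply: tm']. Qed.
Lemma filD m f g : fil m f -> fil m g -> fil m (f + g).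
Proof. by move=> fm gm al be; rewrite chainDE; apply: tsubWD; [apply: fm|apply: gm]. Qed.
Lemma pw_N m s x : pw_P W m s x -> pw_P W m s (- x).
Proof. by move=> xm; rewrite -scaleN1r; apply: pw_Z. Qed.
Lemma filN m f : fil m f -> fil m (- f).
Proof.
by move=> fm al be x; rewrite chainNE monalg.mcoeffN; apply: pw_N; apply: fm.
Qed.
Lemma fil0 m : fil m 0. Proof. by move=> al be x; rewrite monalg.mcoeff0; apply: pw_0. Qed.
Lemma fil_sum m (I : Type) (r : seq I) (Q : pred I) (f : I -> V) :
  (forall t, Q t -> fil m (f t)) -> fil m (\sum_(t <- r | Q t) f t).
Proof. by move=> H; elim/big_ind: _ => //; [apply: fil0|apply: filD]. Qed.

Lemma tsub_sgn b m s (t : T) : tsub (pw_P W m s) t -> tsub (pw_P W m s) ((-1) ^+ b *: t).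
Proof.
rewrite -signr_odd scaler_sign; case: ifP => // _ tm x.
by rewrite monalg.mcoeffN; apply/pw_N/tm.
Qed.
Lemma tsub_le m m' s s' (t : T) : tsub (pw_P W m s) t -> (m + s' <= m' + s)%N -> tsub (pw_P W m' s') t.
Proof. by move=> tm le x; apply: pw_le (tm x) le. Qed.
Lemma tsub_tmap m m' s s' (g : {additive A^c -> A^c}) (t : T) : (forall x, pw_P W m s x -> pw_P W m' s' (g x)) ->
  tsub (pw_P W m s) t -> tsub (pw_P W m' s') (tmap B g t).
Proof. by move=> H tm x; rewrite tmapE; apply: H. Qed.
Lemma tsub_tsgn m m' s s' (g : {additive A^c -> A^c}) (t : T) : (forall x, pw_P W m s x -> pw_P W m' s' (g x)) ->
  tsub (pw_P W m s) t -> tsub (pw_P W m' s') (tsgn g t).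
Proof. by move=> H tm; apply: (tsub_tmap H); apply: tsub_sign tm; apply: pw_Z. Qed.
Lemma tsubWR m s z (t : T) : tsub (pw_P W m s) t -> tsub (pw_P W m s) (R z t).
Proof. by apply: tsub_right; [apply: pw_0|apply: pw_D|apply: pw_Z]. Qed.
Lemma tsubWsgn m s (t : T) : tsub (pw_P W m s) t -> tsub (pw_P W m s) (sgn t).
Proof. by apply: tsub_sign; apply: pw_Z. Qed.

Lemma fil_homotopy m f : fil m f -> fil m (homotopy f).
Proof.
move=> fm; apply: filD.
  move=> al be; apply: tsub_sgn; rewrite chain_sumE.
  elim/big_ind: _ => [||i _]; [exact: tsubW0|exact: tsubWD|].
  rewrite /mx; have [->|ali] := eqVneq (al i) 0%N; first by rewrite mulr0n; apply: tsubW0.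
  have H := fm (al - U_(i))%MM be.
  have {}H : tsub (pw_P W m (mdeg al + #|be|)%N) (coef (c i) f (al - U_(i))%MM be).
    by rewrite (mdeg_subU ali) addSn; apply: tsub_tsgn H => x; apply: pw_Pc.
  by elim: (al i) => [|r IH]; rewrite ?mulr0n ?mulrS; [exact: tsubW0|exact: tsubWD].
apply: fil_sum => a _ al be; rewrite /xi; case: ifP => abe; last exact: tsubW0.
apply: tsub_sgn; rewrite (cardsD1 a be) abe addnCA; apply: tsub_tmap (fm al (be :\ a)) => x.
exact: pw_Pp.
Qed.

Lemma fil_lower m f : fil m.+1 f -> fil m (lower f).
Proof.
move=> fm; apply: filD; first apply: filD.
- move=> al be; apply: tsub_sgn; rewrite chain_sumE.
  elim/big_ind: _ => [||i _]; [exact: tsubW0|exact: tsubWD|].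
  have {}H : tsub (pw_P W m (mdeg al + #|be|)%N) (f (al + U_(i))%MM be).
    by apply: tsub_le (fm _ _) _; rewrite mdegD mdeg1; move: #|be| => b; lia.
  rewrite /dx /coef restE; apply: tsubWD.
    by apply: tsub_tsgn H => x; apply: pw_Pv.
  move=> x; rewrite monalg.mcoeffN; apply: pw_N; move: x; apply: tsubWR.
  exact: tsubWsgn.
- apply: filN; apply: fil_sum => a _ al be; rewrite /iota; case: ifP => abe; first exact: tsubW0.
  apply: tsub_sgn; apply: tsubWR; apply: tsub_le (fm _ _) _.
  by rewrite cardsU1 abe; move: #|be| => b; lia.
- apply: filN; rewrite diff3E; apply: fil_sum => a _; rewrite qxE.
  do 2 apply: fil_sum => ? _; move=> al be x.
  rewrite chainZE monalg.mcoeffZ -[_ * _]/((_ : A) * (_%:A : A)) mulr_algr; apply: pw_Z; move: x.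
  rewrite /= /dx /xi; case: ifP => abe; last exact: tsubW0.
  apply: tsub_sgn; apply: tsub_le (fm _ _) _.
  by rewrite (cardsD1 a be) abe !mdegD !mdeg1; move: #|be :\ a| => b; lia.
Qed.

(** Modulo lower filtration d is l1 + l2. Its anticommutator with the homotopy is |al| + |be| plus
    the Euler operator of the coefficient, which is m on the monomials of total weight m. *)
Lemma fil_step m f : fil m.+1 f -> fil m (d (homotopy f) + homotopy (d f) - f *+ m).
Proof.
move=> fm.
have E := @homotopy_combine V d l1 l2 h1 h2 lower
  (raddfD l1) (raddfD l2) (raddfD h1) (raddfD h2) diff_split
  (lead1_homo2 t_wp) (lead2_homo1 t_cy) f.
rewrite {1 2}/homotopy E addrAC; apply: filD; last first.
  exact: filD (fil_lower (fil_homotopy fm)) (fil_homotopy (fil_lower fm)).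
move=> al be x; rewrite chainDE chainNE (chainDE (l1 _ + _)).
rewrite (lead1_homo1 t_wc) (lead2_homo2 t_py).
have := pw_euler (fm al be x).
congr (pw_P _ _ _ _).
have mE (t : T) r : co x (t *+ r) = co x t *+ r by exact: raddfMn.
have -> : (f *+ m) al be = f al be *+ m by elim: (m) => [|r IH]; rewrite ?mulr0n // !mulrS chainDE IH.
rewrite !monalg.mcoeffD monalg.mcoeffN !mE !(raddf_sum (monalg.mcoeff x)) /=.
have -> : \sum_i co x (w i (c i (f al be))) = \sum_i pw_w W i (pw_c W i (co x (f al be))).
  by apply: eq_bigr => i _; rewrite tsgn_tsgn !tmapE.
have -> : \sum_a co x (yy a (p a (f al be))) = \sum_a pw_y W a (pw_p W a (co x (f al be))).
  by apply: eq_bigr => a _; rewrite !tmapE.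
by rewrite mulrnDr; congr (_ - _); rewrite [RHS](AC (2*2) ((2*4)*(1*3))) /= addrA.
Qed.

Lemma hom_degree_homotopy m f : hom_degree m f -> hom_degree m.+1 (homotopy f).
Proof.
move=> fm; apply: hom_degreeD.
  apply: hom_degree_tau; apply: hom_degree_sum => i _ al be E; rewrite /mx.
  have [->|ali] := eqVneq (al i) 0%N; first by rewrite mulr0n.
  rewrite /coef fm ?raddf0 ?mul0rn //; apply: contraNN E => /eqP <-.
  by rewrite (mdeg_subU ali) addSn.
apply: hom_degree_sum => a _; apply: hom_degree_xi.
by move=> al be E; rewrite /coef fm // raddf0.
Qed.

Lemma tens_bounded (t : T) : exists m, tsub (pw_P W m 0) t.
Proof.
move: t; apply: free_ind => [s t [m sm] [m' tm']||a x].
- exists (m + m')%N; apply: tsubWD.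
    by apply: tsub_le sm _; rewrite !addn0 leq_addr.
  by apply: tsub_le tm' _; rewrite !addn0 leq_addl.
- by exists 0%N; apply: tsubW0.
- have [m am] := pw_bounded W (a : A); exists m => z; rewrite mcoeff_free_gen.
  by case: eqP => _ //; apply: pw_0.
Qed.

(** Only finitely many monomials have homological degree m, and each coefficient has finite
    weight. *)
Lemma fil_bounded m f : hom_degree m f -> exists r, fil r f.
Proof.
move=> fm.
have /choice [b bP] (z : 'X_{1..n < m.+1} * {set 'I_k}) : exists r, tsub (pw_P W r 0) (f z.1 z.2).
  exact: tens_bounded.
exists ((\max_z b z) + m)%N => al be.
have [E|E] := eqVneq (mdeg al + #|be|)%N m; last by rewrite fm //; apply: tsubW0.
have alm : (mdeg al < m.+1)%N by rewrite ltnS -E leq_addr.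
apply: tsub_le (bP (BMultinom alm, be)) _.
rewrite E addn0; move: (@leq_bigmax _ b (BMultinom alm, be)); move: (\max_z b z) (b _) => u v.
lia.
Qed.

Lemma fil_le m m' f : (m <= m')%N -> fil m f -> fil m' f.
Proof. by move=> mm fm al be; apply: tsub_le (fm al be) _; rewrite leq_add2r. Qed.

Lemma fil_0 f : fil 0 f -> f = 0.
Proof.
move=> f0; apply/chainP => al be; apply/malgP => x.
by rewrite monalg.mcoeff0; apply: pw_P0 (f0 al be x).
Qed.

Lemma chain_natP m (f : V) : m.+1%:R != 0 :> F ->
  f = alg_scalar A (m.+1%:R^-1) *: (f *+ m.+1).
Proof.
move=> m0; have E1 : (m.+1%:R^-1 : F) *+ m.+1 = 1 by rewrite -[LHS]mulr_natl divff.
by rewrite -scalerMnr scalerMnl -(raddfMn (alg_scalar A)) E1 /= alg_scalar1 scale1r.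
Qed.

(* If f is a cycle of filtration m + 1 > 1, then m f - d h f is a cycle of filtration m. *)
Lemma exact_descent m0 (Q : V -> Prop) :
  (forall f, hom_degree m0 f -> d f = 0 -> Q f -> forall c,
     hom_degree m0 (f *+ c - d (homotopy f)) -> Q (f *+ c - d (homotopy f))) ->
  (forall f, hom_degree m0 f -> fil 1 f -> Q f -> f = 0) ->
  forall f, hom_degree m0 f -> d f = 0 -> Q f -> exists2 g, hom_degree m0.+1 g & f = d g.
Proof.
move=> QS Q1 f f0 df Qf; have [m fm] := fil_bounded f0.
elim: m f f0 df Qf fm => [|m IH] f f0 df Qf fm.
  exists 0; first exact: hom_degree0.
  by rewrite linear0; apply: fil_0.
(* On total weight 0 the Euler operator is zero and cannot be inverted; that case is left to the
   hypothesis on [fil 1]. *)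
case: m IH fm => [_ fm|m IH fm].
  by exists 0; [apply: hom_degree0|rewrite linear0; apply: Q1].
pose z := f *+ m.+1 - d (homotopy f).
have hf := hom_degree_homotopy f0.
have z0 : hom_degree m0 z.
  apply: hom_degreeB; last exact: hom_degree_diff.
  by elim: (m.+1) => [|r IHr]; rewrite ?mulr0n ?mulrS; [apply: hom_degree0|apply: hom_degreeD].
have F2 : (2 : F) != 0 by apply: charF 1%N.
have h0 : homotopy 0 = 0.
  by rewrite /homotopy; apply: etrans (congr2 +%R (raddf0 h1) (raddf0 h2)) (addr0 _).
have dz : d z = 0.
  have -> : d z = d (f *+ m.+1) - d (d (homotopy f)) by exact: (linearB d).
  have -> : d (d (homotopy f)) = 0 by exact: (diff_diff ops F2).
  by rewrite subr0 (linearMn d) df mul0rn.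
have fz : fil m.+1 z.
  have := fil_step fm; rewrite df h0 addr0 => /filN; rewrite opprB; exact.
have [g gm zE] := IH z z0 dz (QS f f0 df Qf m.+1 z0) fz.
(* With z = d g, the definition of z reads (m + 1) f = d (g + homotopy f), and characteristic zero
   permits the division. *)
exists (alg_scalar A (m.+1%:R^-1) *: (g + homotopy f)).
  by apply: hom_degreeZ; apply: hom_degreeD.
rewrite linearZ_LR linearD -zE /z subrK; exact: chain_natP.
Qed.

Lemma exact_positive m f : hom_degree m.+1 f -> d f = 0 ->
  exists2 g, hom_degree m.+2 g & f = d g.
Proof.
move=> fm df; apply: (@exact_descent _ (fun=> True)) => // {df} {}f {}fm f1 _.
apply/chainP => al be; apply/malgP => x; rewrite monalg.mcoeff0.
have [E|E] := eqVneq (mdeg al + #|be|)%N m.+1; last by rewrite fm ?monalg.mcoeff0.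
(* In positive homological degree the monomial x^(al) xi_be alone exceeds weight 0, so the
   coefficient must vanish. *)
have := f1 al be x; rewrite E => H; apply: (pw_P0 (s := 0%N)).
by apply: pw_le H _; lia.
Qed.

Lemma tens_eval_ad_e i t : tens_eval B (ad_e e B i t) = 0.
Proof. by rewrite ad_eE (linearB (tens_eval B)) tens_eval_left subrr. Qed.
Lemma tens_eval_ad_y a t : tens_eval B (ad_y y B a t) = 0.
Proof. by rewrite ad_yE (linearB (tens_eval B)) tens_eval_left subrr. Qed.

Lemma tens_eval_diff f : tens_eval B (d f 0%MM set0) = 0.
Proof.
have E3 : diff3 ops f 0%MM set0 = 0.
  rewrite diff3E chain_sumE big1 // => a _; rewrite qxE chain_sumE big1 // => i _.
  by rewrite chain_sumE big1 // => j _; rewrite chainZE /= /dx /xi inE scaler0.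
have E1 : tens_eval B (diff1 ops f 0%MM set0) = 0.
  have -> : diff1 ops f 0%MM set0 = \sum_i ad_e e B i (f (0 + U_(i))%MM set0).
    have H (g : V) : opT ops g 0%MM set0 = g 0%MM set0.
      have -> : opT ops g 0%MM set0 = (-1) ^+ odd #|set0 : {set 'I_k}| *: g 0%MM set0 by [].
      by rewrite cards0 scale1r.
    by rewrite diff1E H chain_sumE.
  by rewrite (linear_sum (tens_eval B)) big1 // => i _; exact: tens_eval_ad_e.
have E2 : tens_eval B (diff2 ops f 0%MM set0) = 0.
  rewrite diff2E chain_sumE linear_sum big1 // => a _; rewrite /= /iota inE linearZ_LR.
  by rewrite [X in _ *: X]tens_eval_ad_y scaler0.
by rewrite diffE chainDE chainNE chainDE E3 subr0 (linearD (tens_eval B)) E1 E2 addr0.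
Qed.

(** The chains of total weight 0 are M (x) 1, on which the augmentation is injective. The descent
    keeps the condition of being killed by the augmentation, since boundaries are killed too. *)
Lemma exact_zero f : hom_degree 0 f -> tens_eval B (f 0%MM set0) = 0 ->
  exists2 g, hom_degree 1 g & f = d g.
Proof.
move=> f0 fe; apply: (@exact_descent _ (fun g => tens_eval B (g 0%MM set0) = 0)) => //.
- move=> g _ _ ge c _; rewrite chainDE chainNE (linearB (tens_eval B)) tens_eval_diff subr0.
  have -> : (g *+ c) 0%MM set0 = g 0%MM set0 *+ c.
    by elim: c => [|c IH]; rewrite ?mulr0n // !mulrS chainDE IH.
  by rewrite (linearMn (tens_eval B)) ge mul0rn.
- move=> g g0 g1 ge; apply/chainP => al be; rewrite chain0E.
  have [E|E] := eqVneq (mdeg al + #|be|)%N 0%N; last by rewrite g0.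
  move/eqP: E; rewrite addn_eq0 mdeg_eq0 cards_eq0 => /andP[/eqP -> /eqP ->].
  have := g1 0%MM set0; rewrite mdeg0 cards0 => g1'.
  have [m mE] := tsub_scalar (pw_scalar (p := W)) g1'.
  move: ge; rewrite mE tens_eval1 => ->.
  exact: F_linear0 (@tens1_linear _ _ _ B).
- exact: hom_degree_diff0.
Qed.
End Exactness.

Section CliffordPbw.
Variables (F : fieldType) (n k : nat) (q : 'I_n -> 'I_n -> {mpoly F[k]}).
Hypothesis q_homog : forall i j, q i j \is 1.-homog.
Local Notation A := (graded_clifford q_homog).

Fact if_contr1_wedge1 i j (x : clifford q) :
  wedge1 i (contr1 j x) + contr1 j (wedge1 i x) = if i == j then x else 0 :> clifford q.
Proof.
rewrite contr1_wedge1 addrC subrK eq_sym; case: eqP => _; [exact: scale1r|exact: scale0r].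
Qed.

Definition clifford_pbw : pbw_structure (A := A) (cl_e q) (cl_y q) :=
  @PbwStructure F A n k (cl_e q) (cl_y q)
    (fun i => additive_of (wedge1_zmod (q := q) i : zmod_morphism (wedge1 i : A^c -> A^c)))
    (fun i => additive_of (contr_zmod (q := q) i : zmod_morphism (contr (q i) : A^c -> A^c)))
    (fun i => additive_of (contr1_zmod (q := q) i : zmod_morphism (contr1 i : A^c -> A^c)))
    (fun a => additive_of (deriv_zmod (q := q) a : zmod_morphism (@cl_deriv F n k q a : A^c -> A^c)))
    (fun a => additive_of (ymul_zmod (q := q) a : zmod_morphism ((fun x => cl_y q a * x) : A^c -> A^c)))
    (@pbw F n k q)
    (fun i x => cl_eM i x) (fun a x => erefl)
    (F_homogeneous_wedge1 (q_homog := q_homog)) (F_homogeneous_contr (q_homog := q_homog))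
    (F_homogeneous_contr1 (q_homog := q_homog)) (F_homogeneous_deriv (q_homog := q_homog))
    if_contr1_wedge1
    (fun i a x => esym (deriv_wedge1 a i x))
    (fun i a x => esym (ymul_contr1 a i x))
    (fun a b x => deriv_ymul a b x) (fun w s => pbw0 w s) (fun w s x z => @pbwD F n k q w s x z) (fun w s c x H => pbwZ H)
    (fun w w' s s' x H => pbw_le H) (fun w s i x H => pbw_wedge1 H) (fun w s i x H => pbw_contr q_homog H)
    (fun w s i x H => pbw_contr1 H) (fun w s i x H => pbw_deriv H)
    (fun x => pbw_bounded x) (fun x H => pbw1_scalar H) (fun s x H => pbw_0 H)
    (fun w s x H => pbw_euler H).
End CliffordPbw.

(** * Resolutions by direct summands of chain modules *)

Section KernelSubmodule.
Variables (F : fieldType) (A : gradedAlgebra F) (V V' : lmodType A^c).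
Variables (gr : int -> V -> Prop) (gr' : int -> V' -> Prop).
Hypotheses (grP : @grading F A V gr) (grP' : @grading F A V' gr').
Variables (P : V -> Prop) (u : {linear V -> V'}).

Lemma graded_submodule_ker : graded_submodule gr P ->
  (forall t x, gr t x -> gr' t (u x)) -> graded_submodule gr (fun x => P x /\ u x = 0).
Proof.
move=> [P0 PD PS] ug; split=> [|a x y [Px ux] [Py uy]|x [Px ux]].
- by rewrite linear0.
- by split; [apply: PD|rewrite linearP ux uy scaler0 addr0].
- have [s [f [us fP xE]]] := PS x Px.
  have u0 := grading_indep grP' us (fun i => ug _ _ (fP i).1).
  rewrite -(linear_sum u) -xE in u0.
  (* Independence gives u (f i) = 0 only for i in s, so the components outside s are replaced by
     zero. *)
  exists s, (fun i => if i \in s then f i else 0); split=> // [i|].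
    case: ifP => si; first by have [] := fP i; split=> //; split=> //; apply: u0.
    by rewrite linear0; split; [apply: (grading0 grP)|].
  by rewrite xE [LHS]big_seq [RHS]big_seq; apply: eq_bigr => i ->.
Qed.
End KernelSubmodule.

Section ChainModules.
Variables (F : fieldType) (A : gradedAlgebra F) (T : gradedModule A) (n k : nat).
Local Notation V := (chain T n k).
Implicit Types (f : V) (al : 'X_{1..n}) (be : {set 'I_k}).

Definition delta al be (t : T) : V := fun al' be' => if (al' == al) && (be' == be) then t else 0.

Fact delta_linear al be : linear (delta al be).
Proof.
move=> c s t; apply/chainP => al' be'; rewrite chainDE chainZE /delta.
by case: ifP => _ //; rewrite scaler0 addr0.
Qed.
Definition deltaL al be : {linear T -> V} := linear_of (delta_linear al be).

Lemma delta_hom_degree p al be t : (mdeg al + #|be|)%N = p -> hom_degree p (delta al be t).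
Proof. by move=> <- al' be'; rewrite /delta; case: andP => [[/eqP -> /eqP ->]|//]; rewrite eqxx. Qed.

Definition delta_deg al be : int := (mdeg al)%:Z + 2 * #|be|%:Z.
Lemma delta_gr al be t j : gm_gr j t -> chain_gr (delta_deg al be + j) (delta al be t).
Proof.
move=> tj al' be'; rewrite /delta; case: andP => [[/eqP -> /eqP ->]|_]; last exact: (grading0 (gm_grading T)).
by move: tj; congr (gm_gr _ _); rewrite /delta_deg; move: #|be| => b; lia.
Qed.

Definition hom_index p := [pred z : 'X_{1..n < p.+1} * {set 'I_k} | (mdeg z.1 + #|z.2|)%N == p].

Lemma chain_deltaE p f : hom_degree p f ->
  f = \sum_(z | hom_index p z) deltaL z.1 z.2 (f z.1 z.2).
Proof.
move=> fp; apply/chainP => al be; rewrite chain_sumE /=.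
have [E|E] := eqVneq (mdeg al + #|be|)%N p; last first.
  rewrite fp // big1 // => z /eqP zE; rewrite /linear_of /= /delta.
  by case: andP => // -[/eqP alE /eqP beE]; rewrite -zE alE beE eqxx in E.
have alp : (mdeg al < p.+1)%N by rewrite ltnS -E leq_addr.
rewrite (bigD1 (BMultinom alp, be)) /= ?E // big1 ?addr0 => [|z /andP[_ ze]].
  by rewrite /linear_of /= /delta !eqxx.
rewrite /linear_of /= /delta; case: andP => // -[/eqP alE /eqP beE]; case/eqP: ze.
by case: z alE beE => z1 z2 /= alE ->; congr pair; apply: val_inj.
Qed.

Lemma hom_degree_graded p : graded_submodule (@chain_gr F A T n k) (@hom_degree F A T n k p).
Proof.
split=> [|a x y xp yp|f fp]; first exact: hom_degree0.
  by apply: hom_degreeD => //; apply: hom_degreeZ.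
rewrite (chain_deltaE fp); apply: (graded_sum_big (chain_grading T n k)) => [||z /eqP zp].
- exact: hom_degree0.
- by move=> x y; apply: hom_degreeD.
have [s [g [us gP ->]]] := gm_graded_sum (f z.1 z.2).
rewrite linear_sum; apply: (graded_sum_big (chain_grading T n k)) => [||i _].
- exact: hom_degree0.
- by move=> x y; apply: hom_degreeD.
apply: (@graded_sum_hom _ _ _ _ (chain_grading T n k) _ _ _ (delta_deg z.1 z.2 + i)).
- exact: hom_degree0.
- by move=> x y; apply: hom_degreeD.
- exact: (delta_gr z.1 z.2 (gP i)).
- by apply: delta_hom_degree.
Qed.

Variables (p : nat) (rho : {linear V -> V}).
Hypothesis rho_deg : forall f, hom_degree p f -> hom_degree p (rho f).
Hypothesis rho_gr : forall t f, chain_gr t f -> chain_gr t (rho f).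
Hypothesis rhoK : forall f, hom_degree p f -> rho (rho f) = rho f.

Definition hom_ker f : Prop := hom_degree p f /\ rho f = 0.
Lemma hom_ker_graded : graded_submodule (@chain_gr F A T n k) hom_ker.
Proof.
have G := chain_grading T n k.
exact: (@graded_submodule_ker F A V V _ _ G G (@hom_degree F A T n k p) rho (hom_degree_graded p) rho_gr).
Qed.

Lemma hom_ker_proj f : hom_degree p f -> hom_ker (f - rho f).
Proof.
move=> fp; split; first by apply: hom_degreeB => //; apply: rho_deg.
by rewrite linearB rhoK // subrr.
Qed.

Hypothesis T_proj : graded_projective T.

(** The chains of degree p form a finite sum of shifted copies of the projective module T, and the
    kernel of the idempotent rho is a direct summand of it, with projection 1 - rho. *)
Lemma hom_ker_projective : graded_projective (gsub (chain_grading T n k) hom_ker_graded).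
Proof.
set Q := gsub _ _; move=> M N pi g pig pis gg.
have zE (z : 'X_{1..n < p.+1} * {set 'I_k}) t : hom_index p z -> hom_degree p (deltaL z.1 z.2 t).
  by move=> /eqP zp; apply: delta_hom_degree.
have /choice [h hP] (z : 'X_{1..n < p.+1} * {set 'I_k}) : exists h : {linear T -> M}, hom_index p z ->
    (forall j t, gm_gr j t -> gm_gr (delta_deg z.1 z.2 + j) (h t)) /\
    forall t (H : hom_index p z), pi (h t) = g (gsub_in (chain_grading T n k) hom_ker_graded (hom_ker_proj (zE z t H))).
  have [zp|zp] := pselect (is_true (hom_index p z)); last first.
    have l0 : linear (fun _ : T => 0 : M) by move=> a s t; rewrite scaler0 addr0.
    by exists (linear_of l0).
  (* Placing t at the monomial z raises degrees by [delta_deg]. Shifting M and N by this amount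
     turns the composite into a graded map on T, to which projectivity applies. *)
  pose u (t : T) : gm_shift N (delta_deg z.1 z.2) :=
    g (gsub_in (chain_grading T n k) hom_ker_graded (hom_ker_proj (zE z t zp))).
  have ul : linear u.
    move=> a s t; rewrite /u -[RHS](linearP g); congr (g _); apply: val_inj => /=.
    have E : deltaL z.1 z.2 (a *: s + t) = a *: deltaL z.1 z.2 s + deltaL z.1 z.2 t := linearP _ _ _ _.
    rewrite -[LHS]/(deltaL z.1 z.2 (a *: s + t) - rho (deltaL z.1 z.2 (a *: s + t))).
    rewrite -[RHS]/(a *: (deltaL z.1 z.2 s - rho (deltaL z.1 z.2 s)) + (deltaL z.1 z.2 t - rho (deltaL z.1 z.2 t))).
    by rewrite E (linearP rho) scalerBr opprD addrACA.
  have [||| h [hg hE]] := T_proj (M := gm_shift M (delta_deg z.1 z.2)) (N := gm_shift N (delta_deg z.1 z.2))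
     (p := pi) (g := linear_of ul).
  - by move=> j x; apply: pig.
  - exact: pis.
  - move=> j t tj; apply: gg; apply: (gradingB (chain_grading T n k)); first exact: delta_gr.
    by apply: rho_gr; apply: delta_gr.
  exists h => _; split=> // t H; rewrite (bool_irrelevance H zp); exact: hE.
have hl : linear (fun x : Q => \sum_(z | hom_index p z) h z (gval x z.1 z.2)).
  move=> a x y; rewrite scaler_sumr -big_split; apply: eq_bigr => z _.
  have hlin s t : h z (a *: s + t) = a *: h z s + h z t := linearP (h z) a s t.
  by rewrite (linear_gval (PP := hom_ker_graded)) chainDE chainZE hlin.
exists (linear_of hl); split=> [j x xj|x].
  apply: (grading_sum (gm_grading M)) => z zp.
  have E : delta_deg z.1 z.2 + (j - (mdeg z.1)%:Z - 2 * #|z.2|%:Z) = j.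
    by rewrite /delta_deg; move: (mdeg z.1) #|z.2| => b c; lia.
  by rewrite -E; apply: (hP z zp).1; apply: xj.
rewrite -[linear_of hl x]/(\sum_(z | hom_index p z) h z (gval x z.1 z.2)) linear_sum.
have [xp x0] := gval_P x.
pose v z := if insub z is Some H then gsub_in (chain_grading T n k) hom_ker_graded (hom_ker_proj
   (zE _ (gval x (val (H : {z | hom_index p z})).1 (val H).2) (valP H))) else 0 : Q.
have xE : x = \sum_(z | hom_index p z) v z.
  apply: val_inj; rewrite linear_sum -[LHS]subr0 -[X in _ - X]x0 /=.
  rewrite {1 2}(chain_deltaE xp) (linear_sum rho) -sumrB.
  apply: eq_bigr => z zp; rewrite /v insubT //.
transitivity (g (\sum_(z | hom_index p z) v z)); last by rewrite -xE.
rewrite (linear_sum g); apply: eq_bigr => z zp; rewrite /v insubT /=.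
exact: (hP z zp).2.
Qed.
End ChainModules.

Section ChainResolution.
Variables (F : fieldType) (A : gradedAlgebra F) (T M : gradedModule A) (n k : nat).
Local Notation V := (chain T n k).
Variables (d : {linear V -> V}) (aug : {linear V -> M}) (rho : nat -> {linear V -> V}).
Hypothesis T_proj : graded_projective T.
Hypothesis d_gr : forall t f, chain_gr t f -> chain_gr t (d f).
Hypothesis aug_gr : forall t f, chain_gr t f -> gm_gr t (aug f).
Hypothesis d_deg : forall m f, hom_degree m.+1 f -> hom_degree m (d f).
Hypothesis dd : forall f, d (d f) = 0.
Hypothesis aug_d : forall f, aug (d f) = 0.
Hypothesis rho_deg : forall p f, hom_degree p f -> hom_degree p (rho p f).
Hypothesis rho_gr : forall p t f, chain_gr t f -> chain_gr t (rho p f).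
Hypothesis rhoK : forall p f, hom_degree p f -> rho p (rho p f) = rho p f.
Hypothesis d_ker : forall p f, hom_ker p.+1 (rho p.+1) f -> rho p (d f) = 0.
Hypothesis ker_exact : forall p f, hom_ker p.+1 (rho p.+1) f -> d f = 0 ->
  exists2 g, hom_ker p.+2 (rho p.+2) g & f = d g.
Hypothesis ker_exact0 : forall f, hom_ker 0 (rho 0%N) f -> aug f = 0 ->
  exists2 g, hom_ker 1 (rho 1%N) g & f = d g.
Hypothesis aug_surj : forall m, exists2 f, hom_ker 0 (rho 0%N) f & aug f = m.

(** The maps rho serve two complexes at once. For rho = 0 all chains are kept. In the truncation rho
    is 0 below degree k, a retraction onto the boundaries in degree k and the identity above; so a
    complement of the boundaries survives in degree k, and nothing beyond. *)
Definition ker_module p : gradedModule A :=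
  gsub (chain_grading T n k) (hom_ker_graded p (@rho_gr p)).

Fact d_hom_ker p f : hom_ker p.+1 (rho p.+1) f -> hom_ker p (rho p) (d f).
Proof. by move=> fp; split; [apply: d_deg; case: fp|apply: d_ker]. Qed.

Definition ker_diff p : {linear ker_module p.+1 -> ker_module p} :=
  gsub_map (chain_grading T n k) (hom_ker_graded p.+1 (@rho_gr p.+1)) (hom_ker_graded p (@rho_gr p))
    (@d_hom_ker p).
Lemma ker_diffE p x : gval (ker_diff p x) = d (gval x). Proof. by []. Qed.

Fact ker_aug_linear : linear (fun x : ker_module 0 => aug (gval x)).
Proof.
move=> a x y; have E := linearP aug a (gval x) (gval y); rewrite -E.
by congr (aug _); apply: linear_gval.
Qed.
Definition ker_aug : {linear ker_module 0 -> M} := linear_of ker_aug_linear.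

Lemma ker_in p f : hom_ker p (rho p) f -> exists x : ker_module p, gval x = f.
Proof. by move=> fp; exists (gsub_in _ _ fp). Qed.

Fact ker_exact0P x : ker_aug x = 0 <-> exists y, x = ker_diff 0 y.
Proof.
split=> [x0|[y ->]]; last exact: (aug_d (gval y)).
have [g gP gE] := ker_exact0 (gval_P x) x0; have [y yE] := ker_in gP.
by exists y; apply: val_inj; rewrite /= yE.
Qed.

Fact ker_exactP p x : ker_diff p x = 0 <-> exists y, x = ker_diff p.+1 y.
Proof.
split=> [x0|[y ->]]; last by apply: val_inj; apply: dd.
have dx0 : d (gval x) = 0 by rewrite -ker_diffE x0.
have [g gP gE] := ker_exact (gval_P x) dx0; have [y yE] := ker_in gP.
by exists y; apply: val_inj; rewrite /= yE.
Qed.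

(** Closed with [Defined], because the computation of Ext unfolds the modules and differentials of
    the resolution. *)
Definition chain_resolution : projective_resolution M.
Proof.
refine (@ProjectiveResolution F A M ker_module ker_diff ker_aug _ _ _ _ ker_exact0P ker_exactP).
- by move=> p; apply: hom_ker_projective => //; [apply: rho_deg|apply: rhoK].
- by move=> p; apply: gsub_map_graded => j x _; apply: d_gr.
- by move=> j x; apply: aug_gr.
- by move=> m; have [f fP <-] := aug_surj m; have [x xE] := ker_in fP; exists x; rewrite -xE.
Defined.
End ChainResolution.

Lemma mnm_addAC n (a b c : 'X_{1..n}) : (a + b + c = a + c + b)%MM.
Proof. by rewrite -!addmA [(b + c)%MM]addmC. Qed.

(** * Polynomials acting as differential operators on chains *)

Section PolynomialAction.
Variables (F : fieldType) (A : gradedAlgebra F) (T : gradedModule A) (n k : nat).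
Local Notation V := (chain T n k).
Local Notation S := {mpoly F[n]}.
Implicit Types (f : V) (r : S).

Definition shift (m : 'X_{1..n}) f : V := fun al be => f (al + m)%MM be.

(* The polynomial r, of size at most N, acts as a constant coefficient differential
   operator on divided powers. *)
Definition poly_act N r f : V :=
  \sum_(m : 'X_{1..n < N}) alg_scalar A r@_m *: shift m f.

Fact poly_act_linear N r : linear (poly_act N r).
Proof.
move=> c f g; rewrite scaler_sumr -big_split; apply: eq_bigr => m _ /=.
rewrite -[shift m (c *: f + g)]/(c *: shift m f + shift m g) scalerDr alg_scaleC.
reflexivity.
Qed.
Definition poly_actL N r : {linear V -> V} := linear_of (poly_act_linear N r).

Lemma poly_actD N f r s : poly_act N (r + s) f = poly_act N r f + poly_act N s f.
Proof.
rewrite -big_split; apply: eq_bigr => m _ /=.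
by rewrite mcoeffD (raddfD (alg_scalar A)) scalerDl.
Qed.
Lemma poly_act0 N f : poly_act N 0 f = 0.
Proof. by apply: big1 => m _; rewrite mcoeff0 (raddf0 (alg_scalar A)) scale0r. Qed.
Lemma poly_act_sum N f (I : Type) (s : seq I) (P : pred I) (r : I -> S) :
  poly_act N (\sum_(t <- s | P t) r t) f = \sum_(t <- s | P t) poly_act N (r t) f.
Proof. by apply: (big_morph (fun r => poly_act N r f)); [apply: poly_actD|apply: poly_act0]. Qed.
Lemma poly_actZX N f c (m : 'X_{1..n}) : (mdeg m < N)%N ->
  poly_act N (c *: 'X_[m]) f = alg_scalar A c *: shift m f.
Proof.
move=> mN; rewrite /poly_act (bigD1 (BMultinom mN)) //= mcoeffZ mcoeffX eqxx mulr1.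
rewrite big1 ?addr0 // => m' m'm; rewrite mcoeffZ mcoeffX.
have /negPf -> : m != m' by apply: contraNneq m'm => mE; apply/eqP/val_inj; rewrite /= -mE.
by rewrite mulr0 (raddf0 (alg_scalar A)) scale0r.
Qed.

Lemma hom_degree_shift (m : 'X_{1..n}) q f : hom_degree (q + mdeg m) f -> hom_degree q (shift m f).
Proof.
by move=> fq al be E; apply: fq; rewrite mdegD addnAC eqn_add2r.
Qed.
Lemma chain_gr_shift (m : 'X_{1..n}) t f : chain_gr t f -> chain_gr (t - (mdeg m)%:Z) (shift m f).
Proof.
move=> ft al be; have := ft (al + m)%MM be; rewrite /shift mdegD.
by congr (gm_gr _ _); move: #|be| => c; lia.
Qed.

Lemma hom_degree_poly_act p r q f : r \is p.-homog -> hom_degree (q + p) f ->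
  hom_degree q (poly_act p.+1 r f).
Proof.
move=> /dhomogP rp fq; apply: hom_degree_sum => m _.
have [mr|/memN_msupp_eq0 ->] := boolP (bmnm m \in msupp r); last first.
  by rewrite (raddf0 (alg_scalar A)) scale0r.
by apply/hom_degreeZ/hom_degree_shift; rewrite (rp _ mr).
Qed.
Lemma chain_gr_poly_act p r t f : r \is p.-homog -> chain_gr t f ->
  chain_gr (t - p%:Z) (poly_act p.+1 r f).
Proof.
move=> /dhomogP rp ft; apply: (grading_sum (chain_grading T n k)) => m _.
have [mr|/memN_msupp_eq0 ->] := boolP (bmnm m \in msupp r); last first.
  by rewrite (raddf0 (alg_scalar A)) scale0r; apply: (grading0 (chain_grading T n k)).
apply: (alg_scale_gr _ (chain_grading T n k)); have := chain_gr_shift m ft; rewrite (rp _ mr); exact.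
Qed.

Lemma shift_dx m i f : shift m (dx i f) = dx i (shift m f).
Proof. by apply/chainP => al be; rewrite /shift /dx mnm_addAC. Qed.

Lemma poly_act_dx N r i f : poly_act N r (dx i f) = dx i (poly_act N r f).
Proof.
apply/chainP => al be; rewrite /poly_act /dx !chain_sumE; apply: eq_bigr => m _.
by rewrite !chainZE shift_dx.
Qed.

Variable G : 'I_k -> 'I_n -> 'I_n -> F.
Definition quadric a : S := \sum_i \sum_j G a i j *: ('X_i * 'X_j).

Lemma iter_dx p i f : iter p (@dx _ T n k i) f = shift (U_(i) *+ p) f.
Proof.
elim: p => [|p IH]; apply/chainP => al be; first by rewrite /shift mulm0n addm0.
by rewrite iterS IH /dx /shift mulmS addmA.
Qed.

Variables (Z : 'I_n -> {linear T -> T}) (Y : 'I_k -> {linear T -> T}).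
Hypothesis ZZ : forall i j x,
  Z i (Z j x) + Z j (Z i x) = (\sum_a alg_scalar A (G a i j) *: Y a x) *+ 2.
Hypothesis ZY : forall i a x, Z i (Y a x) = Y a (Z i x).
Hypothesis YY : forall a b x, Y a (Y b x) = Y b (Y a x).
Local Notation ops := (chain_operators ZZ ZY YY).

Lemma shift_qx m a f : shift m (qx ops a f) = qx ops a (shift m f).
Proof.
apply/chainP => al be; rewrite /shift !qxE !chain_sumE; apply: eq_bigr => i _.
rewrite !chain_sumE; apply: eq_bigr => j _; rewrite !chainZE /= /dx.
by rewrite -!addmA [(m + (_ + _))%MM]addmC -!addmA.
Qed.

Lemma shift_diff m f : shift m (diff ops f) = diff ops (shift m f).
Proof.
have H1 : shift m (diff1 ops f) = diff1 ops (shift m f).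
  have HT g : shift m (opT ops g) = opT ops (shift m g) by [].
  rewrite !diff1E HT; congr (opT ops _); apply/chainP => al be.
  rewrite /shift !chain_sumE; apply: eq_bigr => i _.
  by rewrite /= /dx /coef mnm_addAC.
have H2 : shift m (diff2 ops f) = diff2 ops (shift m f).
  by rewrite !diff2E; apply/chainP => al be; rewrite /shift !chain_sumE; apply: eq_bigr.
have H3 : shift m (diff3 ops f) = diff3 ops (shift m f).
  rewrite !diff3E; apply/chainP => al be; rewrite /shift !chain_sumE; apply: eq_bigr => a _.
  exact: (congr1 (fun g : V => g al be) (shift_qx m a _)).
by rewrite !diffE -H1 -H2 -H3.
Qed.

Lemma poly_act_diff N r f : poly_act N r (diff ops f) = diff ops (poly_act N r f).
Proof.
rewrite /poly_act linear_sum; apply: eq_bigr => m _.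
by rewrite linearZ_LR -shift_diff.
Qed.

(** The polynomial identity becomes an identity of operators, with x_j acting as d/dx_j. The cutoffs
    p.+3 and p.+1 just exceed the degrees p + 2 of the power and p of the r a. *)
Lemma quadric_act p (r : 'I_k -> S) i f : (forall a, r a \is p.-homog) ->
  'X_i ^+ p.+2 = \sum_a r a * quadric a ->
  iter p.+2 (@dx _ T n k i) f = \sum_a poly_act p.+1 (r a) (qx ops a f).
Proof.
move=> rp rE; rewrite iter_dx.
have -> : shift (U_(i) *+ p.+2) f = poly_act p.+3 ('X_i ^+ p.+2) f.
  by rewrite mpolyXn -[X in poly_act _ X]scale1r poly_actZX ?alg_scalar1 ?scale1r // mdegMn mdeg1 mul1n.
rewrite rE poly_act_sum; apply: eq_bigr => a _.
have rsz : (msize (r a) <= p.+1)%N.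
  rewrite msizeE; apply/bigmax_leqP_seq => m mr _; rewrite ltnS.
  by have /dhomogP /(_ _ mr) -> := rp a.
rewrite {1}(mpolywE rsz) mulr_suml poly_act_sum; apply: eq_bigr => m _.
rewrite mulr_sumr poly_act_sum; rewrite shift_qx qxE scaler_sumr; apply: eq_bigr => l _.
rewrite mulr_sumr poly_act_sum scaler_sumr; apply: eq_bigr => j _.
rewrite -scalerAl -scalerAr scalerA -!mpolyXD poly_actZX.
  rewrite alg_scaleA; congr (_ *: _); apply/chainP => al be.
  by rewrite /= /shift /dx [(m + _)%MM]addmC !addmA.
by rewrite !mdegD !mdeg1; have := bmdeg m; move: (mdeg m) => c; lia.
Qed.

Lemma poly_act_nilp p (r : 'I_n -> 'I_k -> S) : (forall i a, r i a \is p.-homog) ->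
  (forall i, 'X_i ^+ p.+2 = \sum_a r i a * quadric a) ->
  forall i, exists s : 'I_k -> {linear V -> V},
  [/\ forall a j f, opD ops j (s a f) = s a (opD ops j f),
      forall a f, diff ops (s a f) = s a (diff ops f),
      forall a m f, hom_degree (m + p)%N f -> hom_degree m (s a f),
      forall a t f, chain_gr t f -> chain_gr (t - p%:Z) (s a f) &
      forall f, iter p.+2 (opD ops i) f = \sum_a s a (qx ops a f)].
Proof.
move=> rp rE i; exists (fun a => poly_actL p.+1 (r i a)); split.
- by move=> a j f; apply: esym; apply: poly_act_dx.
- by move=> a f; apply: esym; apply: poly_act_diff.
- by move=> a m f; apply: hom_degree_poly_act.
- by move=> a t f; apply: chain_gr_poly_act.
- by move=> f; apply: quadric_act.
Qed.
End PolynomialAction.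

Section Truncation.
Variables (F : fieldType) (A : gradedAlgebra F) (T : gradedModule A) (n k : nat).
Local Notation V := (chain T n k).
Definition trunc m (f : V) : V := fun al be => if (mdeg al + #|be|)%N == m then f al be else 0.
Fact trunc_linear m : linear (trunc m).
Proof.
move=> c f g; apply/chainP => al be; rewrite chainDE chainZE /trunc.
by case: ifP => _ //; rewrite scaler0 addr0.
Qed.
Definition truncL m : {linear V -> V} := linear_of (trunc_linear m).
Lemma truncLE m f al be : truncL m f al be = if (mdeg al + #|be|)%N == m then f al be else 0.
Proof. by []. Qed.
Lemma trunc_deg m f : hom_degree m (truncL m f).
Proof. by move=> al be /negPf E; rewrite truncLE E. Qed.
Lemma trunc_id m f : hom_degree m f -> truncL m f = f.
Proof. by move=> fm; apply/chainP => al be; rewrite truncLE; case: eqP => // /eqP/fm ->. Qed.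
Lemma trunc_gr m t f : chain_gr t f -> chain_gr t (truncL m f).
Proof.
move=> ft al be; rewrite truncLE; case: ifP => _; first exact: ft.
exact: (grading0 (gm_grading T)).
Qed.
End Truncation.

(** * Truncation and projective dimension *)

Section ExactChainResolution.
Variables (F : fieldType) (A : gradedAlgebra F) (T M : gradedModule A) (n k : nat).
Local Notation V := (chain T n k).
Variables (d : {linear V -> V}) (aug : {linear V -> M}).
Hypothesis dd0 : forall f, d (d f) = 0.
Hypothesis koszul_d_deg : forall m f, hom_degree m.+1 f -> hom_degree m (d f).
Hypothesis koszul_d_gr : forall t f, chain_gr t f -> chain_gr t (d f).
Hypothesis T_proj : graded_projective T.
Hypothesis aug_gr : forall t f, chain_gr t f -> gm_gr t (aug f).
Hypothesis aug_d : forall f, aug (d f) = 0.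
Hypothesis aug_surj : forall m, exists2 f, hom_degree 0 f & aug f = m.
Hypothesis exact_pos : forall m f, hom_degree m.+1 f -> d f = 0 ->
  exists2 g, hom_degree m.+2 g & f = d g.
Hypothesis exact_0 : forall f, hom_degree 0 f -> aug f = 0 -> exists2 g, hom_degree 1 g & f = d g.

Fact zero_linear : linear (fun _ : V => 0 : V). Proof. by move=> c f g; rewrite scaler0 addr0. Qed.
Definition zeroL : {linear V -> V} := linear_of zero_linear.

Definition full_resolution : projective_resolution M.
Proof.
apply: (@chain_resolution F A T M n k d aug (fun=> zeroL)).
- exact: T_proj.
- exact: koszul_d_gr.
- exact: aug_gr.
- exact: koszul_d_deg.
- exact: dd0.
- exact: aug_d.
- by move=> p f _; apply: hom_degree0.
- by move=> p t f _; apply: (grading0 (chain_grading T n k)).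
- by [].
- by [].
- move=> p f [fp _] df; have [g gp gE] := exact_pos fp df.
  by exists g => //; split.
- move=> f [f0 _] fe; have [g gp gE] := exact_0 f0 fe.
  by exists g => //; split.
- by move=> m; have [f f0 fE] := aug_surj m; exists f => //; split.
Defined.

Section Truncated.
Hypothesis k_gt0 : (0 < k)%N.
(* The vanishing of the cohomology of Hom(-, N) in degree k + 1. *)
Hypothesis high : forall (N : gradedModule A) (phi : {linear V -> N}),
  of_degree (@chain_gr F A T n k) 0 phi ->
  (forall z, hom_degree k.+2 z -> phi (d z) = 0) ->
  exists psi : {linear V -> N}, of_degree (@chain_gr F A T n k) 0 psi /\
    forall z, hom_degree k.+1 z -> phi z = psi (d z).

(** The boundary map, regarded as a cochain of degree k + 1 with values in the module of k-cycles,
    is closed because d d = 0. A primitive psi of it satisfies psi (d f) = d f, that is, it fixes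
    the boundaries. *)
Lemma cycle_retraction : exists r : {linear V -> V},
  [/\ forall f, hom_degree k (r f), forall f, d (r f) = 0,
      forall f, hom_degree k.+1 f -> r (d f) = d f &
      forall t f, chain_gr t f -> chain_gr t (r f)].
Proof.
have GV := chain_grading T n k.
have ZP : graded_submodule (@chain_gr F A T n k) (fun f : V => hom_degree k f /\ d f = 0).
  apply: (@graded_submodule_ker F A V V _ _ GV GV); first exact: hom_degree_graded.
  exact: koszul_d_gr.
pose N := gsub GV ZP.
have phiP (f : V) : hom_degree k (d (truncL T n k k.+1 f)) /\ d (d (truncL T n k k.+1 f)) = 0.
  by split; [apply: koszul_d_deg; apply: trunc_deg|apply: dd0].
have phil : linear (fun f : V => gsub_in GV ZP (phiP f) : N).
  move=> c f g; apply: val_inj.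
  rewrite -[LHS]/(d (truncL T n k k.+1 (c *: f + g))).
  rewrite -[RHS]/(c *: d (truncL T n k k.+1 f) + d (truncL T n k k.+1 g)).
  by rewrite (linearP (truncL T n k k.+1)) (linearP d).
have phig : of_degree (@chain_gr F A T n k) 0 (linear_of phil).
  move=> t f ft; rewrite addr0; apply: koszul_d_gr; exact: trunc_gr.
have [|psi [psig psiE]] := high phig.
  move=> z zk; apply: val_inj; rewrite -[LHS]/(d (truncL T n k k.+1 (d z))).
  by rewrite trunc_id ?dd0 //; apply: koszul_d_deg.
have rl : linear (fun f : V => gval (psi f)).
  by move=> c f g; rewrite (linearP psi); apply: (linear_gval (PP := ZP)).
exists (linear_of rl); split=> [f|f|f fk|t f ft].
- by have [] := gval_P (psi f).
- by have [] := gval_P (psi f).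
- rewrite -[LHS]/(gval (psi (d f))) -psiE // -[LHS]/(d (truncL T n k k.+1 f)).
  by rewrite trunc_id.
- by have := psig t f ft; rewrite addr0.
Qed.

Theorem chain_projective_dim : projective_dim_le M k.
Proof.
have [r [r_deg dr rd r_gr]] := cycle_retraction.
pose idL : {linear V -> V} := idfun.
pose rho q : {linear V -> V} := if (q < k)%N then zeroL else if q == k then r else idL.
have rho_lt q : (q < k)%N -> rho q = zeroL by rewrite /rho => ->.
have rho_k : rho k = r by rewrite /rho ltnn eqxx.
have rho_gt q : (k < q)%N -> rho q = idL.
  by move=> kq; rewrite /rho ltnNge ltnW //= gtn_eqF.
have rhoE q : [\/ (q < k)%N, q = k | (k < q)%N].
  by case: (ltngtP q k) => H; [constructor 1|constructor 3|constructor 2].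
(* r f is a cycle of degree k > 0, hence a boundary, and r fixes boundaries. *)
have rr f : hom_degree k f -> r (r f) = r f.
  move=> fk; have [m km] : exists m, k = m.+1 by exists k.-1; rewrite prednK.
  have rk : hom_degree m.+1 (r f) by rewrite -km; apply: r_deg.
  have [g gk gE] := exact_pos rk (dr f).
  by rewrite -km in gk; rewrite gE; apply: rd.
have in_rho q f : hom_degree q f -> hom_ker q (rho q) f \/ (k <= q)%N.
  move=> fq; case: (rhoE q) => [qk|->|/ltnW]; [left|right|right] => //.
  by split=> //; rewrite rho_lt.
(* Subtracting the cycle r f moves a chain of degree k into the kernel of r without changing its
   boundary. *)
have lift q f : hom_degree q f -> (q <= k)%N -> exists2 g, hom_ker q (rho q) g & d g = d f.
  move=> fq; rewrite leq_eqVlt => /orP[/eqP qk|qk].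
    subst q; exists (f - r f); last by rewrite (linearB d) dr subr0.
    split; first exact: hom_degreeB.
    by rewrite rho_k (linearB r) rr // subrr.
  by exists f => //; split=> //; rewrite rho_lt.
have hk_gt q f : hom_ker q (rho q) f -> (k < q)%N -> f = 0.
  by move=> [_ f0] kq; rewrite (rho_gt _ kq) in f0.
have Hg q t f : chain_gr t f -> chain_gr t (rho q f).
  by case: (rhoE q) => [/rho_lt ->|->|/rho_gt -> //]; [|rewrite rho_k; apply: r_gr];
    move=> _; apply: (grading0 (chain_grading T n k)).
unshelve refine (ex_intro _ (@chain_resolution F A T M n k d aug rho
  T_proj koszul_d_gr aug_gr koszul_d_deg dd0 aug_d _ Hg _ _ _ _ _) _).
- move=> q f fq; case: (rhoE q) => [/rho_lt ->|qk|/rho_gt -> //]; first exact: hom_degree0.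
  by rewrite qk rho_k; apply: r_deg.
- move=> q f fq; case: (rhoE q) => [/rho_lt ->|qk|/rho_gt -> //]; first exact: linear0.
  by subst q; rewrite rho_k rr.
- move=> q f fq; case: (rhoE q) => [/rho_lt -> //|qk|qk].
    by rewrite (hk_gt _ _ fq) ?qk // !linear0.
  by rewrite (hk_gt _ _ fq) ?ltnS ?(ltnW qk) // !linear0.
- move=> q f fq df; have [kq|qk] := ltnP k q.+1.
    exists 0; last by rewrite linear0; apply: (hk_gt _ _ fq).
    by split; rewrite ?linear0 //; apply: hom_degree0.
  have [fq1 fq0] := fq; have [g gq gE] := exact_pos fq1 df.
  (* For q.+1 = k a cycle f in the kernel of r is a boundary, so f = r f = 0: the truncated
     differential is injective in its last degree. *)
  move: qk; rewrite leq_eqVlt => /orP[/eqP qk|qk].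
    exists 0; first by split; rewrite ?linear0 //; apply: hom_degree0.
    rewrite qk in gq; rewrite linear0 -fq0 gE qk rho_k; apply: esym; exact: rd.
  by have [g' g'P g'E] := lift _ _ gq qk; exists g' => //; rewrite g'E.
- move=> f [f0 _] fe; have [g gp gE] := exact_0 f0 fe.
  by have [g' g'P g'E] := lift _ _ gp k_gt0; exists g' => //; rewrite g'E.
- by move=> m; have [f f0 fE] := aug_surj m; exists f => //; split=> //; rewrite rho_lt.
- move=> q kq x; apply: val_inj; exact: (hk_gt _ _ (gval_P x) kq).
Qed.
End Truncated.
End ExactChainResolution.

Section KoszulResolution.
Variables (F : fieldType) (A : gradedAlgebra F) (n k : nat).
Variables (e : 'I_n -> A) (y : 'I_k -> A) (G : 'I_k -> 'I_n -> 'I_n -> F).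
Hypothesis e_gr : forall i, ga_gr 1 (e i).
Hypothesis y_gr : forall a, ga_gr 2 (y a).
Hypothesis ee : forall i j, e i * e j + e j * e i = (\sum_a G a i j *: y a) *+ 2.
Hypothesis y_central : forall a x, x * y a = y a * x.
Hypothesis charF : forall m, (m.+1%:R : F) != 0.
Variable W : pbw_structure e y.
Variables (M : gradedModule A) (B : homogeneous_basis M).
Local Notation T := (tens B).
Local Notation V := (chain T n k).
Local Notation ops := (koszul_ops e_gr y_gr ee y_central B).
Local Notation d := (diff ops).

Lemma F2_neq0 : (2 : F) != 0. Proof. exact: charF 1%N. Qed.

Lemma koszul_gradings :
  chain_gradings ops (fun i => @ix _ T n k i) (@hom_degree F A T n k) (@chain_gr F A T n k).
Proof. by apply: concrete_gradings => *; [apply: ad_e_gr|apply: ad_y_gr]. Qed.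

Fact koszul_aug_linear : linear (fun f : V => tens_eval B (f 0%MM set0)).
Proof. by move=> c f g; rewrite chainDE chainZE; apply: linearP. Qed.
Definition koszul_aug : {linear V -> M} := linear_of koszul_aug_linear.

Lemma koszul_aug_gr t f : chain_gr t f -> gm_gr t (koszul_aug f).
Proof.
move=> ft; apply: tens_eval_gr; have := ft 0%MM set0.
by rewrite mdeg0 cards0; congr (gm_gr _ _); lia.
Qed.

Lemma koszul_aug_surj m : exists2 f, hom_degree 0 f & koszul_aug f = m.
Proof.
exists (deltaL T 0%MM set0 (tens1 B m)); last first.
  by rewrite -[LHS]/(tens_eval B (delta 0%MM set0 (tens1 B m) 0%MM set0)) /delta !eqxx tens_eval1.
by apply: delta_hom_degree; rewrite mdeg0 cards0.
Qed.

Fact koszul_d_linear : linear (fun f : V => d f : V). Proof. exact: linearP. Qed.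
Definition koszul_d : {linear V -> V} := linear_of koszul_d_linear.
Lemma koszul_dE f : koszul_d f = d f. Proof. by []. Qed.

Lemma koszul_aug_d f : koszul_aug (koszul_d f) = 0.
Proof. exact: tens_eval_diff. Qed.
Lemma tens_projective : graded_projective T. Proof. exact: free_projective. Qed.

Lemma koszul_dd f : koszul_d (koszul_d f) = 0. Proof. exact: (diff_diff ops F2_neq0). Qed.
Lemma koszul_d_deg m f : hom_degree m.+1 f -> hom_degree m (koszul_d f).
Proof. exact: (W_d koszul_gradings). Qed.
Lemma koszul_d_gr t f : chain_gr t f -> chain_gr t (koszul_d f).
Proof. exact: (gr_d koszul_gradings). Qed.
Lemma koszul_exact m f : hom_degree m.+1 f -> koszul_d f = 0 ->
  exists2 g, hom_degree m.+2 g & f = koszul_d g.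
Proof. exact (@exact_positive F A n k e y G e_gr y_gr ee y_central charF W M B m f). Qed.
Lemma koszul_exact0 f : hom_degree 0 f -> koszul_aug f = 0 ->
  exists2 g, hom_degree 1 g & f = koszul_d g.
Proof. exact (@exact_zero F A n k e y G e_gr y_gr ee y_central charF W M B f). Qed.

Definition koszul_resolution : projective_resolution M :=
  @full_resolution F A T M n k koszul_d koszul_aug koszul_dd koszul_d_deg koszul_d_gr
    tens_projective koszul_aug_gr koszul_aug_d koszul_aug_surj koszul_exact koszul_exact0.

Theorem koszul_projective_dim p (r : 'I_n -> 'I_k -> {mpoly F[n]}) : (0 < k)%N ->
  (forall i a, r i a \is p.-homog) ->
  (forall i, 'X_i ^+ p.+2 = \sum_a r i a * quadric G a) -> projective_dim_le M k.
Proof.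
move=> k0 rp rE.
refine (@chain_projective_dim F A T M n k koszul_d koszul_aug koszul_dd koszul_d_deg koszul_d_gr
    tens_projective koszul_aug_gr koszul_aug_d koszul_aug_surj koszul_exact koszul_exact0 k0 _).
move=> N phi phig phid.
have [|psi [psig psiE]] := high_exact koszul_gradings F2_neq0 (poly_act_nilp _ _ _ rp rE) (leq0n n) (ltnSn k) phig.
  by move=> z zk _; apply: phid.
by exists psi; split=> // z zk; apply: psiE.
Qed.
End KoszulResolution.

(** * The quotient by the y_a, an exterior algebra *)

Section ModuloY.
Variables (F : fieldType) (n k : nat) (q : 'I_n -> 'I_n -> {mpoly F[k]}).
Local Notation S := {mpoly F[k]}.
Local Notation C := (clifford q).
Local Notation ext := {ffun {set 'I_n} -> S^o}.
Hypothesis q_homog : forall i j, q i j \is 1.-homog.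
Implicit Types (x z : ext) (J : {set 'I_n}).

(* The two-sided ideal generated by the y_a. *)
Definition yideal x : Prop := forall J, (x J : S)@_0 = 0.

Lemma yideal0 : yideal 0. Proof. by move=> J; rewrite ffunE mcoeff0. Qed.
Lemma yidealD x z : yideal x -> yideal z -> yideal (x + z).
Proof. by move=> x0 z0 J; rewrite ffunE mcoeffD x0 z0 addr0. Qed.
Lemma yidealN x : yideal x -> yideal (- x).
Proof. by move=> x0 J; rewrite ffunE mcoeffN x0 oppr0. Qed.
Lemma yidealB x z : yideal x -> yideal z -> yideal (x - z).
Proof. by move=> x0 /yidealN; apply: yidealD. Qed.
Lemma yideal_sum (I : Type) (s : seq I) (P : pred I) (f : I -> ext) :
  (forall t, P t -> yideal (f t)) -> yideal (\sum_(t <- s | P t) f t).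
Proof. by move=> H; elim/big_ind: _ => //; [apply: yideal0|apply: yidealD]. Qed.

Lemma mcoeff0_sgn i J (p : S) : (ext_sgn S i J * p)@_0 = ext_sgn F i J * p@_0.
Proof.
rewrite /ext_sgn; case: (odd _) (signr_odd S #|[set j in J | (j < i)%N]|)
  (signr_odd F #|[set j in J | (j < i)%N]|) => <- <- /=; last by rewrite !mul1r.
by rewrite expr1 !mulN1r mcoeffN.
Qed.

Lemma yideal_wedge1 i x : yideal x -> yideal (wedge1 i x).
Proof.
by move=> x0 J; rewrite ffunE; case: ifP => _; rewrite ?mcoeff0 // mcoeff0_sgn x0 mulr0.
Qed.
Lemma yideal_scale d (r : S) x : r \is d.+1.-homog -> yideal (r *: x).
Proof.
move=> rd J; rewrite ffunE.
have -> : (r *: x J : S)@_0 = r@_0 * (x J : S)@_0 by exact: (rmorphM (@mcoeff k F 0%MM)).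
by rewrite (dhomog_nemf_coeff rd) ?mul0r //= mdeg0.
Qed.
Lemma yideal_contr i x : yideal (contr (q i) x).
Proof. by apply: yideal_sum => j _; apply: (@yideal_scale 0). Qed.
Lemma yideal_gen i x : yideal (clifford_gen q i x - wedge1 i x).
Proof. by rewrite /clifford_gen addrAC subrr add0r; apply: yideal_contr. Qed.

Definition ext_parity x : ext := [ffun J : {set _} => (-1) ^+ #|J| * x J].
Lemma parityD x z : ext_parity (x + z) = ext_parity x + ext_parity z.
Proof. by apply/ffunP => J; rewrite !ffunE mulrDr. Qed.
Lemma parity_wedge1 i x : ext_parity (wedge1 i x) = - wedge1 i (ext_parity x).
Proof.
apply/ffunP => J; rewrite !ffunE; case: ifP => iJ; last by rewrite mulr0 oppr0.
by rewrite (cardsD1 i J) iJ exprS mulN1r mulNr mulrCA.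
Qed.
Lemma yideal_parity x : yideal x -> yideal (ext_parity x).
Proof.
move=> x0 J; rewrite ffunE -signr_odd; case: (odd _); rewrite ?mul1r //.
by rewrite expr1 mulN1r mcoeffN x0 oppr0.
Qed.

Lemma wedge1B i x z : wedge1 i (x - z) = wedge1 i x - wedge1 i z. Proof. exact: linearB. Qed.

(** Modulo the y_a the Clifford product is the exterior product, and moving e_i from the right of x
    to its left costs the parity sign. The induction follows the recursion that defines the
    product. *)
Lemma yideal_act s i x : uniq s -> ext_supp s x ->
  yideal (clifford_act q s x (wedge1 i (ext_one S n)) - wedge1 i (ext_parity x)).
Proof.
elim: s x => [|l s IH] x /= => [_ xs|/andP[ls us] xs].
  have -> : ext_parity x = x set0 *: ext_one S n.
    apply/ffunP => J; rewrite !ffunE; have [->|J0] := eqVneq J set0.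
      by rewrite cards0 expr0 mul1r /GRing.scale /= mulr1.
    rewrite xs ?mulr0 /GRing.scale /= ?mulr0 //; apply: contraNN J0 => /subsetP H.
    by apply/eqP/setP => j; rewrite inE; apply/negP => /H.
  by rewrite wedge1Z subrr; apply: yideal0.
have [xs1 xs0] := ext_split xs; set y1 := contr1 l x; set y0 := x - _.
have -> : ext_parity x = ext_parity y0 - wedge1 l (ext_parity y1).
  by rewrite -parity_wedge1 -parityD subrK.
rewrite wedge1B wedge1_anti opprK.
have H0 := IH _ us xs0; have H1 := IH _ us xs1.
have H2 := IH _ us (ext_supp_contr (q l) xs1).
set a0 := clifford_act _ _ y0 _ in H0 *; set a1 := clifford_act _ _ y1 _ in H1 *.
set a2 := clifford_act _ _ (contr _ _) _ in H2 *.
(* Regrouped so that each difference lies in the ideal by an induction hypothesis, and the remaining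
   terms do because the contractions have coefficients linear in the y_a. *)
have -> : a0 + clifford_gen q l a1 - a2 - (wedge1 i (ext_parity y0) + wedge1 l (wedge1 i (ext_parity y1)))
  = (a0 - wedge1 i (ext_parity y0)) + (clifford_gen q l a1 - wedge1 l a1)
    + wedge1 l (a1 - wedge1 i (ext_parity y1)) - (a2 - wedge1 i (ext_parity (contr (q l) y1)))
    - wedge1 i (ext_parity (contr (q l) y1)).
  rewrite wedge1B; move: (clifford_gen q l a1) (wedge1 l a1) (wedge1 l (wedge1 i (ext_parity y1))) (wedge1 i (ext_parity y0)) (wedge1 i (ext_parity (contr (q l) y1))).
  by move=> u1 u2 u3 u4 u5; apply/ffunP => J; rewrite !ffunE; ring.
apply: yidealB; last by apply/yideal_wedge1/yideal_parity/yideal_contr.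
exact (yidealB (yidealD (yidealD H0 (yideal_gen l a1)) (yideal_wedge1 l H1)) H2).
Qed.

Lemma yideal_mul_e i (x : C) : yideal (x * cl_e q i - wedge1 i (ext_parity x)).
Proof. by apply: yideal_act; [apply: enum_uniq|apply: ext_supp_enum]. Qed.

Lemma yideal_mul_y a (x : C) : yideal (x * cl_y q a).
Proof.
rewrite cl_y_central cl_yM; apply: (@yideal_scale 0).
by rewrite dhomogX /= mdeg1.
Qed.

Lemma yideal_top_mul i : yideal ((ext_basis S setT : C) * cl_e q i).
Proof.
have := yideal_mul_e i (ext_basis S setT); rewrite (_ : wedge1 _ _ = 0) ?subr0 //.
apply/ffunP => J; rewrite !ffunE; case: ifP => // iJ.
have /negPf -> : J :\ i != setT by apply/eqP => /setP /(_ i); rewrite !inE eqxx.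
by rewrite !mulr0.
Qed.

(* Modulo the y_a, the elements killed by right multiplication with all e_i are the
   multiples of the top exterior form. *)
Lemma yideal_socle (x : C) : (forall i, yideal (x * cl_e q i)) ->
  (x setT : S)@_0 = 0 -> yideal x.
Proof.
move=> H x0 J; have [->|JT] := eqVneq J setT; first exact: x0.
have [i iJ] : exists i, i \notin J.
  apply/existsP; apply: contraNT JT; rewrite negb_exists => /forallP JT.
  by apply/eqP/setP => i; rewrite inE; apply/negPn/JT.
have := yidealB (H i) (yideal_mul_e i x) (i |: J).
rewrite opprB addrC subrK ffunE setU11 mcoeff0_sgn setU1K // ffunE => /eqP.
rewrite mulf_eq0 => /orP[/eqP s0|].
  by have := ext_sgn2 F i (i |: J); rewrite s0 mul0r => /esym/eqP; rewrite oner_eq0.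
rewrite -signr_odd; case: (odd _); rewrite ?mul1r ?expr1 ?mulN1r ?mcoeffN ?oppr_eq0; exact/eqP.
Qed.

End ModuloY.

(** * The Koszul cochain complex of the y_a *)

Section KoszulCochains.
Variables (F : fieldType) (A : gradedAlgebra F) (k : nat) (y : 'I_k -> A).
Hypothesis y_gr : forall a, ga_gr 2 (y a).
Hypothesis y_central : forall a (x : A), x * y a = y a * x.
Hypothesis charF : forall m, (m.+1%:R : F) != 0.
Local Notation T := (A^c)^o.
Local Notation RM := (regular_module A).
Local Notation V := (chain T 0 k).
Variable p : 'I_k -> {additive T -> T}.
Hypothesis py : forall a b (x : T), p a (y b * (x : A) : A) = (y b * (p a x : A) : A) + (if a == b then x else 0).
Hypothesis p_gr : forall t a x, @gm_gr F A RM t x -> @gm_gr F A RM (t - 2) (p a x).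

(* fil w is the space of elements of y-degree < w, and yid is the ideal of the y_a. *)
Variables (fil : nat -> T -> Prop) (yid : T -> Prop).
Hypothesis fil0 : forall w, fil w 0.
Hypothesis fil_0 : forall x, fil 0 x -> x = 0.
Hypothesis fil_1 : forall x, fil 1 x -> yid x -> x = 0.
Hypothesis fil_le : forall w w' x, (w <= w')%N -> fil w x -> fil w' x.
Hypothesis fil_bounded : forall x, exists w, fil w x.
Hypothesis fil_euler : forall w x, fil w.+1 x ->
  fil w ((x : T) *+ w - \sum_a (y a * (p a x : A) : A) : T).
Hypothesis yid0 : yid 0.
Hypothesis yidD : forall x z, yid x -> yid z -> yid (x + z).
Hypothesis yidN : forall x, yid x -> yid (- x).
Hypothesis yid_y : forall a x, yid (y a * (x : A) : A).
Implicit Types (c : V) (x : T) (be : {set 'I_k}).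

Fact neg_ymul_zmod a : zmod_morphism (fun x : T => - (y a * (x : A)) : T).
Proof. by move=> x z; rewrite mulrBr opprB opprK addrC. Qed.
(** The Weyl relation [p, y] = 1 reads [-y, p] = 1, so the abstract homotopy applies with the roles
    of y and d/dy exchanged: [homo2] becomes the Koszul cochain differential and [lead2] its
    homotopy. *)
Definition neg_ymul a : {additive T -> T} := additive_of (neg_ymul_zmod a).
Lemma neg_ymulE a x : neg_ymul a x = - (y a * (x : A)). Proof. by []. Qed.

Fact neg_ymul_p a b x : neg_ymul a (p b x) = p b (neg_ymul a x) + (if a == b then x else 0).
Proof.
have -> : p b (neg_ymul a x) = - p b (y a * (x : A) : A) by exact: (raddfN (p b)).
rewrite py neg_ymulE opprD -addrA eq_sym.
by case: (a == b); rewrite ?addNr ?addr0 // oppr0 addr0.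
Qed.

Local Notation ko := (homo2 neg_ymul : V -> V).
Local Notation koh := (lead2 p : V -> V).

Lemma ko_ko c : ko (ko c) = 0.
Proof.
have NC a b : coef (neg_ymul a) (coef (neg_ymul b) c) = coef (neg_ymul b) (coef (neg_ymul a) c) :> V.
  apply: coefC => x; rewrite !neg_ymulE !mulrN !mulrA; congr (- - (_ * _)).
  by rewrite y_central.
have E a b : xi a (coef (neg_ymul a) (xi b (coef (neg_ymul b) c))) =
    - xi b (coef (neg_ymul b) (xi a (coef (neg_ymul a) c))) :> V.
  have H a' b' : coef (neg_ymul a') (xi b' (coef (neg_ymul b') c)) =
    xi b' (coef (neg_ymul a') (coef (neg_ymul b') c)) :> V := coef_xi (neg_ymul a') b' _.
  apply: etrans (congr1 (@xi _ T 0 k a) (H a b)) _.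
  apply: etrans (xiC a b _) (congr1 -%R (congr1 (@xi _ T 0 k b) _)).
  apply: etrans (congr1 (@xi _ T 0 k a) (NC a b)) (esym (H b a)).
have D : ko (ko c) = \sum_a \sum_b xi a (coef (neg_ymul a) (xi b (coef (neg_ymul b) c))).
  apply: eq_bigr => a _; rewrite -(linear_sum (xi a)); congr (xi a _).
  exact: (coef_sum (neg_ymul a)).
have N : ko (ko c) = - ko (ko c).
  rewrite [LHS]D [in RHS]D [LHS]exchange_big -sumrN; apply: eq_bigr => a _.
  rewrite -sumrN; apply: eq_bigr => b _; exact: E.
have H2 : ko (ko c) *+ 2 = 0 *+ 2 by rewrite mul0rn mulr2n {1}N addNr.
exact: (alg_double_inj (charF 1) H2).
Qed.

Lemma ko_scale (l : A^c) c : ko (l *: c) = l *: ko c.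
Proof.
rewrite scaler_sumr; apply: eq_bigr => a _; rewrite -(linearZ_LR (@xi _ T 0 k a)); congr (xi a _).
apply/chainP => al be; rewrite chainZE /coef !neg_ymulE.
rewrite -[LHS]/(- (y a * ((c al be : A) * (l : A)))) mulrA.
by rewrite -[RHS]/(- (y a * (c al be : A)) * (l : A)) mulNr.
Qed.

Definition cgr (s : int) c := forall al be, @gm_gr F A RM (s + 2 * #|be|%:Z) (c al be).
Let GT := gm_grading RM.

Lemma cgr_ko s c : cgr s c -> cgr s (ko c).
Proof.
move=> cs al be; rewrite /homo2 chain_sumE; apply: (grading_sum GT) => a _.
rewrite /xi; case: ifP => abe; last exact: (grading0 GT).
apply: (sign_gr (V := RM)); apply: (gradingN GT).
have := gradingM GT (cs al (be :\ a)) (y_gr a).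
rewrite -[X in gm_gr _ X]/((c al (be :\ a) : A) * y a) y_central.
rewrite [in X in _ -> X](cardsD1 a be) abe; congr (gm_gr _ _); move: #|be :\ a| => r; lia.
Qed.

Lemma cgr_koh s c : cgr s c -> cgr s (koh c).
Proof.
move=> cs al be; rewrite /lead2 chain_sumE; apply: (grading_sum GT) => a _.
rewrite /iota; case: ifP => abe; first exact: (grading0 GT).
apply: (sign_gr (V := RM)); have := p_gr a (cs al (a |: be)).
rewrite cardsU1 abe; congr (gm_gr _ _); move: #|be| => u; lia.
Qed.

(* The Koszul cochain complex of the y_a is exact except in degree k, where its
   cohomology is A / (y). *)
Lemma koszul_cochain s m c : (m <= k)%N ->
  (forall al be, #|be| != m -> c al be = 0) -> ko c = 0 -> cgr s c ->
  (m < k)%N \/ yid (c 0%MM setT) -> exists2 b, cgr s b & c = ko b.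
Proof.
move=> mk.
have al0 (al : 'X_{1..0}) : al = 0%MM by apply/mnmP => -[].
have ko0 : ko 0 = 0 := raddf0 _.
have [w] : exists w, forall al be, fil w (c al be).
  have /choice [b bP] be := fil_bounded (c 0%MM be).
  exists (\max_be b be)%N => al be; rewrite (al0 al).
  exact: (fil_le (@leq_bigmax _ b be) (bP be)).
elim: w c => [|w IH] c cw cm cc cs crit.
  exists 0; first by move=> al be; apply: (grading0 GT).
  by rewrite ko0; apply/chainP => al be; apply: fil_0.
(* The factor to be inverted vanishes only for m = k and w = 0. There c is a single coefficient of
   y-degree 0 in the ideal of the y_a, hence zero. *)
have [N0|N0] := eqVneq (k - m + w)%N 0%N.
  exists 0; first by move=> al be; apply: (grading0 GT).
  rewrite ko0; apply/chainP => al be; rewrite (al0 al).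
  have [km w0] : m = k /\ w = 0%N by split; lia.
  have [beT|beT] := eqVneq be setT; last first.
    apply: cm; rewrite km neq_ltn; apply/orP; left.
    rewrite -[X in (_ < X)%N]card_ord -cardsT; apply: proper_card.
    by rewrite properEneq beT subsetT.
  case: crit => [|crit]; first by rewrite km ltnn.
  by rewrite beT; apply: fil_1 => //; apply: (fil_le _ (cw _ _)); rewrite w0.
(* The anticommutator of [ko] and [koh] is |be| - k minus the Euler operator of the y_a, thus m - k
   - w = - N on y-degree w. Hence z has smaller y-degree than c. *)
pose N := (k - m + w)%N; pose z := c *+ N + ko (koh c).
have cMn r al be : (c *+ r) al be = c al be *+ r.
  by elim: r => [|r IHr]; rewrite ?mulr0n // !mulrS chainDE IHr.
have koD := raddfD (homo2 neg_ymul : {additive V -> V}).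
have koB := raddfB (homo2 neg_ymul : {additive V -> V}).
have koMn := raddfMn (homo2 neg_ymul : {additive V -> V}).
have koh0 : koh 0 = 0 := raddf0 (lead2 p : {additive V -> V}).
have kohc0 : koh (ko c) = 0 by rewrite cc koh0.
have zE al be : z al be = c al be *+ N + (c al be *+ #|be| + \sum_a p a (neg_ymul a (c al be))).
  have H := lead2_homo2 neg_ymul_p c al be; rewrite -H -cMn.
  rewrite -[LHS]/((c *+ N) al be + ko (koh c) al be); congr (_ + _).
  by rewrite chainDE kohc0 chain0E add0r.
have kz : ko z = 0.
  have -> : ko z = ko (c *+ N) + ko (ko (koh c)) by exact: koD.
  rewrite ko_ko addr0; have -> : ko (c *+ N) = ko c *+ N by exact: koMn.
  by rewrite cc mul0rn.
have pN a (x : T) : p a (neg_ymul a x) = - (y a * (p a x : A) : A) - x.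
  have -> : p a (neg_ymul a x) = - p a (y a * (x : A) : A) by exact: (raddfN (p a)).
  by rewrite py eqxx opprD.
have zm al be : #|be| != m -> z al be = 0.
  by move=> E; rewrite zE cm // !mul0rn !add0r big1 // => a _; rewrite !raddf0.
have zw al be : fil w (z al be).
  have [E|E] := eqVneq #|be| m; last by rewrite zm.
  have := fil_euler (cw al be); congr (fil _ _).
  rewrite zE (eq_bigr _ (fun a _ => pN a _)) sumrB sumrN sumr_const card_ord.
  rewrite addrA -mulrnDr (_ : (N + #|be|)%N = (w + k)%N).
    by rewrite mulrnDr addrA addrAC addrK.
  rewrite E /N; move: mk; clear; lia.
have zs : cgr s z.
  move=> al be; rewrite -[z al be]/((c *+ N) al be + ko (koh c) al be) cMn; apply: (gradingD GT); last by apply: cgr_ko; apply: cgr_koh.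
  elim: (N) => [|r IHr]; first by rewrite mulr0n; apply: (grading0 GT).
  rewrite (mulrS (c al be)); exact: (gradingD GT (cs al be) IHr).
have zc : (m < k)%N \/ yid (z 0%MM setT).
  case: crit => [|crit]; [by left|right].
  rewrite -[z _ _]/((c *+ N) 0%MM setT + ko (koh c) 0%MM setT) cMn; apply: yidD.
    by elim: (N) => [|r IHr]; rewrite ?mulr0n // mulrS; apply: yidD.
  rewrite /homo2 chain_sumE; elim/big_ind: _ => // a _.
  rewrite /xi in_setT /coef neg_ymulE scaler_sign.
  by case: (sgb _ _); do ?apply: yidN.
have [b bs bE] := IH z zw zm kz zs zc.
exists (alg_scalar A (N%:R^-1) *: (b - koh c)).
  move=> al be; rewrite chainZE.
  apply: (alg_scale_gr _ GT); rewrite chainDE chainNE.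
  by apply: (gradingB GT); [apply: bs|apply: cgr_koh].
rewrite ko_scale; have -> : ko (b - koh c) = c *+ N.
  have -> : ko (b - koh c) = ko b - ko (koh c) by exact: koB.
  by rewrite -bE /z addrK.
have NF : (N%:R : F) != 0 by rewrite -(prednK (_ : 0 < N)%N) ?charF // lt0n.
have E1 : (N%:R^-1 : F) *+ N = 1 by rewrite -[LHS]mulr_natl divff.
by rewrite -scalerMnr scalerMnl -(raddfMn (alg_scalar A)) E1 /= alg_scalar1 scale1r.
Qed.
End KoszulCochains.

Section FlagDiff.
Variables (F : fieldType) (A : gradedAlgebra F) (V : lmodType A^c) (n k : nat).
Variables (G : 'I_k -> 'I_n -> 'I_n -> F) (O : clifford_operators V G).
Lemma flag_diff z : (forall i, opD O i z = 0) -> diff O z = \sum_a opI O a (opY O a z).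
Proof.
move=> z0; rewrite diffE diff1E diff2E diff3E big1 => [|i _]; last by rewrite opD_Z z0 linear0.
rewrite linear0 add0r [X in _ - X]big1 ?subr0 // => a _; rewrite qxE big1 // => i _; rewrite big1 // => j _.
by rewrite opD_X z0 !linear0 scaler0.
Qed.
End FlagDiff.

Section DeltaChains.
Variables (F : fieldType) (A : gradedAlgebra F) (T : gradedModule A) (n k : nat).
Local Notation V := (chain T n k).
Implicit Types (al : 'X_{1..n}) (be : {set 'I_k}) (t : T).

Lemma iota_delta a al be t : iota a (delta al be t) =
  if a \in be then (-1) ^+ sgb a be *: delta al (be :\ a) t else 0 :> V.
Proof.
apply/chainP => al' be'; rewrite /iota /delta.
have [abe|abe] := boolP (a \in be); last first.
  case: ifP => // _; have /negPf -> : a |: be' != be.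
    by apply: contraNneq abe => <-; rewrite setU11.
  by rewrite andbF scaler0.
rewrite chainZE; have [abe'|abe'] := boolP (a \in be').
  have /negPf -> : be' != be :\ a by apply: contraTneq abe' => ->; rewrite !inE eqxx.
  by rewrite andbF scaler0.
have -> : (a |: be' == be) = (be' == be :\ a).
  apply/eqP/eqP => [<-|->]; last by rewrite setD1K.
  by rewrite setU1K.
case: (al' == al) => /=; last by rewrite !scaler0.
have [->|_] := eqVneq be' (be :\ a); last by rewrite !scaler0.
by rewrite sgbD // ltnn.
Qed.

Lemma coef_delta (u : {additive T -> T}) al be t : coef u (delta al be t) = delta al be (u t) :> V.
Proof. by apply/chainP => al' be'; rewrite /coef /delta; case: ifP; rewrite ?raddf0. Qed.

Lemma dx_delta0 i be t : dx i (delta 0%MM be t) = 0 :> V.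
Proof.
apply/chainP => al' be'; rewrite /dx /delta (_ : (_ == _) = false) //.
by apply/eqP => /mnmP /(_ i); rewrite mnmDE mnm1E eqxx addn1 mnm0E.
Qed.

Lemma dx_deltaU i j be t : dx j (delta U_(i)%MM be t) = if i == j then delta 0%MM be t else 0 :> V.
Proof.
apply/chainP => al' be'; rewrite /dx /delta; have [<-|ij] := eqVneq i j.
  rewrite (_ : ((al' + U_(i))%MM == U_(i)%MM) = (al' == 0%MM)) //.
  by rewrite -[X in _ == X]add0m; apply/eqP/eqP => [/addIm|->].
rewrite (_ : (_ == _) = false) //; apply/eqP => /mnmP /(_ j).
by rewrite mnmDE !mnm1E eqxx (negPf ij) addn1.
Qed.

Lemma ix_delta0 i be t : ix i (delta 0%MM be t) = delta U_(i)%MM be t :> V.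
Proof.
apply/chainP => al' be'; rewrite /ix /delta; have [al0|al0] := eqVneq (al' i) 0%N.
  rewrite (_ : (_ == _) = false) //; apply/eqP => /mnmP /(_ i).
  by rewrite al0 mnm1E eqxx.
rewrite (_ : ((al' - U_(i))%MM == 0%MM) = (al' == U_(i)%MM)) //.
apply/eqP/eqP => [E|->]; first by rewrite -(mnm_subUK al0) E add0m.
by apply/mnmP => l; rewrite mnmBE subnn mnm0E.
Qed.

Lemma xi_deltaT a al t : xi a (delta al setT t) = 0 :> V.
Proof.
apply/chainP => al' be'; rewrite /xi /delta; case: ifP => // _.
by rewrite (_ : (_ == setT) = false) ?andbF ?scaler0 //; apply/eqP => /setP /(_ a); rewrite !inE eqxx.
Qed.

Lemma tau_delta al be t : tau (delta al be t) = (-1) ^+ odd #|be| *: delta al be t :> V.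
Proof.
apply/chainP => al' be'; rewrite chainZE /tau /delta; have [->|_] := eqVneq be' be; first by [].
by rewrite andbF !scaler0.
Qed.

Lemma flag_delta (z : V) p : hom_degree p z -> (forall i, dx i z = 0) ->
  z = \sum_(be : {set 'I_k} | #|be| == p) deltaL T 0%MM be (z 0%MM be).
Proof.
move=> zp z0.
have zal al be : al != 0%MM -> z al be = 0.
  move=> al0; have [i ali] : exists i, al i != 0%N.
    apply/existsP; apply: contraNT al0; rewrite negb_exists => /forallP al0.
    by apply/eqP/mnmP => i; have := al0 i; rewrite negbK mnm0E => /eqP.
  have /(congr1 (fun g : V => g (al - U_(i))%MM be)) := z0 i.
  by rewrite /dx mnm_subUK.
apply/chainP => al be; rewrite chain_sumE.
have E al' be' : deltaL T 0%MM be' (z 0%MM be') al' be =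
    delta (n := n) (k := k) 0%MM be' (z 0%MM be') al' be by [].
have [->|al0] := eqVneq al 0%MM; last first.
  by rewrite zal // big1 // => be' _; rewrite E /delta (negPf al0).
have [bp|bp] := eqVneq #|be| p; last first.
  rewrite zp ?mdeg0 ?add0n // big1 // => be' be'p; rewrite E /delta eqxx /=.
  by case: eqP => // be'E; rewrite be'E be'p in bp.
rewrite (bigD1 be) ?bp // big1 => [|be' /andP[_ be'n]].
  by rewrite E /delta !eqxx; exact: esym (addr0 _).
by rewrite E /delta [be == be']eq_sym (negPf be'n) andbF.
Qed.
End DeltaChains.

(** * The residue field: F (x) A as a free module of rank one *)

Section ResidueBasis.
Variables (F : fieldType) (A : gradedAlgebra F).
Local Notation M := (residue_module A).
Definition residue_coord (c : M) : {malg F[unit]} := monalg.mkmalgU tt (c : F).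
Definition residue_one : M := (1 : F).
Fact residue_vec_gr (x : unit) : @gm_gr F A M 0 residue_one. Proof. by left. Qed.
Fact residue_scalar c : alg_scalar A c *: residue_one = (c : F).
Proof. by rewrite -[LHS]/(1 * ga_aug (c%:A : A)) mul1r ga_aug_scalar. Qed.
Fact residue_coordK : cancel residue_coord (malg_lift (alg_scalar A) (fun _ : unit => residue_one)).
Proof. by move=> c; rewrite malg_liftU residue_scalar. Qed.
Fact residue_vecK : cancel (malg_lift (alg_scalar A) (fun _ : unit => residue_one)) residue_coord.
Proof.
apply: malg_ind => [s t sE tE||c []].
- rewrite raddfD -{2}sE -{2}tE /residue_coord; exact: (raddfD (monalg.mkmalgU tt)).
- by rewrite raddf0; exact: (raddf0 (monalg.mkmalgU tt)).
- by rewrite malg_liftU residue_scalar.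
Qed.
Definition residue_basis : homogeneous_basis M :=
  @HBasis F A M unit (fun=> residue_one) (fun=> 0) residue_coord residue_vec_gr residue_coordK residue_vecK.

Local Notation T := (tens residue_basis).
Definition res_gen : T := tens1 residue_basis residue_one.
Lemma res_genE : res_gen = free_gen A tt. Proof. exact: (@tens1_vec _ _ _ residue_basis tt). Qed.
Lemma res_gen_gr : @gm_gr F A T 0 res_gen. Proof. by apply: tens1_gr; left. Qed.
Lemma res_span (t : T) : exists c : A^c, t = c *: res_gen.
Proof.
rewrite res_genE; elim/free_ind: t => [s t [c ->] [c' ->]||c []].
- by exists (c + c'); rewrite scalerDl.
- by exists 0; rewrite scale0r.
- by exists c.
Qed.
(** The right action on the residue field factors through the augmentation. Hence [ad_e] and [ad_y]
    send the generator of F (x) A to its multiples by e_i and y_a. *)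
Lemma res_right (z : A) : ga_aug z = 0 -> tens_right residue_basis z res_gen = 0.
Proof.
move=> z0; rewrite tens_right1 -[X in tens1 _ X]/((1 : F) * ga_aug z) z0 mulr0.
exact: F_linear0 (@tens1_linear _ _ _ residue_basis).
Qed.
Variables (n k : nat) (e : 'I_n -> A) (y : 'I_k -> A).
Hypothesis e_gr : forall i, ga_gr 1 (e i).
Hypothesis y_gr : forall a, ga_gr 2 (y a).
Lemma res_ad_e i : ad_e e residue_basis i res_gen = (e i : A^c) *: res_gen.
Proof.
have E : tens_sign residue_basis res_gen = res_gen.
  have H : @gm_gr F A M 0 residue_one by left.
  by rewrite (tens_sign1 _ H) expr0 scale1r.
rewrite ad_eE E tens_left1.
by rewrite res_right ?subr0 //; apply: (ga_aug_pos (i := 0)).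
Qed.
Lemma res_ad_y a : ad_y y residue_basis a res_gen = (y a : A^c) *: res_gen.
Proof. by rewrite ad_yE tens_left1 res_right ?subr0 //; apply: (ga_aug_pos (i := 1)). Qed.
Definition res_lift (N : lmodType A^c) (v : N) : {linear T -> N} := free_lift (fun _ : unit => v).
Lemma res_liftE (N : lmodType A^c) (v : N) : res_lift v res_gen = v.
Proof. by rewrite res_genE; apply: free_lift_gen. Qed.
Lemma res_lift_gr (N : gradedModule A) (v : N) s : gm_gr s v ->
  forall t x, @gm_gr F A T t x -> gm_gr (t + s) (res_lift v x).
Proof.
move=> vs t x xt; apply: (free_lift_gr (gm_grading N) _ xt) => z; by rewrite add0r.
Qed.
End ResidueBasis.

(** * The Gorenstein property *)

Section GorensteinProperty.
Variables (F : fieldType) (A : gradedAlgebra F) (n k : nat).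
Variables (e : 'I_n -> A) (y : 'I_k -> A) (G : 'I_k -> 'I_n -> 'I_n -> F).
Hypothesis e_gr : forall i, ga_gr 1 (e i).
Hypothesis y_gr : forall a, ga_gr 2 (y a).
Hypothesis ee : forall i j, e i * e j + e j * e i = (\sum_a G a i j *: y a) *+ 2.
Hypothesis y_central : forall a x, x * y a = y a * x.
Hypothesis charF : forall m, (m.+1%:R : F) != 0.
Hypothesis k_gt0 : (0 < k)%N.
Variable W : pbw_structure e y.
Local Notation M := (residue_module A).
Local Notation RM := (regular_module A).
Local Notation B := (residue_basis A).
Local Notation T := (tens B).
Local Notation V := (chain T n k).
Local Notation ops := (koszul_ops e_gr y_gr ee y_central B).
Local Notation d := (koszul_d e_gr y_gr ee y_central B).
Local Notation CG := (koszul_gradings e_gr y_gr ee y_central B).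
Local Notation gr := (@chain_gr F A T n k).
Local Notation gen := (res_gen A).
Let F2 : (2 : F) != 0 := charF 1.

Variable yid : A -> Prop.
Hypothesis yid0 : yid (0 : A).
Hypothesis yidD : forall x z, yid x -> yid z -> yid (x + z).
Hypothesis yidN : forall x, yid x -> yid (- x).
Hypothesis yid_y : forall a x, yid (y a * x).
Local Notation ko := (homo2 (neg_ymul y) : chain (A^c)^o 0 k -> chain (A^c)^o 0 k).
Hypothesis cochain_exact : forall s m (c : chain (A^c)^o 0 k), (m <= k)%N ->
  (forall al (be : {set 'I_k}), #|be| != m -> c al be = 0) -> ko c = 0 -> cgr s c ->
  (m < k)%N \/ yid (c 0%MM setT) -> exists2 b, cgr s b & c = ko b.

Variables (top : A) (topc : A -> F).
Hypothesis top_gr : ga_gr n top.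
Hypothesis topcZ : forall (c : F) x z, topc (c *: x + z) = c * topc x + topc z.
Hypothesis topc_top : topc top = 1.
Hypothesis topc_yid : forall x : A, yid x -> topc x = 0.
Hypothesis topc_gr : forall t (x : A), @gm_gr F A RM t x -> topc x != 0 -> t = n%:Z.
Hypothesis top_e : forall i, yid (top * e i).
Hypothesis socle : forall x : A, (forall i, yid (x * e i)) -> topc x = 0 -> yid x.

Implicit Types (phi psi : {linear V -> RM}) (be : {set 'I_k}).

Definition gdelta be : V := delta 0%MM be gen.
Definition g0 : V := gdelta setT.

Lemma gdelta_deg be : hom_degree #|be| (gdelta be).
Proof. by apply: delta_hom_degree; rewrite mdeg0. Qed.
Lemma gdelta_gr be : gr (2 * #|be|%:Z) (gdelta be).
Proof.
have := delta_gr (n := n) (k := k) 0%MM be (@res_gen_gr F A); rewrite /delta_deg mdeg0 addr0.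
by rewrite [0%:Z + _]add0r.
Qed.
Lemma d_sum phi z : (forall i, dx i z = 0) ->
  phi (d z) = \sum_a phi (iota a (coef (ad_y y B a) z)).
Proof.
move=> z0; rewrite koszul_dE.
have -> : diff ops z = \sum_a iota a (coef (ad_y y B a) z) by exact: (flag_diff (O := ops) z0).
exact: (linear_sum phi).
Qed.

Lemma phi_iota_delta phi al a be : phi (iota a (coef (ad_y y B a) (delta al be gen))) =
  if a \in be then (-1) ^+ sgb a be *: (y a * (phi (delta al (be :\ a) gen) : A) : RM) else 0.
Proof.
have -> : coef (ad_y y B a) (delta al be gen) = delta al be (ad_y y B a gen) :> V by exact: coef_delta.
rewrite (iota_delta (n := n)); case: ifP => _; last exact: linear0.
rewrite (linearZ_LR phi) (res_ad_y y_gr); congr (_ *: _).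
have -> : delta al (be :\ a) ((y a : A^c) *: gen) = (y a : A^c) *: (delta al (be :\ a) gen : V).
  exact: (linearZ_LR (deltaL T (k := k) al (be :\ a))).
rewrite (linearZ_LR phi) -[LHS]/((phi (delta al (be :\ a) gen) : A) * y a).
exact: y_central.
Qed.

Lemma d_gdelta phi be : phi (d (gdelta be)) =
  \sum_(a in be) (-1) ^+ sgb a be *: (y a * (phi (gdelta (be :\ a)) : A) : RM).
Proof.
rewrite d_sum => [|i]; last exact: dx_delta0.
by rewrite [RHS]big_mkcond; apply: eq_bigr => a _; apply: phi_iota_delta.
Qed.

Lemma ko_gdelta (c : chain (A^c)^o 0 k) be : ko c 0%MM be =
  - \sum_(a in be) (-1) ^+ sgb a be *: (y a * (c 0%MM (be :\ a) : A) : RM).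
Proof.
rewrite /homo2 chain_sumE -sumrN [RHS]big_mkcond; apply: eq_bigr => a _.
by rewrite /xi; case: ifP => // _; rewrite /coef neg_ymulE scalerN.
Qed.

(** A cochain on the common kernel of the d/dx_i is the family of its values at the xi_be, and
    composition with d becomes the Koszul cochain differential of the y_a up to sign. The family is
    encoded as a chain without x-variables. *)
Lemma flag_exact s m phi : (m <= k)%N -> of_degree gr s phi ->
  (forall z, hom_degree m.+1 z -> (forall i, dx i z = 0) -> phi (d z) = 0) ->
  (m < k)%N \/ yid (phi g0) ->
  exists psi, of_degree gr s psi /\
    forall z, hom_degree m z -> (forall i, dx i z = 0) -> phi z = psi (d z).
Proof.
move=> mk phis phic crit.
pose c : chain (A^c)^o 0 k := fun _ be => if #|be| == m then phi (gdelta be) else 0.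
have [||||b bs bE] := @cochain_exact s m c mk.
- by move=> al be /negPf E; rewrite /c E.
- apply/chainP => al be; have -> : al = 0%MM by apply/mnmP => -[].
  rewrite ko_gdelta chain0E; have [E|E] := eqVneq #|be| m.+1.
    have := phic (gdelta be); rewrite d_gdelta => H; apply/eqP; rewrite oppr_eq0; apply/eqP.
    rewrite -[RHS]H -?E; [|exact: gdelta_deg|by move=> i; apply: dx_delta0].
    apply: eq_bigr => a abe; congr (_ *: (_ * _)); rewrite /c.
    by move: E; rewrite (cardsD1 a be) abe add1n => -[->]; rewrite eqxx.
  rewrite big1 ?oppr0 // => a abe; rewrite /c.
  have /negPf -> : #|be :\ a| != m by move: E; rewrite (cardsD1 a be) abe add1n eqSS.
  by rewrite mulr0 scaler0.
- move=> al be; rewrite /c; case: eqP => _; last exact: (grading0 (gm_grading RM)).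
  by have := phis _ _ (gdelta_gr be); rewrite addrC.
- case: crit => [mk'|crit]; [by left|right]; rewrite /c; case: eqP => // _; exact: crit.
(* The minus sign offsets the one in [ko], which multiplies by the - y_a. *)
have psil : linear (fun z : V => - \sum_be res_lift (b 0%MM be) (z 0%MM be) : RM).
  move=> l z z'; rewrite scalerN -opprD scaler_sumr -big_split; congr (- _).
  by apply: eq_bigr => be _; rewrite chainDE chainZE (linearP (res_lift _)).
exists (linear_of psil); split=> [t z zt|z zm z0].
  apply: (gradingN (gm_grading RM)); apply: (grading_sum (gm_grading RM)) => be _.
  have := res_lift_gr (N := RM) (bs 0%MM be) (zt 0%MM be).
  by rewrite mdeg0; congr (gm_gr _ _); move: #|be| => r; lia.
rewrite {1 2}(flag_delta zm z0) (linear_sum d) (linear_sum phi) (linear_sum (linear_of psil)).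
apply: eq_bigr => be /eqP bem; have [l ->] := res_span (z 0%MM be).
rewrite (linearZ_LR (deltaL _ _ _)) (linearZ_LR d) (linearZ_LR phi) (linearZ_LR (linear_of psil)).
congr (_ *: _); rewrite -[deltaL _ _ _ gen]/(gdelta be) d_gdelta.
have -> : phi (gdelta be) = c 0%MM be by rewrite /c bem eqxx.
rewrite bE ko_gdelta -sumrN; apply: eq_bigr => a _; rewrite -scalerN; congr (_ *: _).
rewrite -[RHS]/(y a * (- \sum_be' res_lift (b 0%MM be') (gdelta (be :\ a) 0%MM be'))).
rewrite mulrN; congr (- (_ * _)); rewrite (bigD1 (be :\ a)) //= big1 ?addr0 => [|be' be'n].
  by rewrite /gdelta /delta !eqxx res_liftE.
by rewrite /gdelta /delta eqxx /= (negPf be'n) linear0.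
Qed.

(** In d (x_i xi_1 ... xi_k) the bracket term is zero, as no further xi_a fits; the terms in the y_a
    fall into the ideal; and the term in e_i leaves a multiple of g0. This yields both the
    obstruction to extending a class given at g0 and the condition that a cocycle satisfies
    there. *)
Lemma d_ix_g0 phi i : yid (phi (d (ix i g0)) - (-1) ^+ odd k *: (((phi g0 : A) * e i : A) : RM)).
Proof.
rewrite koszul_dE diffE.
have E0 : ix i g0 = delta U_(i)%MM setT gen by exact: ix_delta0.
have E3 : diff3 ops (ix i g0) = 0.
  rewrite diff3E big1 // => a _; rewrite E0.
  have -> : opX ops a (delta U_(i)%MM setT gen) = 0 by exact: xi_deltaT.
  exact: linear0.
have E1 : phi (diff1 ops (ix i g0)) = (-1) ^+ odd k *: (((phi g0 : A) * e i : A) : RM).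
  have -> : diff1 ops (ix i g0) = tau (delta 0%MM setT ((e i : A^c) *: gen)).
    rewrite diff1E; congr (opT ops _); rewrite (bigD1 i) //= E0.
    have H j : opD ops j (opZ ops j (delta U_(i)%MM setT gen)) = if i == j then delta 0%MM setT (ad_e e B j gen) else 0.
      have -> : opZ ops j (delta U_(i)%MM setT gen) = delta U_(i)%MM setT (ad_e e B j gen) by exact: coef_delta.
      exact: dx_deltaU.
    rewrite H eqxx (res_ad_e e_gr) big1 ?addr0 // => j /negPf ji; by rewrite H eq_sym ji.
  rewrite tau_delta cardsT card_ord (linearZ_LR phi); congr (_ *: _).
  have -> : delta 0%MM setT ((e i : A^c) *: gen) = (e i : A^c) *: g0.
    exact: (linearZ_LR (deltaL T (k := k) 0%MM setT)).
  exact: (linearZ_LR phi).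
rewrite E3 subr0 (linearD phi) E1 addrAC subrr add0r diff2E (linear_sum phi) E0.
elim/big_ind: _ => // a _; have := phi_iota_delta phi U_(i)%MM a setT; rewrite in_setT => H.
rewrite [X in yid X]H scaler_sign; by case: ifP => _; [apply: yidN|]; apply: yid_y.
Qed.

Lemma yid_sign (b : bool) (x : RM) : yid ((-1) ^+ b *: x) <-> yid x.
Proof.
rewrite scaler_sign; case: b => //; split; last exact: yidN.
by move/yidN; rewrite opprK.
Qed.

Lemma low_base s m phi : (m < k)%N -> of_degree gr s phi ->
  closed_on ops (@hom_degree F A T n k) n m phi -> exact_on ops (@hom_degree F A T n k) gr s n m phi.
Proof.
move=> mk phis phic; have [|psi [psis psiE]] := flag_exact (ltnW mk) phis _ (or_introl mk).
  by move=> z zm z0; apply: phic => // i _; apply: z0.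
by exists psi; split=> // z zm z0; apply: psiE => // i; apply: z0; apply: ltn_ord.
Qed.

Lemma top_base s phi : of_degree gr s phi -> yid (phi g0) ->
  exact_on ops (@hom_degree F A T n k) gr s n k phi.
Proof.
move=> phis crit; have [|psi [psis psiE]] := flag_exact (leqnn k) phis _ (or_intror crit).
  by move=> z zm z0; rewrite (W_top CG (ltnSn k) zm z0) !linear0.
by exists psi; split=> // z zm z0; apply: psiE => // i; apply: z0; apply: ltn_ord.
Qed.

Lemma g0_dx i : dx i g0 = 0. Proof. exact: dx_delta0. Qed.

Lemma top_gen : exists phi, of_degree gr (n%:Z - 2 * k%:Z) phi /\ phi g0 = (top : RM).
Proof.
have ul : linear (fun z : V => res_lift (top : RM) (z 0%MM setT)).
  by move=> l z z'; rewrite chainDE chainZE (linearP (res_lift _)).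
exists (linear_of ul); split=> [t z zt|]; last first.
  by rewrite -[LHS]/(res_lift (top : RM) (delta 0%MM setT gen 0%MM setT)) /delta !eqxx res_liftE.
have := res_lift_gr (N := RM) (v := top) (s := n%:Z) top_gr (zt 0%MM setT).
by rewrite mdeg0 cardsT card_ord; congr (gm_gr _ _); lia.
Qed.

(** The obstructions met by [top_class] are the products of [top] with the e_i modulo the y_a, and
    these vanish. The degree is n, that of the top form, minus 2k, that of g0. *)
Lemma fundamental_class : exists phi, [/\ of_degree gr (n%:Z - 2 * k%:Z) phi,
  forall z, hom_degree k.+1 z -> phi (d z) = 0 & phi g0 = (top : RM)].
Proof.
have [||phi [phis phic phiE]] := @top_class F A V n k G ops _ _ _ CG F2 RM g0 yid (top : RM) k_gt0
    low_base top_base (fun i => g0_dx i) (n%:Z - 2 * k%:Z).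
- move=> phi i phiE.
  have := yidD (d_ix_g0 phi i) (proj2 (yid_sign (odd k) _) (top_e i)).
  by rewrite phiE subrK.
- exact: top_gen.
by exists phi; split=> // z zk; apply: phic.
Qed.

Variables (p : nat) (r : 'I_n -> 'I_k -> {mpoly F[n]}).
Hypothesis rp : forall i a, r i a \is p.-homog.
Hypothesis rE : forall i, 'X_i ^+ p.+2 = \sum_a r i a * quadric G a.

Lemma koszul_exact_on s m phi : of_degree gr s phi ->
  (forall z, hom_degree m.+1 z -> phi (d z) = 0) -> (m = k -> yid (phi g0)) ->
  exists psi, of_degree gr s psi /\ forall z, hom_degree m z -> phi z = psi (d z).
Proof.
move=> phis phic crit.
have phic' : closed_on ops (@hom_degree F A T n k) 0 m phi by move=> z zm _; apply: phic.
suff [psi [psis psiE]] : exact_on ops (@hom_degree F A T n k) gr s 0 m phi.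
  by exists psi; split=> // z zm; apply: psiE.
case: (ltngtP m k) => mk.
- exact: (low_exact CG F2 low_base (leq0n n) mk phis phic').
- exact: (high_exact CG F2 (poly_act_nilp _ _ _ rp rE) (leq0n n) mk phis phic').
- subst m; exact: (top_exact CG F2 k_gt0 low_base top_base (leq0n n) phis phic' (crit erefl)).
Qed.

Local Notation P := (koszul_resolution e_gr y_gr ee y_central charF W B).

Lemma trunc_ker m z : hom_ker m (zeroL T n k) (truncL T n k m z).
Proof. by split; [apply: trunc_deg|]. Qed.
(** The resolution consists of submodules of chains, while exactness is proved for maps on all
    chains; truncation to degree m mediates between them. The explicit proof term matches the one
    inside [full_resolution], to which P m unfolds. *)
Definition ker_trunc m (z : V) : P m := gsub_in (chain_grading T n k)
  (hom_ker_graded m (fun t f (_ : chain_gr t f) => grading0 (chain_grading T n k) t : chain_gr t (zeroL T n k f)))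
  (trunc_ker m z).
Fact ker_extend_linear (N : lmodType A^c) m (f : {linear P m -> N}) : linear (fun z : V => f (ker_trunc m z)).
Proof.
move=> l z z'; rewrite -(linearP f); congr (f _); apply: val_inj.
exact: (linearP (truncL T n k m)).
Qed.
Definition ker_extend m (N : lmodType A^c) (f : {linear P m -> N}) : {linear V -> N} := linear_of (ker_extend_linear f).
Definition pval m (x : P m) : V := gval x.
Lemma pval_deg m (x : P m) : hom_degree m (pval x). Proof. by have [] := gval_P x. Qed.
Lemma ker_truncK m (x : P m) : ker_trunc m (pval x) = x.
Proof. by apply: val_inj; apply: trunc_id; apply: pval_deg. Qed.
Lemma ker_extendE m (N : lmodType A^c) (f : {linear P m -> N}) x : ker_extend f (pval x) = f x.
Proof. by rewrite -[LHS]/(f (ker_trunc m (pval x))) ker_truncK. Qed.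
Lemma ker_diff_trunc m z : hom_degree m.+1 z -> pr_diff P m (ker_trunc m.+1 z) = ker_trunc m (d z).
Proof.
move=> zm; apply: val_inj; rewrite -[LHS]/(d (truncL T n k m.+1 z)) -[RHS]/(truncL T n k m (d z)).
by rewrite !trunc_id //; apply: koszul_d_deg.
Qed.

Lemma ext_degree m j (f : {linear P m -> gm_shift RM j}) : graded_map f ->
  of_degree gr j (ker_extend f : {linear V -> RM}).
Proof. by move=> fg t z zt; rewrite addrC; apply: fg; apply: trunc_gr. Qed.

Lemma cocycle_coboundary m j (f : {linear P m -> gm_shift RM j}) : cocycle f ->
  (m = k -> yid (ker_extend f g0 : A)) -> coboundary f.
Proof.
move=> [fg fc] crit.
have [|psi [psis psiE]] := @koszul_exact_on j m (ker_extend f : {linear V -> RM}) (ext_degree fg) _ crit.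
- move=> z zm; have := fc (ker_trunc m.+1 z); rewrite ker_diff_trunc //.
have fE x : f x = psi (d (pval x)) by rewrite -psiE ?ker_extendE //; apply: pval_deg.
case: m f fg fc crit psiE fE => [|m] f fg fc crit psiE fE.
  move=> x; rewrite fE koszul_dE.
  have -> : diff ops (pval x) = 0 by apply: hom_degree_diff0; apply: pval_deg.
  exact: linear0.
have gl : linear (fun x : P m => psi (pval x) : gm_shift RM j) by move=> c x z; rewrite -(linearP psi).
exists (linear_of gl); split=> [t x xt|x]; last exact: fE.
by rewrite /gm_gr /= /shift_gr addrC; apply: psis.
Qed.

Lemma coboundary_yid m j (f : {linear P m.+1 -> gm_shift RM j}) : hom_degree m.+1 g0 ->
  coboundary f -> yid (ker_extend f g0 : A).
Proof.
move=> g0m [g [_ gE]].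
have -> : ker_extend f g0 = ker_extend g (d g0).
  by rewrite -[LHS]/(f (ker_trunc m.+1 g0)) gE ker_diff_trunc.
have := d_gdelta (ker_extend g : {linear V -> RM}) setT; rewrite -/g0 => H.
rewrite [X in yid X]H; elim/big_ind: _ => // a _.
by apply/yid_sign; apply: yid_y.
Qed.

Lemma scalar_topc (c : F) (x z : RM) : topc (alg_scalar A c *: x + z) = c * topc x + topc z.
Proof. by rewrite -[_ *: x]/((x : A) * (c%:A : A)) mulr_algr topcZ. Qed.

Theorem koszul_Gorenstein : Gorenstein A k ((2 * k)%:Z - n%:Z).
Proof.
exists P => m j; have [mk|mk] := eqVneq m k; last first.
  exists (fun=> 0); split.
  - by move=> *; rewrite scaler0 addr0.
  - move=> f fc; split=> // _; apply: cocycle_coboundary => // mk'; by rewrite mk' eqxx in mk.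
  - move=> t; split=> [->|[f [_ <-]] //].
    have zl : linear (fun _ : P m => 0 : gm_shift RM j) by move=> c x z; rewrite scaler0 addr0.
    exists (linear_of zl); split=> //; split=> // t' x _; exact: (grading0 (gm_grading (gm_shift RM j))).
have g0m : hom_degree m g0 by have := @gdelta_deg setT; rewrite cardsT card_ord mk.
have g0s : gr (2 * k%:Z) g0 by have := @gdelta_gr setT; rewrite cardsT card_ord.
(* The class of a cocycle of degree k is determined by its value at g0 modulo the y_a. That value
   lies in the socle of the exterior algebra, so its top coefficient is a complete invariant. *)
exists (fun f : {linear P m -> gm_shift RM j} => topc (ker_extend f g0 : A)); split.
- move=> c f g h _ _ _ hE; rewrite -[LHS]/(topc (h (ker_trunc m g0) : A)) hE.
  exact: scalar_topc.
- move=> f fc; split=> [f0|].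
    (* Closedness at x_i g0 says that the value at g0 times e_i lies in the ideal of the y_a. *)
    apply: cocycle_coboundary => // _; apply: socle => // i.
    have := d_ix_g0 (ker_extend f : {linear V -> RM}) i.
    have -> : (ker_extend f : {linear V -> RM}) (d (ix i g0)) = 0.
      have xm : hom_degree m.+1 (ix i g0) by apply: hom_degree_ix.
      by have [_ /(_ (ker_trunc m.+1 (ix i g0)))] := fc; rewrite ker_diff_trunc.
    rewrite sub0r => /yidN; rewrite opprK => /yid_sign; exact.
  move=> fb; apply: topc_yid.
  have [q qm] : exists q, m = q.+1 by exists m.-1; rewrite prednK // mk.
  move: f {fc} fb; rewrite qm => f; apply: coboundary_yid; by rewrite -qm.
- move=> t; split=> [tj|[f [[fg fc] <-]]].
    have [phi [phis phic phiE]] := fundamental_class.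
    have fl : linear (fun x : P m => alg_scalar A t *: phi (pval x) : gm_shift RM j).
      move=> c x z; rewrite -[pval _]/(c *: pval x + pval z) (linearP phi).
      by rewrite (scalerDr (alg_scalar A t)) alg_scaleC.
    exists (linear_of fl); split; first split.
    + move=> t' x xt; case: tj => [tj|t0]; last first.
        rewrite -[linear_of fl x]/(alg_scalar A t *: phi (pval x)) t0 (raddf0 (alg_scalar A)) scale0r.
        exact: (grading0 (gm_grading (gm_shift RM j))).
      apply: (alg_scale_gr _ (gm_grading (gm_shift RM j))); have H := phis _ _ xt.
      have E : t' + (n%:Z - 2 * k%:Z) = j + t' by move: tj; rewrite PoszM; lia.
      rewrite E in H; exact: H.
    + move=> x; rewrite -[LHS]/(alg_scalar A t *: phi (d (pval x))) phic ?scaler0 //.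
      by move: (pval x) (pval_deg x) => z; rewrite mk.
    rewrite -[LHS]/(topc (alg_scalar A t *: phi (truncL T n k m g0))) trunc_id // phiE.
    by have := scalar_topc t (top : RM) 0; rewrite addr0 topc_top mulr1 (topc_yid yid0) addr0.
  (* As g0 has degree 2k, a nonzero top coefficient forces j + 2k = n, the only degree in which the
     shifted residue field is nonzero. *)
  have [-> |t0] := eqVneq (topc (ker_extend f g0 : A)) 0; [by right|left].
  have := topc_gr (ext_degree fg g0s) t0; lia.
Qed.
End GorensteinProperty.

(** * Quadrics without common zeros *)

Section LinearAlgebraFacts.
Variable L : fieldType.

(** Among the matrices whose rows span a part of P, one of maximal rank works: joining a further
    vector of P cannot raise the rank. *)
Lemma subspace_mx N (P : 'rV[L]_N -> Prop) : P 0 ->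
  (forall c u v, P u -> P v -> P (c *: u + v)) ->
  exists A : 'M[L]_N, forall u, P u <-> (u <= A)%MS.
Proof.
move=> P0 PD.
pose Q r := `[< exists2 A : 'M[L]_N, (forall u, (u <= A)%MS -> P u) & \rank A = r >].
have Q0 : exists r, Q r.
  exists 0%N; apply/asboolP; exists 0; last exact: mxrank0.
  by move=> u; rewrite submx0 => /eqP ->.
have Qb r : Q r -> (r <= N)%N by move=> /asboolP [A _ <-]; apply: rank_leq_row.
case: (ex_maxnP Q0 Qb) => r /asboolP [A AP Ar] rmax.
exists A => u; split=> [Pu|]; last exact: AP.
have H : (\rank (A + u)%MS <= \rank A)%N.
  rewrite Ar; apply: rmax; apply/asboolP; exists (A + u)%MS => // v /sub_addsmxP [[x c] /= ->].
  have -> : c *m u = c 0 0 *: u.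
    by rewrite [c]mx11_scalar mul_scalar_mx mxE eqxx mulr1n.
  by rewrite addrC; apply: PD => //; apply: AP; apply: submxMl.
have := mxrank_leqif_sup (addsmxSl A u); rewrite /leqif eqn_leq H => -[-> /esym].
by rewrite addsmx_sub => /andP[].
Qed.
End LinearAlgebraFacts.

Section CommonEigenvector.
Variable L : closedFieldType.

Lemma stable_eigenvector r (U A : 'M[L]_r) : U != 0 -> (U *m A <= U)%MS ->
  exists a, (U :&: eigenspace A a)%MS != 0.
Proof.
move=> U0 UA; pose B := row_base U.
have /submxP [C CE] : (B *m A <= B)%MS.
  by rewrite eq_row_base (eqmxMr _ (eq_row_base U)).
have /closed_rootP [a Ca] : size (char_poly C) != 1%N.
  by rewrite size_char_poly eqSS mxrank_eq0.
rewrite -eigenvalue_root_char in Ca; have /eigenvalueP [v vC v0] := Ca.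
exists a; apply/eqP => E; have : (v *m B <= U :&: eigenspace A a)%MS.
  rewrite sub_capmx -(eq_row_base U) submxMl; apply/eigenspaceP.
  by rewrite -mulmxA CE mulmxA vC scalemxAl.
by rewrite E submx0 mulmx_free_eq0 ?row_base_free // (negPf v0).
Qed.

(** The space is cut down to an eigenspace of one operator after another; commutation keeps it
    stable under all of them. *)
Lemma commuting_eigenvector m r (C : 'I_m -> 'M[L]_r) : (0 < r)%N ->
  (forall i j, C i *m C j = C j *m C i) ->
  exists (v : 'rV[L]_r) (l : 'I_m -> L), v != 0 /\ forall i, v *m C i = l i *: v.
Proof.
move=> r0 CC.
have [U [U0 _ UE]] : exists U : 'M[L]_r, [/\ U != 0, forall i, (U *m C i <= U)%MS &
    forall i, i \in enum 'I_m -> exists a, (U <= eigenspace (C i) a)%MS].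
  elim: (enum 'I_m) => [|i s [U [U0 US UE]]].
    exists 1%:M; split=> // [|i]; last exact: submx1.
    by rewrite -mxrank_eq0 mxrank1 -lt0n.
  have [a Ua] := stable_eigenvector U0 (US i).
  exists (U :&: eigenspace (C i) a)%MS; split=> // [j|j].
    rewrite sub_capmx (submx_trans (submxMr _ (capmxSl _ _)) (US j)) /=.
    apply/eigenspaceP; rewrite -mulmxA CC mulmxA.
    have /eigenspaceP -> := capmxSr U (eigenspace (C i) a).
    by rewrite scalemxAl.
  rewrite inE => /orP[/eqP -> |/UE [b Ub]]; first by exists a; apply: capmxSr.
  by exists b; apply: submx_trans (capmxSl _ _) Ub.
have /choice [l lE] i : exists a, (U <= eigenspace (C i) a)%MS by apply: UE; rewrite mem_enum.
have /rowV0Pn [v vU v0] := U0.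
by exists v, l; split=> // i; apply/eigenspaceP; apply: submx_trans vU (lE i).
Qed.
End CommonEigenvector.

(* A projective Nullstellensatz for quadrics, by Macaulay's inverse systems: [invsys m d]
   is the dual of the degree d part of the quotient by the quadrics and x_m, ..., x_(n-1). *)
Section InverseSystems.
Variables (L : closedFieldType) (n k : nat) (g : 'I_k -> 'I_n -> 'I_n -> L).
Implicit Types (h : 'X_{1..n} -> L) (al : 'X_{1..n}).
Hypothesis no_zero : forall x : 'I_n -> L,
  (forall a, \sum_i \sum_j g a i j * x i * x j = 0) -> forall i, x i = 0.

Definition invsys (m d : nat) h := [/\ forall al, mdeg al != d -> h al = 0,
  forall a al, \sum_i \sum_j g a i j * h (al + U_(i) + U_(j))%MM = 0 &
  forall i : 'I_n, (m <= i)%N -> forall al, h (al + U_(i))%MM = 0].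
Definition D (i : 'I_n) h : 'X_{1..n} -> L := fun al => h (al + U_(i))%MM.

Lemma invsys_D m d i h : invsys m d.+1 h -> invsys m d (D i h).
Proof.
move=> [h1 h2 h3]; split=> [al E|a al|j mj al]; rewrite /D.
- by apply: h1; rewrite mdegD mdeg1 addn1.
- rewrite -[RHS](h2 a (al + U_(i))%MM); apply: eq_bigr => j _; apply: eq_bigr => l _.
  by rewrite (mnm_addAC _ U_(l)%MM) (mnm_addAC al).
- by rewrite mnm_addAC h3.
Qed.
Lemma invsys0 m d : invsys m d (fun=> 0).
Proof. by split=> // a al; rewrite big1 // => i _; rewrite big1 // => j _; rewrite mulr0. Qed.
Lemma invsys_lin m d c h h' : invsys m d h -> invsys m d h' -> invsys m d (fun al => c * h al + h' al).
Proof.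
move=> [h1 h2 h3] [h1' h2' h3']; split=> [al E|a al|j mj al].
- by rewrite h1 // h1' // mulr0 addr0.
- under eq_bigr => i _ do under eq_bigr => j _ do rewrite mulrDr mulrCA.
  under eq_bigr => i _ do rewrite big_split -mulr_sumr.
  by rewrite big_split -mulr_sumr /= h2 h2' mulr0 addr0.
- by rewrite h3 // h3' // mulr0 addr0.
Qed.
Lemma invsys_sum m d (r : nat) (c : 'I_r -> L) (h : 'I_r -> 'X_{1..n} -> L) : (forall l, invsys m d (h l)) ->
  invsys m d (fun al => \sum_l c l * h l al).
Proof.
move=> H; elim: (index_enum _) => [|l s IH].
  have -> : (fun al => \sum_(l <- [::]) c l * h l al) = (fun=> 0) by apply: funext => al; rewrite big_nil.
  exact: invsys0.
have -> : (fun al => \sum_(i <- l :: s) c i * h i al) = (fun al => c l * h l al + \sum_(i <- s) c i * h i al).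
  by apply: funext => al; rewrite big_cons.
exact: invsys_lin.
Qed.
Lemma invsys_eq0 m d h : invsys m d.+1 h -> (forall i al, D i h al = 0) -> forall al, h al = 0.
Proof.
move=> [h1 _ _] Dh al; have [E|E] := eqVneq (mdeg al) d.+1; last exact: h1.
have [i ali] : exists i, al i != 0%N.
  apply/existsP; move: E; apply: contra_eqT; rewrite negb_exists => /forallP al0.
  by rewrite mdegE big1 // => i _; have := al0 i; rewrite negbK => /eqP.
by have := Dh i (al - U_(i))%MM; rewrite /D mnm_subUK.
Qed.
Lemma D_comm i j h : D i (D j h) = D j (D i h).
Proof. by apply: funext => al; rewrite /D mnm_addAC. Qed.

Section Step.
Variables (m : nat) (i0 : 'I_n) (i0E : m = i0) (d0 : nat).
Hypothesis IH : forall d h, (d0 <= d)%N -> invsys m d h -> forall al, h al = 0.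
Hypothesis nonzero : forall d, exists2 h, invsys m.+1 d h & exists al, h al != 0.
Local Notation f := (D i0).

(** A functional of [invsys m.+1] killed by f lies in [invsys m], which is zero from degree d0
    on. *)
Lemma f_inj d h : (d0 <= d.+1)%N -> invsys m.+1 d.+1 h -> (forall al, f h al = 0) -> forall al, h al = 0.
Proof.
move=> dd [h1 h2 h3] fh; apply: (IH dd); split=> // i mi al.
have [->|ii0] := eqVneq i i0; first exact: fh.
by apply: h3; rewrite ltn_neqAle mi andbT i0E; apply: contraNneq ii0 => E; apply/eqP/val_inj.
Qed.

Lemma f_inj2 d h h' : (d0 <= d.+1)%N -> invsys m.+1 d.+1 h -> invsys m.+1 d.+1 h' ->
  (forall al, f h al = f h' al) -> h = h'.
Proof.
move=> dd hi hi' ff; pose w al := -1 * h' al + h al.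
have w0 : forall al, w al = 0.
  apply: (@f_inj d w dd); first exact: invsys_lin.
  by move=> be; have := ff be; rewrite /D /w => ->; rewrite mulN1r addNr.
by apply: funext => al; have /eqP := w0 al; rewrite /w mulN1r addrC subr_eq0 => /eqP.
Qed.

Lemma invsys_iter r d h : invsys m.+1 (d + r) h -> invsys m.+1 d (iter r f h).
Proof.
elim: r d h => [|r IHr] d h; first by rewrite addn0.
by rewrite addnS => hi; rewrite iterSr; apply: IHr; apply: invsys_D.
Qed.
Lemma D_iter r i h : D i (iter r f h) = iter r f (D i h).
Proof. by elim: r => // r IHr; rewrite !iterS D_comm IHr. Qed.
Lemma iter_lin r c h h' : iter r f (fun al => c * h al + h' al) = (fun al => c * iter r f h al + iter r f h' al).
Proof. by elim: r => // r IHr; rewrite !iterS IHr. Qed.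

Local Notation N := #|{: 'X_{1..n < d0.+1}}|.
Definition vec h : 'rV[L]_N := \row_l h (enum_val l : 'X_{1..n < d0.+1}).
Lemma vec_inj h h' : invsys m.+1 d0 h -> invsys m.+1 d0 h' -> vec h = vec h' -> h = h'.
Proof.
move=> [h1 _ _] [h1' _ _] E; apply: funext => al.
have [ald|ald] := eqVneq (mdeg al) d0; last by rewrite h1 // h1'.
have al' : (mdeg al < d0.+1)%N by rewrite ald.
by have /rowP /(_ (enum_rank (BMultinom al'))) := E; rewrite !mxE enum_rankK.
Qed.

(** Elements of degree d0 that lift along f through r degrees. Everything is brought down to the
    fixed degree d0, so that the decreasing images live in one finite-dimensional space and become
    stationary. *)
Definition image r (u : 'rV[L]_N) := exists2 h, invsys m.+1 (d0 + r) h & u = vec (iter r f h).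
Lemma image_lin r c u v : image r u -> image r v -> image r (c *: u + v).
Proof.
move=> [h hi ->] [h' hi' ->]; exists (fun al => c * h al + h' al); first exact: invsys_lin.
by apply/rowP => l; rewrite iter_lin !mxE.
Qed.
Lemma image0 r : image r 0.
Proof.
exists (fun=> 0); first exact: invsys0.
by apply/rowP => l; rewrite !mxE; elim: r (enum_val l : 'X_{1..n}) => // r IHr al; rewrite iterS /D.
Qed.
Lemma imageS r u : image r.+1 u -> image r u.
Proof. by move=> [h hi ->]; exists (f h); [apply: invsys_D; rewrite -addnS|rewrite -iterSr]. Qed.
Lemma image_le r r' u : (r <= r')%N -> image r' u -> image r u.
Proof. by move/subnK <-; elim: (r' - r)%N => // s IHs; rewrite addSn => /imageS. Qed.
Lemma image_nonzero r : exists2 u, image r u & u != 0.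
Proof.
have [h hi [al hal]] := nonzero (d0 + r); exists (vec (iter r f h)); first by exists h.
apply/eqP => E; have : iter r f h = fun=> 0.
  apply: vec_inj; [exact: invsys_iter|exact: invsys0|].
  by rewrite E; apply/rowP => l; rewrite !mxE.
suff H s : iter s f h = (fun=> 0) -> (s <= r)%N -> h = fun=> 0.
  by move/H => /(_ (leqnn r)) h0; rewrite h0 eqxx in hal.
elim: s => // s IHs; rewrite iterS => E' sr; apply: IHs; last exact: ltnW.
have hs : invsys m.+1 (d0 + (r - s.+1)).+1 (iter s f h).
  have dE : ((d0 + (r - s.+1)).+1 + s)%N = (d0 + r)%N by lia.
  by apply: invsys_iter; rewrite dE.
apply: (f_inj2 _ hs (invsys0 _ _)); first by rewrite leqW // leq_addr.
by move=> be; rewrite E'.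
Qed.

(* The intersection of the images of x_m^r. *)
Lemma stable_image : exists K : 'M[L]_N, K != 0 /\ forall u, (u <= K)%MS <-> forall r, image r u.
Proof.
have /choice [A AP] r := subspace_mx (@image0 r) (@image_lin r).
have [r0 r0min] : exists r0, forall r, (\rank (A r0) <= \rank (A r))%N.
  pose Q s := `[< exists r, \rank (A r) = s >].
  have Q0 : exists s, Q s by exists (\rank (A 0%N)); apply/asboolP; exists 0%N.
  case: (ex_minnP Q0) => s /asboolP [r0 rs] smin; exists r0 => r; rewrite rs.
  by apply: smin; apply/asboolP; exists r.
have mono r r' : (r <= r')%N -> (A r' <= A r)%MS.
  move=> rr; apply/row_subP => l; apply/AP; apply: image_le rr _; apply/AP; exact: row_sub.
exists (A r0); split.
  have [u ui u0] := image_nonzero r0; apply: contraNneq u0 => A0.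
  by rewrite -submx0 -A0; apply/AP.
move=> u; split=> [ur r|ur]; last exact/AP/ur.
case: (leqP r r0) => [rr|/ltnW rr]; first by apply: image_le rr _; apply/AP.
apply/AP; have := mxrank_leqif_sup (mono _ _ rr).
by rewrite /leqif eqn_leq r0min => -[-> /esym H]; apply: submx_trans ur H.
Qed.

(** On the stable image K lifting along f is possible and unique, so the D_i composed with the
    inverse of f act on K. They commute and hence have a common eigenvector, whose eigenvalues x_i
    are the coordinates of a common zero of the quadrics. As D_i0 = f, the eigenvalue x_i0 is 1, so
    this zero is not the origin. *)
Lemma step_false : False.
Proof.
have [K [K0 KP]] := stable_image; pose Bk := row_base K; pose r := \rank K.
have r0 : (0 < r)%N by rewrite lt0n mxrank_eq0.
have KB (v : 'rV_r) : (v *m Bk <= K)%MS by rewrite -(eq_row_base K) submxMl.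
have Binj : injective (fun v : 'rV_r => v *m Bk) by apply: row_free_inj; apply: row_base_free.
have uniq1 h h' : invsys m.+1 d0.+1 h -> invsys m.+1 d0.+1 h' -> vec (f h) = vec (f h') -> h = h'.
  move=> hi hi' E; apply: (@f_inj2 d0) => // al.
  by rewrite (vec_inj (invsys_D i0 hi) (invsys_D i0 hi')).
(* K is stable: a lift of f h through s.+1 degrees is, by uniqueness, a lift of h through s degrees,
   and D_i commutes with f. *)
have Kimage i h : (vec (f h) <= K)%MS -> invsys m.+1 d0.+1 h -> (vec (D i h) <= K)%MS.
  move=> uK hi; apply/KP => s; have [h' hi' uE] := proj1 (KP _) uK s.+1.
  have hh : h = iter s f h'.
    by apply: uniq1 => //; apply: invsys_iter; rewrite addSnnS.
  exists (D i h'); first by apply: invsys_D; rewrite -addnS.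
  by rewrite hh D_iter.
have lift1 (v : 'rV_r) : exists2 h, invsys m.+1 d0.+1 h & vec (f h) = v *m Bk.
  by have [h hi hE] := proj1 (KP _) (KB v) 1%N; exists h; [move: hi; rewrite addn1|rewrite hE].
have /choice [g1 g1P] (l : 'I_r) : exists h, invsys m.+1 d0.+1 h /\ vec (f h) = row l Bk.
  by have [h hi hE] := lift1 (delta_mx 0 l); exists h; rewrite hE rowE.
have /choice [C CE] i : exists C : 'M_r, forall l, vec (D i (g1 l)) = row l C *m Bk.
  have /choice [c cE] l : exists c : 'rV_r, vec (D i (g1 l)) = c *m Bk.
    have [gi gE] := g1P l; apply/submxP; rewrite eq_row_base; apply: Kimage => //.
    by rewrite gE -(eq_row_base K) row_sub.
  exists (\matrix_l c l) => l; by rewrite rowK.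
(* right multiplication by C i is multiplication by x_i / x_m *)
have CP i (v : 'rV_r) h : invsys m.+1 d0.+1 h -> vec (f h) = v *m Bk -> vec (D i h) = v *m C i *m Bk.
  move=> hi hE.
  have -> : h = fun al => \sum_l v 0 l * g1 l al.
    apply: uniq1 => //; first by apply: invsys_sum => l; have [] := g1P l.
    rewrite hE; apply/rowP => c; rewrite !mxE; apply: eq_bigr => l _.
    by have [_ /rowP /(_ c)] := g1P l; rewrite !mxE => <-.
  rewrite -mulmxA; apply/rowP => c; rewrite !mxE; apply: eq_bigr => l _.
  have := CE i l; rewrite -row_mul => /rowP /(_ c); rewrite !mxE => <-; exact: erefl.
(* The equations of the quadrics involve products D_i D_j, so they are read off from a lift through
   two degrees. *)
have lift2 (v : 'rV_r) : exists2 h, invsys m.+1 d0.+2 h & vec (f (f h)) = v *m Bk.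
  by have [h hi hE] := proj1 (KP _) (KB v) 2%N; exists h; [move: hi; rewrite addn2|rewrite hE].
have CCE i j (v : 'rV_r) h : invsys m.+1 d0.+2 h -> vec (f (f h)) = v *m Bk ->
    vec (D i (D j h)) = v *m C j *m C i *m Bk.
  move=> hi hE; apply: (CP i); first exact: invsys_D.
  by rewrite D_comm; apply: (CP j) => //; apply: invsys_D.
have CC i j : C i *m C j = C j *m C i.
  apply/row_matrixP => l; apply: Binj; have [h hi hE] := lift2 (delta_mx 0 l).
  have E i' j' : row l (C i' *m C j') *m Bk = vec (D j' (D i' h)).
    by rewrite (CCE _ _ _ _ hi hE) rowE !mulmxA.
  by apply: etrans (E i j) _; rewrite D_comm; apply: esym (E j i).
have [v [x [v0 xE]]] := commuting_eigenvector r0 CC.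
have vB0 : v *m Bk != 0 by rewrite mulmx_free_eq0 ?row_base_free.
have x0 i : x i = 0.
  apply: no_zero => a; have [h hi hE] := lift2 v.
  suff : (\sum_i \sum_j g a i j * x i * x j) *: (v *m Bk) = 0.
    by move/eqP; rewrite scaler_eq0 (negPf vB0) orbF => /eqP.
  have -> : (\sum_i \sum_j g a i j * x i * x j) *: (v *m Bk) =
      \sum_i \sum_j g a i j *: vec (D i (D j h)).
    rewrite scaler_suml; apply: eq_bigr => i' _; rewrite scaler_suml; apply: eq_bigr => j' _.
    have -> : vec (D i' (D j' h)) = (x j' * x i') *: (v *m Bk).
      by rewrite (CCE _ _ _ _ hi hE) xE -scalemxAl xE scalerA -scalemxAl.
    by rewrite scalerA; congr (_ *: _); ring.
  apply/rowP => c; rewrite summxE mxE; have [_ h2 _] := hi.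
  rewrite -[RHS](h2 a (enum_val c : 'X_{1..n < d0.+1})); apply: eq_bigr => i' _.
  by rewrite summxE; apply: eq_bigr => j' _; rewrite !mxE.
(* For i0 the operator is f after its inverse, the identity; its eigenvalue cannot be 0. *)
have [h hi hE] := lift1 v; have := CP i0 v h hi hE; rewrite xE x0 scale0r mul0mx hE => /eqP.
by rewrite (negPf vB0).
Qed.
End Step.

Lemma invsys_step (m : nat) (i0 : 'I_n) : m = i0 ->
  (exists d0, forall d h, (d0 <= d)%N -> invsys m d h -> forall al, h al = 0) ->
  exists d0, forall d h, (d0 <= d)%N -> invsys m.+1 d h -> forall al, h al = 0.
Proof.
move=> mE [d0 IH]; apply: contrapT => H.
(* If the system vanishes in one degree, it vanishes in all later ones, since an element of positive
   degree with all D_i zero is zero. So if the conclusion fails, no degree vanishes. *)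
refine (@step_false m i0 mE d0 IH _) => d; apply: contrapT => Hd; apply: H; exists d => d' h.
move=> /subnK <-; elim: (d' - d)%N h => [|s IHs] h hi al.
  apply/eqP; apply/negPn/negP => hal; apply: Hd; exists h => //; by exists al.
by apply: (invsys_eq0 hi) => i be; apply: IHs; apply: invsys_D.
Qed.

Lemma invsys_vanish m : (m <= n)%N ->
  exists d0, forall d h, (d0 <= d)%N -> invsys m d h -> forall al, h al = 0.
Proof.
elim: m => [_|m IHm mn]; last exact: (@invsys_step m (Ordinal mn) erefl (IHm (ltnW mn))).
exists 1%N => -[//|d] h _ hi; apply: (invsys_eq0 hi) => i al.
by have [_ _ h3] := hi; apply: h3.
Qed.
End InverseSystems.

Lemma mcoeff_quadricX (F : fieldType) n k (G : 'I_k -> 'I_n -> 'I_n -> F) a (b m : 'X_{1..n}) :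
  ('X_[b] * quadric G a)@_m = \sum_i \sum_j G a i j * (b + U_(i) + U_(j) == m)%MM%:R.
Proof.
rewrite mulr_sumr raddf_sum; apply: eq_bigr => i _; rewrite mulr_sumr raddf_sum; apply: eq_bigr => j _ /=.
by rewrite -scalerAr mcoeffZ -!mpolyXD mcoeffX addmA.
Qed.

Lemma quadric_homog (F : fieldType) n k (G : 'I_k -> 'I_n -> 'I_n -> F) a : quadric G a \is 2.-homog.
Proof.
do 2 (apply: rpred_sum => ? _); apply: rpredZ; rewrite -mpolyXD dhomogX /= mdegD !mdeg1.
exact: eqxx.
Qed.

(** The r i a solve a linear system over F, whose solvability may be tested over L. There a column
    of the cokernel of the matrix is an inverse system of degree p + 2, and p was chosen so that
    these vanish. *)
Theorem nullstellensatz (F : fieldType) (L : closedFieldType) (iota : {rmorphism F -> L})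
    n k (G : 'I_k -> 'I_n -> 'I_n -> F) :
  (forall x : 'I_n -> L, (forall a, \sum_i \sum_j iota (G a i j) * x i * x j = 0) -> forall i, x i = 0) ->
  exists (p : nat) (r : 'I_n -> 'I_k -> {mpoly F[n]}),
    (forall i a, r i a \is p.-homog) /\ (forall i, 'X_i ^+ p.+2 = \sum_a r i a * quadric G a).
Proof.
move=> no_zero; have [p pP] := invsys_vanish no_zero (leqnn n).
pose Cm := {m : 'X_{1..n < p.+3} | mdeg m == p.+2}.
pose Rw := ('I_k * 'X_{1..n < p.+1})%type.
(* Rows are the products of a quadric with a monomial of degree p, columns the monomials of degree p
   + 2. The indices in [Rw] with a monomial of smaller degree give zero rows. *)
pose ent (z : Rw) (w : Cm) : F := (mdeg z.2 == p)%:R * ('X_[z.2] * quadric G z.1)@_(val w).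
pose Mx : 'M[F]_(#|{: Rw}|, #|{: Cm}|) := \matrix_(u, v) ent (enum_val u) (enum_val v).
have full : (1%:M <= Mx)%MS.
  rewrite -(map_submx iota) map_mx1 submxE mul1mx; apply/eqP/matrixP => v c.
  (* A column of the cokernel, extended by zero outside degree p + 2, is a functional that kills all
     multiples of the quadrics. *)
  move: (cokermx _) (mulmx_coker (map_mx iota Mx)) => Q Qk; pose h (al : 'X_{1..n}) : L := if insub al is Some z then
     if insub (z : 'X_{1..n < p.+3}) is Some w then Q (enum_rank (w : Cm)) c else 0 else 0.
  have hE (w : Cm) : h (val w) = Q (enum_rank w) c by rewrite /h valK valK.
  have h0 al : mdeg al != p.+2 -> h al = 0.
    rewrite /h => E; case: insubP => // z _ zE; case: insubP => // w /eqP wE.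
    by rewrite -zE wE eqxx in E.
  have hi : invsys (fun a i j => iota (G a i j)) n p.+2 h.
    split=> [//|a al|i ni]; last by have := ltn_ord i; rewrite ltnNge ni.
    have [alp|alp] := eqVneq (mdeg al) p; last first.
      rewrite big1 // => i _; rewrite big1 // => j _; rewrite h0 ?mulr0 //.
      by rewrite !mdegD !mdeg1 !addn1 !eqSS.
    have alb : (mdeg al < p.+1)%N by rewrite alp.
    have := Qk => /matrixP /(_ (enum_rank ((a, BMultinom alb) : Rw)) c).
    rewrite !mxE => E; rewrite -[RHS]E; apply: esym.
    have sumE (c' : 'I_n -> 'I_n -> F) q0 :
        iota (\sum_i \sum_j c' i j) * q0 = \sum_i \sum_j iota (c' i j) * q0.
      by rewrite rmorph_sum mulr_suml; apply: eq_bigr => i _; rewrite rmorph_sum mulr_suml.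
    under eq_bigr => v' _ do rewrite !mxE enum_rankK /ent /= alp eqxx mul1r mcoeff_quadricX sumE.
    rewrite exchange_big; apply: eq_bigr => i _; rewrite exchange_big; apply: eq_bigr => j _ /=.
    have bp : (mdeg (al + U_(i) + U_(j))%MM < p.+3)%N by rewrite !mdegD !mdeg1 alp !addn1.
    have bp' : mdeg (BMultinom bp) == p.+2 by rewrite /= !mdegD !mdeg1 alp !addn1.
    rewrite (bigD1 (enum_rank (exist _ (BMultinom bp) bp' : Cm))) //= enum_rankK /= eqxx mulr1 -hE.
    rewrite big1 ?addr0 // => v' v'n; rewrite (_ : (_ == _) = false) ?mulr0 ?rmorph0 ?mul0r //.
    apply: contraNF v'n => /eqP E'; rewrite -[v']enum_valK; apply/eqP; congr enum_rank.
    by apply: val_inj; apply: val_inj.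
  rewrite mxE; have := pP _ h _ hi (val (enum_val v)); rewrite hE enum_valK; apply.
  by rewrite -addn2 leq_addr.
have [Qm QE] := submxP full.
pose ci (i : 'I_n) := (U_(i) *+ p.+2)%MM.
have cib i : (mdeg (ci i) < p.+3)%N by rewrite mdegMn mdeg1 mul1n.
have cip i : mdeg (BMultinom (cib i)) == p.+2 by rewrite /= mdegMn mdeg1 mul1n.
pose c i : 'I_#|{: Cm}| := enum_rank (exist _ (BMultinom (cib i)) (cip i) : Cm).
pose r i a : {mpoly F[n]} := \sum_(b : 'X_{1..n < p.+1} | mdeg b == p)
   Qm (c i) (enum_rank ((a, b) : Rw)) *: 'X_[b].
have rp i a : r i a \is p.-homog.
  by apply: rpred_sum => b bp; apply: rpredZ; rewrite dhomogX.
exists p, r; split=> // i; apply/mpolyP => m.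
have [mp|mp] := eqVneq (mdeg m) p.+2; last first.
  rewrite mpolyXn mcoeffX (_ : (_ == m) = false); last first.
    by apply: contraNF mp => /eqP <-; rewrite mdegMn mdeg1 mul1n.
  rewrite raddf_sum big1 // => a _; apply: (dhomog_nemf_coeff (d := (p + 2)%N)).
    by apply: dhomogM => //; apply: quadric_homog.
  by rewrite addn2.
have mb : (mdeg m < p.+3)%N by rewrite mp.
have mb' : mdeg (BMultinom mb) == p.+2 by rewrite /= mp.
pose v : 'I_#|{: Cm}| := enum_rank (exist _ (BMultinom mb) mb' : Cm).
have := congr1 (fun X : 'M_(_, _) => X (c i) v) QE; rewrite !mxE.
have -> : (c i == v) = (ci i == m).
  by apply/eqP/eqP => [/enum_rank_inj/(congr1 val)/(congr1 val)//|E]; congr enum_rank; do 2 apply: val_inj.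
rewrite mpolyXn mcoeffX -/(ci i) => ->; rewrite raddf_sum /=.
rewrite (reindex (fun z : Rw => enum_rank z)) /=; last first.
  by exists enum_val => z _; rewrite ?enum_rankK ?enum_valK.
transitivity (\sum_a \sum_(b : 'X_{1..n < p.+1}) Qm (c i) (enum_rank ((a, b) : Rw)) * ent (a, b) (enum_val v)).
  by rewrite pair_bigA; apply: eq_bigr => -[a b] _; rewrite mxE enum_rankK.
apply: eq_bigr => a _.
rewrite /r mulr_suml raddf_sum /= [RHS]big_mkcond; apply: eq_bigr => b _ /=.
rewrite /ent /= enum_rankK /=; case: (mdeg b == p); last by rewrite mul0r mulr0.
by rewrite mul1r -scalerAl mcoeffZ.
Qed.

Lemma leq_expn_base m n k : (m <= n)%N -> (m ^ k <= n ^ k)%N.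
Proof. by move=> mn; case: k => // k; rewrite leq_exp2r. Qed.

Lemma card_bmultinom k M : (#|{: 'X_{1..k < M.+1}}| <= M.+1 ^ k)%N.
Proof.
have H (m : 'X_{1..k < M.+1}) a : (m a < M.+1)%N.
  by apply: leq_ltn_trans (bmdeg m); rewrite mdegE (bigD1 a) //= leq_addr.
pose phi (m : 'X_{1..k < M.+1}) : {ffun 'I_k -> 'I_M.+1} := [ffun a => Ordinal (H m a)].
have inj : injective phi.
  move=> m m' /ffunP E; apply: val_inj; apply/mnmP => a.
  by have := E a; rewrite !ffunE => /(congr1 val).
by have := leq_card phi inj; rewrite card_ffun !card_ord.
Qed.

(** * Hilbert series and growth *)

Section NumberOfQuadrics.
Variables (F : fieldType) (n k p : nat) (G : 'I_k -> 'I_n -> 'I_n -> F).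
Variable r : 'I_n -> 'I_k -> {mpoly F[n]}.
Hypothesis rp : forall i a, r i a \is p.-homog.
Hypothesis rE : forall i, 'X_i ^+ p.+2 = \sum_a r i a * quadric G a.
Local Notation N := p.+2.

Section Span.
Variable M : nat.
Local Notation Z := ('X_{1..k < M.+1} * {ffun 'I_n -> 'I_N})%type.
Definition qmono (g : 'X_{1..k}) (b : 'X_{1..n}) : {mpoly F[n]} :=
  \prod_a quadric G a ^+ g a * 'X_[b].
Definition zmono (z : Z) : {mpoly F[n]} := qmono z.1 [multinom (z.2 i : nat) | i < n].
(** The products q^g x^b with all b_i < N generate F[x] as a vector space. The bound e counts the
    quadrics used, and the cutoff M keeps the index set finite. *)
Definition qspan e (v : {mpoly F[n]}) : Prop :=
  exists c : Z -> F, v = \sum_(z : Z | (mdeg z.1 <= e)%N) c z *: zmono z.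

Lemma qspan_lin e c u v : qspan e u -> qspan e v -> qspan e (c *: u + v).
Proof.
move=> [cu ->] [cv ->]; exists (fun z => c * cu z + cv z).
by rewrite scaler_sumr -big_split; apply: eq_bigr => z _; rewrite scalerDl scalerA.
Qed.
Lemma qspan0 e : qspan e 0.
Proof. by exists (fun=> 0); rewrite big1 // => z _; rewrite scale0r. Qed.
Lemma qspan_sum e (I : Type) (s : seq I) (P : pred I) (c : I -> F) (f : I -> {mpoly F[n]}) :
  (forall i, P i -> qspan e (f i)) -> qspan e (\sum_(i <- s | P i) c i *: f i).
Proof.
move=> H; elim/big_rec: _ => [|i v Pi]; [exact: qspan0|by apply: qspan_lin; apply: H].
Qed.
Lemma qspan_mono (e : nat) (g : 'X_{1..k}) (b : 'X_{1..n}) : (mdeg g <= e)%N -> (e <= M)%N -> (forall i, (b i < N)%N) -> qspan e (qmono g b).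
Proof.
move=> ge eM bN; have gM : (mdeg g < M.+1)%N by rewrite ltnS (leq_trans ge).
pose z : Z := (BMultinom gM, [ffun i => Ordinal (bN i)]).
exists (fun z' => (z' == z)%:R); rewrite (bigD1 z) //= eqxx scale1r big1 => [|z' /andP[_ /negPf ->]].
  rewrite addr0 /zmono /=; congr (qmono _ _).
  by apply/mnmP => i; rewrite mnmE ffunE.
by rewrite scale0r.
Qed.
Lemma qspan_mul e a v : (e < M)%N -> qspan e v -> qspan e.+1 (quadric G a * v).
Proof.
move=> eM [c ->]; rewrite mulr_sumr.
under eq_bigr => z _ do rewrite -scalerAr.
apply: qspan_sum => z ze; have -> : quadric G a * zmono z = qmono (z.1 + U_(a)) [multinom (z.2 i : nat) | i < n].
  rewrite /zmono /qmono mulrA; congr (_ * _).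
  rewrite [RHS](bigD1 a) //= [in LHS](bigD1 a) //= mnmDE mnm1E eqxx addn1 exprS -!mulrA.
  congr (_ * (_ * _)); apply: eq_bigr => b /negPf ba.
  by rewrite mnmDE mnm1E eq_sym ba addn0.
apply: qspan_mono => //; first by rewrite mdegD mdeg1 addn1 ltnS.
by move=> i; rewrite mnmE.
Qed.
(** A monomial divisible by x_i^N is rewritten with the sum of the r_a q_a: one quadric is gained
    and the cofactor has lost degree 2, so the number of quadrics never exceeds the degree. *)
Lemma qspan_X (e : nat) (al : 'X_{1..n}) : (e <= M)%N -> (mdeg al <= e)%N -> qspan e 'X_[al].
Proof.
elim: e al => [|e IH] al eM ale.
  have -> : 'X_[al] = qmono 0%MM al.
    by rewrite /qmono big1 ?mul1r // => a _; rewrite mnm0E.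
  apply: qspan_mono; rewrite ?mdeg0 // => i.
  apply: leq_ltn_trans (_ : mdeg al < _)%N; last by apply: leq_ltn_trans ale _.
  by rewrite mdegE (bigD1 i) //= leq_addr.
have [/forallP alN|] := boolP [forall i, (al i < N)%N].
  have -> : 'X_[al] = qmono 0%MM al.
    by rewrite /qmono big1 ?mul1r // => a _; rewrite mnm0E.
  by apply: qspan_mono; rewrite ?mdeg0.
rewrite negb_forall => /existsP[i]; rewrite -leqNgt => Ni.
have alE : al = (al - U_(i) *+ N + U_(i) *+ N)%MM.
  rewrite submK //; apply/mnm_lepP => j; rewrite mulmnE mnm1E.
  by case: eqP => [<-|]; rewrite ?mul1n ?mul0n.
have dE : mdeg al = (mdeg (al - U_(i) *+ N)%MM + N)%N by rewrite {1}alE mdegD mdegMn mdeg1 mul1n.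
rewrite alE mpolyXD -mpolyXn rE mulr_sumr.
under eq_bigr => a _ do rewrite mulrA mulrC -[_ * _]scale1r.
apply: qspan_sum => a _; apply: qspan_mul => //.
rewrite [r i a]mpolyE mulr_sumr; under eq_bigr => m _ do rewrite -scalerAr -mpolyXD.
rewrite big_seq; apply: qspan_sum => m mr; apply: IH; first exact: ltnW.
have /dhomogP /(_ m mr) rm := rp i a; rewrite mdegD rm.
by move: ale; rewrite dE; lia.
Qed.
End Span.

(** The D^n monomials with exponents below D are linearly independent and lie in the span of the
    products q^g x^b; the right side bounds the number of these. *)
Lemma monomials_bound D : (D ^ n <= (n * D).+1 ^ k * N ^ n)%N.
Proof.
pose M := (n * D)%N; pose Z := ('X_{1..k < M.+1} * {ffun 'I_n -> 'I_N})%type.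
pose I := {ffun 'I_n -> 'I_D}; pose mon (i : I) : 'X_{1..n} := [multinom (i j : nat) | j < n].
have mon_inj : injective mon.
  move=> i j /mnmP E; apply/ffunP => l; apply: val_inj.
  by have := E l; rewrite !mnmE.
have /choice [c cE] (i : I) : exists c : Z -> F, 'X_[mon i] = \sum_z c z *: zmono z.
  have [|c ->] := @qspan_X M M (mon i) (leqnn M).
    have -> : M = (\sum_(j < n) D)%N by rewrite sum_nat_const card_ord.
    by rewrite mdegE; apply: leq_sum => j _; rewrite mnmE ltnW.
  exists c; apply: eq_bigl => z; by have := bmdeg z.1; rewrite ltnS.
pose C : 'M[F]_(#|{: I}|, #|{: Z}|) := \matrix_(u, v) c (enum_val u) (enum_val v).
pose E : 'M[F]_(#|{: Z}|, #|{: I}|) := \matrix_(u, v) (zmono (enum_val u))@_(mon (enum_val v)).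
have CE : C *m E = 1%:M.
  apply/matrixP => u v; rewrite !mxE.
  have := congr1 (mcoeff (mon (enum_val v))) (cE (enum_val u)).
  rewrite mcoeffX (inj_eq mon_inj) (inj_eq enum_val_inj) => ->; rewrite raddf_sum /=.
  rewrite (reindex (fun z : Z => enum_rank z)) /=; last first.
    by exists enum_val => z _; rewrite ?enum_rankK ?enum_valK.
  by apply: eq_bigr => z _; rewrite !mxE enum_rankK mcoeffZ.
have H : (#|{: I}| <= #|{: Z}|)%N.
  by have := leq_trans (mxrankM_maxl C E) (rank_leq_col _); rewrite CE mxrank1.
rewrite card_ffun !card_ord in H; apply: leq_trans H _.
rewrite card_prod card_ffun !card_ord leq_mul2r; apply/orP; right; exact: card_bmultinom.
Qed.

Lemma quadrics_le : (n <= k)%N.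
Proof.
rewrite leqNgt; apply/negP => kn.
(* If k < n, this D gives D^(k+1) <= D^n <= (n D + 1)^k N^n <= D^k (n + 1)^k N^n = D^k (D - 1),
   which is absurd. *)
pose D := (n.+1 ^ k * N ^ n).+1; have := monomials_bound D.
have H1 : ((n * D).+1 ^ k <= n.+1 ^ k * D ^ k)%N.
  rewrite -expnMn; by apply: leq_expn_base; rewrite mulSn addnC -addn1 leq_add2l.
have H2 : (D ^ k * D <= D ^ n)%N by rewrite -expnSr leq_pexp2l // /D.
have D0 : (0 < D ^ k)%N by rewrite expn_gt0 [(0 < D)%N]ltn0Sn.
move=> H; have : (D ^ k * D <= D ^ k * (n.+1 ^ k * N ^ n))%N.
  apply: leq_trans H2 (leq_trans H _); by rewrite mulnA [(D ^ k * _)%N]mulnC leq_mul2r H1 orbT.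
by rewrite leq_pmul2l // ltnn.
Qed.
End NumberOfQuadrics.

Section Hilbert.
Variables (F : fieldType) (n k : nat) (q : 'I_n -> 'I_n -> {mpoly F[k]}).
Local Notation S := {mpoly F[k]}.
Local Notation C := (clifford q).
Hypothesis q_homog : forall i j, q i j \is 1.-homog.
Local Notation A := (graded_clifford q_homog).

Definition pbw_mono (J : {set 'I_n}) (m : 'X_{1..k}) : C :=
  [ffun K : {set 'I_n} => if K == J then 'X_[m] else 0].

Lemma pbw_monoE J m K m' : (pbw_mono J m K : S)@_m' = ((K == J) && (m == m'))%:R.
Proof. by rewrite ffunE; case: eqP => _; rewrite ?mcoeffX ?mcoeff0. Qed.

Lemma pbw_sumE (I : finType) (J : I -> {set 'I_n}) (m : I -> 'X_{1..k}) (c : I -> F) i :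
  injective (fun i => (J i, m i)) ->
  ((\sum_i c i *: pbw_mono (J i) (m i) : C) (J i) : S)@_(m i) = c i.
Proof.
move=> inj; rewrite sum_ffunE raddf_sum (bigD1 i) //= big1 ?addr0 => [|j ji].
  by rewrite cl_scaleE mcoeffZ pbw_monoE !eqxx mulr1.
rewrite cl_scaleE mcoeffZ pbw_monoE; case: eqP => [E|]; last by rewrite mulr0.
case: eqP => [E'|]; last by rewrite mulr0.
by case/eqP: ji; apply: inj; rewrite E E'.
Qed.

(* A family of distinct PBW monomials is a basis of the elements supported on it. *)
Lemma pbw_basis (P : C -> Prop) (I : finType) (J : I -> {set 'I_n}) (m : I -> 'X_{1..k}) :
  injective (fun i => (J i, m i)) ->
  (forall x, P x <-> forall K m', m' \in msupp (x K : S) -> exists i, J i = K /\ m i = m') ->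
  exists b : 'I_#|I| -> C,
    (forall c : 'I_#|I| -> F, \sum_i c i *: b i = 0 -> forall i, c i = 0) /\
    (forall v, P v <-> exists c : 'I_#|I| -> F, v = \sum_i c i *: b i).
Proof.
move=> inj PE; pose J' (u : 'I_#|I|) := J (enum_val u); pose m' (u : 'I_#|I|) := m (enum_val u).
have inj' : injective (fun u => (J' u, m' u)).
  by move=> u v E; apply: enum_val_inj; apply: inj.
exists (fun u => pbw_mono (J' u) (m' u)); split=> [c c0 u|x].
  by have := pbw_sumE c u inj'; rewrite c0 ffunE mcoeff0 => <-.
split=> [/PE xP|[c ->]].
  exists (fun u => (x (J' u) : S)@_(m' u)); apply/ffunP => K; apply/mpolyP => r.
  have [Kr|Kr] := pselect (exists i, J i = K /\ m i = r).
    have [i [iK ir]] := Kr; have := pbw_sumE (fun u => (x (J' u) : S)@_(m' u)) (enum_rank i) inj'.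
    by rewrite /J' /m' enum_rankK iK ir => ->.
  have [/xP//|/memN_msupp_eq0 ->] := boolP (r \in msupp (x K : S)).
  rewrite sum_ffunE raddf_sum big1 // => u _; rewrite cl_scaleE /= mcoeffZ pbw_monoE.
  case: eqP => [E|]; last by rewrite mulr0.
  case: eqP => [E'|]; last by rewrite mulr0.
  by case: Kr; exists (enum_val u); split; [exact: esym E|exact: E'].
apply/PE => K r; rewrite mcoeff_msupp sum_ffunE raddf_sum => H.
apply: contrapT => Kr; case/eqP: H; rewrite big1 // => u _; rewrite cl_scaleE /= mcoeffZ pbw_monoE.
case: eqP => [E|]; last by rewrite mulr0.
case: eqP => [E'|]; last by rewrite mulr0.
by case: Kr; exists (enum_val u); split; [exact: esym E|exact: E'].
Qed.

(** The pairs (J, m) of PBW monomials of degree i. Exponents are bounded by N to make the type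
    finite; in degree i they are at most i, so every N >= i gives the same count. *)
Definition hilb_index N i : finType :=
  {z : {set 'I_n} * {ffun 'I_k -> 'I_N.+1} | (#|z.1| + 2 * \sum_a z.2 a)%N == i}.
Definition hilb i := #|{: hilb_index i i}|.

Lemma mdeg_ffun N (f : {ffun 'I_k -> 'I_N.+1}) : mdeg [multinom (f a : nat) | a < k] = (\sum_a f a)%N.
Proof. by rewrite mdegE; apply: eq_bigr => a _; rewrite mnmE. Qed.

Lemma clifford_Hilbert : Hilbert_series A hilb.
Proof.
move=> i; pose J (z : hilb_index i i) := (val z).1.
pose m (z : hilb_index i i) : 'X_{1..k} := [multinom ((val z).2 a : nat) | a < k].
apply: (@pbw_basis _ (hilb_index i i) J m).
  move=> [[z1 z2] zP] [[z1' z2'] zP'] E; apply: val_inj => /=.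
  have /= -> : z1 = z1' := congr1 fst E; congr pair; apply/ffunP => a; apply: val_inj.
  by have := congr1 (fun r : 'X_{1..k} => r a) (congr1 snd E); rewrite /m /= !mnmE.
move=> x; split=> [xi K r /xi E|H K r /H [z [<- <-]]]; last first.
  by rewrite /m mdeg_ffun; apply/eqP; apply: (valP z).
have ri a : (r a < i.+1)%N.
  rewrite ltnS -E; apply: leq_trans (_ : mdeg r <= _)%N; first by rewrite mdegE (bigD1 a) //= leq_addr.
  by rewrite mul2n -addnn addnA leq_addl.
pose f : {ffun 'I_k -> 'I_i.+1} := [ffun a => Ordinal (ri a)].
have fr : [multinom (f a : nat) | a < k] = r by apply/mnmP => a; rewrite mnmE ffunE.
have fi : (#|(K, f).1| + 2 * \sum_a (K, f).2 a)%N == i by rewrite /= -mdeg_ffun fr E.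
by exists (exist _ (K, f) fi : hilb_index i i).
Qed.

Lemma hilb_stable N i : (i <= N)%N -> #|{: hilb_index N i}| = hilb i.
Proof.
move=> iN.
pose w (z : {set 'I_n} * {ffun 'I_k -> 'I_i.+1}) : {set 'I_n} * {ffun 'I_k -> 'I_N.+1} :=
  (z.1, [ffun a => widen_ord (iN : i.+1 <= N.+1)%N (z.2 a)]).
have w_inj : injective w.
  move=> [J f] [J' f'] E; have /= -> : J = J' := congr1 fst E; congr pair; apply/ffunP => a.
  by have /ffunP /(_ a) := congr1 snd E; rewrite !ffunE => /(congr1 val) H; apply: val_inj.
have wE z : (\sum_a (w z).2 a)%N = (\sum_a z.2 a)%N.
  by apply: eq_bigr => a _; rewrite ffunE.
rewrite /hilb !card_sig -(card_image w_inj); apply: eq_card => -[J f]; rewrite !inE.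
apply/idP/imageP => [/eqP Ji|[z zi ->]]; last by rewrite wE; rewrite inE in zi.
have fi a : (f a < i.+1)%N.
  by move: Ji; rewrite /= (bigD1 a) //=; move: #|J| (\sum_(_ | _) _)%N (f a : nat) => u v t; lia.
exists (J, [ffun a => Ordinal (fi a)]).
  rewrite inE; apply/eqP/(etrans _ Ji); congr (_ + 2 * _)%N; by apply: eq_bigr => a _; rewrite ffunE.
by congr pair; apply/ffunP => a; rewrite !ffunE; apply: val_inj.
Qed.

Lemma hilb_coef N : (1 + 'X) ^+ n * (\sum_(j < N.+1) 'X^(2 * j)) ^+ k =
  \sum_(z : {set 'I_n} * {ffun 'I_k -> 'I_N.+1}) 'X^(#|z.1| + 2 * \sum_a z.2 a) :> {poly int}.
Proof.
have -> : (1 + 'X) ^+ n = \sum_(J : {set 'I_n}) 'X^#|J| :> {poly int}.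
  rewrite addrC -[n in LHS]card_ord -prodr_const bigA_distr /=; apply: eq_bigr => J _.
  by rewrite -prodr_const [RHS]big_mkcond.
have -> : (\sum_(j < N.+1) 'X^(2 * j)) ^+ k =
    \sum_(f : {ffun 'I_k -> 'I_N.+1}) 'X^(2 * \sum_a f a) :> {poly int}.
  rewrite -[k in LHS]card_ord -prodr_const bigA_distr_bigA /=; apply: eq_bigr => f _.
  by rewrite big_distrr /= prodrXr.
rewrite big_distrlr pair_bigA; apply: eq_bigr => z _; by rewrite exprD.
Qed.

Lemma coef_hilb N i : (i <= N)%N ->
  ((1 + 'X) ^+ n * (\sum_(j < N.+1) 'X^(2 * j)) ^+ k : {poly int})`_i = (hilb i)%:Z.
Proof.
move=> iN; rewrite hilb_coef poly.coef_sum -(hilb_stable iN) card_sig.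
rewrite -sum1_card -[RHS]natz natr_sum [RHS]big_mkcond /=; apply: eq_bigr => z _.
by rewrite coefXn eq_sym inE; case: eqP.
Qed.

Lemma hilb_series : (n <= k)%N -> series_eq_inv hilb ((1 - 'X) ^+ n * (1 - 'X^2) ^+ (k - n)).
Proof.
move=> nk N; set p := _ * _.
(* Cutting the geometric series of 1 / (1 - X^2) after N.+1 terms does not affect coefficients up to
   degree N. *)
pose H : {poly int} := (1 + 'X) ^+ n * (\sum_(j < N.+1) 'X^(2 * j)) ^+ k.
have -> : \sum_(i < N.+1) (hilb i)%:Z * p`_(N - i) = (H * p)`_N.
  by rewrite coefM; apply: eq_bigr => i _; rewrite coef_hilb // -ltnS.
(* Since n <= k, the factors (1 + X)^n (1 - X)^n (1 - X^2)^(k - n) combine to (1 - X^2)^k and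
   telescope against the cut series. *)
have -> : H * p = (1 - 'X^(2 * N.+1)) ^+ k.
  have E : (1 - 'X^2) * \sum_(j < N.+1) 'X^(2 * j) = 1 - 'X^(2 * N.+1) :> {poly int}.
    have := subrXX 1 ('X^2 : {poly int}) N.+1; rewrite expr1n -exprM => ->; congr (_ * _).
    by apply: eq_bigr => j _; rewrite expr1n mul1r -exprM.
  rewrite -E exprMn /H /p -(subnK nk) addnK [in X in _ = X * _]exprD.
  have -> : (1 - 'X^2) ^+ n = (1 + 'X) ^+ n * (1 - 'X) ^+ n :> {poly int}.
    by rewrite -exprMn; congr (_ ^+ _); rewrite mulrC -subr_sqr expr1n.
  by rewrite -!mulrA; ring.
have [w ->] : exists w, (1 - 'X^(2 * N.+1)) ^+ k = 1 + 'X^(2 * N.+1) * w :> {poly int}.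
  elim: (k) => [|l [w wE]]; first by exists 0; rewrite expr0 mulr0 addr0.
  by exists (w - 1 - 'X^(2 * N.+1) * w); rewrite exprS wE; ring.
rewrite coefD coefXnM coef1 ifT ?addr0; first by case: eqP.
by rewrite mul2n -addnn addSn ltnS leq_addr.
Qed.
End Hilbert.

(** * Dimensions of subspaces *)

Section FiniteDimension.
Variables (F : fieldType) (V : lmodType F).

Lemma lin_span0 (P : V -> Prop) : lin_span P 0.
Proof. by exists 0%N, (fun=> 0), (fun=> 0); split=> [[]|] //; rewrite big_ord0. Qed.

Lemma lin_span_lin (P : V -> Prop) c u v : lin_span P u -> lin_span P v -> lin_span P (c *: u + v).
Proof.
move=> [m1 [c1 [b1 [b1P ->]]]] [m2 [c2 [b2 [b2P ->]]]].
exists (m1 + m2)%N, (fun i => match fintype.split i with inl j => c * c1 j | inr j => c2 j end),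
  (fun i => match fintype.split i with inl j => b1 j | inr j => b2 j end).
split=> [i|]; first by case: (fintype.split i).
rewrite big_split_ord scaler_sumr; congr (_ + _); apply: eq_bigr => i _.
  by rewrite -[lshift _ _]/(unsplit (inl i)) unsplitK scalerA.
by rewrite -[rshift _ _]/(unsplit (inr i)) unsplitK.
Qed.

Lemma subspace_dim (P Q : V -> Prop) (M : nat) : has_dim P M -> (forall x, Q x -> P x) ->
  Q 0 -> (forall c u v, Q u -> Q v -> Q (c *: u + v)) -> exists2 d, has_dim Q d & (d <= M)%N.
Proof.
move=> [b [b_free b_span]] QP Q0 QD.
pose lc (u : 'rV[F]_M) : V := \sum_i u 0 i *: b i.
have lc_lin c u v : lc (c *: u + v) = c *: lc u + lc v.
  rewrite /lc scaler_sumr -big_split; apply: eq_bigr => i _ /=.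
  by rewrite !mxE scalerDl scalerA.
have lc0 : lc 0 = 0 by rewrite /lc big1 // => i _; rewrite mxE scale0r.
have lc_inj u : lc u = 0 -> u = 0.
  by move=> /b_free u0; apply/rowP => i; rewrite mxE u0.
have [||A AQ] := @subspace_mx F M (fun u => Q (lc u)).
- by rewrite lc0.
- by move=> c u v Qu Qv; rewrite lc_lin; apply: QD.
exists (\rank A); last exact: rank_leq_col.
have lcM r (c : 'rV[F]_r) (X : 'M[F]_(r, M)) : lc (c *m X) = \sum_l c 0 l *: lc (row l X).
  rewrite /lc; under eq_bigr => i _ do rewrite mxE scaler_suml.
  rewrite exchange_big; apply: eq_bigr => l _; rewrite scaler_sumr; apply: eq_bigr => i _.
  by rewrite mxE scalerA.
exists (fun l => lc (row l (row_base A))); split=> [c c0 l|x].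
  have : (\row_l c l) *m row_base A = 0.
    by apply: lc_inj; rewrite lcM -[RHS]c0; apply: eq_bigr => i _; rewrite mxE.
  move/eqP; rewrite mulmx_free_eq0 ?row_base_free // => /eqP/rowP/(_ l); by rewrite !mxE.
split=> [Qx|[c ->]].
  have [u xE] := (b_span x).1 (QP x Qx).
  have xE' : x = lc (\row_i u i) by rewrite xE; apply: eq_bigr => i _; rewrite mxE.
  have : (\row_i u i <= row_base A)%MS by rewrite eq_row_base; apply/AQ; rewrite -xE'.
  by move=> /submxP [c cE]; exists (fun l => c 0 l); rewrite xE' cE lcM.
have -> : \sum_l c l *: lc (row l (row_base A)) = lc ((\row_l c l) *m row_base A).
  by rewrite lcM; apply: eq_bigr => l _; rewrite mxE.
by apply/AQ; rewrite -(eq_row_base A) submxMl.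
Qed.
End FiniteDimension.

(** * Gelfand-Kirillov dimension *)

Section GelfandKirillov.
Variables (F : fieldType) (n k : nat) (q : 'I_n -> 'I_n -> {mpoly F[k]}).
Local Notation S := {mpoly F[k]}.
Local Notation C := (clifford q).
Hypothesis q_homog : forall i j, q i j \is 1.-homog.
Local Notation A := (graded_clifford q_homog).

Definition degle (N : nat) (x : C) : Prop :=
  forall J m, m \in msupp (x J : S) -> (#|J| + 2 * mdeg m <= N)%N.

Lemma degle_gr i N x : clifford_gr i x -> (i <= N)%N -> degle N x.
Proof. by move=> xi iN J m /xi ->. Qed.
Lemma degle0 N : degle N 0. Proof. by move=> J m; rewrite ffunE msupp0. Qed.
Lemma degleD N x z : degle N x -> degle N z -> degle N (x + z).
Proof. by move=> xN zN J m; rewrite ffunE => /msuppD_le; rewrite mem_cat => /orP[/xN|/zN]. Qed.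
Lemma degleZ N (c : F) x : degle N x -> degle N (c *: x).
Proof. by move=> xN J m; rewrite cl_scaleE => /msuppZ_le/xN. Qed.
Lemma degle_le N N' x : (N <= N')%N -> degle N x -> degle N' x.
Proof. by move=> NN xN J m /xN H; apply: leq_trans NN. Qed.
Lemma degle_decomp N x : degle N x -> x = \sum_(i < N.+1) clifford_comp i x.
Proof.
move=> xN; apply/ffunP => J; apply/mpolyP => m; rewrite sum_ffunE raddf_sum /=.
under eq_bigr => i _ do rewrite mcoeff_clifford_comp.
have [mx|mx] := boolP (m \in msupp (x J : S)); last first.
  by rewrite (memN_msupp_eq0 mx) big1 // => i _; rewrite if_same.
have iN : (#|J| + 2 * mdeg m < N.+1)%N by rewrite ltnS; apply: xN.
rewrite (bigD1 (Ordinal iN)) //= eqxx big1 ?addr0 // => i /negPf.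
by rewrite -val_eqE /= eq_sym => ->.
Qed.
Lemma degleM N N' (x z : C) : degle N x -> degle N' z -> degle (N + N') (x * z).
Proof.
move=> /degle_decomp -> /degle_decomp ->; rewrite big_distrlr /=.
elim/big_ind: _ => [||i _]; [exact: degle0|exact: degleD|].
elim/big_ind: _ => [||j _]; [exact: degle0|exact: degleD|].
have H := clifford_grM q_homog (@clifford_comp_gr F n k q i x) (@clifford_comp_gr F n k q j z).
by apply: degle_gr H _; apply: leq_add; rewrite -ltnS.
Qed.
Lemma degle_bounded x : exists N, degle N x.
Proof.
exists (\max_(J : {set 'I_n}) (#|J| + 2 * msize (x J : S)))%N => J m xm.
apply: leq_trans (leq_bigmax J); rewrite leq_add2l leq_mul2l /= ltnW //.
exact: msize_mdeg_lt.
Qed.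

Lemma degle_dim N (Q : C -> Prop) : (forall x, Q x -> degle N x) -> Q 0 ->
  (forall c u v, Q u -> Q v -> Q (c *: u + v)) ->
  exists2 d, has_dim Q d & (d <= 2 ^ n * N.+1 ^ k)%N.
Proof.
move=> QN Q0 QD; pose I := ({set 'I_n} * 'X_{1..k < N.+1})%type.
pose P (x : C) := forall J m, m \in msupp (x J : S) -> (mdeg m < N.+1)%N.
have PI : has_dim P #|{: I}|.
  apply: (@pbw_basis F n k q P I fst (fun z => bmnm z.2)) => [[J m] [J' m'] E|x].
    by have /= -> := congr1 fst E; congr pair; apply: val_inj; apply: (congr1 snd E).
  split=> [xP K m /xP mN|H K m /H [[J m'] /= [_ <-]]]; last exact: bmdeg.
  by exists (K, BMultinom mN).
have [|d Qd dI] := subspace_dim PI _ Q0 QD.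
  move=> x /QN xN J m /xN H; rewrite ltnS; apply: leq_trans H.
  by rewrite mul2n -addnn addnA leq_addl.
exists d => //; apply: leq_trans dI _.
have cs : #|{: {set 'I_n}}| = (2 ^ n)%N by rewrite -cardsT -powersetT card_powerset cardsT card_ord.
rewrite card_prod cs leq_mul2l; apply/orP; right; exact: card_bmultinom.
Qed.

Lemma clifford_growth (ws : seq A) : exists c (d : nat -> nat), growth ws d /\
  forall m, (d m <= 2 ^ n * (c * m).+1 ^ k)%N.
Proof.
have [c cP] : exists c, forall x : A, x \in ws -> degle c x.
  elim: ws => [|x ws [c cP]]; first by exists 0%N.
  have [c' xc] := degle_bounded x; exists (c + c')%N => z; rewrite inE => /orP[/eqP ->|/cP].
    by apply: degle_le xc; apply: leq_addl.
  by apply: degle_le; apply: leq_addr.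
pose gen m (x : A) := exists t : seq A, [/\ (size t <= m)%N, {subset t <= ws} & x = \prod_(y <- t) y].
have genP m x : gen m x -> degle (c * m) x.
  move=> [t [tm tws ->]]; apply: (@degle_le (c * size t)); first by rewrite leq_mul2l tm orbT.
  elim: t {tm} tws => [_|y t IH tws].
    rewrite big_nil muln0; apply: degle_gr (leqnn 0); exact: clifford_gr_one.
  rewrite big_cons /= mulnS; apply: degleM; first by apply/cP/tws/mem_head.
  by apply: IH => z zt; apply: tws; rewrite inE zt orbT.
have /choice [d dP] m : exists d, has_dim (lin_span (gen m)) d /\ (d <= 2 ^ n * (c * m).+1 ^ k)%N.
  have [|||d Qd dN] := @degle_dim (c * m) (lin_span (gen m)).
  - move=> x [r [a [b [bP ->]]]]; elim/big_ind: _ => [||i _]; [exact: degle0|exact: degleD|].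
    by apply: degleZ; apply: genP.
  - exact: lin_span0.
  - exact: lin_span_lin.
  by exists d.
by exists c, d; split=> m; have [] := dP m.
Qed.

Lemma log_growth_le (d : nat -> nat) (r m : nat) : (1 < m)%N -> (d m <= m ^ r)%N ->
  Rdefinitions.Rle (log_growth d m) (Raxioms.INR r).
Proof.
move=> m1 dm.
have m0 : Rdefinitions.Rlt (Raxioms.INR 1) (Raxioms.INR m).
  by apply: RIneq.lt_INR; apply/ssrnat.ltP.
have mp : Rdefinitions.Rlt (Rdefinitions.IZR BinNums.Z0) (Raxioms.INR m).
  by apply: (RIneq.lt_INR 0); apply/ssrnat.ltP; apply: ltnW.
have lm : Rdefinitions.Rlt (Rdefinitions.IZR BinNums.Z0) (Rpower.ln (Raxioms.INR m)).
  rewrite -Rpower.ln_1; apply: Rpower.ln_increasing m0; exact: RIneq.Rlt_0_1.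
apply/(Rcomplements.Rle_div_l _ _ _ lm); rewrite -Rcomplements.ln_pow //.
(* [ln] takes the default value 0 at 0. *)
have [d0|d0] := eqVneq (d m) 0%N.
  have -> : Rpower.ln (Raxioms.INR (d m)) = Rdefinitions.IZR BinNums.Z0.
    by rewrite d0 /Rpower.ln; case: RIneq.Rlt_dec => // H; case: (RIneq.Rlt_irrefl _ H).
  by rewrite Rcomplements.ln_pow //; apply: RIneq.Rmult_le_pos; [apply: RIneq.pos_INR|apply: RIneq.Rlt_le].
have INR_expn : Raxioms.INR (m ^ r)%N = Rpow_def.pow (Raxioms.INR m) r.
  by elim: (r) => // r' IH; rewrite expnS -multE RIneq.mult_INR IH.
apply: Rcomplements.ln_le; first by apply: (RIneq.lt_INR 0); apply/ssrnat.ltP; rewrite lt0n.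
by rewrite -INR_expn; apply: RIneq.le_INR; apply/ssrnat.leP.
Qed.

(** The dimensions are at most 2^n (c m + 1)^k. The exponent k.+1 absorbs the constants once m
    exceeds 2^n (c + 1)^k, whence the threshold; its summand 2 makes ln m positive. *)
Lemma clifford_GKdim : finite_GKdim A.
Proof.
exists (Raxioms.INR k.+1) => ws; have [c [d [dg dle]]] := clifford_growth ws.
exists d; split=> //.
rewrite -(Lim_seq.LimSup_seq_const (Raxioms.INR k.+1)).
apply: Lim_seq.LimSup_le; exists (2 + 2 ^ n * c.+1 ^ k)%N => m /ssrnat.leP Hm.
have m2 : (1 < m)%N by apply: leq_trans Hm; rewrite leq_addr.
apply: log_growth_le => //; apply: leq_trans (dle m) _.
have H1 : ((c * m).+1 ^ k <= c.+1 ^ k * m ^ k)%N.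
  by rewrite -expnMn; apply: leq_expn_base; rewrite mulSn addnC -addn1 leq_add2l ltnW.
apply: leq_trans (_ : 2 ^ n * (c.+1 ^ k * m ^ k) <= _)%N; first by rewrite leq_mul2l H1 orbT.
by rewrite mulnA expnSr mulnC leq_mul2l (leq_trans _ Hm) ?orbT // leq_addl.
Qed.
End GelfandKirillov.

(** * Clifford algebras *)

Section CliffordRegularity.
Variables (F : fieldType) (n k : nat) (q : 'I_n -> 'I_n -> {mpoly F[k]}).
Hypothesis q_homog : forall i j, q i j \is 1.-homog.
Local Notation S := {mpoly F[k]}.
Local Notation C := (clifford q).
Local Notation A := (graded_clifford q_homog).
Local Notation RM := (regular_module A).

Definition y_degree_lt w (x : C) : Prop := forall J m, m \in msupp (x J : S) -> (mdeg m < w)%N.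

Lemma y_degree_lt0 x : y_degree_lt 0 x -> x = 0.
Proof.
move=> x0; apply/ffunP => J; apply/mpolyP => m; rewrite ffunE mcoeff0.
by apply: memN_msupp_eq0; apply/negP => /x0.
Qed.
Lemma y_degree_lt1 x : y_degree_lt 1 x -> yideal x -> x = 0.
Proof.
move=> x1 xy; apply: y_degree_lt0 => J m mx; have := x1 _ _ mx.
rewrite ltnS leqn0 mdeg_eq0 => /eqP m0; move: mx.
by rewrite m0 mcoeff_msupp xy eqxx.
Qed.
Lemma y_degree_bounded x : exists w, y_degree_lt w x.
Proof. by have [w xw] := pbw_bounded x; exists w => J m /xw; lia. Qed.

Lemma y_degree_euler w x : y_degree_lt w.+1 x ->
  y_degree_lt w (x *+ w - \sum_a cl_y q a * cl_deriv a x).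
Proof.
move=> xw J m; rewrite mcoeff_msupp => xm.
have nE r : ((x *+ r) J : S)@_m = (x J : S)@_m *+ r.
  by elim: r => [|r IH]; rewrite ?mulr0n ?ffunE ?mcoeff0 // !mulrS ffunE mcoeffD IH.
rewrite ffunE mcoeffD [(- _ : C) J]ffunE mcoeffN nE mcoeff_ysum in xm.
have mx : m \in msupp (x J : S).
  by rewrite mcoeff_msupp; apply: contraNN xm => /eqP ->; rewrite !mul0rn subrr.
have := xw _ _ mx; rewrite ltnS leq_eqVlt => /orP[/eqP wE|//].
by rewrite wE subrr eqxx in xm.
Qed.

Lemma msupp_deriv a (x : C) J m :
  m \in msupp (cl_deriv a x J : S) -> (m + U_(a))%MM \in msupp (x J : S).
Proof.
rewrite ffunE !mcoeff_msupp mcoeff_mderiv; apply: contraNN => /eqP ->.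
by rewrite mul0rn.
Qed.

(** For t < 2 the degree t - 2 is negative and the grading leaves only zero there; the derivative
    does vanish, since no y_a occurs in such degrees. *)
Lemma cl_deriv_gr t a (x : C) :
  @gm_gr F A RM t x -> @gm_gr F A RM (t - 2) (cl_deriv a x).
Proof.
have G0 := grading0 (gm_grading RM).
case: t => [i|i] xi; last first.
  have x0 : x = 0 := xi.
  have -> : cl_deriv a x = 0 by rewrite x0; apply/ffunP => J; rewrite !ffunE mderiv0.
  exact: G0.
have D J m : m \in msupp (cl_deriv a x J : S) -> (#|J| + 2 * mdeg m).+2 = i.
  by move=> /msupp_deriv/xi; rewrite mdegD mdeg1; move: #|J| => c; lia.
have [i2|i2] := leqP 2 i.
  have -> : Posz i - 2 = Posz (i - 2) by lia.
  by move=> J m /D; move: #|J| => c; lia.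
suff -> : cl_deriv a x = 0 by exact: G0.
by apply: y_degree_lt0 => J m /D; move: #|J| => c; lia.
Qed.

Definition top_form : C := ext_basis S setT.
Definition top_coef (x : C) : F := (x setT : S)@_0.

Lemma top_form_gr : clifford_gr n top_form.
Proof.
move=> J m; rewrite ffunE; case: eqP => [->|_]; last by rewrite msupp0.
by rewrite msupp1 inE => /eqP ->; rewrite mdeg0 cardsT card_ord muln0 addn0.
Qed.
Lemma top_coefZ c (x z : C) : top_coef (c *: x + z) = c * top_coef x + top_coef z.
Proof. by rewrite /top_coef ffunE mcoeffD cl_scaleE mcoeffZ. Qed.
Lemma top_coef1 : top_coef top_form = 1.
Proof. by rewrite /top_coef ffunE eqxx mcoeff1 eqxx. Qed.
Lemma top_coef_gr t (x : C) : @gm_gr F A RM t x -> top_coef x != 0 -> t = n%:Z.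
Proof.
case: t => [i|i] xi; last first.
  have x0 : x = 0 := xi.
  by rewrite x0 /top_coef ffunE mcoeff0 eqxx.
rewrite /top_coef -mcoeff_msupp => /xi; rewrite cardsT card_ord mdeg0 => <-.
by rewrite muln0 addn0.
Qed.

Variable G : 'I_k -> 'I_n -> 'I_n -> F.
Hypothesis qE : forall i j, q i j = \sum_a G a i j *: 'X_a.
Hypothesis Gsym : forall a i j, G a i j = G a j i.
Hypothesis charF : forall m, (m.+1%:R : F) != 0.
Hypothesis k_gt0 : (0 < k)%N.
Variables (p : nat) (r : 'I_n -> 'I_k -> {mpoly F[n]}).
Hypothesis rp : forall i a, r i a \is p.-homog.
Hypothesis rE : forall i, 'X_i ^+ p.+2 = \sum_a r i a * quadric G a.

Let e_gr : forall i, @ga_gr F A 1 (cl_e q i) := @cl_e_gr F n k q q_homog.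
Let y_gr : forall a, @ga_gr F A 2 (cl_y q a) := @cl_y_gr F n k q q_homog.
Let ee : forall i j, cl_e q i * cl_e q j + cl_e q j * cl_e q i
    = (\sum_a G a i j *: cl_y q a) *+ 2 :> A := cl_ee qE Gsym.
Let y_central : forall a (x : A), x * cl_y q a = cl_y q a * x :=
  fun a x => cl_y_central a x.

Lemma yideal_ymul a (x : C) : yideal (cl_y q a * x).
Proof. by rewrite -cl_y_central; apply: yideal_mul_y. Qed.

Definition cl_partial a : {additive (A^c)^o -> (A^c)^o} :=
  additive_of (deriv_zmod (q := q) a : zmod_morphism (@cl_deriv F n k q a : (A^c)^o -> (A^c)^o)).

Lemma clifford_cochain : forall s m (c : chain (A^c)^o 0 k), (m <= k)%N ->
  (forall al (be : {set 'I_k}), #|be| != m -> c al be = 0) ->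
  (homo2 (neg_ymul (A := A) (cl_y q)) : chain (A^c)^o 0 k -> chain (A^c)^o 0 k) c = 0 -> cgr s c ->
  (m < k)%N \/ yideal (c 0%MM setT : C) -> exists2 b, cgr s b & c = homo2 (neg_ymul (A := A) (cl_y q)) b.
Proof.
move=> s m c.
exact: (@koszul_cochain F A k (cl_y q) y_gr y_central charF cl_partial
  (fun a b x => deriv_ymul a b x) (fun t a x => @cl_deriv_gr t a x) y_degree_lt (@yideal F n k)
  (fun w J m => ltac:(by rewrite ffunE msupp0))
  y_degree_lt0 y_degree_lt1 (fun w w' x ww xw J m mx => leq_trans (xw J m mx) ww)
  y_degree_bounded y_degree_euler (@yideal0 F n k) (@yidealD F n k) (@yidealN F n k) yideal_ymul).
Qed.

Theorem clifford_AS_regular : AS_regular A k ((2 * k)%:Z - n%:Z).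
Proof.
have W := clifford_pbw q_homog; split.
- move=> M; have [B] := exists_homogeneous_basis M.
  exact: (koszul_projective_dim e_gr y_gr ee y_central charF W B k_gt0 rp rE).
- exact: clifford_GKdim.
- apply: (@koszul_Gorenstein F A n k (cl_e q) (cl_y q) G e_gr y_gr ee y_central charF k_gt0 W
    (@yideal F n k) (@yideal0 F n k) (@yidealD F n k) (@yidealN F n k) yideal_ymul
    clifford_cochain top_form top_coef top_form_gr top_coefZ top_coef1 _ top_coef_gr _ _ p r rp rE).
  + by move=> x; apply.
  + exact: yideal_top_mul.
  + exact: yideal_socle.
Qed.
End CliffordRegularity.

(** * From the base locus to powers of the coordinates *)

Section BaseLocus.
Variables (F : fieldType) (V : vectType F) (U : {vspace 'Hom(V, 'Hom(V, F^o))}).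
Local Notation n := (\dim {: V}).
Local Notation k := (\dim U).

Definition gram_coef (a : 'I_k) (i j : 'I_n) : F :=
  form_basis a (vec_basis i) (vec_basis j).

Lemma form_value_basis (L : fieldType) (iota : {rmorphism F -> L}) u (x : 'I_n -> L) :
  u \in U -> (forall a, \sum_i \sum_j iota (gram_coef a i j) * x i * x j = 0) ->
  form_value iota u x = 0.
Proof.
move=> uU Hx; pose c a := coord (vbasis U) a u.
have uE v w : u v w = \sum_a c a * (form_basis a v w : F).
  rewrite {1}(coord_vbasis uU) !sum_lfunE; apply: eq_bigr => a _.
  by rewrite !scale_lfunE /form_basis (tnth_nth 0).
rewrite /form_value.
have -> : \sum_i \sum_j iota (u (vec_basis i) (vec_basis j) : F) * x i * x j
    = \sum_i \sum_j \sum_a iota (c a) * (iota (gram_coef a i j) * x i * x j).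
  apply: eq_bigr => i _; apply: eq_bigr => j _; rewrite uE rmorph_sum !mulr_suml.
  by apply: eq_bigr => a _; rewrite rmorphM !mulrA.
under eq_bigr => i _ do rewrite exchange_big.
rewrite exchange_big big1 //= => a _.
under eq_bigr do rewrite -mulr_sumr.
by rewrite -mulr_sumr Hx mulr0.
Qed.

Lemma empty_base_locus_powers : empty_base_locus U ->
  exists (p : nat) (r : 'I_n -> 'I_k -> {mpoly F[n]}),
    (forall i a, r i a \is p.-homog) /\
    (forall i, 'X_i ^+ p.+2 = \sum_a r i a * quadric gram_coef a).
Proof.
move=> [L [iota [_ Hx]]]; apply: (nullstellensatz (iota := iota)) => x xG.
by apply: Hx => u uU; apply: form_value_basis.
Qed.
End BaseLocus.

Theorem proposition4p9
    (F : fieldType) (F_char0 : [pchar F] =i pred0)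
    (V : vectType F) (n : nat) (dimV : \dim {: V} = n) (n_gt0 : (1 <= n)%N)
    (U : {vspace 'Hom(V, 'Hom(V, F^o))}) (k : nat) (dimU : \dim U = k)
    (U_sym : symmetric_forms U) (U_empty : empty_base_locus U) :
  AS_regular (coordinate_algebra U) k ((2 * k)%:Z - n%:Z) /\
  exists h : nat -> nat,
    Hilbert_series (coordinate_algebra U) h /\
    series_eq_inv h ((1 - 'X) ^+ n * (1 - 'X^2) ^+ (k - n)).
Proof.
subst n k; have charF m : (m.+1%:R : F) != 0 by move/pcharf0P: F_char0 => ->.
have [p [r [rp rE]]] := empty_base_locus_powers U_empty.
(* Besides the exponent k - n of the Hilbert series, this gives k > 0, on which the truncation in
   degree k relies. *)
have nk := quadrics_le rp rE.
split; last first.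
  exists (hilb (\dim {: V}) (\dim U)); split; first exact: clifford_Hilbert.
  exact: hilb_series.
apply: (clifford_AS_regular _ _ _ charF (leq_trans n_gt0 nk) rp rE) => // a i j.
exact: U_sym (vbasis_mem (mem_tnth _ _)).
Qed.
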